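(* Let $X$ be a compact metrizable space and $T:X\to X$ a homeomorphism such that $(X,T)$ has the marker property. Suppose $\mathrm{mdim}(T,X)<\infty$. Let $\mathcal D'(X)$ be the set of compatible metrics $d$ on $X$ with $\overline{\mathrm{mdim}}_M(T,X,d)<\infty$. Then, for every choice of the measure-theoretic $\epsilon$-entropy $h_\mu(T,\epsilon)$ (computed with respect to the metric $d$) from $\mathcal E\cup\{R_{\mu,L^p}(\epsilon)\}$, where $1\le p<\infty$, $$\mathrm{mdim}(T,X)=\min_{d\in\mathcal D'(X)}\ \sup_{\mu\in E(X,T)}\Big\{\limsup_{\epsilon\to0}\frac{1}{\log\frac1\epsilon}h_\mu(T,\epsilon)\Big\}=\min_{d\in\mathcal D'(X)}\ \sup_{\mu\in M(X,T)}\Big\{\limsup_{\epsilon\to0}\frac{1}{\log\frac1\epsilon}h_\mu(T,\epsilon)\Big\}$$ (in particular both minima are attained). Here $\mathcal E$ is the set of candidates $$R_{\mu,L^\infty}(\epsilon),\ \inf_{\mathrm{diam}(\alpha)\le\epsilon,\,\alpha\in\mathcal P_X}h_\mu(T,\alpha),\ \inf_{\mathrm{diam}(\mathcal U)\le\epsilon,\,\mathcal U\in\mathcal C_X^o}h_\mu(T,\mathcal U),\ \underline h_\mu^K(T,\epsilon,\delta),\ \overline h_\mu^K(T,\epsilon,\delta),\ \underline h_\mu^K(T,\epsilon),\ \overline h_\mu^K(T,\epsilon),\ \overline h_\mu^{BK}(T,\epsilon),\ PS_\mu(T,\epsilon),$$ where $\delta\in(0,1)$ is arbitrary but fixed.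
   Context: Logarithms are natural. $M(X)$, $M(X,T)$, $E(X,T)$ denote the sets of Borel probability measures, $T$-invariant ones, and $T$-ergodic ones on $X$; $M(X)$ carries the weak$^*$ topology. $\mathcal P_X$ is the set of finite Borel partitions of $X$ and $\mathcal C_X^o$ the set of finite open covers. For covers, $\alpha\vee\beta=\{A\cap B:A\in\alpha,B\in\beta\}$, $\alpha^n=\bigvee_{j=0}^{n-1}T^{-j}\alpha$, and $\alpha\succ\beta$ means each element of $\alpha$ is contained in some element of $\beta$. For a metric $d$, $\mathrm{diam}(\alpha)=\sup_{A\in\alpha}\mathrm{diam}(A,d)$. Marker property: for every $n\ge1$ there is an open set $U\subset X$ with $U\cap T^jU=\emptyset$ for $1\le j\le n$ and $X=\bigcup_{k\in\mathbb Z}T^kU$. Mean dimension: for $\mathcal V\in\mathcal C_X^o$, $\mathrm{ord}(\mathcal V)=\max_{x\in X}\sum_{V\in\mathcal V}\chi_V(x)-1$; for $\mathcal U\in\mathcal C_X^o$, $\mathcal D(\mathcal U)=\min\{\mathrm{ord}(\mathcal V):\mathcal V\in\mathcal C_X^o,\ \mathcal V\succ\mathcal U\}$; and $\mathrm{mdim}(T,X)=\sup_{\mathcal U\in\mathcal C_X^o}\lim_{n\to\infty}\frac{\mathcal D(\mathcal U^n)}n$ (the limit exists by subadditivity). Upper metric mean dimension: let $d_n(x,y)=\max_{0\le j\le n-1}d(T^jx,T^jy)$. For $Z\subset X$, a set $F\subset Z$ is $(d_n,\epsilon)$-separated if $d_n(x,y)\ge\epsilon$ for distinct $x,y\in F$;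 $s(Z,d_n,\epsilon)$ is the largest cardinality of such $F$. Then $\overline{\mathrm{mdim}}_M(T,X,d)=\limsup_{\epsilon\to0}\frac{1}{\log\frac1\epsilon}\limsup_{n\to\infty}\frac1n\log s(X,d_n,\epsilon)$. Let $B_n(x,\epsilon)=\{y:d_n(x,y)<\epsilon\}$. Measure-theoretic $\epsilon$-entropies (for $\mu\in M(X,T)$ and a compatible metric $d$): - For measurable maps $\xi,\eta$ on a probability space $(\Omega,\mathbb P)$, the mutual information $I(\xi;\eta)$ is the supremum over finite measurable partitions $\{P_m\}$, $\{Q_n\}$ of their target spaces of $\sum_{m,n}\mathbb P(\xi\in P_m,\eta\in Q_n)\log\frac{\mathbb P(\xi\in P_m,\eta\in Q_n)}{\mathbb P(\xi\in P_m)\mathbb P(\eta\in Q_n)}$, with $0\log\frac0a=0$. For $1\le p<\infty$, $R_{\mu,L^p}(\epsilon)$ is the infimum of $\frac{I(\xi;\eta)}n$ over all positive integers $n$ and random variables $\xi$, $\eta=(\eta_0,\dots,\eta_{n-1})$ on some probability space such that $\xi$ takes values in $X$ with law $\mu$, each $\eta_k$ takes values in $X$, and $\mathbb E\big(\frac1n\sum_{k=0}^{n-1}d(T^k\xi,\eta_k)^p\big)<\epsilon^p$. For $s>0$, $R_{\mu,L^\infty}(\epsilon,s)$ is defined in the same way with the last condition replaced by $\mathbb E(\#\{0\le k\le n-1:d(T^k\xi,\eta_k)\ge\epsilon\})<sn$, and $R_{\mu,L^\infty}(\epsilon)=\lim_{s\to0}R_{\mu,L^\infty}(\epsilon,s)$.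 - $h_\mu(T,\alpha)=\lim_{n\to\infty}\frac1nH_\mu(\alpha^n)$ with $H_\mu(\alpha)=-\sum_{A\in\alpha}\mu(A)\log\mu(A)$ for $\alpha\in\mathcal P_X$; $h_\mu(T,\mathcal U)=\inf_{\alpha\succ\mathcal U,\,\alpha\in\mathcal P_X}h_\mu(T,\alpha)$ for $\mathcal U\in\mathcal C_X^o$. - Katok: $R_\mu^\delta(T,n,\epsilon)$ is the minimal cardinality of a set $E\subset X$ with $\mu(\bigcup_{x\in E}B_n(x,\epsilon))>1-\delta$; $\overline h_\mu^K(T,\epsilon,\delta)=\limsup_{n\to\infty}\frac1n\log R_\mu^\delta(T,n,\epsilon)$, $\underline h_\mu^K(T,\epsilon,\delta)$ is the corresponding $\liminf$; $\overline h_\mu^K(T,\epsilon)=\lim_{\delta\to0}\overline h_\mu^K(T,\epsilon,\delta)$, $\underline h_\mu^K(T,\epsilon)=\lim_{\delta\to0}\underline h_\mu^K(T,\epsilon,\delta)$. - Brin–Katok: $\overline h_\mu^{BK}(T,\epsilon)=\int\limsup_{n\to\infty}-\frac{\log\mu(B_n(x,\epsilon))}n\,d\mu(x)$. - Pfister–Sullivan: $PS_\mu(T,\epsilon)=\inf_{F\ni\mu}\limsup_{n\to\infty}\frac1n\log s(X_{n,F},d_n,\epsilon)$, where $F$ ranges over neighborhoods of $\mu$ in $M(X)$ and $X_{n,F}=\{x\in X:\frac1n\sum_{j=0}^{n-1}\delta_{T^jx}\in F\}$ (with $\log 0=-\infty$ when $X_{n,F}=\emptyset$). *)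

(* Defs.v *)
From HB Require Import structures.
From mathcomp Require Import all_boot all_order all_algebra finmap.
From mathcomp Require Import all_classical all_reals all_analysis.

Set Implicit Arguments.
Unset Strict Implicit.
Unset Printing Implicit Defensive.

Import Order.TTheory GRing.Theory Num.Theory.
Import numFieldNormedType.Exports.

Local Open Scope classical_set_scope.
Local Open Scope ring_scope.

Notation borel X := (g_sigma_algebraType (@open X)).

Definition homeomorphism (X : topologicalType) (T : X -> X) : Prop :=
  exists S : X -> X, [/\ continuous T, continuous S, cancel T S & cancel S T].

(* [T^k U]; for negative [k] and [T] bijective this is a preimage. *)
Definition zimage (X : Type) (T : X -> X) (k : int) (U : set X) : set X :=
  match k with
  | Posz n => iter n T @` U
  | Negz n => iter n.+1 T @^-1` U
  end.

Definition marker_property (X : topologicalType) (T : X -> X) : Prop :=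
  forall n : nat, (1 <= n)%N ->
  exists U : set X,
    [/\ open U,
        forall j : nat, (1 <= j <= n)%N -> U `&` (iter j T @` U) = set0 &
        \bigcup_(k : int) zimage T k U = setT].

Section metrics.
Context {R : realType} {X : topologicalType}.
Implicit Types (d : X -> X -> R) (T : X -> X).

Definition compatible_metric d : Prop :=
  [/\ forall x y, 0 <= d x y,
      forall x y, d x y = 0 <-> x = y,
      forall x y, d x y = d y x,
      forall x y z, d x z <= d x y + d y z &
      forall x, nbhs x =
        filter_from [set e : R | 0 < e] (fun e => [set y | d x y < e])].

Definition bowen_metric d T (n : nat) (x y : X) : R :=
  \big[Num.max/0]_(j < n) d (iter j T x) (iter j T y).

Definition bowen_ball d T n (x : X) (eps : R) : set X :=
  [set y | bowen_metric d T n x y < eps].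

(* The largest cardinality of a separated subset of [Z]; [+oo] if unbounded. *)
Definition sep_number d T (Z : set X) (n : nat) (eps : R) : \bar R :=
  ereal_sup [set (#|` F|%:R)%:E | F in [set F : {fset X} |
    [set` F] `<=` Z /\
    forall x y, x \in F -> y \in F -> x != y -> eps <= bowen_metric d T n x y]].

(* The empty set has diameter [-oo] here, which is below every positive
   bound, just as the diameter [0] is. *)
Definition diam d (A : set X) : \bar R :=
  ereal_sup [set (d z.1 z.2)%:E | z in A `*` A].

Definition mesh d (alpha : {fset set X}) : \bar R :=
  ereal_sup [set diam d A | A in [set` alpha]].

End metrics.

Section metrizable.
Variables (R : realType) (X : topologicalType).

Definition metrizable : Prop := exists d : X -> X -> R, compatible_metric d.

End metrizable.

Section rates.
Context {R : realType}.
Local Open Scope ereal_scope.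

(* [lne 0 = -oo], so an empty family has rate [-oo]. *)
Definition log_rate_sup (u : nat -> \bar R) : \bar R :=
  limn_esup (fun n => (n%:R^-1)%:E * lne (u n)).

Definition log_rate_inf (u : nat -> \bar R) : \bar R :=
  limn_einf (fun n => (n%:R^-1)%:E * lne (u n)).

Definition upper_log_scaling (h : R -> \bar R) : \bar R :=
  limf_esup (fun eps : R => ((ln eps^-1)^-1)%:E * h eps) 0^'+.

End rates.

Section covers.
Context {X : Type}.
Implicit Types (T : X -> X) (alpha beta : {fset set X}).

Definition is_cover alpha : Prop := \bigcup_(A in [set` alpha]) A = setT.

Definition cover_join alpha beta : {fset set X} :=
  [fset (A `&` B)%classic | A in alpha, B in beta]%fset.

Definition cover_preimage (f : X -> X) alpha : {fset set X} :=
  [fset (f @^-1` A)%classic | A in alpha]%fset.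

(* [\bigvee_(j < n) T^-j alpha]; the trivial cover [{X}] is neutral. *)
Fixpoint cover_iter T alpha (n : nat) : {fset set X} :=
  match n with
  | 0 => [fset setT%classic]%fset
  | m.+1 => cover_join (cover_iter T alpha m) (cover_preimage (iter m T) alpha)
  end.

Definition refines alpha beta : Prop :=
  forall A, A \in alpha -> exists2 B, B \in beta & A `<=` B.

End covers.

Definition finite_open_cover (X : topologicalType) (U : {fset set X}) : Prop :=
  (forall A, A \in U -> open A) /\ is_cover U.

Definition finite_partition d (X : measurableType d) (alpha : {fset set X}) :
    Prop :=
  [/\ forall A, A \in alpha -> measurable A,
      trivIset [set` alpha] id & is_cover alpha].

Section mean_dimension.
Variables (R : realType) (X : topologicalType).
Local Open Scope ereal_scope.

(* The sup and the inf below are over integer values, hence attained. *)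
Definition cover_ord (V : {fset set X}) : \bar R :=
  ereal_sup [set (\sum_(A <- V) \1_A x)%:E - 1 | x in [set: X]].

Definition cover_dim (U : {fset set X}) : \bar R :=
  ereal_inf [set cover_ord V | V in
    [set V | finite_open_cover V /\ refines V U]].

(* The limit exists by subadditivity of [n |-> cover_dim (cover_iter T U n)]. *)
Definition mdim (T : X -> X) : \bar R :=
  ereal_sup [set limn (fun n => (n%:R^-1)%:E * cover_dim (cover_iter T U n)) |
    U in finite_open_cover (X := X)].

End mean_dimension.

Definition upper_mdimM (R : realType) (X : topologicalType) (T : X -> X)
    (d : X -> X -> R) : \bar R :=
  upper_log_scaling (fun eps =>
    log_rate_sup (fun n => sep_number d T setT n eps)).

Section measures.
Variables (R : realType) (X : ptopologicalType).
Implicit Types (T : X -> X) (mu : probability (borel X) R).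

Definition invariant_measure T : set (probability (borel X) R) :=
  [set mu | forall A : set (borel X),
    measurable A -> mu (T @^-1` A) = mu A].

Definition ergodic_measure T : set (probability (borel X) R) :=
  [set mu | invariant_measure T mu /\
    forall A : set (borel X),
      measurable A -> T @^-1` A = A -> mu A = 0%E \/ mu A = 1%E].

Definition integral_map mu : {ptws continuousType X R -> R} :=
  fun f => \int[mu]_x f x.

Definition weak_star : topologicalType := initial_topology integral_map.

End measures.

Section empirical.
Context {R : realType} {X : ptopologicalType}.
Variables (T : X -> X) (n : nat) (x : X).

(* [1/(n+1) \sum_(j <= n) \d_(T^j x)]: index [n] stands for [n.+1] points, so
   that the total mass is always 1. *)
Definition empirical : set (borel X) -> \bar R :=
  mscale (n.+1%:R^-1)%:nng
    (msum (fun j => \d_(iter j T x : borel X)) n.+1).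

HB.instance Definition _ := Measure.on empirical.

Let empirical_setT : empirical setT = 1%E.
Proof.
rewrite /empirical /mscale/= /msum (eq_bigr (fun=> 1%E)); last first.
  by move=> i _; rewrite /= diracE in_setT.
rewrite sumEFin -EFinM big_const_ord iter_addr_0 mulVf//.
Qed.

HB.instance Definition _ := Measure_isProbability.Build _ _ _
  empirical empirical_setT.

End empirical.

Section mutual_information.
Local Open Scope ereal_scope.
Context {R : realType} {d d1 d2 : measure_display} {Omega : measurableType d}
  {E1 : measurableType d1} {E2 : measurableType d2}.

(* Uses [0 * ln _ = 0]. *)
Definition mutual_information (P : probability Omega R)
    (xi : {RV P >-> E1}) (eta : {RV P >-> E2}) : \bar R :=
  ereal_sup [set (\sum_(A <- ab.1) \sum_(B <- ab.2)
      let pA := fine (P (xi @^-1` A)) in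
      let pB := fine (P (eta @^-1` B)) in
      let pAB := fine (P (xi @^-1` A `&` eta @^-1` B)) in
      pAB * ln (pAB / (pA * pB)))%:E |
    ab in finite_partition (X := E1) `*` finite_partition (X := E2)].

End mutual_information.

Section entropies.
Context {R : realType} {X : ptopologicalType}.
Variable T : X -> X.
Local Open Scope ereal_scope.
Implicit Types (d : X -> X -> R) (mu : probability (borel X) R) (eps : R).

(* Infimum of [I(xi; eta) / n] over all [n > 0] and all couplings [(xi, eta)],
   [xi] of law [mu], whose expected cost [c] is less than [t n]. *)
Definition rate_distortion mu (c : forall n, X -> n.-tuple X -> R)
    (t : nat -> R) : \bar R :=
  ereal_inf [set r | exists (dO : measure_display) (Omega : measurableType dO)
      (P : probability Omega R) (n : nat)
      (xi : {RV P >-> borel X}) (eta : {RV P >-> n.-tuple (borel X)}),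
    [/\ (0 < n)%N,
        forall A : set (borel X), measurable A -> P (xi @^-1` A) = mu A,
        'E_P[fun w => c n (xi w) (eta w)] < (t n)%:E &
        r = (n%:R^-1)%:E * mutual_information xi eta]].

Definition rate_Lp (p : R) d mu eps : \bar R :=
  rate_distortion mu
    (fun n x y =>
       n%:R^-1 * \sum_(k < n) d (iter k T x) (tnth y k) `^ p)%R
    (fun=> eps `^ p)%R.

Definition rate_Loo_at d mu eps (s : R) : \bar R :=
  rate_distortion mu
    (fun n x y => #|[pred k : 'I_n | (eps <= d (iter k T x) (tnth y k))%R]|%:R)
    (fun n => s * n%:R)%R.

Definition rate_Loo d mu eps : \bar R :=
  lim (rate_Loo_at d mu eps s @[s --> 0^'+]).

Definition partition_entropy mu (alpha : {fset set X}) : R :=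
  (- \sum_(A <- alpha) fine (mu A) * ln (fine (mu A)))%R.

Definition entropy_of_partition mu (alpha : {fset set X}) : \bar R :=
  limn (fun n => (n%:R^-1 * partition_entropy mu (cover_iter T alpha n))%:E).

Definition entropy_of_cover mu (U : {fset set X}) : \bar R :=
  ereal_inf [set entropy_of_partition mu alpha | alpha in
    [set alpha | finite_partition (X := borel X) alpha /\ refines alpha U]].

Definition inf_partition_entropy d mu eps : \bar R :=
  ereal_inf [set entropy_of_partition mu alpha | alpha in
    [set alpha | finite_partition (X := borel X) alpha /\
                 mesh d alpha <= eps%:E]].

Definition inf_cover_entropy d mu eps : \bar R :=
  ereal_inf [set entropy_of_cover mu U | U in
    [set U | finite_open_cover U /\ mesh d U <= eps%:E]].

Definition katok_number (delta : R) d mu (n : nat) eps : \bar R :=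
  ereal_inf [set (#|` F|%:R)%:E | F in [set F : {fset X} |
    (1 - delta)%:E < mu (\bigcup_(x in [set` F]) bowen_ball d T n x eps)]].

Definition katok_sup_at (delta : R) d mu eps : \bar R :=
  log_rate_sup (fun n => katok_number delta d mu n eps).

Definition katok_inf_at (delta : R) d mu eps : \bar R :=
  log_rate_inf (fun n => katok_number delta d mu n eps).

Definition katok_sup d mu eps : \bar R :=
  lim (katok_sup_at delta d mu eps @[delta --> 0^'+]).

Definition katok_inf d mu eps : \bar R :=
  lim (katok_inf_at delta d mu eps @[delta --> 0^'+]).

Definition brin_katok_sup d mu eps : \bar R :=
  \int[mu]_x limn_esup (fun n =>
    (n%:R^-1)%:E * - lne (mu (bowen_ball d T n x eps))).

(* For [n > 0]: [empirical] is indexed by the number of points minus one. *)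
Definition empirical_in (F : set (probability (borel X) R)) (n : nat) : set X :=
  [set x | F (empirical T n.-1 x)].

Definition pfister_sullivan d mu eps : \bar R :=
  ereal_inf [set log_rate_sup (fun n => sep_number d T (empirical_in F n) n eps)
    | F in nbhs (mu : weak_star R X)].

Definition entropy_candidates (delta : R) :
    set ((X -> X -> R) -> probability (borel X) R -> R -> \bar R) :=
  [set rate_Loo; inf_partition_entropy; inf_cover_entropy;
       katok_inf_at delta; katok_sup_at delta; katok_inf; katok_sup;
       brin_katok_sup; pfister_sullivan].

End entropies.

Definition finite_mdimM_metrics (R : realType) (X : topologicalType)
    (T : X -> X) : set (X -> X -> R) :=
  [set d | compatible_metric d /\ (upper_mdimM T d < +oo)%E].

Definition sup_log_scaling (R : realType) (X : ptopologicalType)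
    (M : set (probability (borel X) R))
    (h : (X -> X -> R) -> probability (borel X) R -> R -> \bar R)
    (d : X -> X -> R) : \bar R :=
  ereal_sup [set upper_log_scaling (h d mu) | mu in M].

Definition is_minimum (R : realType) (S : set (\bar R)) (m : \bar R) : Prop :=
  S m /\ lbound S m.

(* Main.v *)
(* Lower bound. Call an ergodic measure compressible at scale eps with rate c if some finite sub-probability Q on
   words of some length n satisfies E[- ln (sum_q Q(q) exp (- cost(q, x) / eps))] < n c, where cost(q, x) is the
   total distance between q and the orbit of x. A bound c on any of the entropies at scale eps gives the rate c + 10.
   If all ergodic measures have rate s ln(1/eps) for small eps, the good points form open sets which every long
   orbit visits most of the time (else its empirical measures charge a closed set that some ergodic measure avoids),
   so concatenating the Q gives one sub-probability on long words N that works at every point. The image of X in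
   [0,1]^(mN) under N iterates of m bump functions then has so small a neighbourhood that a translate of a
   coarse grid is nearly missed: at each point at most about s N coordinates are close to their thresholds. The
   level sets above the thresholds give covers of multiplicity about s N, so mdim <= s.

   Attained value. By the marker property and the definition of mdim, a point can be coded so that along a marker
   block of length N all values are read off the first point, where only about mdim * N coordinates are positive;
   quantised to eta, the code has at most exp (n (mdim + g) ln(1/eta) + C n) words of length n, with g small. Each
   ingredient of the k-th code A_k depends only on the next, much finer code F_(k+1), and F_k = A_k (F_(k+1)) is
   obtained by a limit. In the metric sup_k delta_k |F_k x - F_k y|, with delta_k decreasing fast enough to absorb
   the constants C, the words of a single F_k determine an orbit up to eps, and every entropy at scale 2 eps
   is at most the growth rate of the number of words. *)
From HB Require Import structures.
Require Import Defs.
From mathcomp Require Import all_boot all_order all_algebra finmap.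
From mathcomp Require Import all_classical all_reals all_analysis.
From mathcomp Require Import measurable_realfun.
From mathcomp Require Import ring lra zify.

Set Implicit Arguments.
Unset Strict Implicit.
Unset Printing Implicit Defensive.

Import Order.TTheory GRing.Theory Num.Theory.
Import numFieldNormedType.Exports.

Local Open Scope classical_set_scope.
Local Open Scope ring_scope.

(** * Compact metric spaces *)

Section clamp.
Context {R : realType}.
Implicit Types a b e x : R.

(** The metric [d] may have infinite box dimension: its nets at scale [exp (- e)] can have far more
    than [exp (O(e))] points, and then the bad times of an orbit could not be paid for. The lower
    bound therefore passes to the pseudo-metric [fdist] of the [m] bump functions, whose nets have
    at most [exp (m (1 + e))] points, so that bad times of small frequency cost a small multiple of
    [e] per unit of time. The soft quantity [pot] replaces Bowen balls because it is continuous,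
    multiplicative under concatenation and additive under mixtures; all the entropies then enter
    through the single notion [compressible]. The good scale depends on the ergodic measure, hence
    on the orbit segment, but only finitely many scales occur and one first-moment count treats them
    together. For the attained value, the words of one code must control all coarser codes, since
    counting unrelated codes together would add up their growth rates; this is why each code is a
    function of the next one. Additive constants in the rates are harmless, because every rate is
    finally divided by [ln (1/eps)]. *)

Definition clamp a : R := Num.max 0 (Num.min 1 a).

Lemma clamp_ge0 a : 0 <= clamp a.
Proof. by rewrite /clamp le_max lexx. Qed.

Lemma clamp_le1 a : clamp a <= 1.
Proof. by rewrite /clamp ge_max ler01 ge_min lexx. Qed.

Lemma clamp_ge1 a : 1 <= a -> clamp a = 1.
Proof. by move=> a1; rewrite /clamp min_l// max_r. Qed.

Lemma clamp_le0 a : a <= 0 -> clamp a = 0.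
Proof. by move=> a0; rewrite /clamp max_l// ge_min a0 orbT. Qed.

Lemma clamp_gt0 a : 0 < clamp a -> 0 < a.
Proof. by rewrite ltNge => h; rewrite ltNge; apply: contra h => a0; rewrite clamp_le0. Qed.

Lemma max_near a a' b b' e : `|a - a'| <= e -> `|b - b'| <= e ->
  `|Num.max a b - Num.max a' b'| <= e.
Proof.
rewrite !ler_norml => /andP[h1 h2] /andP[h3 h4].
by rewrite /Num.max; case: ifP => ?; case: ifP => ?; apply/andP; split; lra.
Qed.

Lemma min_near a a' b b' e : `|a - a'| <= e -> `|b - b'| <= e ->
  `|Num.min a b - Num.min a' b'| <= e.
Proof.
rewrite !ler_norml => /andP[h1 h2] /andP[h3 h4].
by rewrite /Num.min; case: ifP => ?; case: ifP => ?; apply/andP; split; lra.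
Qed.

Lemma clamp_near a a' e : `|a - a'| <= e -> `|clamp a - clamp a'| <= e.
Proof.
move=> h; have e0 : 0 <= e by exact: le_trans h.
by apply: max_near; [rewrite subrr normr0|apply: min_near => //; rewrite subrr normr0].
Qed.

Lemma bigmax_near (I : Type) (s : seq I) (P : pred I) (F G : I -> R) e : 0 <= e ->
  (forall i, P i -> `|F i - G i| <= e) ->
  `|\big[Num.max/0]_(i <- s | P i) F i - \big[Num.max/0]_(i <- s | P i) G i| <= e.
Proof.
move=> e0 h; elim/big_ind2 : _ => //; first by rewrite subrr normr0.
by move=> *; exact: max_near.
Qed.

Lemma bigmax_ge0 (I : Type) (s : seq I) (P : pred I) (F : I -> R) :
  0 <= \big[Num.max/0]_(i <- s | P i) F i.
Proof. exact: bigmax_ge_id. Qed.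

Lemma bigmax_gt0P (I : eqType) (s : seq I) (P : pred I) (F : I -> R) c : 0 <= c ->
  c < \big[Num.max/0]_(i <- s | P i) F i ->
  exists i, [/\ i \in s, P i & c < F i].
Proof.
move=> c0 h; apply: contrapT => /forallNP H; move: h; apply/negP; rewrite -leNgt.
rewrite big_seq_cond; apply: bigmax_le => // i /andP[is_ Pi].
by rewrite leNgt; apply/negP => ?; apply: (H i).
Qed.

End clamp.

Section compact_metric.
Context {R : realType} {X : ptopologicalType} (d : X -> X -> R).
Hypotheses (cX : compact [set: X]) (cd : compatible_metric d).

Lemma cm_ge0 x y : 0 <= d x y. Proof. by case: cd. Qed.
Lemma cm_xx x : d x x = 0. Proof. by case: cd => _ h _ _ _; apply/h. Qed.
Lemma cm_sym x y : d x y = d y x. Proof. by case: cd. Qed.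
Lemma cm_tri y x z : d x z <= d x y + d y z. Proof. by case: cd. Qed.
Lemma cm_eq0 x y : d x y = 0 -> x = y. Proof. by case: cd => _ h _ _ _ /h. Qed.

Lemma cm_nbhsP x (A : set X) :
  nbhs x A <-> exists2 e, 0 < e & forall y, d x y < e -> A y.
Proof. by case: cd => _ _ _ _ ->; split=> -[e e0 h]; exists e. Qed.

Lemma cm_openP (A : set X) :
  open A <-> forall x, A x -> exists2 e, 0 < e & forall y, d x y < e -> A y.
Proof.
rewrite openE; split=> h x Ax; first by have /cm_nbhsP := h x Ax.
by apply/cm_nbhsP; exact: h.
Qed.

Lemma cm_open_ball x e : open [set y | d x y < e].
Proof.
apply/cm_openP => y /= xy; exists (e - d x y); first by rewrite subr_gt0.
by move=> z yz; have := cm_tri y x z; lra.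
Qed.

Lemma cm_fin_cover (I : choiceType) (U : I -> set X) :
  (forall i, open (U i)) -> (forall x, exists i, U i x) ->
  exists s : seq I, forall x, exists2 i, i \in s & U i x.
Proof.
move=> oU cU; have := cX; rewrite compact_cover => /(_ _ setT U) [|x _|D _ DU].
- by move=> i _; exact: oU.
- by have [i Ui] := cU x; exists i.
exists (enum_fset D) => x; have [i iD Ui] := DU x Logic.I.
by exists i.
Qed.

Lemma cm_ball_cover (r : X -> R) : (forall x, 0 < r x) ->
  exists s : seq X, forall y, exists2 x, x \in s & d x y < r x.
Proof.
move=> r0; apply: (@cm_fin_cover X (fun x => [set y | d x y < r x])).
  by move=> x; exact: cm_open_ball.
by move=> x; exists x; rewrite /= cm_xx.
Qed.

Lemma cm_seq_min (s : seq X) (r : X -> R) : (forall x, 0 < r x) ->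
  exists2 e, 0 < e & forall x, x \in s -> e <= r x.
Proof.
move=> r0; elim: s => [|x s [e e0 h]]; first by exists 1.
exists (Num.min e (r x)); first by rewrite lt_min e0 r0.
move=> y; rewrite inE => /predU1P[->|ys]; first by rewrite ge_min lexx orbT.
by rewrite ge_min h.
Qed.

Lemma cm_lebesgue (C : set (set X)) : (forall A, C A -> open A) ->
  (forall x, exists2 A, C A & A x) ->
  exists2 e, 0 < e & forall x, exists2 A, C A & forall y, d x y < e -> A y.
Proof.
move=> oC cC.
have /choice[r hr] x : exists e, 0 < e /\ exists2 A, C A & forall y, d x y < e -> A y.
  have [A CA Ax] := cC x; have /cm_openP/(_ _ Ax)[e e0 eA] := oC _ CA.
  by exists e; split=> //; exists A.
have r0 x : 0 < r x / 2 by rewrite divr_gt0//; case: (hr x).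
have [s hs] := cm_ball_cover r0.
have [e e0 he] := cm_seq_min s r0.
exists e => // x; have [z zs zx] := hs x; have [_ [A CA hA]] := hr z.
exists A => // y xy; apply: hA; have := cm_tri x z y; have := he z zs; lra.
Qed.

Lemma cm_ucont (f : X -> R) : continuous f -> forall e, 0 < e ->
  exists2 r, 0 < r & forall x y, d x y < r -> `|f x - f y| < e.
Proof.
move=> cf e e0.
pose C := [set A : set X | exists z, A = f @^-1` [set t | `|t - f z| < e / 2]].
have oC A : C A -> open A.
  move=> [z ->]; apply: (open_comp (fun x _ => cf x)).
  have -> : [set t | `|t - f z| < e / 2] = ball (f z) (e / 2).
    by apply/seteqP; split=> t; rewrite /ball/= distrC.
  by apply: ball_open; rewrite divr_gt0.
have [|r r0 hr] := cm_lebesgue oC.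
  by move=> x; exists (f @^-1` [set t | `|t - f x| < e / 2]); [exists x|rewrite /= subrr normr0 divr_gt0].
exists r => // x y xy; have [_ [z ->] h] := hr x.
have /h/= hy := xy; have /= hx : (f @^-1` [set t | `|t - f z| < e / 2]) x by apply: h; rewrite cm_xx.
by rewrite (le_lt_trans (ler_distD (f z) _ _))// (splitr e) ltrD// distrC.
Qed.

Lemma cm_cont (f : X -> R) :
  (forall x e, 0 < e -> exists2 r, 0 < r & forall y, d x y < r -> `|f x - f y| < e) ->
  continuous f.
Proof.
move=> h x; apply/cvgrPdist_lt => e e0; have [r r0 hr] := h x e e0.
by apply/cm_nbhsP; exists r => // y; exact: hr.
Qed.

Lemma cm_lip_cont (f : X -> R) L : (forall x y, `|f x - f y| <= L * d x y) -> continuous f.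
Proof.
move=> h; apply: cm_cont => x e e0; exists (e / (`|L| + 1)).
  by rewrite divr_gt0// ltr_wpDl.
move=> y xy; apply: (le_lt_trans (h x y)).
rewrite (@le_lt_trans _ _ ((`|L| + 1) * d x y))//.
  by rewrite ler_wpM2r ?cm_ge0// (le_trans (ler_norm _))// lerDl.
by rewrite mulrC -ltr_pdivlMr// ltr_wpDl.
Qed.

Lemma cm_dist_lip z x y : `|d x z - d y z| <= d x y.
Proof.
rewrite ler_norml; apply/andP; split.
  by have := cm_tri x y z; rewrite (cm_sym y x); lra.
by have := cm_tri y x z; lra.
Qed.

Lemma cm_dist_cont z : continuous (d^~ z).
Proof. by apply: (@cm_lip_cont _ 1) => x y; rewrite mul1r cm_dist_lip. Qed.

Lemma cm_bounded : exists2 D, 0 < D & forall x y, d x y <= D.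
Proof.
have [s hs] := @cm_ball_cover (fun=> 1) (fun=> ltr01).
pose p : X := point.
exists (2 * (1 + \big[Num.max/0]_(x <- s) d x p)).
  by rewrite mulr_gt0// ltr_pwDl// bigmax_ge0.
have h x : d x p <= 1 + \big[Num.max/0]_(x <- s) d x p.
  have [z zs zx] := hs x; have := cm_tri z x p; rewrite (cm_sym x z).
  have : d z p <= \big[Num.max/0]_(x <- s) d x p by apply: le_bigmax_seq.
  lra.
by move=> x y; have := cm_tri p x y; have := h x; have := h y; rewrite (cm_sym p y); lra.
Qed.

Lemma cm_dense : exists D : nat -> X, forall x e, 0 < e -> exists n, d (D n) x < e.
Proof.
have inv0 n : 0 < (n.+1%:R : R)^-1 by [].
have /choice[s hs] n : exists s : seq X, forall y, exists2 x, x \in s & d x y < n.+1%:R^-1.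
  by have := @cm_ball_cover (fun=> n.+1%:R^-1) (fun=> inv0 n).
(* The index [k] encodes a pair (scale, position in the net of that scale); codes of nothing and
   positions past the end fall back on defaults. *)
exists (fun k => let: (n, i) := odflt (0%N, 0%N) (choice.unpickle k) in nth point (s n) i).
move=> x e e0.
have [n ne] : exists n, n.+1%:R^-1 < e.
  exists (Num.truncn e^-1); rewrite invf_plt ?posrE//.
  exact: Num.Theory.truncnS_gt.
have [z zs zx] := hs n x; exists (choice.pickle (n, index z (s n))).
by rewrite choice.pickleK/= nth_index// (lt_trans zx).
Qed.

(** A plateau: 1 on the ball of radius [r], 0 outside the ball of radius [2 r], with Lipschitz
    constant [1 / r]. *)
Definition bump (z : X) (r : R) (x : X) : R := clamp (2 - d x z / r).

Lemma bump_lip z r x y : 0 < r -> `|bump z r x - bump z r y| <= r^-1 * d x y.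
Proof.
move=> r0; apply: clamp_near.
rewrite opprB addrC addrA subrK -mulrBl normrM (gtr0_norm (x := r^-1)) ?invr_gt0//.
rewrite [leRHS]mulrC ler_pM2r ?invr_gt0// (cm_sym x y); exact: cm_dist_lip.
Qed.

Lemma bump_gt0 z r x : 0 < r -> 0 < bump z r x -> d x z < 2 * r.
Proof. by move=> r0 /clamp_gt0; rewrite subr_gt0 ltr_pdivrMr. Qed.

Lemma bump_eq1 z r x : 0 < r -> d x z <= r -> bump z r x = 1.
Proof. by move=> r0 h; apply: clamp_ge1; have := h; rewrite -[X in _ <= X -> _]mul1r -ler_pdivrMr//; lra.
Qed.

(** Each point of a net at half the Lebesgue number is assigned to a set containing its whole ball,
    and [f i] is the maximum of the bumps assigned to [i]. A maximum is used instead of a partition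
    of unity because the exact value 1 must be attained at every point: thresholds and recodings
    rely on it. *)
Lemma cm_soft_cover (m : nat) (U : 'I_m -> set X) : (forall i, open (U i)) ->
  (forall x, exists i, U i x) ->
  exists (f : 'I_m -> X -> R) (L : R), 0 < L /\
   [/\ forall i x, 0 <= f i x <= 1,
       forall i x y, `|f i x - f i y| <= L * d x y,
       forall i x, 0 < f i x -> U i x &
       forall x, exists i, f i x = 1].
Proof.
move=> oU cU.
have [e e0 he] : exists2 e, 0 < e & forall x, exists i, forall y, d x y < e -> U i y.
  have [||e e0 he] := @cm_lebesgue (range U).
  - by move=> _ [i _ <-].
  - by move=> x; have [i] := cU x; exists (U i) => //; exists i.
  by exists e => // x; have [_ [i _ <-]] := he x; exists i.
have [s hs] := @cm_ball_cover (fun=> e / 2) (fun=> (divr_gt0 e0 (ltr0Sn _ 1))).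
have [k hk] := choice he.
have r0 : 0 < e / 2 by rewrite divr_gt0.
exists (fun i x => \big[Num.max/0]_(z <- s | k z == i) bump z (e / 2) x), (e / 2)^-1.
split; first by rewrite invr_gt0.
split.
- move=> i x; rewrite bigmax_ge0/=; apply: bigmax_le => // z _; exact: clamp_le1.
- move=> i x y; apply: bigmax_near => [|z _]; last exact: bump_lip.
  by rewrite mulr_ge0 ?cm_ge0// invr_ge0 ltW.
- move=> i x /bigmax_gt0P[//|z [zs /eqP <-]] /(bump_gt0 r0) h.
  by apply: hk; rewrite cm_sym; lra.
- move=> x; have [z zs zx] := hs x; exists (k z); apply/le_anti/andP; split.
    by apply: bigmax_le => // ? _; exact: clamp_le1.
  have b1 : bump z (e / 2) x = 1 by apply: bump_eq1 => //; rewrite cm_sym ltW.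
  by rewrite -[leLHS]b1; apply: (le_bigmax_seq _ z).
Qed.

End compact_metric.

(** * Covers of small multiplicity and mean dimension *)

Section fekete.
Context {R : realType} (a : nat -> R).
Hypotheses (a0 : forall n, 0 <= a n) (asub : forall m n, a (m + n)%N <= a m + a n).

Lemma subadd_mul k q : a (q * k)%N <= q%:R * a k + a 0%N.
Proof.
elim: q => [|q IH]; first by rewrite mul0n mul0r add0r.
by rewrite mulSn (le_trans (asub _ _))// -natr1 mulrDl mul1r; lra.
Qed.

Lemma fekete : exists l : R, (fun n => n%:R^-1 * a n) @ \oo --> l /\
  forall n, l * n%:R <= a n.
Proof.
pose E := [set n%:R^-1 * a n | n in [set n | (0 < n)%N]].
have E0 : lbound E 0 by move=> _ [n _ <-]; rewrite mulr_ge0.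
have hE : has_inf E by split; [exists (1%:R^-1 * a 1%N); exists 1%N|exists 0].
have lb n : (0 < n)%N -> inf E <= n%:R^-1 * a n.
  by move=> n0; apply: ge_inf; [case: hE|exists n].
exists (inf E); split; last first.
  move=> [|n]; first by rewrite mulr0.
  by rewrite -ler_pdivlMr// mulrC; exact: lb.
apply/cvgrPdist_lt => e e0.
have e20 : 0 < e / 2 by rewrite divr_gt0.
have [_ [k /= k0 <-] hk] := inf_adherent e20 hE.
(* One constant for all remainders of the division by [k]; the term [a 0] is there because [a 0]
   need not vanish. *)
pose C := \sum_(r < k) a r + a 0%N.
have aC r : (r < k)%N -> a r <= \sum_(r < k) a r.
  by move=> rk; rewrite (bigD1 (Ordinal rk))//= lerDl sumr_ge0.
have bnd n : (0 < n)%N -> n%:R^-1 * a n <= k%:R^-1 * a k + n%:R^-1 * C.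
  move=> n0; rewrite {2}(divn_eq n k).
  have h : a n <= (n %/ k)%:R * a k + C.
    rewrite {1}(divn_eq n k) (le_trans (asub _ _))// /C.
    have := subadd_mul k (n %/ k); have := aC _ (ltn_pmod n k0); lra.
  rewrite -divn_eq.
  have kk : (0:R) < k%:R by rewrite ltr0n.
  have nn : (0:R) < n%:R by rewrite ltr0n.
  rewrite ler_pdivrMl// mulrDr mulrA mulVKf ?gt_eqF//.
  have : (n %/ k)%:R * a k <= n%:R / k%:R * a k.
    by rewrite ler_wpM2r// ler_pdivlMr// -natrM ler_nat leq_divM.
  lra.
have C0 : 0 <= C by rewrite addr_ge0// sumr_ge0.
near=> n.
have n0 : (0 < n)%N by near: n; exists 1%N.
have := lb n n0; have := bnd n n0.
have : n%:R^-1 * C < e / 2.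
  rewrite ltr_pdivrMl ?ltr0n// mulrC -ltr_pdivrMl//.
  rewrite mulrC.
  by near: n; exact: nbhs_infty_gtr.
rewrite ltr_distlC; lra.
Unshelve. all: by end_near. Qed.

End fekete.

Section cover_iter.
Context {X : Type}.
Implicit Types (T : X -> X) (U V : {fset set X}).

Lemma cover_iterP T U n (C : set X) : C \in cover_iter T U n <->
  exists2 g : nat -> set X, (forall t, (t < n)%N -> g t \in U) &
    C = [set x | forall t, (t < n)%N -> g t (iter t T x)].
Proof.
elim: n C => [|n IH] C /=.
  rewrite inE; split=> [/eqP ->|[g _ ->]].
    by exists (fun=> set0) => //; apply/seteqP; split.
  by apply/eqP/seteqP; split.
split.
  case/imfset2P => A /= /IH[g gU ->] [_ /imfsetP[B /= BU ->] ->].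
  exists (fun t => if t == n then B else g t) => [t|].
    by rewrite ltnS leq_eqVlt; case: eqVneq => //= _ /gU.
  apply/seteqP; split=> x /=.
    by move=> [h Bx] t; rewrite ltnS leq_eqVlt; case: eqVneq => [-> //|_ /= /h].
  move=> h; split; last by have := h n (ltnSn n); rewrite eqxx.
  by move=> t tn; have := h t (ltnW tn); rewrite (ltn_eqF tn).
move=> [g gU ->]; apply/imfset2P.
exists [set x | forall t, (t < n)%N -> g t (iter t T x)] => /=.
  by apply/IH; exists g => // t tn; apply: gU; exact: ltnW.
exists (iter n T @^-1` g n) => /=.
  by apply/imfsetP; exists (g n) => //=; apply: gU.
apply/seteqP; split=> x /=.
  by move=> h; split; [move=> t tn; apply: h; exact: ltnW|exact: h].
by move=> [h hn] t; rewrite ltnS leq_eqVlt => /predU1P[->//|]; exact: h.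
Qed.

Lemma cover_iter_cover T U n : is_cover U -> is_cover (cover_iter T U n).
Proof.
rewrite /is_cover -!subTset => cU x _.
have /choice[g hg] t : exists B, B \in U /\ B (iter t T x).
  by have [B /= BU Bx] := cU (iter t T x) Logic.I; exists B.
exists [set y | forall t, (t < n)%N -> g t (iter t T y)].
  by apply/cover_iterP; exists g => // t _; case: (hg t).
by move=> t _; case: (hg t).
Qed.

Lemma refines_cover_iter T U V n : refines V (cover_iter T U n) <->
  forall A, A \in V -> forall t, (t < n)%N -> exists2 B, B \in U & A `<=` iter t T @^-1` B.
Proof.
split.
  move=> h A /h[_ /cover_iterP[g gU ->] AC] t tn; exists (g t); first exact: gU.
  by move=> x /AC; apply.
move=> h A AV.
have /choice[g hg] t : exists B, (t < n)%N -> B \in U /\ A `<=` iter t T @^-1` B.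
  by have [/(h A AV)[B]|] := boolP (t < n)%N; [exists B|exists set0].
exists [set x | forall t, (t < n)%N -> g t (iter t T x)].
  by apply/cover_iterP; exists g => // t /hg[].
by move=> x Ax t /hg[_]; apply.
Qed.

Lemma is_coverP U : is_cover U <-> forall x, exists2 A, A \in U & A x.
Proof.
rewrite /is_cover -subTset; split=> h x; first by have [A] := h x Logic.I; exists A.
by move=> _; have [A AU Ax] := h x; exists A.
Qed.

End cover_iter.

Definition multiplicity (X : Type) (V : {fset set X}) (x : X) : nat := count (fun A => x \in A) V.

(** * Covers by upper level sets of finitely many functions *)

Section chain_cover.
Context {R : realType} {X : ptopologicalType} (d : X -> X -> R).
Hypotheses (cX : compact [set: X]) (cd : compatible_metric d).

(** The open star of the vertex [S] in the barycentric subdivision of the simplex on [I], pulled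
    back by [y]. *)
Definition upper_level (I : finType) (y : I -> X -> R) (S : {set I}) : set X :=
  [set x | (forall c, c \in S -> 0 < y c x) /\
           (forall c c', c \in S -> c' \notin S -> y c' x < y c x)].

Lemma open_upper_level (I : finType) (y : I -> X -> R) (S : {set I}) :
  (forall c, continuous (y c)) -> open (upper_level y S).
Proof.
move=> cy.
have o1 c : open [set x | 0 < y c x].
  have := @open_comp _ _ (y c) [set t : R | 0 < t] (fun x _ => cy c x); apply; exact: open_gt.
have o2 c c' : open [set x | y c' x < y c x].
  have -> : [set x | y c' x < y c x] = (fun x => y c x - y c' x) @^-1` [set t : R | 0 < t].
    by apply/seteqP; split=> x /=; rewrite subr_gt0.
  apply: open_comp; last exact: open_gt.
  by move=> x _; apply: cvgB; exact: cy.
have fin (P : I -> Prop) (F : I -> set X) : (forall i, open (F i)) ->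
   open [set x | forall c, P c -> F c x].
  move=> oF; have -> : [set x | forall c, P c -> F c x] =
     \big[setI/setT]_(c <- enum I | `[< P c >]) F c.
    rewrite -bigcap_seq_cond; apply/seteqP; split=> x /= h c.
      by move=> /= /andP[_ /asboolP]; exact: h.
    by move=> Pc; apply: h; rewrite /= mem_enum; apply/asboolP.
  by elim/big_ind : _ => //; [exact: openT|exact: openI].
have -> : upper_level y S = [set x | forall c, c \in S -> 0 < y c x] `&`
   [set x | forall c, c \in S -> forall c', c' \notin S -> y c' x < y c x].
  by apply/seteqP; split=> x /= [h1 h2]; split=> // c c1 c2 c3; exact: h2.
apply: openI; first exact: (@fin (fun c => c \in S) (fun c => [set x | 0 < y c x])).
apply: (@fin (fun c => c \in S) (fun c => [set x | forall c', c' \notin S -> y c' x < y c x])) => c.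
exact: (@fin (fun c' => c' \notin S) (fun c' => [set x | y c' x < y c x])).
Qed.

(** Two such index sets at one point are comparable, since an element of each outside the other
    would have the larger value; equal size then forces equality. *)
Lemma upper_level_chain (I : finType) (y : I -> X -> R) (S S' : {set I}) x :
  upper_level y S x -> upper_level y S' x -> #|S| = #|S'| -> S = S'.
Proof.
move=> [_ h] [_ h'] e; apply/eqP; rewrite eqEcard e leqnn andbT.
apply/fintype.subsetP => c cS; apply/negPn/negP => cS'.
have [c' c'S' c'S] : exists2 c', c' \in S' & c' \notin S.
  apply: contrapT => H.
  have : S' \subset S.
    by apply/fintype.subsetP => c' c'S'; apply/negPn/negP => ?; apply: H; exists c'.
  move=> /subset_cardP; rewrite -e => /(_ erefl) => E.
  by move: cS'; rewrite E cS.
by have := lt_trans (h _ _ cS c'S) (h' _ _ c'S' cS'); rewrite ltxx.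
Qed.

(** The index sets at a point form a chain, so they are told apart by their sizes; sizes confined to
    [q + 1] consecutive integers leave at most [q + 1] sets. The predicate [P] selects the levels
    kept, and is where refinement of a given cover is imposed. *)
Lemma chain_cover (I : finType) (y : I -> X -> R) (P : pred {set I}) (q : nat) :
  (forall c, continuous (y c)) ->
  (forall x, exists a, forall S, P S -> upper_level y S x -> (a <= #|S| <= a + q)%N) ->
  (forall x, exists2 S, P S & upper_level y S x) ->
  exists V : {fset set X}, [/\ finite_open_cover V,
    forall A, A \in V -> exists2 S, P S & A = upper_level y S &
    forall x, (multiplicity V x <= q.+1)%N].
Proof.
move=> cy sz cov.
pose V := [fset upper_level y B | B in [seq B <- enum {set I} | P B]]%fset.
have VP A : A \in V -> exists2 S, P S & A = upper_level y S.
  by move/imfsetP => [S /=]; rewrite mem_filter => /andP[PS _] ->; exists S.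
exists V; split=> //.
  split; first by move=> A /VP[S _ ->]; exact: open_upper_level.
  apply/is_coverP => x; have [S PS Sx] := cov x; exists (upper_level y S) => //.
  by apply/imfsetP; exists S => //=; rewrite mem_filter PS mem_enum.
move=> x; have [a ha] := sz x.
pose G := [set B : {set I} | P B && `[< upper_level y B x >]]%SET.
apply: (@leq_trans #|G|).
  rewrite /multiplicity -size_filter.
  apply: (@leq_trans (size [seq upper_level y B | B <- enum G])); last first.
    by rewrite size_map -cardE.
  apply: uniq_leq_size; first exact: (filter_uniq _ (fset_uniq V)).
  move=> A; rewrite mem_filter => /andP[]; rewrite inE => Ax /VP[S PS eA].
  by rewrite eA; apply: map_f; rewrite mem_enum inE PS; apply/asboolP; rewrite -eA.
have inj : {in G &, injective (fun S : {set I} => inord (#|S| - a) : 'I_q.+1)}.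
  move=> S S'; rewrite !inE => /andP[PS /asboolP Sx] /andP[PS' /asboolP S'x] /(congr1 val)/=.
  have /andP[h1 h2] := ha _ PS Sx; have /andP[h1' h2'] := ha _ PS' S'x.
  rewrite !inordK ?ltnS ?leq_subLR// => e.
  by apply: upper_level_chain Sx S'x _; rewrite -(subnK h1) e subnK.
by rewrite -(card_in_imset inj) (leq_trans (max_card _))// card_ord.
Qed.

(** On the disjoint union of two soft covers, keep the levels that meet both halves. Their sizes run
    from 2 to [(p1 + 1) + (p2 + 1)], a window of [p1 + p2 + 1] integers; the lower end 2 is what
    makes the orders add up. *)
Lemma join_cover (m1 m2 : nat) (V1 : 'I_m1 -> set X) (V2 : 'I_m2 -> set X) (p1 p2 : nat) :
  (forall i, open (V1 i)) -> (forall i, open (V2 i)) ->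
  (forall x, exists i, V1 i x) -> (forall x, exists i, V2 i x) ->
  (forall x, #|[set i | `[< V1 i x >]]%SET| <= p1.+1)%N ->
  (forall x, #|[set i | `[< V2 i x >]]%SET| <= p2.+1)%N ->
  exists V : {fset set X}, [/\ finite_open_cover V,
    forall A, A \in V -> exists i j, A `<=` V1 i `&` V2 j &
    forall x, (multiplicity V x <= (p1 + p2).+1)%N].
Proof.
move=> o1 o2 c1 c2 n1 n2.
have [f1 [L1 [_ [_ f1L f1V f11]]]] := cm_soft_cover cX cd o1 c1.
have [f2 [L2 [_ [_ f2L f2V f21]]]] := cm_soft_cover cX cd o2 c2.
pose y (c : 'I_m1 + 'I_m2) : X -> R := match c with inl i => f1 i | inr j => f2 j end.
pose P (S : {set 'I_m1 + 'I_m2}) :=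
  [exists i, inl i \in S] && [exists j, inr j \in S].
have cy c : continuous (y c).
  by case: c => i; [exact: (cm_lip_cont cd (f1L i))|exact: (cm_lip_cont cd (f2L i))].
have [x|x|V [oV VS mV]] := @chain_cover _ y P (p1 + p2) cy.
- exists 2%N => S /andP[/existsP[i iS] /existsP[j jS]] [Spos _]; apply/andP; split.
    by apply/card_gt1P; exists (inl i), (inr j).
  pose A := [set inl i | i in [set i | `[< V1 i x >]]]%SET : {set 'I_m1 + 'I_m2}.
  pose B := [set inr i | i in [set i | `[< V2 i x >]]]%SET : {set 'I_m1 + 'I_m2}.
  have SAB : S \subset A :|: B.
    apply/fintype.subsetP => -[k|k] kS; rewrite inE; apply/orP; [left|right]; apply/imsetP; exists k => //.
      by rewrite inE; apply/asboolP; apply: f1V; exact: (Spos _ kS).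
    by rewrite inE; apply/asboolP; apply: f2V; exact: (Spos _ kS).
  apply: (leq_trans (subset_leq_card SAB)); apply: (leq_trans (leq_card_setU _ _)).
  apply: (@leq_trans (p1.+1 + p2.+1)%N); last by rewrite addSn addnS.
  by apply: leq_add; rewrite (leq_trans (leq_imset_card _ _)).
- exists [set c | 0 < y c x]%SET.
    have [i i1] := f11 x; have [j j1] := f21 x.
    by apply/andP; split; apply/existsP; [exists i|exists j]; rewrite inE /= ?i1 ?j1 ltr01.
  split=> [c|c c']; rewrite !inE// => c0; rewrite -leNgt => c'0; exact: le_lt_trans c0.
exists V; split=> // A /VS[S /andP[/existsP[i iS] /existsP[j jS]] ->].
by exists i, j => x [Spos _]; split; [apply: f1V; exact: (Spos _ iS)|apply: f2V; exact: (Spos _ jS)].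
Qed.

End chain_cover.

(** * Subadditivity and the limit defining mean dimension *)

Section mean_dimension_facts.
Context {R : realType} {X : ptopologicalType} (d : X -> X -> R) (T : X -> X).
Hypotheses (cX : compact [set: X]) (cd : compatible_metric d) (cT : continuous T).
Implicit Types (U V : {fset set X}).

Lemma continuous_iter n : continuous (iter n T).
Proof.
elim: n => [|n IH] x; first exact: cvg_id.
by apply: continuous_comp; [exact: IH|exact: cT].
Qed.

Lemma open_iter n (A : set X) : open A -> open (iter n T @^-1` A).
Proof. by move=> oA; apply: open_comp => // x _; exact: continuous_iter. Qed.

Lemma finite_open_cover_iter U n : finite_open_cover U -> finite_open_cover (cover_iter T U n).
Proof.
move=> [oU cU]; split; last exact: cover_iter_cover.
elim: n => [|n IH] A /=; first by rewrite inE => /eqP ->; exact: openT.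
case/imfset2P => B /= /IH oB [_ /imfsetP[C /= CU ->] ->].
by apply: openI => //; apply: open_iter; exact: oU.
Qed.

Lemma sum_indic_multiplicity V (x : X) : \sum_(A <- V) \1_A x = (multiplicity V x)%:R :> R.
Proof.
rewrite /multiplicity -sum1_count natr_sum [RHS]big_mkcond/=.
by apply: eq_bigr => A _; rewrite indicE; case: (x \in A).
Qed.

Lemma multiplicity_gt0 V (x : X) : is_cover V -> (0 < multiplicity V x)%N.
Proof.
move=> /is_coverP/(_ x)[A AV Ax]; rewrite -has_count; apply/hasP; exists A => //.
by rewrite inE.
Qed.

Lemma cover_dim_ge0 U : (0 <= cover_dim R U)%E.
Proof.
apply: le_ereal_inf_tmp => _ [V [[_ cV] _] <-].
apply: (@le_trans _ _ ((\sum_(A <- V) \1_A (point : X))%:E - 1)%E).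
  rewrite sum_indic_multiplicity -EFinB lee_fin subr_ge0 ler1n.
  exact: multiplicity_gt0.
by apply: ereal_sup_ubound; exists point.
Qed.

Lemma cover_dim_le U V p : finite_open_cover V -> refines V U ->
  (forall x, (multiplicity V x <= p.+1)%N) -> (cover_dim R U <= p%:R%:E)%E.
Proof.
move=> oV rV mV; apply: (@le_trans _ _ (cover_ord R V)).
  by apply: ereal_inf_lbound; exists V.
apply: ub_ereal_sup => _ [x _ <-]; rewrite sum_indic_multiplicity -EFinB lee_fin.
by rewrite lerBlDr natr1 ler_nat.
Qed.

Lemma cover_dim_lt U (c : R) : (cover_dim R U < c%:E)%E ->
  exists V, [/\ finite_open_cover V, refines V U & forall x, (multiplicity V x)%:R < c + 1].
Proof.
move=> /ereal_inf_lt[_ [V [oV rV] <-]] h; exists V; split=> // x.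
rewrite -ltrBlDr -lte_fin EFinB -sum_indic_multiplicity.
by apply: le_lt_trans h; apply: ereal_sup_ubound; exists x.
Qed.

Lemma cover_dim_fin U : finite_open_cover U -> cover_dim R U \is a fin_num.
Proof.
move=> oU; rewrite ge0_fin_numE ?cover_dim_ge0//.
apply: (@le_lt_trans _ _ (size U)%:R%:E); last exact: ltry.
apply: (@cover_dim_le U U) => //; first by move=> A AU; exists A.
by move=> x; rewrite (leq_trans (count_size _ _)).
Qed.

Lemma card_nth_count V (x : X) :
  #|[set i : 'I_(size V) | `[< (nth set0 V i) x >]]%SET| = multiplicity V x.
Proof.
rewrite /multiplicity -sum1_card -sum1_count (big_nth set0) big_mkord.
by apply: eq_bigl => i; rewrite finset.in_set; apply/asboolP/idP; rewrite inE.
Qed.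

(** A cover adapted to the first [m] iterates is joined with the pull-back by the [m]-th iterate of
    a cover adapted to the next [n]. *)
Lemma cover_dim_iter_sub U m n : finite_open_cover U ->
  fine (cover_dim R (cover_iter T U (m + n))) <=
  fine (cover_dim R (cover_iter T U m)) + fine (cover_dim R (cover_iter T U n)).
Proof.
move=> oU; have oI k := finite_open_cover_iter k oU; have fI k := cover_dim_fin (oI k).
apply/ler_addgt0Pr => e e0.
have e20 : 0 < e / 2 by rewrite divr_gt0.
have near k : exists V p, [/\ finite_open_cover V, refines V (cover_iter T U k),
    forall x, (multiplicity V x <= p.+1)%N & p%:R <= fine (cover_dim R (cover_iter T U k)) + e / 2].
  have [V [oV rV mV]] : exists V, [/\ finite_open_cover V, refines V (cover_iter T U k) &
      forall x, (multiplicity V x)%:R < fine (cover_dim R (cover_iter T U k)) + e / 2 + 1].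
    by apply: cover_dim_lt; rewrite EFinD fineK// lteDl.
  pose D := fine (cover_dim R (cover_iter T U k)) + e / 2.
  have D0 : 0 <= D by rewrite addr_ge0 ?fine_ge0 ?cover_dim_ge0// ltW.
  (* Rounding down turns a multiplicity below [D + 1], for a real [D], into one at most [p + 1] with
     an integer [p <= D]. *)
  exists V, (Num.truncn D); split=> //; last by rewrite truncn_le.
  move=> x; rewrite -ltnS -(ltr_nat R) (lt_trans (mV x))// -/D -natr1.
  by rewrite ltrD2r truncnS_gt.
have [V1 [p1 [[oV1 cV1] rV1 mV1 hp1]]] := near m.
have [V2 [p2 [[oV2 cV2] rV2 mV2 hp2]]] := near n.
pose W1 (i : 'I_(size V1)) := nth set0 V1 i.
pose W2 (i : 'I_(size V2)) := iter m T @^-1` nth set0 V2 i.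
have [||||||V [oV VW mV]] := @join_cover R X d cX cd _ _ W1 W2 p1 p2.
- by move=> i; apply: oV1; exact: mem_nth.
- by move=> i; apply: open_iter; apply: oV2; exact: mem_nth.
- move=> x; have /is_coverP/(_ x)[A AV Ax] := cV1.
  have iA : (index A V1 < size V1)%N by rewrite index_mem.
  by exists (Ordinal iA); rewrite /W1 nth_index.
- move=> x; have /is_coverP/(_ (iter m T x))[A AV Ax] := cV2.
  have iA : (index A V2 < size V2)%N by rewrite index_mem.
  by exists (Ordinal iA); rewrite /W2/= nth_index.
- by move=> x; rewrite (card_nth_count V1).
- by move=> x; rewrite /W2 (card_nth_count V2 (iter m T x)).
have rV : refines V (cover_iter T U (m + n)).
  apply/refines_cover_iter => A /VW[i [j AW]] t tmn.
  have i1 : W1 i \in V1 by exact: mem_nth.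
  have j2 : nth set0 V2 j \in V2 by exact: mem_nth.
  have [tm|mt] := ltnP t m.
    have [B BU WB] := (refines_cover_iter _ _ _ _).1 rV1 _ i1 t tm.
    by exists B => // x /AW[/WB].
  have tn : (t - m < n)%N by rewrite ltn_subLR.
  have [B BU WB] := (refines_cover_iter _ _ _ _).1 rV2 _ j2 _ tn.
  by exists B => // x /AW[_ /WB] /=; rewrite -iterD subnK.
have := cover_dim_le oV rV mV.
rewrite -(fineK (fI _)) lee_fin natrD; lra.
Qed.

Lemma mdim_limit U : finite_open_cover U -> exists l : R,
  [/\ (fun n => n%:R^-1 * fine (cover_dim R (cover_iter T U n))) @ \oo --> l,
      (limn (fun n => (n%:R^-1)%:E * cover_dim R (cover_iter T U n)) = l%:E)%E &
      (l%:E <= mdim R T)%E].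
Proof.
move=> oU.
have [||l [hl _]] := @fekete R (fun n => fine (cover_dim R (cover_iter T U n))).
- by move=> n; rewrite fine_ge0 ?cover_dim_ge0.
- by move=> m n; exact: cover_dim_iter_sub.
have e : (limn (fun n => (n%:R^-1)%:E * cover_dim R (cover_iter T U n)) = l%:E)%E.
  have -> : (fun n => (n%:R^-1)%:E * cover_dim R (cover_iter T U n))%E =
     (fun n => (n%:R^-1 * fine (cover_dim R (cover_iter T U n)))%:E).
    by apply/funext => n; rewrite EFinM fineK// cover_dim_fin//; exact: finite_open_cover_iter.
  by apply/cvg_lim => //; apply/fine_cvgP; split; [exact: nearW|exact: hl].
exists l; split=> //; rewrite -e.
by apply: ereal_sup_ubound; exists U.
Qed.

Lemma mdim_ltP (c : R) U N0 : (mdim R T < c%:E)%E -> finite_open_cover U ->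
  exists N V, [/\ (N0 <= N)%N, (0 < N)%N, finite_open_cover V, refines V (cover_iter T U N) &
    forall x, (multiplicity V x)%:R <= c * N%:R + 1].
Proof.
move=> mc oU; have [l [hl _ lm]] := mdim_limit oU.
have lc : l < c by rewrite -lte_fin (le_lt_trans lm).
have : \forall n \near \oo, n%:R^-1 * fine (cover_dim R (cover_iter T U n)) < c.
  by apply: (cvgr_lt l).
move=> [N1 _ hN1]; pose N := maxn (maxn N0 N1) 1.
have NN1 : (N1 <= N)%N by rewrite /N !leq_max leqnn orbT.
have N_gt0 : (0 < N)%N by rewrite /N leq_max leqnn orbT.
have /= := hN1 N NN1; rewrite ltr_pdivrMl ?ltr0n// mulrC => h.
have [|V [oV rV mV]] := @cover_dim_lt (cover_iter T U N) (c * N%:R).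
  by rewrite -(fineK (cover_dim_fin (finite_open_cover_iter N oU))) lte_fin.
exists N, V; split=> //; first by rewrite /N !leq_max leqnn.
by move=> x; rewrite ltW.
Qed.

Lemma mdim_leP (c : R) :
  (forall U, finite_open_cover U -> exists N0, forall N, (N0 <= N)%N -> exists V p,
     [/\ finite_open_cover V, refines V (cover_iter T U N),
       forall x, (multiplicity V x <= p.+1)%N & p%:R <= c * N%:R]) ->
  (mdim R T <= c%:E)%E.
Proof.
move=> H; apply: ub_ereal_sup => _ [U oU <-].
have [l [hl -> _]] := mdim_limit oU; rewrite lee_fin.
apply: (cvgr_to_le hl).
have [N0 hN0] := H U oU; exists (maxn N0 1) => // n /=; rewrite geq_max => /andP[/hN0[V [p [oV rV mV pc]]] n0].
have := cover_dim_le oV rV mV.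
rewrite -(fineK (cover_dim_fin (finite_open_cover_iter n oU))) lee_fin => h.
by rewrite ler_pdivrMl ?ltr0n// mulrC (le_trans h).
Qed.

End mean_dimension_facts.

(** * Sub-probabilities on words and tilings *)

Section potentials.
Context {R : realType} {X : choiceType} (T : X -> X) (dd : X -> X -> R) (eps : R).
Hypotheses (dd0 : forall x y, 0 <= dd x y) (eps0 : 0 < eps).
Implicit Types (Q : seq (R * seq X)) (x : X) (l : seq X).

Fixpoint cost l x : R := if l is y :: l' then dd x y + cost l' (T x) else 0.

(* [Q] lists weighted words; [pot Q x] is small unless [Q] gives weight to words close to the orbit of [x]. *)
Definition pot Q x : R := \sum_(q <- Q) q.1 * expR (- (cost q.2 x / eps)).

(** The Kraft inequality for words of length [n]: [- ln (pot Q x)] reads as a code length for the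
    orbit of [x], with distortion measured in units of [eps]. *)
Definition valid Q (n : nat) : Prop :=
  (forall q, q \in Q -> 0 <= q.1 /\ size q.2 = n) /\ \sum_(q <- Q) q.1 <= 1.

Definition pscale (w : R) Q := [seq (w * q.1, q.2) | q <- Q].

Definition pprod Q Q' := [seq (q.1 * q'.1, q.2 ++ q'.2) | q <- Q, q' <- Q'].

Lemma cost_ge0 l x : 0 <= cost l x.
Proof. by elim: l x => //= y l IH x; rewrite addr_ge0. Qed.

Lemma cost_cat l l' x : cost (l ++ l') x = cost l x + cost l' (iter (size l) T x).
Proof.
elim: l x => [|y l IH] x /=; first by rewrite add0r.
by rewrite IH -addrA; congr (_ + (_ + cost _ _)); rewrite -iterSr.
Qed.

Lemma pot_ge0 Q n x : valid Q n -> 0 <= pot Q x.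
Proof.
move=> [vQ _]; rewrite /pot big_seq; apply: sumr_ge0 => q /vQ[q0 _].
by rewrite mulr_ge0// expR_ge0.
Qed.

Lemma pot_le1 Q n x : valid Q n -> pot Q x <= 1.
Proof.
move=> [vQ sQ]; apply: le_trans sQ; rewrite /pot !big_seq.
apply: ler_sum => q /vQ[q0 _]; rewrite ler_piMr// -expR0 ler_expR oppr_le0.
by rewrite divr_ge0 ?cost_ge0// ltW.
Qed.

Lemma pot_cat Q Q' x : pot (Q ++ Q') x = pot Q x + pot Q' x.
Proof. by rewrite /pot big_cat. Qed.

Lemma pot_scale w Q x : pot (pscale w Q) x = w * pot Q x.
Proof.
by rewrite /pot/pscale big_map mulr_sumr; apply: eq_bigr => q _ /=; rewrite mulrA.
Qed.

Lemma pot_flatten (I : Type) (s : seq I) (F : I -> seq (R * seq X)) x :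
  pot (flatten [seq F i | i <- s]) x = \sum_(i <- s) pot (F i) x.
Proof.
elim: s => [|i s IH] /=; first by rewrite /pot !big_nil.
by rewrite pot_cat IH big_cons.
Qed.

Lemma pot_prod Q Q' n x : valid Q n -> pot (pprod Q Q') x = pot Q x * pot Q' (iter n T x).
Proof.
move=> [vQ _]; rewrite /pot/pprod big_allpairs_dep/= mulr_suml big_seq [RHS]big_seq.
apply: eq_bigr => q /vQ[_ qn]; rewrite mulr_sumr; apply: eq_bigr => q' _.
by rewrite cost_cat qn mulrDl opprD expRD mulrACA.
Qed.

Lemma valid_unit : valid [:: (1, [::])] 0.
Proof. by split=> [q|]; rewrite ?big_seq1//= inE => /eqP -> /=; rewrite ler01. Qed.

Lemma pot_unit x : pot [:: (1, [::])] x = 1.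
Proof. by rewrite /pot big_seq1/= mul0r oppr0 expR0 mulr1. Qed.

Lemma valid_scale w Q n : 0 <= w <= 1 -> valid Q n -> valid (pscale w Q) n.
Proof.
move=> /andP[w0 w1] [vQ sQ]; split.
  by move=> _ /mapP[q /vQ[q0 qn] ->] /=; rewrite mulr_ge0.
rewrite big_map/= -mulr_sumr (@le_trans _ _ w)// ler_piMr//.
Qed.

Lemma valid_prod Q Q' n n' : valid Q n -> valid Q' n' -> valid (pprod Q Q') (n + n').
Proof.
move=> [vQ sQ] [vQ' sQ']; split.
  move=> _ /allpairsP[[q q'] /= [/vQ[q0 qn] /vQ'[q'0 q'n] ->]] /=.
  by rewrite mulr_ge0// size_cat qn q'n.
rewrite big_allpairs_dep/=.
under eq_bigr do rewrite -mulr_sumr.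
rewrite -mulr_suml.
have h : 0 <= \sum_(q <- Q) q.1 by rewrite big_seq sumr_ge0// => q /vQ[].
have h' : 0 <= \sum_(q <- Q') q.1 by rewrite big_seq sumr_ge0// => q /vQ'[].
by rewrite (le_trans (ler_wpM2r h' sQ))// mul1r.
Qed.

Lemma expR1_ge2 : expR (-1) <= 2^-1 :> R.
Proof.
rewrite expRN lef_pV2 ?posrE ?expR_gt0//.
by have := expR_ge1Dx (1 : R); lra.
Qed.

Section tilings.
Variables (J : nat) (n_ : nat -> nat) (Q_ : nat -> seq (R * seq X)) (w_ : nat -> R)
  (Sk : seq (R * seq X)).
Hypotheses (vSk : valid Sk 1) (n_gt0 : forall i, (i < J)%N -> (0 < n_ i)%N)
  (vQ : forall i, (i < J)%N -> valid (Q_ i) (n_ i))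
  (w_ge0 : forall i, (i < J)%N -> 0 <= w_ i) (w_sum : \sum_(i < J) w_ i <= 1).

(** A mixture: with weight 1/2 one letter from [Sk] precedes a shorter tiling, and with weight
    [w_ i / 2] the block [Q_ i] does. *)
Let step (N : nat) (prev : seq (seq (R * seq X))) :=
  pscale 2^-1 (pprod Sk (nth [::] prev 0)) ++
  flatten [seq pscale (2^-1 * w_ i) (pprod (Q_ i) (nth [::] prev (n_ i).-1)) |
           i <- [seq i <- iota 0 J | (n_ i <= N)%N]].

(** Course-of-values recursion: entry [k] of the list is the tiling of length [N - k], because a
    block looks back [n_ i] lengths. *)
Fixpoint tiling_list (N : nat) : seq (seq (R * seq X)) :=
  if N is N'.+1 then step N (tiling_list N') :: tiling_list N' else [:: [:: (1, [::])]].

Definition tiling (N : nat) := head [::] (tiling_list N).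

Lemma tiling_nth N k : (k <= N)%N -> nth [::] (tiling_list N) k = tiling (N - k).
Proof.
by elim: N k => [|N IH] [|k]//; rewrite ltnS => kN /=; rewrite IH.
Qed.

Lemma tilingS N : tiling N.+1 = pscale 2^-1 (pprod Sk (tiling N)) ++
  flatten [seq pscale (2^-1 * w_ i) (pprod (Q_ i) (tiling (N.+1 - n_ i))) |
           i <- [seq i <- iota 0 J | (n_ i <= N.+1)%N]].
Proof.
change (tiling N.+1) with (step N.+1 (tiling_list N)).
rewrite /step tiling_nth// subn0; congr (_ ++ flatten _).
apply/eq_in_map => i; rewrite mem_filter mem_iota add0n /= => /andP[iN /n_gt0 n0].
rewrite tiling_nth; last by rewrite -ltnS prednK.
by congr (pscale _ (pprod _ (tiling _))); rewrite -{2}(prednK n0) subSS.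
Qed.

Lemma sum_w_filter (P : pred nat) : \sum_(i <- [seq i <- iota 0 J | P i]) w_ i <= 1.
Proof.
apply: le_trans w_sum.
rewrite big_filter (_ : iota 0 J = index_iota 0 J); last by rewrite /index_iota subn0.
rewrite -[leRHS](big_mkord xpredT).
rewrite [X in X <= _]big_mkcond/= big_nat [X in _ <= X]big_nat; apply: ler_sum => i /andP[_ iJ].
by case: (P i) => //; exact: w_ge0.
Qed.

Lemma valid_tiling N : valid (tiling N) N.
Proof.
elim/ltn_ind: N => -[|N] IH; first exact: valid_unit.
have v1 : valid (pscale 2^-1 (pprod Sk (tiling N))) N.+1.
  apply: valid_scale; first by rewrite invr_ge0 ler0n invf_le1// ler1n.
  by rewrite -add1n; apply: valid_prod => //; exact: IH.
have v2 i : (i < J)%N -> (n_ i <= N.+1)%N ->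
    valid (pprod (Q_ i) (tiling (N.+1 - n_ i))) N.+1.
  move=> iJ iN; rewrite -[X in valid _ X](subnKC iN); apply: valid_prod; first exact: vQ.
  by apply: IH; rewrite ltn_subrL n_gt0.
rewrite tilingS; split.
  move=> q; rewrite mem_cat => /orP[qin|]; first by case: v1 => + _; apply.
  move=> /flattenP[B /mapP[i]].
  rewrite mem_filter mem_iota add0n /= => /andP[iN iJ] -> /mapP[q' q'in ->] /=; have [/(_ _ q'in)[q0 qn] _] := v2 i iJ iN.
  by rewrite !mulr_ge0// ?invr_ge0 ?w_ge0.
have h12 : (1 : R) = 2^-1 + 2^-1 by lra.
rewrite big_cat/= [leRHS]h12; apply: lerD.
  rewrite big_map/= -mulr_sumr ler_piMr ?invr_ge0//.
  have := (valid_prod vSk (IH N (ltnSn N))).2; exact.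
rewrite big_flatten/= big_map.
apply: (@le_trans _ _ (\sum_(i <- [seq i <- iota 0 J | (n_ i <= N.+1)%N]) 2^-1 * w_ i)).
  rewrite !big_seq; apply: ler_sum => i; rewrite mem_filter mem_iota add0n /= => /andP[iN iJ].
  rewrite big_map/= -mulr_sumr ler_piMr ?mulr_ge0 ?invr_ge0 ?w_ge0//.
  by have [] := v2 i iJ iN.
by rewrite -mulr_sumr ler_piMr ?invr_ge0// sum_w_filter.
Qed.

Lemma tiling_skip N x : 2^-1 * pot Sk x * pot (tiling N) (T x) <= pot (tiling N.+1) x.
Proof.
rewrite tilingS pot_cat pot_scale (pot_prod _ _ vSk) mulrA lerDl pot_flatten.
rewrite big_seq; apply: sumr_ge0 => i; rewrite mem_filter mem_iota add0n /= => /andP[iN iJ].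
rewrite pot_scale (pot_prod _ _ (vQ iJ)) !mulr_ge0 ?invr_ge0 ?w_ge0//.
  exact: pot_ge0 (vQ iJ).
exact: pot_ge0 (valid_tiling _).
Qed.

Lemma tiling_block N i x : (i < J)%N -> (n_ i <= N)%N ->
  2^-1 * (w_ i * pot (Q_ i) x) * pot (tiling (N - n_ i)) (iter (n_ i) T x) <= pot (tiling N) x.
Proof.
case: N => [|N] iJ iN; first by have := n_gt0 iJ; rewrite ltnNge iN.
rewrite tilingS pot_cat pot_flatten.
have ii : i \in [seq i <- iota 0 J | (n_ i <= N.+1)%N] by rewrite mem_filter iN mem_iota.
rewrite (bigD1_seq i)//=; last by rewrite filter_uniq// iota_uniq.
rewrite 2!pot_scale (pot_prod _ _ (vQ iJ)) -!mulrA addrCA lerDl addr_ge0//.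
  rewrite (pot_prod _ _ vSk) !mulr_ge0 ?invr_ge0//; first exact: pot_ge0 vSk.
  exact: pot_ge0 (valid_tiling _).
rewrite big_seq_cond; apply: sumr_ge0 => k /andP[]; rewrite mem_filter mem_iota add0n /= => /andP[kN kJ] _.
rewrite pot_scale (pot_prod _ _ (vQ kJ)) !mulr_ge0 ?invr_ge0 ?w_ge0//.
  exact: pot_ge0 (vQ kJ).
exact: pot_ge0 (valid_tiling _).
Qed.

Variable kappa : R.
Hypotheses (kappa0 : 0 <= kappa) (hk : forall x, expR (- kappa) <= pot Sk x).

Lemma tiling_skipE N x a : expR (- a) <= pot (tiling N) (T x) ->
  expR (- (1 + kappa + a)) <= pot (tiling N.+1) x.
Proof.
move=> h; apply: le_trans (tiling_skip N x).
rewrite !opprD !expRD; apply: ler_pM => //; rewrite ?mulr_ge0 ?expR_ge0//.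
by apply: ler_pM => //; rewrite ?expR_ge0// expR1_ge2.
Qed.

Lemma tiling_blockE N i x b a : (i < J)%N -> (n_ i <= N)%N ->
  expR (- b) <= w_ i * pot (Q_ i) x ->
  expR (- a) <= pot (tiling (N - n_ i)) (iter (n_ i) T x) ->
  expR (- (1 + b + a)) <= pot (tiling N) x.
Proof.
move=> iJ iN h1 h2; apply: le_trans (tiling_block x iJ iN).
rewrite !opprD !expRD; apply: ler_pM => //; rewrite ?mulr_ge0 ?expR_ge0//.
by apply: ler_pM => //; rewrite ?expR_ge0// expR1_ge2.
Qed.

Lemma tiling_skips N x : expR (- (N%:R * (1 + kappa))) <= pot (tiling N) x.
Proof.
elim: N x => [|N IH] x; first by rewrite mul0r oppr0 expR0 pot_unit.
by rewrite -natr1 mulrDl mul1r addrC; apply: tiling_skipE.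
Qed.

(** Parse the orbit greedily: use a block whenever the current point is good for one, otherwise skip
    one letter. A skip happens only at a bad time or in the tail and costs [1 + kappa], where the 1
    pays for the factor 1/2 of the mixture; the same 1 per block turns [c] into [c + 1]. *)
Lemma tiling_greedy (G : nat -> set X) (c : R) (nmax : nat) : 0 <= c ->
  (forall i, (i < J)%N -> (n_ i <= nmax)%N) ->
  (forall i x, (i < J)%N -> G i x -> expR (- ((n_ i)%:R * c)) <= w_ i * pot (Q_ i) x) ->
  forall N x, expR (- (N%:R * (c + 1) +
     ((\sum_(t < N) ~~ `[< exists2 i, (i < J)%N & G i (iter t T x) >])%N + nmax)%:R * kappa))
     <= pot (tiling N) x.
Proof.
move=> c0 nm hG; elim/ltn_ind => N IH x.
case: N IH => [|N] IH.
  rewrite mul0r add0r pot_unit -[leRHS]expR0 ler_expR oppr_le0 mulr_ge0//.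
case: (pselect (exists2 i, (i < J)%N & G i x)) => [[i iJ Gx]|nG]; last first.
  have h := IH N (ltnSn N) (T x).
  apply: le_trans (tiling_skipE h); rewrite ler_expR lerN2.
  rewrite big_ord_recl/= asboolF// /= add1n addSn -!natr1 !mulrDl !mul1r.
  have -> : (\sum_(t < N) ~~ `[< exists2 i0, (i0 < J)%N & G i0 (T (iter (0 + t) T x)) >] =
     \sum_(t < N) ~~ `[< exists2 i, (i < J)%N & G i (iter t T (T x)) >])%N.
    by apply: eq_bigr => t _; rewrite add0n -iterSr.
  by set A := (\sum_(i < N) _)%N; lra.
(* A good block that overshoots the end is replaced by skips; fewer than [nmax] letters remain,
   whence the term [nmax * kappa]. *)
have [iN|Ni] := leqP (n_ i) N.+1; last first.
  apply: le_trans (tiling_skips N.+1 x); rewrite ler_expR lerN2.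
  set M := ((_ + nmax)%N%:R * kappa).
  have : N.+1%:R * kappa <= M.
    by rewrite /M ler_wpM2r// ler_nat (leq_trans (ltnW Ni))// (leq_trans (nm _ iJ))// leq_addl.
  have : 0 <= N.+1%:R * c by rewrite mulr_ge0.
  rewrite !mulrDr mulr1; lra.
have ni0 := n_gt0 iJ.
have h := IH (N.+1 - n_ i)%N _ (iter (n_ i) T x).
have lt : (N.+1 - n_ i < N.+1)%N by rewrite ltn_subrL ni0.
apply: le_trans (tiling_blockE iJ iN (hG i x iJ Gx) (h lt)); rewrite ler_expR lerN2.
have bad : (\sum_(t < N.+1 - n_ i) ~~ `[< exists2 i0, (i0 < J)%N & G i0 (iter t T (iter (n_ i) T x)) >] <=
    \sum_(t < N.+1) ~~ `[< exists2 i0, (i0 < J)%N & G i0 (iter t T x) >])%N.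
  rewrite -[in leqRHS](subnKC iN) big_split_ord/=; apply: leq_trans (leq_addl _ _).
  apply: leq_sum => t _; rewrite -iterD addnC //.
have : ((\sum_(t < N.+1 - n_ i) ~~ `[< exists2 i0, (i0 < J)%N & G i0 (iter t T (iter (n_ i) T x)) >] + nmax)%N%:R : R) * kappa <=
    (\sum_(t < N.+1) ~~ `[< exists2 i0, (i0 < J)%N & G i0 (iter t T x) >] + nmax)%N%:R * kappa.
  by rewrite ler_wpM2r// ler_nat leq_add2r.
set A := _%:R * kappa; set B := _%:R * kappa.
have : (1 : R) <= (n_ i)%:R by rewrite ler1n.
rewrite natrB// mulrBl; lra.
Qed.

End tilings.

End potentials.

(** * A volume bound for covers *)

Section grid_sum.
Context {R : realType}.

(** A two-sided geometric progression centred at [n0]; the exponent is [|k - n0|] written with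
    truncated subtraction. *)
Lemma geometric_dist (rho : R) (n0 K : nat) : 0 <= rho <= 1 ->
  (1 - rho) * \sum_(k < K) rho ^+ ((k - n0) + (n0 - k)) <= 2.
Proof.
move=> /andP[r0 r1].
(* An explicit majorant of the partial sums, obtained by telescoping on each side of [n0]. *)
pose G K := if (K <= n0)%N then rho ^+ (n0 - K) else 2 - rho ^+ (K - n0).
suff H : (1 - rho) * \sum_(k < K) rho ^+ ((k - n0) + (n0 - k)) <= G K.
  apply: (le_trans H); rewrite /G; case: ifP => _.
    by rewrite (@le_trans _ _ 1)// ?exprn_ile1// ler1n.
  by rewrite gerBl exprn_ge0.
elim: K => [|K IH]; first by rewrite big_ord0 mulr0 /G leq0n exprn_ge0.
rewrite big_ord_recr/= mulrDr; apply: (le_trans (lerD IH (lexx _))).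
rewrite /G; case: (ltngtP K n0) => hK.
- have [m e] : exists m, (n0 - K)%N = m.+1 by exists (n0 - K).-1; lia.
  have -> : (n0 - K.+1)%N = m by lia.
  have -> : (K - n0)%N = 0%N by lia.
  rewrite e add0n exprS.
  have : 0 <= (1 - rho) * (1 - rho) * rho ^+ m by rewrite mulr_ge0 ?exprn_ge0// -expr2 sqr_ge0.
  lra.
- have -> : (n0 - K)%N = 0%N by lia.
  have -> : (K.+1 - n0)%N = (K - n0).+1 by lia.
  by rewrite addn0 exprS; lra.
- by rewrite hK subnn subSnn addn0 expr0 expr1; lra.
Qed.

(** A Riemann sum, over [K] equally spaced thresholds in [1/4, 3/4], of an exponential bump of width
    [delta]. The condition [1 / K <= delta] makes the grid finer than the bump, so that its mean is
    of order [delta]. *)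
Lemma exp_grid_sum (K : nat) (z delta eta : R) : 0 < delta -> (0 < K)%N ->
  K%:R^-1 <= delta -> eta <= delta ->
  \sum_(k < K) expR ((eta - `|4^-1 + k%:R / (2 * K%:R) - z|) / delta) <=
    K%:R * (6 * expR 2 * delta).
Proof.
move=> d0 K0 Kd ed.
have KR : (0 : R) < K%:R by rewrite ltr0n.
have K2 : (0 : R) < 2 * K%:R by rewrite mulr_gt0.
pose b := (2 * K%:R * delta)^-1 : R.
have b0 : 0 < b by rewrite invr_gt0 mulr_gt0.
have b1 : b <= 2^-1.
  rewrite /b lef_pV2 ?posrE ?mulr_gt0// -mulrA ler_peMr//.
  by rewrite -ler_pdivrMl// mulr1.
pose zeta := (z - 4^-1) * (2 * K%:R).
(* The integer part of [zeta], or 0 below the grid (it may exceed [K]); replacing [zeta] by it costs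
   at most 1 in the lower bound on distances. *)
pose n0 := if 0 <= zeta then Num.truncn zeta else 0%N.
have dist (k : nat) : ((k - n0) + (n0 - k))%N%:R - 1 <= `|k%:R - zeta|.
  have e : ((k - n0) + (n0 - k))%N%:R = `|k%:R - n0%:R| :> R.
    case: (leqP k n0) => h.
      have -> : (k - n0)%N = 0%N by lia.
      by rewrite add0n natrB// distrC ger0_norm// subr_ge0 ler_nat.
    have -> : (n0 - k)%N = 0%N by lia.
    by rewrite addn0 natrB 1?ltnW// ger0_norm// subr_ge0 ler_nat ltnW.
  rewrite e /n0; case: ifP => z0.
    have := truncn_itv z0; move=> /andP[h1 h2].
    have h3 : `|(Num.truncn zeta)%:R - zeta| <= 1.
      rewrite ler_norml; move: h2; rewrite -natr1 => h2; apply/andP; split; lra.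
    have := ler_distD zeta k%:R (Num.truncn zeta)%:R; rewrite (distrC zeta); lra.
  move/negbT: z0; rewrite -ltNge => z0; rewrite subr0 ger0_norm//.
  have := ler_norm (k%:R - zeta); lra.
(* The factor [expR 2] absorbs [eta / delta <= 1] and the rounding error [b <= 1/2]. *)
have step (k : 'I_K) : expR ((eta - `|4^-1 + k%:R / (2 * K%:R) - z|) / delta) <=
    expR 2 * expR (- b) ^+ ((k - n0) + (n0 - k)).
  rewrite -expRM_natl -expRD ler_expR.
  have -> : 4^-1 + k%:R / (2 * K%:R) - z = (k%:R - zeta) / (2 * K%:R).
    by rewrite /zeta; field; rewrite gt_eqF.
  rewrite normrM (gtr0_norm (x := (_)^-1)) ?invr_gt0//.
  have -> : (eta - `|k%:R - zeta| / (2 * K%:R)) / delta = eta / delta - b * `|k%:R - zeta|.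
    by rewrite /b; field; rewrite !gt_eqF.
  have h1 : eta / delta <= 1 by rewrite ler_pdivrMr// mul1r.
  have := dist k; rewrite -(ler_pM2l b0) mulrBr mulr1 => h2.
  rewrite mulrC; move: h2; set A := _%:R; lra.
apply: (le_trans (ler_sum _ (fun k _ => step k))); rewrite -mulr_sumr.
set S := \sum_(k < K) _.
have rho01 : 0 <= expR (- b) <= 1.
  by rewrite expR_ge0/= -[leRHS]expR0 ler_expR oppr_le0 ltW.
have := @geometric_dist _ n0 K rho01; rewrite -/S => h.
have S0 : 0 <= S by apply: sumr_ge0 => k _; rewrite exprn_ge0// expR_ge0.
have hb : 2 / 3 * b <= 1 - expR (- b).
  have h1 : expR (- b) <= (1 + b)^-1.
    by rewrite expRN lef_pV2 ?posrE ?expR_gt0 ?addr_gt0// expR_ge1Dx.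
  have h2 : (1 + b)^-1 <= 1 - 2 / 3 * b.
    rewrite -[leLHS]mul1r ler_pdivrMr ?addr_gt0//.
    have : 0 <= b * (1 - 2 * b) by apply: mulr_ge0; lra.
    lra.
  lra.
have h3 : 2 / 3 * b * S <= 2 by apply: le_trans h; rewrite ler_wpM2r.
have -> : K%:R * (6 * expR 2 * delta) = expR 2 * (3 / b).
  by rewrite /b invrK; ring.
rewrite ler_wpM2l ?expR_ge0// ler_pdivlMr//; lra.
Qed.

End grid_sum.

Lemma continuous_clamp {R : realType} (X : topologicalType) (g : X -> R) :
  continuous g -> continuous (fun x => clamp (g x)).
Proof.
move=> cg x; apply/cvgrPdist_lt => e e0.
have /cvgrPdist_lt/(_ e e0) := cg x; apply: filterS => z; apply: le_lt_trans.
exact: clamp_near.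
Qed.

(** * From sub-probabilities on words to covers of small multiplicity *)

Section volume.
Context {R : realType} {X : ptopologicalType} (d : X -> X -> R) (T : X -> X).
Hypotheses (cX : compact [set: X]) (cd : compatible_metric d) (cT : continuous T).
Variables (m : nat) (f : 'I_m -> X -> R).
Hypotheses (cf : forall i, continuous (f i)) (f11 : forall x, exists i, f i x = 1).

Definition fdist (x y : X) : R := \big[Num.max/0]_(i < m) `|f i x - f i y|.

Lemma fdist_ge0 x y : 0 <= fdist x y.
Proof. exact: bigmax_ge0. Qed.

Lemma fdist_ge i x y : `|f i x - f i y| <= fdist x y.
Proof. exact: le_bigmax. Qed.

(** The ramp [y c] is intermediate between 0 and 1 only within [eta] of its threshold. A kept level
    contains every coordinate with value 1, since the values on it would otherwise exceed 1, and
    besides them only intermediate ones; at each point its size thus varies by at most [q]. *)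
Lemma avoid_grid_cover (U : {fset set X}) (N q : nat) (a : 'I_N * 'I_m -> R) (eta : R) :
  (forall i, exists2 A, A \in U & forall x, 0 < f i x -> A x) ->
  0 < eta -> (forall c, eta <= a c <= 1 - eta) ->
  (forall x, (#|[set c : 'I_N * 'I_m | (`|f c.2 (iter c.1 T x) - a c| < eta)%R]%SET| <= q)%N) ->
  exists V, [/\ finite_open_cover V, refines V (cover_iter T U N) &
    forall x, (multiplicity V x <= q.+1)%N].
Proof.
move=> fU eta0 ha hq.
pose y (c : 'I_N * 'I_m) (x : X) : R := clamp ((f c.2 (iter c.1 T x) - a c) / (2 * eta) + 2^-1).
(* Meeting every time [t] is what makes the levels refine the iterated cover. *)
pose P (S : {set 'I_N * 'I_m}) := [forall t, exists i, (t, i) \in S].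
have e20 : 0 < 2 * eta by rewrite mulr_gt0.
have cy c : continuous (y c).
  apply: continuous_clamp => x; apply: cvgD; last exact: cvg_cst.
  apply: cvgMr_tmp; apply: cvgB; last exact: cvg_cst.
  apply: (@continuous_comp _ _ _ (iter c.1 T) (f c.2)); last exact: cf.
  exact: continuous_iter.
have ypos c x : 0 < y c x -> - eta < f c.2 (iter c.1 T x) - a c.
  move=> /clamp_gt0 h.
  have : - 2^-1 < (f c.2 (iter c.1 T x) - a c) / (2 * eta) by lra.
  rewrite ltr_pdivlMr//; lra.
have y1 (c : 'I_N * 'I_m) x : f c.2 (iter c.1 T x) - a c >= eta -> y c x = 1.
  move=> h; apply: clamp_ge1.
  have : 2^-1 <= (f c.2 (iter c.1 T x) - a c) / (2 * eta) by rewrite ler_pdivlMr//; lra.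
  lra.
have [x|x|V [oV VS mV]] := @chain_cover R X _ y P q cy.
- pose One := [set c | y c x == 1]%SET; exists #|One| => S /forallP PS [Spos Slev].
  have OS : One \subset S.
    apply/fintype.subsetP => c; rewrite inE => /eqP yc.
    have [i iS] := existsP (PS c.1); apply/negPn/negP => cS.
    have := Slev _ _ iS cS; rewrite yc ltNge; apply/negP/negPn; exact: clamp_le1.
  rewrite subset_leq_card//=.
  have SOA : S \subset One :|: [set c : 'I_N * 'I_m | `|f c.2 (iter c.1 T x) - a c| < eta]%SET.
    apply/fintype.subsetP => c /Spos yc; rewrite !inE.
    have [//|yc1] := eqVneq (y c x) 1; rewrite orFb ltr_norml (ypos _ _ yc)/= ltNge.
    by apply: contraNN yc1 => /y1 ->.
  apply: (leq_trans (subset_leq_card SOA)); apply: (leq_trans (leq_card_setU _ _)).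
  by rewrite leq_add2l hq.
- exists [set c | 0 < y c x]%SET.
    apply/forallP => t; have [i i1] := f11 (iter t T x); apply/existsP; exists i.
    rewrite inE /= y1 ?ltr01//= i1; have /andP[_] := ha (t, i); lra.
  split=> [c|c c']; rewrite !inE// => c0; rewrite -leNgt => c'0; exact: le_lt_trans c0.
exists V; split=> //; apply/refines_cover_iter => A /VS[S /forallP PS ->] t tN.
have [i iS] := existsP (PS (Ordinal tN)); have [B BU hB] := fU i.
exists B => // x [Spos _]; apply: hB.
have := ypos _ _ (Spos _ iS); have /andP[+ _] := ha (Ordinal tN, i); rewrite /=; lra.
Qed.

Lemma cost_nth (dd : X -> X -> R) l x :
  cost T dd l x = \sum_(t < size l) dd (iter t T x) (nth point l t).
Proof.
elim: l x => [|z l IH] x /=; first by rewrite big_ord0.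
by rewrite big_ord_recl/= IH; congr (_ + _); apply: eq_bigr => t _; rewrite -iterSr.
Qed.

(** A first-moment argument over all assignments of thresholds. If each [a] had a point with [r]
    coordinates near their thresholds, then [Phi a >= 1] for all [a]; but thresholds of distinct
    coordinates are independent, so the mean of [Phi] factors into the sums of [exp_grid_sum] and
    stays below 1. *)
Lemma exists_avoiding_grid (N r K k : nat) (eps B : 'I_k -> R) (Q : 'I_k -> seq (R * seq X)) (eta : R) :
  (0 < m)%N -> (0 < K)%N -> 
  (forall e, [/\ 0 < eps e, valid (Q e) N, K%:R^-1 <= m%:R * eps e & eta <= m%:R * eps e]) ->
  (forall x, exists e, expR (- B e) <= pot T fdist (eps e) (Q e) x) ->
  \sum_e 2 ^+ (m * N) * expR (B e) * (6 * expR 2 * (m%:R * eps e)) ^+ r < 1 ->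
  exists a : 'I_N * 'I_m -> 'I_K, forall x,
   (#|[set c : 'I_N * 'I_m | (`|f c.2 (iter c.1 T x) - (4^-1 + (a c)%:R / (2 * K%:R))| < eta)%R]%SET| < r)%N.
Proof.
move=> m0 K0 he hx small; apply: contrapT => /forallNP bad.
pose I := ('I_N * 'I_m)%type.
have mR : (0 : R) < m%:R by rewrite ltr0n.
(* At a coordinate near its threshold, the value on the orbit may be traded for the threshold at the
   price [eta]. The scale is [m eps] because [fdist] dominates the mean of the [m] coordinate
   distances. *)
pose h (e : 'I_k) (l : seq X) (c : I) (j : 'I_K) : R :=
  expR ((eta - `|4^-1 + j%:R / (2 * K%:R) - f c.2 (nth point l c.1)|) / (m%:R * eps e)).
pose W (e : 'I_k) (J : {set I}) (a : {ffun I -> 'I_K}) : R :=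
  \sum_(q <- Q e) q.1 * \prod_(c in J) h e q.2 c (a c).
pose Phi (a : {ffun I -> 'I_K}) := \sum_e \sum_(J : {set I} | #|J| == r) expR (B e) * W e J a.
have W0 e J a : 0 <= W e J a.
  have [_ [vQ _] _ _] := he e.
  rewrite /W big_seq; apply: sumr_ge0 => q /vQ[q0 _]; rewrite mulr_ge0//.
  by apply: prodr_ge0 => c _; exact: expR_ge0.
have Phi1 a : 1 <= Phi a.
  have [x hxa] : exists x, (r <= #|[set c : I | (`|f c.2 (iter c.1 T x) - (4^-1 + (a c)%:R / (2 * K%:R))| < eta)%R]%SET|)%N.
    have /existsNP[x /negP] := bad a; rewrite -leqNgt => hxa; by exists x.
  have [s [us sr hs]] := card_geqP hxa.
  have [J [Jr hJ]] : exists J : {set I}, #|J| = r /\ {subset J <= [set c : I | (`|f c.2 (iter c.1 T x) - (4^-1 + (a c)%:R / (2 * K%:R))| < eta)%R]%SET}.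
    exists [set c in s]%SET; split; first by rewrite cardsE (card_uniqP us).
    by move=> c; rewrite inE => /hs.
  have [e hex] := hx x.
  have [e0 vQ _ _] := he e.
  rewrite /Phi (bigD1 e)//= (bigD1 J)//=; last exact/eqP.
  rewrite -addrA ler_wpDr//.
    rewrite addr_ge0//; first by apply: sumr_ge0 => ? _; rewrite mulr_ge0 ?expR_ge0.
    by apply: sumr_ge0 => ? _; apply: sumr_ge0 => ? _; rewrite mulr_ge0 ?expR_ge0.
  have -> : (1 : R) = expR (B e) * expR (- B e) by rewrite -expRD subrr expR0.
  rewrite ler_wpM2l ?expR_ge0//; apply: (le_trans hex).
  rewrite /pot /W !big_seq; apply: ler_sum => q qQ; have [q0 qN] := vQ.1 q qQ.
  rewrite ler_wpM2l//.
  rewrite -expR_sum ler_expR.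
  have cN : cost T fdist q.2 x >= m%:R^-1 * \sum_(c in J) `|f c.2 (iter c.1 T x) - f c.2 (nth point q.2 c.1)|.
    rewrite cost_nth qN ler_pdivrMl//.
    apply: (@le_trans _ _ (\sum_(c : I) `|f c.2 (iter c.1 T x) - f c.2 (nth point q.2 c.1)|)).
      by rewrite [leRHS](bigID (fun c => c \in J))/= lerDl sumr_ge0.
    rewrite -(pair_bigA _ (fun (t : 'I_N) (i : 'I_m) => `|f i (iter t T x) - f i (nth point q.2 t)|))/=.
    rewrite mulr_sumr; apply: ler_sum => t _.
    apply: (le_trans (ler_sum _ (fun i _ => fdist_ge i (iter t T x) (nth point q.2 t)))).
    by rewrite big_const_ord iter_addr addr0 mulr_natl.
  apply: (@le_trans _ _ (- (m%:R^-1 * \sum_(c in J) `|f c.2 (iter c.1 T x) - f c.2 (nth point q.2 c.1)| / eps e))).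
    by rewrite lerN2 -mulr_suml mulrA ler_wpM2r ?invr_ge0// ltW.
  rewrite mulr_sumr -sumrN; apply: ler_sum => c cJ.
  have /= : c \in [set c : I | (`|f c.2 (iter c.1 T x) - (4^-1 + (a c)%:R / (2 * K%:R))| < eta)%R]%SET.
    exact: hJ.
  rewrite inE => hc.
  set A := `|f _ _ - f _ _|.
  rewrite (_ : - (m%:R^-1 * (A / eps e)) = - A / (m%:R * eps e)); last by field; rewrite !gt_eqF.
  rewrite ler_wpM2r ?invr_ge0 ?mulr_ge0 1?ltW// {}/A.
  have := ler_distD (f c.2 (iter c.1 T x)) (4^-1 + (a c)%:R / (2 * K%:R)) (f c.2 (nth point q.2 c.1)).
  rewrite (distrC (4^-1 + _) (f _ (iter _ _ _))); lra.
have sumPhi : \sum_a Phi a <= (\sum_e 2 ^+ (m * N) * expR (B e) * (6 * expR 2 * (m%:R * eps e)) ^+ r) * K%:R ^+ (N * m).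
  rewrite /Phi exchange_big/= mulr_suml; apply: ler_sum => e _.
  have [e0 vQ Ke etae] := he e.
  have me0 : 0 < m%:R * eps e by rewrite mulr_gt0.
  rewrite exchange_big/=.
  have bJ (J : {set I}) : #|J| == r -> \sum_a expR (B e) * W e J a <=
      expR (B e) * (6 * expR 2 * (m%:R * eps e)) ^+ r * K%:R ^+ (N * m).
    move=> /eqP Jr; rewrite -mulr_sumr -mulrA ler_wpM2l ?expR_ge0// /W exchange_big/=.
    have inner (q : R * seq X) : \sum_(a : {ffun I -> 'I_K}) \prod_(c in J) h e q.2 c (a c) <=
       (6 * expR 2 * (m%:R * eps e)) ^+ r * K%:R ^+ (N * m).
      rewrite (eq_bigr (fun a : {ffun I -> 'I_K} => \prod_c (if c \in J then h e q.2 c (a c) else 1))); last first.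
        by move=> a _; rewrite big_mkcond.
      rewrite -(bigA_distr_bigA (fun c j => if c \in J then h e q.2 c j else 1))/=.
      apply: (@le_trans _ _ (\prod_(c : I) (K%:R * (if c \in J then 6 * expR 2 * (m%:R * eps e) else 1)))).
        apply: ler_prod => c _; apply/andP; split.
          by apply: sumr_ge0 => j _; case: ifP => // _; exact: expR_ge0.
        case: ifP => _; last by rewrite sumr_const card_ord mulr1.
        exact: exp_grid_sum.
      rewrite big_split/= prodr_const card_prod !card_ord -big_mkcond/= prodr_const Jr.
      by rewrite mulrC.
    apply: (@le_trans _ _ (\sum_(q <- Q e) q.1 * ((6 * expR 2 * (m%:R * eps e)) ^+ r * K%:R ^+ (N * m)))).
      rewrite !big_seq; apply: ler_sum => q qQ; have [q0 _] := vQ.1 q qQ.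
      by rewrite -mulr_sumr ler_wpM2l.
    rewrite -mulr_suml ler_piMl//; last exact: vQ.2.
    by rewrite mulr_ge0 ?exprn_ge0// mulr_ge0 ?mulr_ge0 ?expR_ge0// ltW.
  apply: (le_trans (ler_sum _ bJ)); rewrite sumr_const -[in leRHS]mulrA -[in leRHS]mulrA [in leRHS](mulrA (expR _)).
  set A := expR (B e) * _ * _.
  have A0 : 0 <= A by rewrite !mulr_ge0 ?exprn_ge0 ?expR_ge0// !mulr_ge0 ?expR_ge0// ltW.
  rewrite -[A *+ _]mulr_natl ler_wpM2r// -natrX ler_nat.
  apply: (leq_trans (max_card _)).
  by rewrite -cardsT -powersetT card_powerset cardsT card_prod !card_ord mulnC.
have lowPhi : K%:R ^+ (N * m) <= \sum_a Phi a.
  apply: (@le_trans _ _ (\sum_(a : {ffun I -> 'I_K}) 1)); last exact: ler_sum.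
  by rewrite sumr_const card_ffun card_prod !card_ord -natrX.
have KN : (0 : R) < K%:R ^+ (N * m) by rewrite exprn_gt0// ltr0n.
have := le_lt_trans (le_trans lowPhi sumPhi); move=> /(_ (K%:R ^+ (N * m))).
by rewrite ltxx -[ltRHS]mul1r ltr_pM2r// small => /(_ isT).
Qed.

(** With [r] just above [(s + g) N], the grid factor [exp (- lam e)] to the power [r] beats
    [exp (N s lam e)] from the code length by [exp (- g lam e N)], and this margin also absorbs all
    bounded factors once [lam e >= lam0]. Each scale contributes at most [2 ^ - N], so up to [N]
    scales are affordable. *)
Lemma volume_bound (U : {fset set X}) (s g C lam0 : R) (k N : nat) (lam : 'I_k -> R)
    (Q : 'I_k -> seq (R * seq X)) :
  (forall i, exists2 A, A \in U & forall x, 0 < f i x -> A x) ->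
  0 <= s -> 0 < g -> 0 <= C -> 0 <= lam0 -> (forall e, lam0 <= lam e) ->
  2 ^+ m * expR C * (6 * expR 2 * m%:R) ^+ m * expR (- (g * lam0)) <= 2^-1 ->
  (k <= N)%N -> (forall e, valid (Q e) N) ->
  (forall x, exists e, expR (- (N%:R * (s * lam e + C))) <= pot T fdist (expR (- lam e)) (Q e) x) ->
  exists V p, [/\ finite_open_cover V, refines V (cover_iter T U N),
    forall x, (multiplicity V x <= p.+1)%N & p%:R <= (s + g) * N%:R].
Proof.
move=> fU s0 g0 C0 lam00 lamge small kN vQ hx.
have m0 : (0 < m)%N by have [[i im] _] := f11 point; exact: leq_ltn_trans im.
have mR : (1 : R) <= m%:R by rewrite ler1n.
pose D := (s + g) * N%:R; pose q := Num.truncn D.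
have D0 : 0 <= D by rewrite mulr_ge0// addr_ge0// ltW.
have qD : D < q.+1%:R by exact: truncnS_gt.
have qD' : q%:R <= D by rewrite truncn_le.
pose E := \big[Num.max/0]_e lam e.
have lE e : lam e <= E by exact: le_bigmax.
(* A margin below all scales [exp (- lam e)], so that one grid serves them together, and at most
   1/4, so that thresholds in [1/4, 3/4] stay [t] away from 0 and 1. *)
pose t := expR (- E) / 4.
have t0 : 0 < t by rewrite divr_gt0// expR_gt0.
have E0 : 0 <= E by exact: bigmax_ge0.
have t4 : t <= 4^-1 by rewrite /t ler_piMl// -expR0 ler_expR oppr_le0.
have te e : t <= m%:R * expR (- lam e).
  apply: (@le_trans _ _ (expR (- lam e))).
    by rewrite (@le_trans _ _ (expR (- E)))// ?ler_expR ?lerN2// /t ler_piMr ?expR_ge0//; lra.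
  by rewrite ler_peMl ?expR_ge0.
suff [a ha] : exists a : 'I_N * 'I_m -> R, (forall c, t <= a c <= 1 - t) /\
    forall x, (#|[set c : 'I_N * 'I_m | (`|f c.2 (iter c.1 T x) - a c| < t)%R]%SET| <= q)%N.
  have [V [h1 h2 h3]] := avoid_grid_cover fU t0 ha.1 ha.2.
  by exists V, q.
(* When [q] is at least the number of coordinates, constant thresholds will do. *)
have [qNm|Nmq] := ltnP q (N * m); last first.
  exists (fun=> 2^-1); split; first by move=> _; apply/andP; split; lra.
  by move=> x; apply: leq_trans Nmq; rewrite (leq_trans (max_card _))// card_prod !card_ord.
pose K := (Num.truncn t^-1).+1.
have Kt : K%:R^-1 <= t by rewrite invf_ple ?posrE ?ltr0n// ltW// truncnS_gt.
have [||||a ha] := @exists_avoiding_grid N q.+1 K k (fun e => expR (- lam e))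
   (fun e => N%:R * (s * lam e + C)) Q t m0.
- by [].
- by move=> e; split; [exact: expR_gt0|exact: vQ|exact: le_trans Kt _|exact: te].
- exact: hx.
- have c1 : 1 <= 6 * expR 2 * m%:R :> R.
    have h2 : 1 <= expR (2 : R) by rewrite -expR0 ler_expR.
    by apply: mulr_ege1 => //; lra.
  pose th := 2 ^+ m * expR C * (6 * expR 2 * m%:R) ^+ m * expR (- (g * lam0)) : R.
  have bnd e : 2 ^+ (m * N) * expR (N%:R * (s * lam e + C)) * (6 * expR 2 * (m%:R * expR (- lam e))) ^+ q.+1 <= th ^+ N.
    have le0 : 0 <= lam e by exact: le_trans (lamge e).
    rewrite mulrA exprMn -expRM_natl.
    apply: (@le_trans _ _ (2 ^+ (m * N) * expR (N%:R * (s * lam e + C)) *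
        ((6 * expR 2 * m%:R) ^+ (m * N) * expR (- ((s + g) * N%:R * lam e))))).
      apply: ler_wpM2l; first by rewrite mulr_ge0 ?exprn_ge0 ?expR_ge0.
      apply: ler_pM; rewrite ?expR_ge0 ?exprn_ge0//.
      - by rewrite ler_weXn2l// mulnC.
      - by rewrite ler_expR mulrN lerN2 ler_wpM2r// ltW.
    rewrite /th; move: c1; generalize (6 * expR 2 * m%:R : R) => A c1.
    have -> : (2 ^+ m * expR C * A ^+ m * expR (- (g * lam0))) ^+ N =
      2 ^+ (m * N) * (A ^+ (m * N) * expR (N%:R * (C - g * lam0))).
      rewrite -!mulrA exprMn -exprM; congr (_ * _).
      by rewrite mulrCA exprMn -exprM -expRD -expRM_natl.
    rewrite -!mulrA ler_wpM2l ?exprn_ge0// mulrCA ler_wpM2l ?exprn_ge0 ?(le_trans ler01 c1)//.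
    rewrite -expRD ler_expR.
    have : N%:R * (g * lam0) <= N%:R * (g * lam e).
      by rewrite ler_wpM2l// ler_wpM2l// ltW.
    lra.
  apply: (le_lt_trans (ler_sum _ (fun e _ => bnd e))).
  rewrite big_const_ord iter_addr addr0.
  have thN : th ^+ N <= (2^-1) ^+ N.
    by rewrite lerXn2r// nnegrE ?invr_ge0// !mulr_ge0 ?exprn_ge0 ?expR_ge0// (le_trans ler01 c1).
  apply: (@le_lt_trans _ _ (k%:R * 2^-1 ^+ N)).
    by rewrite mulr_natl lerMn2r thN orbT.
  rewrite exprVn ltr_pdivrMr ?exprn_gt0// mul1r -natrX ltr_nat.
  exact: leq_ltn_trans kN (ltn_expl _ _).
exists (fun c => 4^-1 + (a c)%:R / (2 * K%:R)); split; last by move=> x; exact: ha.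
move=> c; apply/andP; split.
  by apply: (le_trans t4); rewrite lerDl divr_ge0// mulr_ge0.
have : (a c)%:R / (2 * K%:R) <= 2^-1 :> R.
  by rewrite invfM mulrCA ler_piMr// ler_pdivrMr ?ltr0n// mul1r ler_nat ltnW.
lra.
Qed.

End volume.

(** * Weak limits of empirical measures *)

Section regularization.
Context {R : realType} {X : ptopologicalType} (d : X -> X -> R) (m : set X -> R).
Hypotheses (cX : compact [set: X]) (cd : compatible_metric d).
Hypotheses (m0 : forall A, 0 <= m A) (m1 : m setT = 1)
  (madd : forall A B, A `&` B = set0 -> m (A `|` B) = m A + m B).
Local Open Scope ereal_scope.

Lemma fa_mono A B : A `<=` B -> (m A <= m B)%R.
Proof.
move=> AB; have -> : B = A `|` (B `\` A) by apply/seteqP; split=> x /=; have := AB x; have [] := pselect (A x); tauto.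
rewrite madd ?lerDl//; first by rewrite setDE setICA setICr setI0.
Qed.

Lemma fa_set0 : m set0 = 0%R.
Proof. by have := @madd set0 set0 (setI0 _); rewrite setU0; lra. Qed.

Lemma fa_subU A B : (m (A `|` B) <= m A + m B)%R.
Proof.
have -> : A `|` B = A `|` (B `\` A).
  by apply/seteqP; split=> x /=; have [] := pselect (A x); tauto.
rewrite madd ?lerD2l; first by apply: fa_mono => x [].
by rewrite setDE setICA setICr setI0.
Qed.

(** A finitely additive [m] need not be countably additive; its values on closed sets determine a
    content on open sets, and compactness makes the resulting outer content countably
    subadditive. *)
Definition inner_content (V : set X) : \bar R :=
  ereal_sup [set (m C)%:E | C in [set C | closed C /\ C `<=` V]].

Definition outer_content (A : set X) : \bar R :=
  ereal_inf [set inner_content V | V in [set V | open V /\ A `<=` V]].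

Lemma inner_content_ge (C V : set X) : closed C -> C `<=` V -> (m C)%:E <= inner_content V.
Proof. by move=> cC CO; apply: ereal_sup_ubound; exists C. Qed.

Lemma inner_content_ge0 V : 0 <= inner_content V.
Proof. by rewrite -[leLHS]/(0%R%:E) -fa_set0; apply: inner_content_ge; [exact: closed0|exact: sub0set]. Qed.

Lemma inner_content_le V : inner_content V <= (m V)%:E.
Proof. by apply: ub_ereal_sup => _ [C [_ CO] <-]; rewrite lee_fin fa_mono. Qed.

Lemma inner_content_mono V V' : V `<=` V' -> inner_content V <= inner_content V'.
Proof.
move=> OO'; apply: ub_ereal_sup => _ [C [cC CO] <-].
by apply: inner_content_ge => //; exact: subset_trans OO'.
Qed.

Lemma outer_content_open V : open V -> outer_content V = inner_content V.
Proof.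
move=> oO; apply/eqP; rewrite eq_le; apply/andP; split.
  by apply: ereal_inf_lbound; exists V => //; split.
by apply: le_ereal_inf_tmp => _ [V' [_ OO'] <-]; exact: inner_content_mono.
Qed.

Lemma outer_content_ge0 A : 0 <= outer_content A.
Proof. by apply: le_ereal_inf_tmp => _ [V _ <-]; exact: inner_content_ge0. Qed.

Lemma outer_content_mono : {homo outer_content : A B / A `<=` B >-> A <= B}.
Proof.
move=> A B AB; apply: le_ereal_inf_tmp => _ [V [oO BO] <-].
by apply: ereal_inf_lbound; exists V => //; split=> //; exact: subset_trans BO.
Qed.

Lemma outer_content_le1 A : outer_content A <= 1.
Proof.
apply: (@le_trans _ _ (inner_content setT)); last by rewrite (le_trans (inner_content_le _))// m1.
by apply: ereal_inf_lbound; exists setT => //; split=> //; exact: openT.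
Qed.

Lemma outer_content_fin A : outer_content A \is a fin_num.
Proof. by rewrite ge0_fin_numE ?outer_content_ge0// (le_lt_trans (outer_content_le1 _))// ltry. Qed.

(** With [e] a Lebesgue number, [C1] and [C2] collect the points of [C] whose [e]-ball lies in [O1],
    respectively in [O2]. *)
Lemma closed_split (C O1 O2 : set X) : closed C -> open O1 -> open O2 -> C `<=` O1 `|` O2 ->
  exists C1 C2, [/\ closed C1, closed C2, C1 `<=` O1, C2 `<=` O2 & C `<=` C1 `|` C2].
Proof.
move=> cC o1 o2 CO.
have [||e e0 he] := cm_lebesgue cX cd (C := [set O1; O2; ~` C]).
- by move=> A [[->|->]|->] //; exact: closed_openC.
- move=> x; have [Cx|nCx] := pselect (C x); last by exists (~` C) => //; right.
  by have [?|?] := CO _ Cx; [exists O1 => //; left; left|exists O2 => //; left; right].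
pose I V := C `&` [set x | forall y, (d x y < e)%R -> V y].
have cI V : closed (I V).
  apply: closedI => //; rewrite -openC; apply/(cm_openP cd) => x /= /existsNP[y /not_implyP[xy nOy]].
  exists (e - d x y)%R; first by rewrite subr_gt0.
  move=> z xz /(_ y) h; apply: nOy; apply: h.
  by have := cm_tri cd x z y; rewrite (cm_sym cd z x); lra.
exists (I O1), (I O2); split=> //.
- by move=> x [_ h]; apply: h; rewrite (cm_xx cd).
- by move=> x [_ h]; apply: h; rewrite (cm_xx cd).
move=> x Cx; have [_ [[->|->]|->] h] := he x; [by left; split|by right; split|].
by have := h x; rewrite (cm_xx cd) e0 => /(_ isT).
Qed.

Lemma inner_contentU O1 O2 : open O1 -> open O2 ->
  inner_content (O1 `|` O2) <= inner_content O1 + inner_content O2.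
Proof.
move=> o1 o2; apply: ub_ereal_sup => _ [C [cC CO] <-].
have [C1 [C2 [c1 c2 CO1 CO2 C12]]] := closed_split cC o1 o2 CO.
apply: (@le_trans _ _ ((m C1)%:E + (m C2)%:E)).
  by rewrite -EFinD lee_fin (le_trans (fa_mono C12))// fa_subU.
by apply: leeD; exact: inner_content_ge.
Qed.

(** A closed set inside the union is compact, hence inside a finite union: here finite additivity
    becomes countable subadditivity. *)
Lemma inner_content_bigcup (V : nat -> set X) : (forall i, open (V i)) ->
  inner_content (\bigcup_i V i) <= \sum_(i <oo) inner_content (V i).
Proof.
move=> oO; apply: ub_ereal_sup => _ [C [cC CO] <-].
pose P n := \big[setU/set0]_(i < n) V i.
have oP n : open (P n) by rewrite /P; elim/big_ind : _ => //; [exact: open0|exact: openU].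
have fin n : inner_content (P n) <= \sum_(i < n) inner_content (V i).
  elim: n => [|n IH]; rewrite /P ?big_ord0.
    by rewrite (le_trans (inner_content_le _))// fa_set0.
  by rewrite !big_ord_recr/= (le_trans (inner_contentU _ _))// ?leeD2r//; exact: oP.
have [n Cn] : exists n, C `<=` P n.
  pose F (i : option nat) : set X := if i is Some i then V i else ~` C.
  have [||s hs] := cm_fin_cover cX (U := F).
  - by case=> [i|]; [exact: oO|exact: closed_openC].
  - move=> x; have [/CO[i _ Oi]|] := pselect (C x); [by exists (Some i)|by exists None].
  exists (\max_(i <- s) odflt 0%N i).+1 => x Cx; have [[i|] iS Fx] := hs x; last by [].
  rewrite /P -bigcup_mkord; exists i => //=; rewrite ltnS.
  exact: (@leq_bigmax_seq _ _ xpredT (odflt 0%N) (Some i)).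
apply: (le_trans (inner_content_ge cC Cn)); apply: (le_trans (fin n)).
rewrite -(big_mkord xpredT (fun i => inner_content (V i))); apply: nneseries_lim_ge => i _ _; exact: inner_content_ge0.
Qed.

Lemma outer_content_sigma_subadditive : sigma_subadditive outer_content.
Proof.
move=> A; apply/lee_addgt0Pr => e e0.
have /choice[V hO] i : exists V, [/\ open V, A i `<=` V & inner_content V <= outer_content (A i) + (e / (2 ^ i.+1)%:R)%:E].
  have : outer_content (A i) < outer_content (A i) + (e / (2 ^ i.+1)%:R)%:E.
    by rewrite lteDl ?outer_content_fin// lte_fin divr_gt0// ltr0n expn_gt0.
  by move=> /ereal_inf_lt[_ [V [oO AO] <-] h]; exists V; split=> //; exact: ltW.
apply: (@le_trans _ _ (inner_content (\bigcup_i V i))).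
  apply: ereal_inf_lbound; exists (\bigcup_i V i) => //; split.
    by apply: bigcup_open => i _; case: (hO i).
  by move=> x [i _ Ax]; exists i => //; case: (hO i) => _ + _; apply.
apply: (le_trans (inner_content_bigcup _)) => [i|]; first by case: (hO i).
apply: le_trans (epsilon_trick xpredT _ (ltW e0)); last by move=> i; exact: outer_content_ge0.
by apply: lee_nneseries => i *; [exact: inner_content_ge0|case: (hO i)].
Qed.

Lemma outer_content0 : outer_content set0 = 0.
Proof.
apply/eqP; rewrite eq_le outer_content_ge0 andbT outer_content_open; last exact: open0.
by rewrite (le_trans (inner_content_le _))// fa_set0.
Qed.

HB.instance Definition _ := isOuterMeasure.Build R X outer_content
  outer_content0 outer_content_ge0 outer_content_mono outer_content_sigma_subadditive.

(** Only open sets [V] have to be split. Approximate the part of [V] in [G] from inside by a closed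
    [C]; then [C] is disjoint from every closed subset of the rest of [V], and [m] is additive on
    disjoint sets. *)
Lemma open_caratheodory (G : set X) : open G -> caratheodory_measurable outer_content G.
Proof.
move=> oG; apply: le_caratheodory_measurable => A.
apply: le_ereal_inf_tmp => _ [V [oO AO] <-].
apply: (@le_trans _ _ (outer_content (V `&` G) + outer_content (V `\` G))).
  by apply: leeD; apply: outer_content_mono => x [? ?]; split=> //; exact: AO.
rewrite outer_content_open; last exact: openI.
apply/lee_addgt0Pr => e e0.
have fin : inner_content (V `&` G) \is a fin_num.
  by rewrite -outer_content_open ?outer_content_fin//; exact: openI.
have : inner_content (V `&` G) - e%:E < inner_content (V `&` G).
  by rewrite lteBlDr// lteDl// lte_fin.
move=> /ereal_sup_gt[_ [C [cC CO] <-]] h1.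
apply: (@le_trans _ _ ((m C)%:E + e%:E + inner_content (V `\` C))).
  apply: leeD; first by rewrite -leeBlDr// ltW.
  apply: ereal_inf_lbound; exists (V `\` C) => //; split; first by rewrite setDE; apply: openI => //; exact: closed_openC.
  by move=> x [Ox nG]; split=> // /CO[].
rewrite addeAC leeD2r//.
have fin2 : inner_content (V `\` C) \is a fin_num.
  by rewrite -outer_content_open ?outer_content_fin//; by rewrite setDE; apply: openI => //; exact: closed_openC.
rewrite -leeBrDl//; apply: ub_ereal_sup => _ [C' [cC' C'V] <-].
rewrite leeBrDl// -EFinD -madd; last by apply/seteqP; split=> x // [Cx /C'V[]].
apply: inner_content_ge; first exact: closedU.
by move=> x [/CO[]|/C'V[]].
Qed.

Lemma borel_caratheodory (A : set (borel X)) : measurable A ->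
  caratheodory_measurable outer_content A.
Proof.
move=> mA.
have : <<s @open X >> `<=` (@measurable _ (caratheodory_type outer_content)).
  by apply: smallest_sub; [exact: sigma_algebra_measurable|move=> G; exact: open_caratheodory].
exact.
Qed.

Definition regular_extension (A : set (borel X)) : \bar R := outer_content A.

Let re0 : regular_extension set0 = 0. Proof. exact: outer_content0. Qed.
Let re_ge0 A : 0 <= regular_extension A. Proof. exact: outer_content_ge0. Qed.
Let re_sigma : semi_sigma_additive regular_extension.
Proof.
move=> F mF tF mUF.
have mF' n : @measurable _ (caratheodory_type outer_content) (F n).
  exact: borel_caratheodory.
apply: (@caratheodory_measure_sigma_additive R X outer_content F mF' tF).
exact: borel_caratheodory.
Qed.

HB.instance Definition _ := isMeasure.Build _ _ _ regular_extension re0 re_ge0 re_sigma.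

Let re1 : regular_extension setT = 1.
Proof.
rewrite /regular_extension outer_content_open; last exact: openT.
apply/eqP; rewrite eq_le (le_trans (inner_content_le _)) ?m1//=.
by rewrite -{1}m1; apply: inner_content_ge => //; exact: closedT.
Qed.

HB.instance Definition _ := Measure_isProbability.Build _ _ _ regular_extension re1.

Lemma finitely_additive_regularization : exists mu : probability (borel X) R,
  [/\ forall A, mu A = outer_content A,
      forall V, open V -> mu V <= (m V)%:E &
      forall C, closed C -> (m C)%:E <= mu C].
Proof.
exists (regular_extension : probability (borel X) R); split => // [V oO|C cC].
  by rewrite -[X in X <= _]/(outer_content V) outer_content_open// inner_content_le.
apply: le_ereal_inf_tmp => _ [V [oO CO] <-]; exact: inner_content_ge.
Qed.

End regularization.

(** * Limits of bounded sequences along an ultrafilter *)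

Section generalized_limit.
Context {R : realType}.
Implicit Types u v : nat -> R.

(** The limit along an ultrafilter containing the neighbourhoods of infinity exists for every
    bounded sequence, so frequencies of arbitrary sets acquire a limit without extraction of
    subsequences. *)
Lemma generalized_limit : exists L : (nat -> R) -> R,
  [/\ forall u v (C : R) n0, (forall n, `|u n| <= C) -> (forall n, `|v n| <= C) ->
        (forall n, (n0 <= n)%N -> u n <= v n) -> L u <= L v,
      forall c, L (fun=> c) = c &
      forall u v (C : R), (forall n, `|u n| <= C) -> (forall n, `|v n| <= C) ->
        L (fun n => u n + v n) = L u + L v].
Proof.
have [U [UU sU]] := @ultraFilterLemma nat \oo _.
have PU : ProperFilter U by exact: ultra_proper.
have cv u (C : R) : (forall n, `|u n| <= C) -> exists p : R, u @ U --> p.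
  move=> hu; have cC : compact `[- C, C]%classic by exact: segment_compact.
  have FU : ProperFilter (u @ U) by apply: fmap_proper_filter.
  have UC : (u @ U) `[- C, C]%classic.
    rewrite nbhs_simpl/=; apply: (@filterS _ U _ setT); last exact: filterT.
    by move=> n _; rewrite /= in_itv/= -ler_norml.
  have [p [_ clp]] := cC _ FU UC; exists p.
  apply/cvgrPdist_lt => e e0.
  have [//|bad] := in_ultra_setVsetC [set n | `|p - u n| < e] UU.
  have nb : nbhs p [set t | `|p - t| < e].
    by apply/nbhs_ballP; exists e.
  have [_ [[n nn <-] /=]] : (u @` (~` [set n | `|p - u n| < e])) `&` [set t | `|p - t| < e] !=set0.
    apply: clp => //; rewrite nbhs_simpl/=; apply: (@filterS _ U _ (~` [set n | `|p - u n| < e])) => //.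
    by move=> n nn; exists n.
  by move=> h; exfalso; apply: nn.
exists (fun u => lim (u @ U)); split.
- move=> u v C n0 hu hv uv; have [p hp] := cv u C hu; have [q hq] := cv v C hv.
  rewrite (cvg_lim _ hp)// (cvg_lim _ hq)//.
  apply: (ler_cvg_to hp hq); apply: sU; exists n0 => // n /=; exact: uv.
- by move=> c; apply: cvg_lim => //; exact: cvg_cst.
- move=> u v C hu hv; have [p hp] := cv u C hu; have [q hq] := cv v C hv.
  rewrite (cvg_lim _ hp)// (cvg_lim _ hq)//; apply: cvg_lim => //; exact: cvgD.
Qed.

End generalized_limit.

Section empirical_limits.
Context {R : realType} {X : ptopologicalType} (d : X -> X -> R) (T S : X -> X).
Hypotheses (cX : compact [set: X]) (cd : compatible_metric d).
Hypotheses (cT : continuous T) (cS : continuous S) (TK : cancel T S) (SK : cancel S T).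

Definition freq (A : set X) (x : X) (N : nat) : R :=
  N%:R^-1 * \sum_(t < N) \1_A (iter t T x).

Lemma indic01 (A : set X) x : 0 <= (\1_A x : R) <= 1.
Proof. by rewrite indicE; case: (_ \in _); rewrite ?lexx ?ler01. Qed.

Lemma freq_itv A x N : 0 <= freq A x N <= 1.
Proof.
case: N => [|N]; first by rewrite /freq big_ord0 mulr0 lexx ler01.
apply/andP; split.
  by rewrite mulr_ge0// sumr_ge0// => t _; case/andP: (indic01 A (iter t T x)).
rewrite ler_pdivrMl ?ltr0n// mulr1.
apply: (@le_trans _ _ (\sum_(t < N.+1) 1)); last by rewrite big_const_ord iter_addr addr0.
by apply: ler_sum => t _; case/andP: (indic01 A (iter t T x)).
Qed.

Lemma freqU A B x N : A `&` B = set0 -> freq (A `|` B) x N = freq A x N + freq B x N.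
Proof.
move=> AB; rewrite /freq -mulrDr -big_split/=; congr (_ * _); apply: eq_bigr => t _.
rewrite !indicE in_setU; case: (boolP (_ \in A)) => a; case: (boolP (_ \in B)) => b; rewrite ?addr0 ?add0r//.
by have : (A `&` B) (iter t T x) by [split; exact: set_mem]; rewrite AB.
Qed.

Lemma freq_preim A x N : `|freq (T @^-1` A) x N - freq A x N| <= N%:R^-1.
Proof.
case: N => [|N]; first by rewrite /freq !big_ord0 !mulr0 subrr normr0 invr0.
rewrite /freq -mulrBr normrM ger0_norm ?invr_ge0// ler_piMr ?invr_ge0//.
rewrite big_ord_recr [X in _ - X]big_ord_recl/=.
have -> : \sum_(i < N) \1_(T @^-1` A) (iter i T x) = \sum_(i < N) \1_A (T (iter (0 + i) T x)) :> R.
  by apply: eq_bigr => i _; rewrite add0n !indicE.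
have := indic01 A x; have := indic01 (T @^-1` A) (iter N T x).
move=> /andP[h1 h2] /andP[h3 h4]; rewrite ler_norml; apply/andP; split; lra.
Qed.

(** Frequencies along the segments have a generalised limit on all sets, an invariant finitely
    additive probability. Its regularisation is at least as large on closed sets and at most as
    large on open ones, and stays invariant since a homeomorphism permutes open sets and closed
    sets. *)
Lemma weak_limit (x : nat -> X) (N : nat -> nat) : (forall k, (k < N k)%N) ->
  exists mu : probability (borel X) R, [/\ invariant_measure T mu,
    forall (C : set X) tau k0, closed C ->
      (forall k, (k0 <= k)%N -> tau <= freq C (x k) (N k)) -> (tau%:E <= mu C)%E,
    forall (G : set X) tau k0, open G ->
      (forall k, (k0 <= k)%N -> freq G (x k) (N k) <= tau) -> (mu G <= tau%:E)%E &
    forall (A : set X) e, 0 < e -> exists G, [/\ open G, A `<=` G & (mu G <= mu A + e%:E)%E]].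
Proof.
move=> hN; have [L [Lle Lc Ladd]] := @generalized_limit R.
pose m (A : set X) := L (fun k => freq A (x k) (N k)).
have fn A k : `|freq A (x k) (N k)| <= 1.
  by have /andP[h0 h1] := freq_itv A (x k) (N k); rewrite ger0_norm.
have cn (c : R) : 0 <= c <= 1 -> forall n : nat, `|c| <= 1.
  by move=> /andP[c0 c1] _; rewrite ger0_norm.
have m0 A : 0 <= m A.
  rewrite -(Lc 0); apply: (Lle _ _ 1 0%N) => // n; first by rewrite normr0.
  by case/andP: (freq_itv A (x n) (N n)).
have m1 : m setT = 1.
  rewrite -[RHS]Lc; congr L; apply/funext => k; rewrite /freq.
  rewrite (eq_bigr (fun=> 1)); last by move=> i _; rewrite indicT.
  by rewrite big_const_ord iter_addr addr0 mulVf// pnatr_eq0 -lt0n (leq_ltn_trans _ (hN k)).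
have madd A B : A `&` B = set0 -> m (A `|` B) = m A + m B.
  move=> AB; rewrite -(Ladd _ _ 1)//; congr L; apply/funext => k; exact: freqU.
(* Shifting a segment changes a frequency by at most [1 / N k], which tends to 0 because
   [k < N k]. *)
have minv A : m (T @^-1` A) = m A.
  suff H (u v : nat -> R) : (forall n, `|u n| <= 1) -> (forall n, `|v n| <= 1) ->
      (forall n, u n <= v n + (N n)%:R^-1) -> L u <= L v.
    apply/eqP; rewrite eq_le; apply/andP; split; apply: H => // n;
      have := freq_preim A (x n) (N n); rewrite ler_norml => /andP[h1 h2]; lra.
  move=> hu hv uv; apply/ler_addgt0Pr => e e0; rewrite -[X in _ <= _ + X]Lc -(Ladd _ _ (`|e| + 1)); last 2 first.
  - by move=> n; rewrite (le_trans (hv n))// lerDr.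
  - by move=> n; rewrite lerDl.
  apply: (Lle _ _ (1 + (`|e| + 1)) (Num.truncn e^-1)).
  - by move=> n; rewrite (le_trans (hu n))// lerDl addr_ge0.
  - move=> n; apply: (le_trans (ler_normD _ _)); apply: lerD; first exact: hv.
    by rewrite lerDl.
  - move=> n hn; apply: (le_trans (uv n)); rewrite lerD2l.
    have N0 : (0 < N n)%N by rewrite (leq_ltn_trans _ (hN n)).
    rewrite invf_ple ?posrE ?ltr0n//.
    apply: ltW; apply: (lt_le_trans (truncnS_gt _)).
    by rewrite ler_nat (leq_trans _ (hN n)).
have [mu [muE muO muC]] := finitely_additive_regularization cX cd m0 m1 madd.
exists mu; split.
- move=> A mA; rewrite !muE.
  have icT G : inner_content m (T @^-1` G) = inner_content m G.
    apply/eqP; rewrite eq_le; apply/andP; split; apply: ub_ereal_sup => _ [C [cC CG] <-].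
      have -> : m C = m (S @^-1` C).
        rewrite -(minv (S @^-1` C)); congr m; apply/seteqP; split=> y /=; by rewrite TK.
      apply: inner_content_ge; first by apply: closed_comp => // y _; exact: cS.
      by move=> y /CG /=; rewrite SK.
    rewrite -(minv C); apply: inner_content_ge; first by apply: closed_comp => // y _; exact: cT.
    by move=> y /CG.
  apply/eqP; rewrite eq_le; apply/andP; split; apply: le_ereal_inf_tmp => _ [G [oG AG] <-].
    rewrite -icT; apply: ereal_inf_lbound; exists (T @^-1` G) => //; split.
      by apply: open_comp => // y _; exact: cT.
    by move=> y /AG.
  have -> : inner_content m G = inner_content m (S @^-1` G).
    rewrite -(icT (S @^-1` G)); congr (inner_content m _).
    by apply/seteqP; split=> y /=; rewrite TK.
  apply: ereal_inf_lbound; exists (S @^-1` G) => //; split.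
    by apply: open_comp => // y _; exact: cS.
  by move=> y Ay; apply: AG; rewrite /= SK.
- move=> C tau k0 cC h; apply: le_trans (muC C cC); rewrite lee_fin -(Lc tau).
  apply: (Lle _ _ (`|tau| + 1) k0) => // n; first by rewrite lerDl.
  by rewrite (le_trans (fn _ _))// lerDr.
- move=> G tau k0 oG h; apply: (le_trans (muO G oG)); rewrite lee_fin -(Lc tau).
  apply: (Lle _ _ (`|tau| + 1) k0) => // n; last by rewrite lerDl.
  by rewrite (le_trans (fn _ _))// lerDr.
- move=> A e e0.
  have : (outer_content m A < outer_content m A + e%:E)%E.
    by rewrite lteDl ?lte_fin//; exact: outer_content_fin.
  move=> /ereal_inf_lt[_ [G [oG AG] <-] h]; exists G; split=> //.
  by rewrite !muE outer_content_open// ltW.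
Qed.

End empirical_limits.

(** * Expectations and the ergodic theorem *)

Section limsup_facts.
Context {R : realType}.
Implicit Types (u : nat -> \bar R) (c : \bar R).
Local Open Scope ereal_scope.

Lemma limn_esup_leP u c n0 : (forall n, (n0 <= n)%N -> u n <= c) -> limn_esup u <= c.
Proof.
move=> h; rewrite /limn_esup limf_esupE.
apply: (@le_trans _ _ (ereal_sup (u @` [set n | (n0 <= n)%N]))).
  by apply: ereal_inf_lbound; exists [set n | (n0 <= n)%N] => //; exists n0.
by apply: ub_ereal_sup => _ [n /= hn <-]; exact: h.
Qed.

Lemma limn_esup_ltP u c : limn_esup u < c -> exists n0, forall n, (n0 <= n)%N -> u n < c.
Proof.
rewrite /limn_esup limf_esupE => /ereal_inf_lt[_ [A [n0 _ hA] <-] h].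
exists n0 => n hn; apply: le_lt_trans h; apply: ereal_sup_ubound; exists n => //.
exact: hA.
Qed.

Lemma limn_esup_gtP u c n0 : c < limn_esup u -> exists2 n, (n0 <= n)%N & c < u n.
Proof.
move=> h; apply: contrapT => H; move: h; apply/negP; rewrite -leNgt.
apply: (@limn_esup_leP _ _ n0) => n hn; rewrite leNgt; apply/negP => ?.
by apply: H; exists n.
Qed.

Lemma limn_esup_geP u c : (forall n0, exists2 n, (n0 <= n)%N & c <= u n) -> c <= limn_esup u.
Proof.
move=> h; rewrite leNgt; apply/negP => /limn_esup_ltP[n0 H].
by have [n /H + /le_lt_trans cu] := h n0 => /cu; rewrite ltxx.
Qed.

Lemma limn_einf_ltP u c n0 : limn_einf u < c -> exists2 n, (n0 <= n)%N & u n < c.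
Proof.
rewrite /limn_einf lteNl => /(@limn_esup_gtP _ _ n0)[n hn]; rewrite lteN2.
by exists n.
Qed.

Lemma limn_esup_mono u v n0 : (forall n, (n0 <= n)%N -> u n <= v n) -> limn_esup u <= limn_esup v.
Proof.
move=> h; rewrite /limn_esup !limf_esupE; apply: le_ereal_inf_tmp => _ [A [n1 _ hA] <-].
apply: (@le_trans _ _ (ereal_sup (u @` [set n | (maxn n0 n1 <= n)%N]))).
  apply: ereal_inf_lbound; exists [set n | (maxn n0 n1 <= n)%N] => //.
  by exists (maxn n0 n1).
apply: ub_ereal_sup => _ [n /= + <-]; rewrite geq_max => /andP[hn0 hn1].
by apply: (le_trans (h _ hn0)); apply: ereal_sup_ubound; exists n => //; exact: hA.
Qed.

End limsup_facts.

Section bounded_expectation.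
Context {R : realType} {dY : measure_display} {Y : measurableType dY} (mu : probability Y R).
Implicit Types f g : Y -> R.

Definition bm f := measurable_fun setT f /\ exists C, forall x, `|f x| <= C.

Definition Ex f : R := \int[mu]_x f x.

Lemma mu_setT : mu setT = 1%E. Proof. exact: probability_setT. Qed.

Lemma bm_integrable f : bm f -> mu.-integrable setT (EFin \o f).
Proof.
move=> [mf [C hC]]; apply: measurable_bounded_integrable => //.
  by change (mu setT < +oo)%E; rewrite mu_setT ltry.
exists C; split; first exact: num_real.
by move=> M CM x _ /=; rewrite (le_trans (hC x))// ltW.
Qed.

Lemma bm_cst c : bm (fun=> c).
Proof. by split; [exact: measurable_cst|exists `|c|]. Qed.

Lemma bmD f g : bm f -> bm g -> bm (fun x => f x + g x).
Proof.
move=> [mf [C hC]] [mg [D hD]]; split; first exact: measurable_funD.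
by exists (C + D) => x; rewrite (le_trans (ler_normD _ _))// lerD.
Qed.

Lemma bmZ c f : bm f -> bm (fun x => c * f x).
Proof.
move=> [mf [C hC]]; split; first exact: measurable_funM.
by exists (`|c| * C) => x; rewrite normrM ler_wpM2l.
Qed.

Lemma bmB f g : bm f -> bm g -> bm (fun x => f x - g x).
Proof.
move=> bf bg; have -> : (fun x => f x - g x) = (fun x => f x + (-1) * g x).
  by apply/funext => x; rewrite mulN1r.
by apply: bmD => //; exact: bmZ.
Qed.

Lemma bm_norm f : bm f -> bm (fun x => `|f x|).
Proof.
move=> [mf [C hC]]; split; last by exists C => x; rewrite normr_id.
exact: measurableT_comp.
Qed.

Lemma bm_indic (A : set Y) : measurable A -> bm (\1_A : Y -> R).
Proof.
move=> mA; split; first exact: measurable_indic.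
by exists 1 => x; rewrite indicE; case: (_ \in _); rewrite ?normr1 ?normr0 ?ler01.
Qed.

Lemma bm_sum (I : Type) (s : seq I) (P : pred I) (F : I -> Y -> R) :
  (forall i, P i -> bm (F i)) -> bm (fun x => \sum_(i <- s | P i) F i x).
Proof.
move=> h; elim: s => [|i s IH].
  by rewrite (_ : (fun _ => _) = (fun=> 0)); [exact: bm_cst|apply/funext => x; rewrite big_nil].
case: (boolP (P i)) => Pi.
  rewrite (_ : (fun _ => _) = (fun x => F i x + \sum_(i <- s | P i) F i x)).
    by apply: bmD => //; exact: h.
  by apply/funext => x; rewrite big_cons Pi.
rewrite (_ : (fun _ => _) = (fun x => \sum_(i <- s | P i) F i x))//.
by apply/funext => x; rewrite big_cons (negbTE Pi).
Qed.

Lemma Ex_EFin f : bm f -> (\int[mu]_x (f x)%:E = (Ex f)%:E)%E.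
Proof.
move=> bf; rewrite /Ex /Rintegral fineK//.
exact: integral_fune_fin_num (bm_integrable bf).
Qed.

Lemma ExD f g : bm f -> bm g -> Ex (fun x => f x + g x) = Ex f + Ex g.
Proof. by move=> bf bg; rewrite /Ex RintegralD//; exact: bm_integrable. Qed.

Lemma ExZ c f : bm f -> Ex (fun x => c * f x) = c * Ex f.
Proof. by move=> bf; rewrite /Ex RintegralZl//; exact: bm_integrable. Qed.

Lemma ExB f g : bm f -> bm g -> Ex (fun x => f x - g x) = Ex f - Ex g.
Proof. by move=> bf bg; rewrite /Ex RintegralB//; exact: bm_integrable. Qed.

Lemma Ex_le f g : bm f -> bm g -> (forall x, f x <= g x) -> Ex f <= Ex g.
Proof.
by move=> bf bg h; apply: le_Rintegral => //; exact: bm_integrable.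
Qed.

Lemma Ex_cst c : Ex (fun=> c) = c.
Proof. by rewrite /Ex Rintegral_cst//; change (c * fine (mu setT) = c); rewrite mu_setT/= mulr1. Qed.

Lemma Ex_ge0 f : bm f -> (forall x, 0 <= f x) -> 0 <= Ex f.
Proof. by move=> bf h; rewrite -(Ex_cst 0); apply: Ex_le => //; exact: bm_cst. Qed.

Lemma Ex_indic (A : set Y) : measurable A -> Ex (\1_A) = fine (mu A).
Proof. by move=> mA; rewrite /Ex /Rintegral integral_indic// setIT. Qed.

Lemma Ex_sum (I : Type) (s : seq I) (P : pred I) (F : I -> Y -> R) :
  (forall i, P i -> bm (F i)) ->
  Ex (fun x => \sum_(i <- s | P i) F i x) = \sum_(i <- s | P i) Ex (F i).
Proof.
move=> h; elim: s => [|i s IH].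
  by rewrite big_nil -[RHS](Ex_cst 0); congr Ex; apply/funext => x; rewrite big_nil.
rewrite big_cons; case: (boolP (P i)) => Pi.
  rewrite -IH -ExD//; [|exact: h|exact: bm_sum].
  by congr Ex; apply/funext => x; rewrite big_cons Pi.
by rewrite -IH; congr Ex; apply/funext => x; rewrite big_cons (negbTE Pi).
Qed.

Lemma mu_fin (A : set Y) : measurable A -> mu A = (fine (mu A))%:E.
Proof. by move=> mA; rewrite fineK// fin_num_measure. Qed.

Lemma measurable_le_set f s : measurable_fun setT f -> measurable [set x | s <= f x].
Proof.
move=> mf; have -> : [set x | s <= f x] = f @^-1` `[s, +oo[%classic.
  by apply/seteqP; split=> x /=; rewrite in_itv/= andbT.
by rewrite -[X in measurable X]setTI; exact: mf.
Qed.

Lemma measurable_lt_set f s : measurable_fun setT f -> measurable [set x | s < f x].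
Proof.
move=> mf; have -> : [set x | s < f x] = f @^-1` `]s, +oo[%classic.
  by apply/seteqP; split=> x /=; rewrite in_itv/= andbT.
by rewrite -[X in measurable X]setTI; exact: mf.
Qed.

Lemma Ex_markov f s : bm f -> (forall x, 0 <= f x) -> 0 < s ->
  fine (mu [set x | s <= f x]) <= Ex f / s.
Proof.
move=> bf f0 s0; have mA := measurable_le_set s bf.1.
rewrite ler_pdivlMr// mulrC -Ex_indic// -ExZ; last exact: bm_indic.
apply: Ex_le => //; first by apply: bmZ; exact: bm_indic.
move=> x; rewrite indicE; case: (boolP (_ \in _)) => [/set_mem/=|_]; first by rewrite mulr1.
by rewrite mulr0.
Qed.

Lemma Ex_eq0_null f : bm f -> (forall x, 0 <= f x) -> Ex f = 0 -> mu [set x | 0 < f x] = 0%E.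
Proof.
move=> bf f0 e0.
have -> : [set x | 0 < f x] = \bigcup_n [set x | n.+1%:R^-1 <= f x].
  apply/seteqP; split=> x /=.
    move=> h; exists (Num.truncn (f x)^-1) => //=.
    rewrite invf_ple ?posrE//; exact/ltW/truncnS_gt.
  by move=> [n _ /=]; apply: lt_le_trans.
apply/eqP; rewrite -measure_le0.
apply: (le_trans (@measure_sigma_subadditive _ _ _ mu _ (fun n => [set x | n.+1%:R^-1 <= f x]) _ _ _)) => //.
- by move=> n; exact: measurable_le_set bf.1.
- by apply: bigcup_measurable => n _; exact: measurable_le_set bf.1.
rewrite eseries0 => [//|n _ _].
apply/eqP; rewrite eq_le measure_ge0 andbT.
have mA : measurable [set x | n.+1%:R^-1 <= f x] by exact: measurable_le_set bf.1.
change (mu [set x | (n.+1%:R^-1 <= f x)%R] <= 0)%E; rewrite (mu_fin mA) lee_fin.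
by rewrite (le_trans (@Ex_markov f n.+1%:R^-1 bf f0 _))// e0 mul0r.
Qed.

End bounded_expectation.

Lemma orbit_sum_split {R : realType} (Y : Type) (T : Y -> Y) (F : Y -> R) n M x : (n <= M)%N ->
  \sum_(t < M) F (iter t T x) =
  \sum_(t < n) F (iter t T x) + \sum_(t < M - n) F (iter t T (iter n T x)).
Proof.
move=> nM; transitivity (\sum_(t < n + (M - n)) F (iter t T x)); first by rewrite subnKC.
rewrite big_split_ord/=; congr (_ + _).
by apply: eq_bigr => t _; rewrite addnC iterD.
Qed.

(** * The pointwise ergodic theorem *)

Section birkhoff.
Context {R : realType} {dY : measure_display} {Y : measurableType dY} (mu : probability Y R).
Variable T : Y -> Y.
Hypotheses (mT : measurable_fun setT T)
  (Tinv : forall A, measurable A -> mu (T @^-1` A) = mu A).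
Implicit Types g : Y -> R.

Lemma bm_comp g : bm g -> bm (g \o T).
Proof.
move=> [mg [C hC]]; split; last by exists C => x; exact: hC.
exact: measurableT_comp.
Qed.

Lemma Ex_comp g : bm g -> Ex mu (g \o T) = Ex mu g.
Proof.
move=> bg; rewrite /Ex /Rintegral; congr fine.
have e (A : set Y) : measurable A -> A `<=` setT -> mu A = pushforward mu T A.
  by move=> mA _; rewrite /pushforward Tinv.
rewrite [RHS](eq_measure_integral (pushforward mu T) e).
rewrite integral_pushforward//= ?preimage_setT//.
  by apply/measurable_EFinP; exact: bg.1.
exact: (bm_integrable mu (bm_comp bg)).
Qed.

Lemma bm_iter g t : bm g -> bm (fun x => g (iter t T x)).
Proof.
move=> bg; elim: t => [//|t IH].
have -> : (fun x => g (iter t.+1 T x)) = (fun x => g (iter t T x)) \o T.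
  by apply/funext => x /=; rewrite -iterSr.
exact: bm_comp.
Qed.

Lemma Ex_iter g t : bm g -> Ex mu (fun x => g (iter t T x)) = Ex mu g.
Proof.
move=> bg; elim: t => [//|t IH]; rewrite -IH -[RHS](Ex_comp (bm_iter t bg)).
by congr (Ex mu _); apply/funext => x /=; rewrite -iterSr.
Qed.

Definition avg g n x : R := n%:R^-1 * \sum_(t < n) g (iter t T x).

Lemma bm_avg g n : bm g -> bm (avg g n).
Proof. by move=> bg; apply: bmZ; apply: bm_sum => t _; exact: bm_iter. Qed.

Lemma Ex_sum_iter g n : bm g -> Ex mu (fun x => \sum_(t < n) g (iter t T x)) = n%:R * Ex mu g.
Proof.
move=> bg; rewrite Ex_sum; last by move=> t _; exact: bm_iter.
by rewrite (eq_bigr (fun=> Ex mu g)) ?big_const_ord ?iter_addr ?addr0 ?mulr_natl// => t _; exact: Ex_iter.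
Qed.

Lemma avg_itv g n x : (forall x, 0 <= g x <= 1) -> 0 <= avg g n x <= 1.
Proof.
move=> g01; case: n => [|n]; first by rewrite /avg big_ord0 mulr0 lexx ler01.
apply/andP; split.
  by rewrite mulr_ge0// sumr_ge0// => t _; case/andP: (g01 (iter t T x)).
rewrite ler_pdivrMl ?ltr0n// mulr1.
apply: (@le_trans _ _ (\sum_(t < n.+1) 1)); last by rewrite big_const_ord iter_addr addr0.
by apply: ler_sum => t _; case/andP: (g01 (iter t T x)).
Qed.

Lemma avg_shift g n x : (forall x, 0 <= g x <= 1) -> `|avg g n (T x) - avg g n x| <= n%:R^-1.
Proof.
move=> g01; case: n => [|n]; first by rewrite /avg !big_ord0 !mulr0 subrr normr0 invr0.
rewrite /avg -mulrBr normrM ger0_norm ?invr_ge0// ler_piMr ?invr_ge0//.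
rewrite big_ord_recr [X in _ - X]big_ord_recl/= -iterSr iterS.
have -> : \sum_(i < n) g (iter i T (T x)) = \sum_(i < n) g (T (iter (0 + i) T x)).
  by apply: eq_bigr => i _; rewrite -iterSr.
have /andP[h1 h2] := g01 x; have /andP[h3 h4] := g01 (T (iter n T x)).
rewrite ler_norml; apply/andP; split; lra.
Qed.

Definition gsup g x : R := fine (limn_esup (fun n => (avg g n x)%:E)).

Section unit_interval.
Variable g : Y -> R.
Hypotheses (bg : bm g) (g01 : forall x, 0 <= g x <= 1).

Lemma gsup_fin x : limn_esup (fun n => (avg g n x)%:E) = (gsup g x)%:E.
Proof.
rewrite /gsup fineK//; apply/fin_real/andP; split.
  apply: (@lt_le_trans _ _ 0%E); first exact: ltNyr.
  by apply: limn_esup_geP => n0; exists n0 => //; rewrite lee_fin; case/andP: (avg_itv n0 x g01).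
apply: (@le_lt_trans _ _ 1%E); last exact: ltry.
by apply: (@limn_esup_leP _ _ _ 0) => n _; rewrite lee_fin; case/andP: (avg_itv n x g01).
Qed.

Lemma gsup_gt x e : 0 < e -> exists n0, forall n, (n0 <= n)%N -> avg g n x < gsup g x + e.
Proof.
move=> e0; have : (limn_esup (fun n => (avg g n x)%:E) < (gsup g x + e)%:E)%E.
  by rewrite gsup_fin lte_fin ltrDl.
by move=> /limn_esup_ltP[n0 h]; exists n0 => n /h; rewrite lte_fin.
Qed.

Lemma gsup_often x e n0 : 0 < e -> exists2 n, (n0 <= n)%N & gsup g x - e < avg g n x.
Proof.
move=> e0; have : ((gsup g x - e)%:E < limn_esup (fun n => (avg g n x)%:E))%E.
  by rewrite gsup_fin lte_fin gtrBl.
by move=> /(@limn_esup_gtP _ _ _ n0)[n hn]; rewrite lte_fin; exists n.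
Qed.

Lemma gsup_le x c n0 : (forall n, (n0 <= n)%N -> avg g n x <= c) -> gsup g x <= c.
Proof.
move=> h; rewrite -lee_fin -gsup_fin.
by apply: (@limn_esup_leP _ _ _ n0) => n hn; rewrite lee_fin h.
Qed.

Lemma gsup_itv x : 0 <= gsup g x <= 1.
Proof.
apply/andP; split; last by apply: (@gsup_le _ _ 0) => n _; case/andP: (avg_itv n x g01).
rewrite -lee_fin -gsup_fin; apply: limn_esup_geP => n0; exists n0 => //.
by rewrite lee_fin; case/andP: (avg_itv n0 x g01).
Qed.

Lemma gsup_inv x : gsup g (T x) = gsup g x.
Proof.
have small e : 0 < e -> exists n0, forall n, (n0 <= n)%N -> n%:R^-1 < e :> R.
  move=> e0; exists (Num.truncn e^-1).+1 => n hn.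
  rewrite invf_plt ?posrE ?ltr0n//; last exact: leq_trans hn.
  by rewrite (lt_le_trans (truncnS_gt _))// ler_nat.
apply/eqP; rewrite eq_le; apply/andP; split; apply/ler_addgt0Pr => e e0.
  have e20 : 0 < e / 2 by rewrite divr_gt0.
  have [n0 h0] := gsup_gt x e20; have [n1 h1] := small _ e20.
  apply: (@gsup_le _ _ (maxn n0 n1)) => n; rewrite geq_max => /andP[/h0 hn0 /h1 hn1].
  have := avg_shift n x g01; rewrite ler_norml => /andP[_]; lra.
have e20 : 0 < e / 2 by rewrite divr_gt0.
have [n0 h0] := gsup_gt (T x) e20; have [n1 h1] := small _ e20.
apply: (@gsup_le _ _ (maxn n0 n1)) => n; rewrite geq_max => /andP[/h0 hn0 /h1 hn1].
have := avg_shift n x g01; rewrite ler_norml => /andP[+ _]; lra.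
Qed.

Lemma gsup_iter n x : gsup g (iter n T x) = gsup g x.
Proof. by elim: n => //= n IH; rewrite gsup_inv. Qed.

Lemma bm_gsup : bm (gsup g).
Proof.
split; last by exists 1 => x; have /andP[h0 h1] := gsup_itv x; rewrite ger0_norm.
apply: (measurableT_comp (f := fine)) => //.
apply: measurable_fun_limn_esup => n; apply/measurable_EFinP; exact: (bm_avg n bg).1.
Qed.

(** The Katznelson-Weiss argument: cut a long orbit into short pieces along which the average of [g]
    nearly reaches [gsup g], which is constant along the orbit, then integrate. *)
Lemma Ex_gsup_le : Ex mu (gsup g) <= Ex mu g.
Proof.
apply/ler_addgt0Pr => e e0.
pose delta := Num.min (e / 2) 1.
have d0 : 0 < delta by rewrite lt_min divr_gt0/=.
have d1 : delta <= 1 by rewrite ge_min lexx orbT.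
have de : delta <= e / 2 by rewrite ge_min lexx.
pose D n := [set x | delta <= gsup g x - avg g n.+1 x].
have mD n : measurable (D n) by apply: measurable_le_set; exact: (bmB bm_gsup (bm_avg n.+1 bg)).1.
(* The points where no average over at most [L] steps comes within [delta] of the upper limit; [D n]
   concerns [n + 1] steps. *)
pose B L := \bigcap_n (if (n < L)%N then D n else setT).
have mB L : measurable (B L) by apply: bigcapT_measurable => n; case: ifP.
have BE L x : B L x <-> forall n, (n < L)%N -> D n x.
  split=> [h n nL|h n _]; first by have := h n Logic.I; rewrite nL.
  by case: ifP => // /h.
have B0 : \bigcap_L B L = set0.
  apply/seteqP; split=> x //= h.
  have [n n1 hn] := gsup_often x 1 d0.
  have /BE/(_ n.-1) := h n Logic.I.
  rewrite prednK// leqnn /D/= prednK// => /(_ isT); lra.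
have cvB : (mu \o B) L @[L --> \oo] --> (0%:E : \bar R).
  have -> : 0%:E = mu (\bigcap_L B L) by rewrite B0 measure0.
  apply: nonincreasing_cvg_mu => //.
  - change (mu (B 0%N) < +oo)%E; rewrite (mu_fin mu (mB 0%N)); exact: ltry.
  - by rewrite B0.
  - by move=> n m nm; apply/subsetPset => x /BE h; apply/BE => k km; apply: h; exact: leq_trans nm.
have [L Ld] : exists L, fine (mu (B L)) < delta.
  have : \forall L \near \oo, ((mu \o B) L < delta%:E)%E.
    by apply: (cvB [set t | (t < delta%:E)%E]); apply: open_ereal_lt'; rewrite lte_fin.
  move=> [L _ /(_ L (leqnn L))/= hL]; exists L.
  by rewrite -lte_fin -(mu_fin mu (mB L)).
(* A point of [B L] is passed in one step, paid for by the indicator; any other point starts a piece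
   of at most [L] steps with a good average. The constant [L + 1] covers the unfinished last
   piece. *)
have tile M x : M%:R * (gsup g x - delta) - L.+1%:R <=
    \sum_(t < M) (g (iter t T x) + \1_(B L) (iter t T x)).
  elim/ltn_ind: M x => M IH x.
  have /andP[s0 s1] := gsup_itv x.
  have pos N y : 0 <= \sum_(t < N) (g (iter t T y) + \1_(B L) (iter t T y)).
    by apply: sumr_ge0 => t _; rewrite addr_ge0//; case/andP: (g01 (iter t T y)).
  have [ML|LM] := leqP M L.
    apply: le_trans (pos _ _).
    have : M%:R * (gsup g x - delta) <= M%:R * 1 by rewrite ler_wpM2l//; lra.
    have : M%:R <= L.+1%:R :> R by rewrite ler_nat (leq_trans ML).
    lra.
  have split n : (n <= M)%N -> \sum_(t < M) (g (iter t T x) + \1_(B L) (iter t T x)) =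
     \sum_(t < n) (g (iter t T x) + \1_(B L) (iter t T x)) +
     \sum_(t < M - n) (g (iter t T (iter n T x)) + \1_(B L) (iter t T (iter n T x))).
    exact: (orbit_sum_split T (fun y => g y + \1_(B L) y)).
  have [Bx|nBx] := pselect (B L x).
    have M0 : (0 < M)%N by exact: leq_ltn_trans LM.
    rewrite (split 1%N M0) big_ord1/= indicE mem_set//.
    have := IH (M - 1)%N _ (T x); rewrite gsup_inv ltn_subrL M0 => /(_ isT).
    rewrite natrB// mulrBl mul1r (_ : true%:R = 1)//; have /andP[g0 _] := g01 x; lra.
  have [n nL nD] : exists2 n, (n < L)%N & ~ D n x.
    apply: contrapT => H; apply: nBx; apply/BE => n nL; apply: contrapT => nD.
    by apply: H; exists n.
  have nM : (n.+1 <= M)%N by exact: leq_trans (ltnW LM).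
  rewrite (split _ nM).
  have := IH (M - n.+1)%N _ (iter n.+1 T x); rewrite gsup_iter ltn_subrL (leq_ltn_trans _ LM)// => /(_ isT).
  rewrite natrB// mulrBl.
  have : n.+1%:R * (gsup g x - delta) <= \sum_(t < n.+1) (g (iter t T x) + \1_(B L) (iter t T x)).
    apply: (@le_trans _ _ (\sum_(t < n.+1) g (iter t T x))).
      have : gsup g x - delta <= avg g n.+1 x by move: nD; rewrite /D/= => /negP; rewrite -ltNge; lra.
      by rewrite /avg -(ler_pM2l (ltr0Sn R n)) mulVKf// pnatr_eq0.
    by apply: ler_sum => t _; rewrite lerDl indicE; case: (_ \in _).
  lra.
have key M : M%:R * (Ex mu (gsup g) - delta) - L.+1%:R <= M%:R * (Ex mu g + delta).
  have bI : bm (\1_(B L) : Y -> R) by exact: bm_indic.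
  have bgI : bm (fun x => g x + \1_(B L) x) by exact: bmD.
  apply: (@le_trans _ _ (M%:R * (Ex mu g + fine (mu (B L))))); last first.
    by rewrite ler_wpM2l// lerD2l ltW.
  rewrite -Ex_indic// -ExD// -(Ex_sum_iter M bgI).
  have <- : Ex mu (fun x => M%:R * (gsup g x - delta) - L.+1%:R) = M%:R * (Ex mu (gsup g) - delta) - L.+1%:R.
    have b2 : bm (fun _ : Y => delta) by exact: bm_cst.
    have b3 : bm (fun _ : Y => L.+1%:R : R) by exact: bm_cst.
    have b1 := bmB bm_gsup b2.
    by rewrite (ExB _ (bmZ M%:R b1) b3) (ExZ _ _ b1) (ExB _ bm_gsup b2) !Ex_cst.
  apply: Ex_le; [|by apply: bm_sum => t _; exact: (bm_iter t bgI)|exact: tile].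
  apply: bmB; last exact: bm_cst.
  by apply: bmZ; apply: bmB; [exact: bm_gsup|exact: bm_cst].
rewrite leNgt; apply/negP => bad.
pose gap := Ex mu (gsup g) - Ex mu g - 2 * delta.
have gap0 : 0 < gap by rewrite /gap; lra.
have := key (Num.truncn (L.+1%:R / gap)).+1.
have : L.+1%:R / gap < (Num.truncn (L.+1%:R / gap)).+1%:R by exact: truncnS_gt.
rewrite ltr_pdivrMr//; set M := _%:R; rewrite /gap !mulrBr !mulrDr; lra.
Qed.

End unit_interval.

(** The one-sided inequality is applied to [g] and to [1 - g]: the two upper limits have sum at
    least 1 everywhere and mean sum at most 1, so the sum is 1 outside a null set, where the
    averages converge. *)
Lemma birkhoff g : bm g -> (forall x, 0 <= g x <= 1) -> exists gb : Y -> R,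
  [/\ bm gb, forall x, 0 <= gb x <= 1, forall x, gb (T x) = gb x, Ex mu gb = Ex mu g &
   exists Z, [/\ measurable Z, mu Z = 0%E & forall x, ~ Z x -> forall e, 0 < e ->
      exists n0, forall n, (n0 <= n)%N -> `|avg g n x - gb x| < e]].
Proof.
move=> bg g01.
pose g' x := 1 - g x.
have bg' : bm g' by apply: bmB => //; exact: bm_cst.
have g'01 x : 0 <= g' x <= 1 by rewrite /g'; have /andP[? ?] := g01 x; apply/andP; split; lra.
have avg' n x : (0 < n)%N -> avg g' n x = 1 - avg g n x.
  move=> n0; rewrite /avg /g' sumrB big_const_ord iter_addr addr0 mulrBr mulVf//.
  by rewrite pnatr_eq0 -lt0n.
have h1 := Ex_gsup_le bg g01; have h2 := Ex_gsup_le bg' g'01.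
have E' : Ex mu g' = 1 - Ex mu g by rewrite ExB ?Ex_cst//; exact: bm_cst.
have low x : 0 <= gsup g x + gsup g' x - 1.
  apply/ler_addgt0Pr => e e0; have e20 : 0 < e / 2 by rewrite divr_gt0.
  have [n0 hn0] := gsup_gt g01 x e20; have [n1 hn1] := gsup_gt g'01 x e20.
  have := hn0 (maxn (maxn n0 n1) 1); rewrite !leq_max leqnn => /(_ isT).
  have := hn1 (maxn (maxn n0 n1) 1); rewrite !leq_max leqnn orbT => /(_ isT).
  rewrite avg' ?leq_max ?orbT//; lra.
have bs := bm_gsup bg g01; have bs' := bm_gsup bg' g'01.
have bl : bm (fun x => gsup g x + gsup g' x - 1).
  by apply: bmB; [exact: bmD|exact: bm_cst].
have El : Ex mu (fun x => gsup g x + gsup g' x - 1) = Ex mu (gsup g) + Ex mu (gsup g') - 1.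
  by rewrite ExB; [rewrite ExD// Ex_cst|exact: bmD|exact: bm_cst].
have El0 : Ex mu (fun x => gsup g x + gsup g' x - 1) = 0.
  apply/eqP; rewrite eq_le Ex_ge0// andbT El.
  by move: h1 h2 E'; clear; lra.
exists (gsup g); split => //.
- exact: gsup_itv.
- exact: gsup_inv.
- by apply/eqP; rewrite eq_le h1/=; move: El0 h2 E'; rewrite El; clear; lra.
exists [set x | 0 < gsup g x + gsup g' x - 1]; split.
- exact: measurable_lt_set bl.1.
- exact: Ex_eq0_null.
move=> x /negP; rewrite -leNgt => hx e e0.
have [n0 hn0] := gsup_gt g01 x e0; have [n1 hn1] := gsup_gt g'01 x e0.
exists (maxn (maxn n0 n1) 1) => n; rewrite !geq_max -andbA => /and3P[/hn0 a /hn1 b n_gt0].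
by move: b a hx; rewrite avg'// ltr_distlC; clear => b a hx; apply/andP; split; lra.
Qed.

End birkhoff.

(** * Ergodic measures charging closed sets *)

Lemma borel_open {X : ptopologicalType} (A : set (borel X)) : open (A : set X) -> measurable A.
Proof. move=> oA; exact: sub_sigma_algebra. Qed.
Lemma borel_continuous {R : realType} {X : ptopologicalType} (f : X -> R) : continuous f -> measurable_fun (setT : set (borel X)) (f : borel X -> R).
Proof.
move=> cf; apply: (@measurability _ _ (borel X) R setT f (@RGenOInfty.G R)) => [|_ [_ [a ->] <-]].
  exact: RGenOInfty.measurableE.
rewrite setTI; apply: borel_open.
apply: open_comp => [x _|]; first exact: cf.
rewrite set_itvoy. exact: open_gt.
Qed.
Lemma borel_map {X : ptopologicalType} (T : X -> X) : continuous T -> measurable_fun (setT : set (borel X)) (T : borel X -> borel X).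
Proof.
move=> cf; apply: (@measurability _ _ (borel X) (borel X) setT T (@open X)) => [|_ [A oA <-]]; first by [].
rewrite setTI; apply: borel_open.
by apply: open_comp => [x _|]; first exact: cf.
Qed.

Section convergence_in_mean.
Context {R : realType} {dY : measure_display} {Y : measurableType dY} (mu : probability Y R).

Lemma mu_lt_of_null (P : nat -> set Y) (Z : set Y) e : (forall n, measurable (P n)) ->
  (forall n m, (n <= m)%N -> P m `<=` P n) -> measurable Z -> mu Z = 0%E ->
  \bigcap_n P n `<=` Z -> 0 < e -> exists n, fine (mu (P n)) < e.
Proof.
move=> mP dP mZ Z0 PZ e0.
have mI : measurable (\bigcap_n P n) by exact: bigcapT_measurable.
have I0 : mu (\bigcap_n P n) = 0%E.
  by apply/eqP; rewrite eq_le measure_ge0 andbT -Z0; apply: le_measure; rewrite ?inE.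
have cv : (mu \o P) n @[n --> \oo] --> (0%:E : \bar R).
  have -> : 0%:E = mu (\bigcap_n P n) by rewrite I0.
  apply: nonincreasing_cvg_mu => //.
    by change (mu (P 0%N) < +oo)%E; rewrite (mu_fin mu (mP 0%N)) ltry.
  by move=> n m nm; apply/subsetPset; exact: dP.
have [L _ hL] : \forall n \near \oo, ((mu \o P) n < e%:E)%E.
  by apply: (cv [set t | (t < e%:E)%E]); apply: open_ereal_lt'; rewrite lte_fin.
by exists L; have /= := hL L (leqnn L); rewrite (mu_fin mu (mP L)).
Qed.

(** Bounded convergence: the events that some [f k] with [k >= n] is at least [e / 2] decrease to a
    null set. *)
Lemma Ex_small (f : nat -> Y -> R) (Z : set Y) e : (forall n, bm (f n)) ->
  (forall n x, 0 <= f n x <= 1) -> measurable Z -> mu Z = 0%E ->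
  (forall x, ~ Z x -> forall e, 0 < e -> exists n0, forall n, (n0 <= n)%N -> f n x < e) ->
  0 < e -> exists n, Ex mu (f n) < e.
Proof.
move=> bf f01 mZ Z0 cv e0.
have e20 : 0 < e / 2 by rewrite divr_gt0.
pose P n := \bigcup_k [set x | e / 2 <= f (n + k)%N x].
have mP n : measurable (P n).
  by apply: bigcupT_measurable => k; apply: measurable_le_set; exact: (bf _).1.
have [||n hn] := @mu_lt_of_null P Z (e / 2) mP _ mZ Z0 _ e20.
- move=> n m nm x [k _ /= h]; exists (m - n + k)%N => //=.
  by rewrite addnA subnKC.
- move=> x Px; apply: contrapT => nZ; have [n0 h] := cv x nZ _ e20.
  have [k _ /=] := Px n0 Logic.I; rewrite leNgt h//; exact: leq_addr.
exists n; apply: (@le_lt_trans _ _ (e / 2 + fine (mu (P n)))); last by move: hn; lra.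
have bI : bm (\1_(P n) : Y -> R) by exact: bm_indic.
rewrite -(Ex_indic mu (mP n)) -[X in X + _](Ex_cst mu) -ExD//; last exact: bm_cst.
apply: Ex_le => //; first by apply: bmD => //; exact: bm_cst.
move=> x; have /andP[f0 f1] := f01 n x; rewrite indicE.
case: (boolP (x \in P n)) => [_|xP]; first by rewrite (_ : true%:R = 1)//; lra.
rewrite addr0 leNgt; apply/negP => h; move: xP => /negP; apply; apply/mem_set.
by exists 0%N => //=; rewrite addn0 ltW.
Qed.

Lemma mu_le_fin (P : set Y) (r : R) : measurable P -> fine (mu P) <= r -> (mu P <= r%:E)%E.
Proof. by move=> mP h; rewrite (mu_fin mu mP) lee_fin. Qed.

Lemma null_setU (P Q : set Y) :
  measurable P -> measurable Q -> mu P = 0%E -> mu Q = 0%E -> mu (P `|` Q) = 0%E.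
Proof.
move=> mP mQ P0 Q0; apply/eqP; rewrite eq_le measure_ge0 andbT.
have h : (mu (P `|` Q) <= mu P + mu Q)%E by exact: measureU2.
by apply: (le_trans h); rewrite P0 Q0 adde0.
Qed.

Lemma null_bigcup (Z : nat -> set Y) : (forall n, measurable (Z n)) ->
  (forall n, mu (Z n) = 0%E) -> mu (\bigcup_n Z n) = 0%E.
Proof.
move=> mZ Z0; apply/eqP; rewrite eq_le measure_ge0 andbT.
apply: (le_trans (@measure_sigma_subadditive _ _ _ mu _ Z _ _ _)) => //.
  exact: bigcupT_measurable.
by rewrite eseries0// => n _ _; exact: Z0.
Qed.

End convergence_in_mean.

Section ergodic_component.
Context {R : realType} {X : ptopologicalType} (d : X -> X -> R) (T S : X -> X).
Hypotheses (cX : compact [set: X]) (cd : compatible_metric d).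
Hypotheses (cT : continuous T) (cS : continuous S) (TK : cancel T S) (SK : cancel S T).

Lemma borel_closed (A : set (borel X)) : closed (A : set X) -> measurable A.
Proof.
move=> cA; rewrite -(setCK A); apply: measurableC; apply: borel_open; exact: closed_openC.
Qed.

Lemma freq_avg (A : set X) x N : freq T A x N = avg (T : borel X -> borel X) (\1_A : borel X -> R) N x.
Proof. by []. Qed.

Section family.
Variable D : nat -> X.
Hypothesis hD : forall x e, 0 < e -> exists n, d (D n) x < e.

(** A countable family of continuous functions, where [c] encodes a finite list of centres and
    radii; it is rich enough to separate a closed set from the complement of an open
    neighbourhood. *)
Definition bumps (c : nat) (x : X) : R :=
  \big[Num.max/0]_(p <- odflt [::] (choice.unpickle c : option (seq (nat * nat))))
    bump d (D p.1) p.2.+1%:R^-1 x.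

Lemma bumps_itv c x : 0 <= bumps c x <= 1.
Proof.
by rewrite bigmax_ge0/=; apply: bigmax_le => // p _; exact: clamp_le1.
Qed.

Lemma bumps_cont c : continuous (bumps c).
Proof.
rewrite /bumps; elim: (odflt [::] _) => [|p s IH].
  rewrite (_ : (fun x => _) = (fun=> 0)); first by move=> x; exact: cvg_cst.
  by apply/funext => x; rewrite big_nil.
rewrite (_ : (fun x => _) = (fun x => Num.max (bump d (D p.1) p.2.+1%:R^-1 x)
   (\big[Num.max/0]_(p <- s) bump d (D p.1) p.2.+1%:R^-1 x))); last first.
  by apply/funext => x; rewrite big_cons.
have cb : continuous (bump d (D p.1) p.2.+1%:R^-1).
  by apply: (cm_lip_cont cd) => x y; exact: (bump_lip cd).
apply: (cm_cont cd) => x e e0.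
have /(cm_nbhsP cd)[r1 r10 h1] : \forall y \near x, `|bump d (D p.1) p.2.+1%:R^-1 x - bump d (D p.1) p.2.+1%:R^-1 y| < e / 2.
  by have /cvgrPdist_lt := cb x; apply; rewrite divr_gt0.
have /(cm_nbhsP cd)[r2 r20 h2] : \forall y \near x, `|(\big[Num.max/0]_(p <- s) bump d (D p.1) p.2.+1%:R^-1 x) - (\big[Num.max/0]_(p <- s) bump d (D p.1) p.2.+1%:R^-1 y)| < e / 2.
  by have /cvgrPdist_lt := IH x; apply; rewrite divr_gt0.
exists (Num.min r1 r2); first by rewrite lt_min r10.
move=> y; rewrite lt_min => /andP[/h1 a1 /h2 a2].
apply: (@le_lt_trans _ _ (e / 2)); last by lra.
by apply: max_near; exact: ltW.
Qed.

Lemma bumps_urysohn (C V : set X) : closed C -> open V -> C `<=` V ->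
  exists c, (forall x, C x -> bumps c x = 1) /\ (forall x, ~ V x -> bumps c x = 0).
Proof.
move=> cC oV CV.
pose F (i : option (nat * nat)) : set X :=
  if i is Some p then [set x | d x (D p.1) < p.2.+1%:R^-1 /\
      forall y, d y (D p.1) < 2 * p.2.+1%:R^-1 -> V y] else ~` C.
have oF i : open (F i).
  case: i => [p|]; last exact: closed_openC.
  have [h|nh] := pselect (forall y, d y (D p.1) < 2 * p.2.+1%:R^-1 -> V y).
    rewrite (_ : F _ = [set x | d (D p.1) x < p.2.+1%:R^-1]); first exact: cm_open_ball.
    by apply/seteqP; split=> x /=; rewrite (cm_sym cd x); [case|].
  by rewrite (_ : F _ = set0); [exact: open0|apply/seteqP; split=> x //= []].
have [|s hs] := cm_fin_cover cX oF.
  move=> x; have [Cx|nC] := pselect (C x); last by exists None.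
  have /(cm_openP cd)/(_ x (CV x Cx))[e e0 he] := oV.
  pose k := Num.truncn (3 / e).
  have k0 : 0 < (k.+1%:R : R)^-1 by [].
  have ke : k.+1%:R^-1 < e / 3.
    by rewrite invf_plt ?posrE ?divr_gt0// invf_div truncnS_gt.
  have [n hn] := hD x k0.
  exists (Some (n, k)); split; first by rewrite (cm_sym cd).
  move=> y /= hy; apply: he; have := cm_tri cd (D n) x y.
  by rewrite (cm_sym cd x (D n)) (cm_sym cd (D n) y); move: hn hy ke; set r := (k.+1%:R : R)^-1; set a := d _ _; set b := d y _; set c := d x y; clear; lra.
pose t := [seq p <- pmap id s | `[< forall y, d y (D p.1) < 2 * p.2.+1%:R^-1 -> V y >]].
exists (choice.pickle t); rewrite /bumps choice.pickleK/=; split=> x.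
  move=> Cx; have [[p|] ps Fx] := hs x; last by [].
  have pt : p \in t by rewrite mem_filter mem_pmap map_id ps andbT; apply/asboolP; case: Fx.
  apply/le_anti/andP; split; first by apply: bigmax_le => // q _; exact: clamp_le1.
  have r0 : 0 < (p.2.+1%:R : R)^-1 by [].
  have b1 : bump d (D p.1) p.2.+1%:R^-1 x = 1 by apply: bump_eq1 => //; exact/ltW/Fx.1.
  by rewrite -[leLHS]b1; apply: (le_bigmax_seq _ p).
move=> nV; apply/le_anti/andP; split; last exact: bigmax_ge0.
rewrite big_seq_cond; apply: bigmax_le => // p /andP[]; rewrite mem_filter => /andP[/asboolP h _] _.
rewrite leNgt; apply/negP => b0; apply: nV; apply: h.
by apply: (bump_gt0 (d := d)) => //.
Qed.

End family.

Lemma continuous_avg (f : X -> R) n : continuous f ->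
  continuous (fun y => n%:R^-1 * \sum_(t < n) f (iter t T y) : R).
Proof.
move=> cf.
have cs : continuous (fun y => \sum_(t < n) f (iter t T y) : R).
  apply: continuous_big => [|t _]; first exact: add_continuous.
  by move=> y; apply: (@continuous_comp _ _ _ (iter t T) f); [exact: continuous_iter|exact: cf].
by move=> y; apply: cvgM; [exact: cvg_cst|exact: cs].
Qed.

Lemma abs_sub01 (a b : R) : 0 <= a <= 1 -> 0 <= b <= 1 -> `|a - b| <= 1.
Proof. by move=> /andP[a0 a1] /andP[b0 b1]; rewrite ler_norml; apply/andP; split; lra. Qed.

(** The ergodic measure comes from a single orbit, not from an ergodic decomposition. The point [x]
    is chosen so that the averages of all [bumps c] converge along it, its frequency of visits to
    [A] is positive, and the deviations of long averages from their limits are small on average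
    along its orbit. *)
Lemma ergodic_charging (mu : probability (borel X) R) (A : set X) :
  invariant_measure T mu -> closed A -> (0 < mu A)%E ->
  exists2 nu : probability (borel X) R, ergodic_measure T nu & (0 < nu A)%E.
Proof.
move=> imu cA muA.
have mT : measurable_fun setT (T : borel X -> borel X) by exact: borel_map.
have [D hD] := cm_dense cX cd.
pose f c : borel X -> R := bumps D c.
have cf c : continuous (f c : X -> R) by exact: bumps_cont.
have bf c : bm (f c).
  split; first exact: borel_continuous.
  by exists 1 => x; have /andP[? ?] := bumps_itv D c x; rewrite ger0_norm.
have f01 c x : 0 <= f c x <= 1 by exact: bumps_itv.
have /choice[gb hgb] c := birkhoff mT imu (bf c) (f01 c).
have /choice[Zg hZg] c : exists Z, [/\ measurable Z, mu Z = 0%E & forall x, ~ Z x -> forall e, 0 < e ->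
      exists n0, forall n, (n0 <= n)%N -> `|avg (T : borel X -> borel X) (f c) n x - gb c x| < e].
  by have [_ _ _ _ [Z hZ]] := hgb c; exists Z.
pose g c N x := `|avg (T : borel X -> borel X) (f c) N.+1 x - gb c x|.
have bg c N : bm (g c N).
  by apply: bm_norm; apply: bmB; [exact: (bm_avg mT)|case: (hgb c)].
have g01 c N x : 0 <= g c N x <= 1.
  rewrite normr_ge0/=; have /andP[a0 a1] := avg_itv (T : borel X -> borel X) N.+1 x (f01 c).
  have [_ /(_ x)/andP[b0 b1] _ _ _] := hgb c.
  rewrite ler_norml; apply/andP; split; lra.
have /choice[hb hhb] cN := birkhoff mT imu (bg cN.1 cN.2) (g01 cN.1 cN.2).
have /choice[Zh hZh] cN : exists Z, [/\ measurable Z, mu Z = 0%E & forall x, ~ Z x -> forall e, 0 < e ->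
      exists n0, forall n, (n0 <= n)%N -> `|avg (T : borel X -> borel X) (g cN.1 cN.2) n x - hb cN x| < e].
  by have [_ _ _ _ [Z hZ]] := hhb cN; exists Z.
have mA : measurable (A : set (borel X)) by exact: borel_closed.
have bA : bm (\1_A : borel X -> R) by exact: bm_indic.
have A01 x : 0 <= (\1_A : borel X -> R) x <= 1 by exact: indic01.
have [ab [bab ab01 _ Eab [ZA [mZA ZA0 hZA]]]] := birkhoff mT imu bA A01.
(* Off these null sets, for every [c], the limiting mean deviation of the averages over [N + 1]
   steps has infimum 0 over [N]. *)
pose W ck := \bigcap_N [set x | ck.2.+1%:R^-1 <= hb (ck.1, N) x].
have mW ck : measurable (W ck).
  by apply: bigcapT_measurable => N; apply: measurable_le_set; case: (hhb (ck.1, N)) => -[].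
have W0 ck : mu (W ck) = 0%E.
  apply/eqP; rewrite eq_le measure_ge0 andbT (mu_fin mu (mW ck)) lee_fin.
  apply/ler_addgt0Pr => e e0; rewrite add0r.
  have ek : 0 < e / ck.2.+1%:R by rewrite divr_gt0.
  have [mZ Z0 hZ] := hZg ck.1.
  have [|N hN] := @Ex_small R _ _ mu (g ck.1) (Zg ck.1) _ (bg ck.1) (g01 ck.1) mZ Z0 _ ek.
    move=> x nZ e' e'0; have [n0 h] := hZ x nZ e' e'0; exists n0 => n n0n.
    by apply: h; exact: leqW.
  have [bhb hb01 _ Ehb _] := hhb (ck.1, N).
  have mhb := measurable_le_set ck.2.+1%:R^-1 bhb.1.
  apply: (@le_trans _ _ (fine (mu [set x | ck.2.+1%:R^-1 <= hb (ck.1, N) x]))).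
    rewrite -lee_fin -(mu_fin mu (mW ck)) -(mu_fin mu mhb).
    by apply: le_measure; rewrite ?inE// => x; apply.
  have hb0 x : 0 <= hb (ck.1, N) x by case/andP: (hb01 x).
  have k0 : 0 < (ck.2.+1%:R : R)^-1 by [].
  apply: (le_trans (Ex_markov mu bhb hb0 k0)).
  by rewrite Ehb invrK -ler_pdivlMr// ltW.
pose dec n : nat * nat := odflt (0%N, 0%N) (choice.unpickle n).
pose Bad := ZA `|` (\bigcup_c Zg c) `|` (\bigcup_n Zh (dec n)) `|` (\bigcup_n W (dec n)).
have [mBad Bad0] : measurable Bad /\ mu Bad = 0%E.
  have mZg c : measurable (Zg c) by case: (hZg c).
  have mZh cN : measurable (Zh cN) by case: (hZh cN).
  have z1 : mu (\bigcup_c Zg c) = 0%E by apply: null_bigcup => // c; case: (hZg c).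
  have z2 : mu (\bigcup_n Zh (dec n)) = 0%E by apply: null_bigcup => // n; case: (hZh (dec n)).
  have z3 : mu (\bigcup_n W (dec n)) = 0%E by apply: null_bigcup.
  have m1 : measurable (\bigcup_c Zg c) by exact: bigcupT_measurable.
  have m2 : measurable (\bigcup_n Zh (dec n)) by exact: bigcupT_measurable.
  have m3 : measurable (\bigcup_n W (dec n)) by exact: bigcupT_measurable.
  have m4 : measurable (ZA `|` \bigcup_c Zg c) by exact: measurableU.
  have m5 : measurable (ZA `|` \bigcup_c Zg c `|` \bigcup_n Zh (dec n)) by exact: measurableU.
  split; first exact: measurableU.
  by do 3!apply: null_setU => //.
have [x [nBad abx]] : exists x, ~ Bad x /\ 0 < ab x.
  apply: contrapT => /forallNP H.
  have sub : [set x | 0 < ab x] `<=` Bad.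
    by move=> x abx; apply: contrapT => nB; apply: (H x).
  have mab := measurable_lt_set 0 bab.1.
  have ab0 : mu [set x | 0 < ab x] = 0%E.
    by apply/eqP; rewrite eq_le measure_ge0 andbT -Bad0; apply: le_measure; rewrite ?inE.
  have : Ex mu ab <= 0.
    apply: (@le_trans _ _ (Ex mu (\1_[set x | 0 < ab x]))); last by rewrite Ex_indic// ab0.
    apply: Ex_le => //; first exact: bm_indic.
    move=> y; rewrite indicE; have /andP[y0 y1] := ab01 y.
    case: (boolP (_ \in _)) => [//|/negP]; rewrite inE /= => /negP; rewrite -leNgt => yle.
    exact: yle.
  rewrite Eab Ex_indic// => muA0; move: muA; rewrite (mu_fin mu mA) lte_fin.
  by rewrite ltNge muA0.
have nZA : ~ ZA x by move=> h; apply: nBad; left; left; left.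
have nZg c : ~ Zg c x by move=> h; apply: nBad; left; left; right; exists c.
have nZh cN : ~ Zh cN x.
  by move=> h; apply: nBad; left; right; exists (choice.pickle cN) => //; rewrite /dec choice.pickleK.
have nW ck : ~ W ck x.
  by move=> h; apply: nBad; right; exists (choice.pickle ck) => //; rewrite /dec choice.pickleK.
have [nu [inu nuC nuO nureg]] := weak_limit cX cd cT cS TK SK (fun=> x) (fun k => ltnSn k).
exists nu; last first.
  have [n0 hn0] := hZA x nZA _ (divr_gt0 abx (ltr0n R 2)).
  apply: (@lt_le_trans _ _ (ab x / 2)%:E); first by rewrite lte_fin divr_gt0.
  apply: (nuC A (ab x / 2) n0) => // k n0k; rewrite freq_avg.
  have := hn0 k.+1 (leqW n0k); rewrite ltr_distl => /andP[+ _].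
  by rewrite [X in X - _](splitr (ab x)) addrK => /ltW.
split=> // B mB TB.
have nuB := mu_fin nu mB; set b := fine (nu B) in nuB.
have b01 : 0 <= b <= 1.
  by rewrite -!lee_fin -nuB measure_ge0 probability_le1.
apply: contrapT => /not_orP[b0 b1].
have bb : 0 < b < 1.
  case/andP: b01 => h0 h1; rewrite !lt_neqAle h0 h1 !andbT; apply/andP; split; apply/eqP => e.
    by apply: b0; rewrite nuB -e.
  by apply: b1; rewrite nuB e.
(* If [B] is invariant of measure [b], then [1_B] is at mean distance at least
   [min (b, 1 - b) >= 8 eta] from any constant in [0, 1], whereas the estimates below give at most
   [4 eta]. *)
pose eta := Num.min b (1 - b) / 8.
have /andP[bb0 bb1] := bb.
have eta0 : 0 < eta by rewrite divr_gt0// lt_min bb0 subr_gt0.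
have etab : 8 * eta <= b by rewrite /eta mulrC divfK// ge_min lexx.
have etab' : 8 * eta <= 1 - b by rewrite /eta mulrC divfK// ge_min lexx orbT.
have [V [oV BV nuV]] := nureg B eta eta0.
have [V' [oV' BV' nuV']] := nureg (~` B) eta eta0.
have mV : measurable (V : set (borel X)) by exact: borel_open.
have mV' : measurable (V' : set (borel X)) by exact: borel_open.
have CV : ~` V' `<=` V.
  by move=> y nV'; apply: BV; apply: contrapT => nB; apply: nV'; exact: BV'.
have [c [fC fV]] := bumps_urysohn hD (open_closedC oV') oV CV.
pose h y := `|(\1_B : borel X -> R) y - f c y|.
have bB : bm (\1_B : borel X -> R) by exact: bm_indic.
have bh : bm h by apply: bm_norm; exact: bmB.
have Eh : Ex nu h <= 2 * eta.
  have bV : bm (\1_V : borel X -> R) by exact: bm_indic.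
  have bV' : bm (\1_V' : borel X -> R) by exact: bm_indic.
  apply: (@le_trans _ _ (Ex nu (fun y => (\1_V : borel X -> R) y + \1_V' y - 1))).
    apply: Ex_le => //; first by apply: bmB; [exact: bmD|exact: bm_cst].
    move=> y; rewrite /h !indicE; have /andP[q0 q1] := f01 c y.
    case: (boolP (y \in V)) => [yV|/negP yV]; case: (boolP (y \in V')) => [yV'|/negP yV'].
    - rewrite (_ : true%:R + true%:R - 1 = 1); last by rewrite addrK.
      by apply: abs_sub01 => //; case: (y \in B); rewrite ?lexx ?ler01.
    - have -> : y \in B by apply/mem_set; apply: contrapT => nB; apply: yV'; apply/mem_set; exact: BV'.
      have -> : f c y = 1 by apply: fC => V'y; apply: yV'; exact/mem_set.
      by rewrite subrr normr0 addr0 subrr.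
    - have -> : (y \in B) = false by apply/negP => /set_mem/BV Vy; apply: yV; exact/mem_set.
      have -> : f c y = 0 by apply: fV => Vy; apply: yV; exact/mem_set.
      by rewrite subrr normr0 add0r subrr.
    - by exfalso; apply: yV; apply/mem_set; apply: CV => V'y; apply: yV'; exact/mem_set.
  rewrite ExB; [|exact: bmD|exact: bm_cst]; rewrite ExD// !Ex_indic// Ex_cst.
  move: nuV nuV'; rewrite (mu_fin nu mV) (mu_fin nu mV') nuB.
  have mcB : measurable (~` B) by exact: measurableC.
  rewrite (mu_fin nu mcB) (_ : fine (nu (~` B)) = 1 - b); last first.
    by rewrite probability_setC// nuB.
  rewrite -!EFinD !lee_fin /=; move: (fine (nu V)) (fine (nu V')) => u v hu hv.
  by rewrite lerBlDr (le_trans (lerD hu hv))// addrACA subrKC addrC mulr2n mulrDl mul1r.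
pose c0 := gb c x.
have gbi t : gb c (iter t T x) = c0.
  by elim: t => [//|t IH]; have [_ _ e _ _] := hgb c; rewrite iterS e.
have c01 : 0 <= c0 <= 1 by have [_ + _ _ _] := hgb c; apply.
have /andP[c00 c011] := c01.
pose s := eta.
have [k ks] : exists k, k.+1%:R^-1 < s ^+ 2.
  exists (Num.truncn (s ^+ 2)^-1); rewrite invf_plt ?posrE ?exprn_gt0//; exact: truncnS_gt.
have [N hN] : exists N, hb (c, N) x < s ^+ 2.
  have /existsNP[N hN] : ~ (forall N, k.+1%:R^-1 <= hb (c, N) x) by move=> H; apply: (nW (c, k)) => N _; exact: H.
  by exists N; apply: lt_trans ks; rewrite ltNge; apply/negP.
(* The places where the average of [f c] differs by more than [s] from its limit [c0] along the
   orbit of [x]. This set is open, so its measure is bounded by its frequency along the orbit, which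
   Markov's inequality bounds by [s ^ 2 / s]. *)
pose G := [set y : X | s < `|avg (T : borel X -> borel X) (f c) N.+1 y - c0|].
have cavg : continuous (avg (T : borel X -> borel X) (f c) N.+1 : X -> R).
  exact: continuous_avg.
have oG : open G.
  have -> : G = (fun y => `|avg (T : borel X -> borel X) (f c) N.+1 y - c0|) @^-1` [set t : R | s < t] by [].
  apply: open_comp; last exact: open_gt.
  move=> y _; apply: (@continuous_comp _ _ _ (fun y => avg (T : borel X -> borel X) (f c) N.+1 y - c0) Num.norm).
    by apply: cvgB; [exact: cavg|exact: cvg_cst].
  exact: norm_continuous.
have s0 : 0 < s by [].
have nuG : (nu G <= s%:E)%E.
  have [_ _ hZ] := hZh (c, N).
  have [n0 hn0] := hZ x (nZh (c, N)) (s ^+ 2 - hb (c, N) x) ltac:(by rewrite subr_gt0).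
  apply: (nuO G s n0) => // m n0m.
  have := hn0 m.+1 (leqW n0m); rewrite ltr_distl => /andP[_]; rewrite addrC subrK => hm.
  rewrite -(ler_pM2l s0) -expr2; apply: ltW; apply: le_lt_trans hm.
  rewrite /freq mulrCA ler_wpM2l ?invr_ge0// mulr_sumr; apply: ler_sum => t _.
  rewrite /g/= gbi indicE; case: (boolP (_ \in _)) => [/set_mem/ltW|_]; first by rewrite mulr1.
  by rewrite mulr0.
have mG : measurable (G : set (borel X)) by exact: borel_open.
have bG : bm (\1_G : borel X -> R) by exact: bm_indic.
have TBi t y : (\1_B : borel X -> R) (iter t T y) = \1_B y.
  elim: t => [//|t IH]; rewrite iterS -IH !indicE; congr (_%:R); congr nat_of_bool.
  by apply/idP/idP => /set_mem H; apply/mem_set; [rewrite -TB|rewrite -[B]TB in H].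
have avgB y : (\1_B : borel X -> R) y = avg (T : borel X -> borel X) (\1_B : borel X -> R) N.+1 y.
  rewrite /avg (eq_bigr (fun=> (\1_B : borel X -> R) y)) => [|t _]; last exact: TBi.
  by rewrite big_const_ord iter_addr addr0 -[X in _ = _ * X]mulr_natl mulKf// pnatr_eq0.
(* As [1_B] is invariant, it equals its own averages, so the averages of [f c] approximate it in
   mean as well as [f c] does. *)
have low : b * (1 - c0) + (1 - b) * c0 <= 2 * eta + (s + s).
  have bl : bm (fun y => (1 - c0) * (\1_B : borel X -> R) y + c0 * (1 - (\1_B : borel X -> R) y)).
    by apply: bmD; apply: bmZ => //; apply: bmB => //; exact: bm_cst.
  have -> : b * (1 - c0) + (1 - b) * c0 = Ex nu (fun y => (1 - c0) * (\1_B : borel X -> R) y + c0 * (1 - (\1_B : borel X -> R) y)).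
    have b1B : bm (fun y => 1 - (\1_B : borel X -> R) y) by apply: bmB => //; exact: bm_cst.
    rewrite ExD; [|exact: bmZ|exact: bmZ]; rewrite !ExZ// ExB//; last exact: bm_cst.
    by rewrite Ex_cst Ex_indic// -/b mulrC [X in _ + X]mulrC.
  have Tinv' := inu.
  have bavh : bm (avg (T : borel X -> borel X) h N.+1) by exact: (bm_avg mT).
  have Eavh : Ex nu (avg (T : borel X -> borel X) h N.+1) = Ex nu h.
    rewrite /avg ExZ; last by apply: bm_sum => t _; exact: (bm_iter mT).
    by rewrite (Ex_sum_iter mT inu)// mulKf// pnatr_eq0.
  apply: (@le_trans _ _ (Ex nu (fun y => avg (T : borel X -> borel X) h N.+1 y + (s + \1_G y)))).
    apply: Ex_le => //.
      by apply: bmD => //; apply: bmD => //; exact: bm_cst.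
    move=> y.
    have i1 : `|(\1_B : borel X -> R) y - avg (T : borel X -> borel X) (f c) N.+1 y| <= avg (T : borel X -> borel X) h N.+1 y.
      rewrite {1}avgB /avg -mulrBr normrM ger0_norm ?invr_ge0// ler_wpM2l ?invr_ge0// -sumrB.
      exact: ler_norm_sum.
    have i2 : `|avg (T : borel X -> borel X) (f c) N.+1 y - c0| <= s + \1_G y.
      rewrite indicE; case: (boolP (y \in G)) => [_|/negP yG].
        have /andP[a0 a1] := avg_itv (T : borel X -> borel X) N.+1 y (f01 c).
        by apply: (@le_trans _ _ 1); [apply: abs_sub01; apply/andP|rewrite lerDr ltW].
      by rewrite addr0 leNgt; apply/negP => hG; apply: yG; exact/mem_set.
    apply: (@le_trans _ _ `|(\1_B : borel X -> R) y - c0|); last first.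
      by apply: (le_trans (ler_distD (avg (T : borel X -> borel X) (f c) N.+1 y) _ _)); exact: lerD.
    have -> : (1 - c0) * (\1_B : borel X -> R) y + c0 * (1 - (\1_B : borel X -> R) y) = `|(\1_B : borel X -> R) y - c0|.
      rewrite indicE; case: (_ \in _).
        by rewrite (_ : true%:R = 1)// subrr mulr0 addr0 mulr1 ger0_norm// subr_ge0.
      by rewrite (_ : false%:R = 0)// mulr0 add0r subr0 mulr1 sub0r normrN ger0_norm.
    by [].
  rewrite ExD//; last by apply: bmD => //; exact: bm_cst.
  rewrite ExD//; last exact: bm_cst.
  rewrite Eavh Ex_cst Ex_indic// lerD// lerD2l.
  by rewrite -lee_fin -(mu_fin nu mG).
have l1 : 8 * eta * (1 - c0) <= b * (1 - c0) by rewrite ler_wpM2r// subr_ge0.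
have l2 : 8 * eta * c0 <= (1 - b) * c0 by rewrite ler_wpM2r.
move: low l1 l2 eta0; rewrite /s; clear; lra.
Qed.

(* Pick a point that is generic for countably many continuous functions and visits the closed sets with
   positive frequency; its empirical measures accumulate at an ergodic measure. *)
Lemma ergodic_component (mu : probability (borel X) R) (K : nat -> set X) (tau : R) (e0 : nat) :
  invariant_measure T mu -> (forall e, closed (K e)) -> 0 < tau ->
  (forall e, (e0 <= e)%N -> (tau%:E <= mu (K e))%E) ->
  exists2 nu : probability (borel X) R, ergodic_measure T nu & forall m, exists2 e, (m <= e)%N & (0 < nu (K e))%E.
Proof.
move=> imu cK tau0 hK.
have mK e : measurable (K e : set (borel X)) by exact: borel_closed.
pose U m := \bigcup_k K (m + k)%N.
have mU m : measurable (U m : set (borel X)) by exact: bigcupT_measurable.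
pose P m n := \bigcap_k (if (k < n)%N then U m `\` K (m + k)%N else setT).
have mP m n : measurable (P m n : set (borel X)).
  by apply: bigcapT_measurable => k; case: ifP => // _; exact: measurableD.
have PE m n x : (0 < n)%N -> P m n x <-> U m x /\ forall k, (k < n)%N -> ~ K (m + k)%N x.
  move=> n0; split.
    move=> h; split; first by have := h 0%N Logic.I; rewrite n0 => -[].
    by move=> k kn; have := h k Logic.I; rewrite kn => -[].
  by move=> [Ux h] k _; case: ifP => // kn; split=> //; exact: h.
(* A finite union exhausts [U m] up to measure [tau / 2 ^ (m + 2)]; using it instead of [U m] makes
   the upper limit set closed, at a total loss of at most [tau / 2]. *)
have /choice[n hn] m : exists n, fine (mu (P m n.+1)) < tau / 2 / (2 ^ m.+1)%:R.
  apply: (@mu_lt_of_null _ _ _ mu (fun n => P m n.+1) set0) => //.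
  - move=> k l kl x /PE-/(_ isT)[Ux h]; apply/PE => //; split=> // i ik.
    by apply: h; apply: (leq_trans ik); rewrite ltnS.
  - move=> x h /=; have /PE-/(_ isT)[[k _ Kx] _] := h 0%N Logic.I.
    by have /PE-/(_ isT)[_ /(_ k (ltnSn k))] := h k Logic.I.
  - by rewrite !divr_gt0// ltr0n expn_gt0.
pose F m := \big[setU/set0]_(k < (n m).+1) K (m + k)%N.
have cF m : closed (F m) by rewrite /F; elim/big_ind : _ => //; [exact: closed0|exact: closedU].
(* A measure that charges this closed set charges [K e] for arbitrarily large [e]. *)
pose A := \bigcap_m F m.
have cA : closed A by exact: closed_bigI.
have mA : measurable (A : set (borel X)) by exact: borel_closed.
pose L := \bigcap_m U m.
have mL : measurable (L : set (borel X)) by exact: bigcapT_measurable.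
have muL : (tau%:E <= mu L)%E.
  have cv : (mu \o U) k @[k --> \oo] --> mu L.
    apply: nonincreasing_cvg_mu => //.
      by change (mu (U 0%N) < +oo)%E; rewrite (mu_fin mu (mU 0%N)) ltry.
    move=> i j ij; apply/subsetPset => x [k _ Kx]; exists (j - i + k)%N => //.
    by rewrite addnA subnKC.
  rewrite -(cvg_lim _ cv)//; apply: lime_ge; first by apply/cvg_ex; exists (mu L).
  exists e0 => // k /hK /le_trans; apply; apply: le_measure; rewrite ?inE//.
  by move=> x Kx; exists 0%N => //; rewrite addn0.
have LA : L `\` A `<=` \bigcup_m P m (n m).+1.
  move=> x [Lx nA]; apply: contrapT => nP; apply: nA => m _.
  apply: contrapT => nF; apply: nP; exists m => //; apply/PE => //; split; first exact: Lx.
  by move=> k kn Kx; apply: nF; rewrite /F -(bigcup_mkord (n m).+1 (fun k => K (m + k)%N)); exists k.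
have muA : (0 < mu A)%E.
  rewrite (mu_fin mu mA) lte_fin.
  have mLA : measurable (L `\` A : set (borel X)) by exact: measurableD.
  have h1 : (mu (L `\` A) <= (tau / 2)%:E)%E.
    apply: (le_trans (@measure_sigma_subadditive _ _ _ mu _ (fun m => P m (n m).+1) _ _ LA)) => //.
    apply: le_trans (epsilon_trick0 xpredT _); last by rewrite divr_ge0// ltW.
    apply: lee_nneseries => m *; first exact: measure_ge0.
    by apply: mu_le_fin; [exact: mP|exact/ltW/hn].
  have h2 : (mu L <= mu A + mu (L `\` A))%E.
    apply: (@le_trans _ _ (mu (A `|` (L `\` A)))).
      apply: le_measure; rewrite ?inE//; first exact: measurableU.
      by move=> x Lx; have [?|?] := pselect (A x); [left|right].
    exact: measureU2.
  move: muL h1 h2; rewrite (mu_fin mu mL) (mu_fin mu mA) (mu_fin mu mLA) -EFinD !lee_fin; lra.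
have [nu enu nuA] := ergodic_charging imu cA muA.
exists nu => // m; apply: contrapT => H.
have nuK k : nu (K (m + k)%N) = 0%E.
  apply/eqP; rewrite eq_le measure_ge0 andbT leNgt; apply/negP => h.
  by apply: H; exists (m + k)%N => //; exact: leq_addr.
have : (nu A <= 0)%E.
  have nuU : nu (U m) = 0%E by apply: null_bigcup.
  rewrite -nuU; apply: le_measure; rewrite ?inE// => x /(_ m Logic.I).
  by rewrite /F -(bigcup_mkord (n m).+1 (fun k => K (m + k)%N)) => -[k _ Kx]; exists k.
by rewrite leNgt nuA.
Qed.

End ergodic_component.

(** * Mean dimension is bounded by compression rates *)

Section prob.
Context {R : realType} {dY : measure_display} {Y : measurableType dY} (mu : probability Y R).

Lemma mu_lty (A : set Y) : measurable A -> (mu A < +oo)%E.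
Proof. by move=> mA; rewrite (mu_fin mu mA) ltry. Qed.

Lemma limsup_set_ge (A : nat -> set Y) (r : \bar R) : (forall n, measurable (A n)) ->
  (forall m, exists k, (r <= mu (A (m + k)%N))%E) -> (r <= mu (\bigcap_m \bigcup_k A (m + k)%N))%E.
Proof.
move=> mA hA; pose U m := \bigcup_k A (m + k)%N.
have mU m : measurable (U m) by exact: bigcupT_measurable.
have cv : (mu \o U) k @[k --> \oo] --> mu (\bigcap_m U m).
  apply: nonincreasing_cvg_mu => //; first exact: mu_lty.
    exact: bigcapT_measurable.
  move=> i j ij; apply/subsetPset => x [k _ Kx]; exists (j - i + k)%N => //.
  by rewrite addnA subnKC.
rewrite -(cvg_lim _ cv)//; apply: lime_ge; first by apply/cvg_ex; exists (mu (\bigcap_m U m)).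
near=> m; have [k /le_trans] := hA m; apply; apply: le_measure; rewrite ?inE//.
by move=> x Kx; exists k.
Unshelve. all: by end_near. Qed.

End prob.

Section good.
Context {R : realType} {X : ptopologicalType} (T : X -> X) (dd : X -> X -> R).
Hypotheses (cT : continuous T) (dd0 : forall x y, 0 <= dd x y) (ddc : forall y, continuous (dd^~ y)).
Implicit Types (Q : seq (R * seq X)) (nu : probability (borel X) R).

(** Code length and distortion are counted together by [- ln pot]; the bound [kap] keeps this
    function bounded, so that its expectation makes sense. *)
Definition compressible (eps : R) nu (c : R) := exists n Q kap,
  [/\ (0 < n)%N, valid Q n, forall x, expR (- kap) <= pot T dd eps Q x &
      Ex nu (fun x => - ln (pot T dd eps Q x)) < n%:R * c].

Lemma cost_continuous l : continuous (cost T dd l).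
Proof.
elim: l => [|y l IH] x /=; first exact: cvg_cst.
apply: cvgD; first exact: ddc.
by apply: (@continuous_comp _ _ _ T (cost T dd l)); [exact: cT|exact: IH].
Qed.

Lemma pot_continuous eps Q : continuous (pot T dd eps Q).
Proof.
apply: continuous_big => [|q _]; first exact: add_continuous.
move=> x; apply: cvgM; first exact: cvg_cst.
apply: (@continuous_comp _ _ _ (fun x => - (cost T dd q.2 x / eps)) expR); last exact: continuous_expR.
apply: cvgN; apply: cvgM; [exact: cost_continuous|exact: cvg_cst].
Qed.

Lemma bm_pot eps Q n kap : 0 < eps -> valid Q n -> (forall x, expR (- kap) <= pot T dd eps Q x) ->
  bm (fun x : borel X => - ln (pot T dd eps Q x)) /\
  forall x, 0 <= - ln (pot T dd eps Q x) <= kap.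
Proof.
move=> eps0 vQ hk.
have p0 x : 0 < pot T dd eps Q x by apply: lt_le_trans (hk x); exact: expR_gt0.
have h x : 0 <= - ln (pot T dd eps Q x) <= kap.
  rewrite oppr_ge0 ln_le0 ?(pot_le1 T dd0 eps0 x vQ)//=.
  by rewrite lerNl -[X in X <= _]expRK ler_ln ?posrE ?expR_gt0.
split=> //; split; last by exists kap => x; have /andP[a b] := h x; rewrite ger0_norm.
apply: borel_continuous => x; apply: cvgN.
apply: (@continuous_comp _ _ _ (pot T dd eps Q) (@ln R)); first exact: pot_continuous.
exact: continuous_ln.
Qed.

Fixpoint Qpow Q L := if L is L'.+1 then pprod Q (Qpow Q L') else [:: (1 : R, [::] : seq X)].

Lemma valid_Qpow Q n L : valid Q n -> valid (Qpow Q L) (L * n).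
Proof.
by move=> vQ; elim: L => [|L IH] /=; [exact: valid_unit|rewrite mulSn; exact: valid_prod].
Qed.

Lemma pot_Qpow eps Q n L x (u : X -> R) : valid Q n -> (forall x, expR (- u x) <= pot T dd eps Q x) ->
  expR (- \sum_(j < L) u (iter (j * n) T x)) <= pot T dd eps (Qpow Q L) x.
Proof.
move=> vQ hu; elim: L x => [|L IH] x /=; first by rewrite big_ord0 oppr0 expR0 pot_unit.
rewrite big_ord_recl opprD expRD (pot_prod _ _ _ _ _ vQ).
have -> : iter (@ord0 L * n) T x = x by [].
apply: ler_pM => //; rewrite ?expR_ge0//.
apply: le_trans (IH _); rewrite le_eqVlt; apply/orP; left; apply/eqP; congr (expR (- _)).
by apply: eq_bigr => j _; rewrite -iterD lift0 mulSn addnC.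
Qed.

End good.

Section ergodic_visits.
Context {R : realType} {X : ptopologicalType} (T : X -> X).
Hypothesis mT : measurable_fun setT (T : borel X -> borel X).
Variable nu : probability (borel X) R.
Hypothesis enu : ergodic_measure T nu.

Lemma inv_iter k (A : set (borel X)) : measurable A ->
  measurable (iter k T @^-1` A : set (borel X)) /\ nu (iter k T @^-1` A) = nu A.
Proof.
case: enu => inu _; elim: k A => [//|k IH] A mA.
have mTA : measurable (T @^-1` A : set (borel X)) by rewrite -[X in measurable X]setTI; exact: mT.
have [m1 e1] := IH _ mTA.
rewrite (_ : iter k.+1 T @^-1` A = iter k T @^-1` (T @^-1` A))//.
by split=> //; rewrite e1; exact: inu.
Qed.

(** The set [B] of points that reach [W] contains its preimage, which has the same measure; hence it
    differs by a null set from the strictly invariant [C], to which ergodicity applies. *)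
Lemma ergodic_visits (W : set (borel X)) : measurable W -> (0 < nu W)%E ->
  nu (\bigcup_k (iter k T @^-1` W)) = 1%E.
Proof.
move=> mW W0; set B := \bigcup_k _.
have mB : measurable (B : set (borel X)) by apply: bigcupT_measurable => k; exact: (inv_iter k mW).1.
have BT x : B (T x) -> B x by move=> [k _ h]; exists k.+1 => //=; rewrite -iterS iterSr.
have BTk k x : B (iter k T x) -> B x.
  by elim: k => [//|k IH]; rewrite iterS => /BT; exact: IH.
pose C := \bigcap_k (iter k T @^-1` B).
have mC : measurable (C : set (borel X)) by apply: bigcapT_measurable => k; exact: (inv_iter k mB).1.
have TC : T @^-1` C = C.
  apply/seteqP; split=> x /= h k _ /=.
    by apply: (@BTk 1%N); rewrite /= -iterS iterSr; exact: h.
  by rewrite -iterSr; exact: (h k.+1).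
have BC : nu (B `\` C) = 0%E.
  have sub : B `\` C `<=` \bigcup_k (B `\` iter k T @^-1` B).
    move=> x [Bx nC]; apply: contrapT => H; apply: nC => k _.
    by apply: contrapT => nk; apply: H; exists k.
  have mk k : measurable (B `\` iter k T @^-1` B : set (borel X)).
    by apply: measurableD => //; exact: (inv_iter k mB).1.
  have z : nu (\bigcup_k (B `\` iter k T @^-1` B)) = 0%E.
    apply: null_bigcup => // k.
    have [mk' ek] := inv_iter k mB.
    have e : nu (B `\` iter k T @^-1` B) = (nu B - nu (iter k T @^-1` B))%E.
      rewrite measureD//; last exact: mu_lty.
      by congr (_ - nu _)%E; apply/seteqP; split=> [x []//|x h]; split=> //; exact: BTk h.
    by rewrite e ek (mu_fin nu mB) subee.
  by apply/eqP; rewrite eq_le measure_ge0 andbT -z; apply: le_measure; rewrite ?inE//;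
    [exact: measurableD|exact: bigcupT_measurable].
have CB : C `<=` B by move=> x /(_ 0%N Logic.I).
have nBC : nu B = nu C.
  have : nu (C `|` (B `\` C)) = nu C.
    apply/eqP; rewrite eq_le; apply/andP; split.
      have h : (nu (C `|` (B `\` C)) <= nu C + nu (B `\` C))%E by apply: measureU2 => //; exact: measurableD.
      by rewrite BC adde0 in h.
    have mm : measurable (C `|` (B `\` C) : set (borel X)) by apply: measurableU => //; exact: measurableD.
    by apply: le_measure; rewrite ?inE//; exact: subsetUl.
  move=> <-; congr (nu _); apply/seteqP; split=> x; last by move=> [/CB|[]].
  by move=> Bx; have [?|?] := pselect (C x); [left|right].
have [_ /(_ C mC TC)[C0|C1]] := enu; last by rewrite nBC.
have : (nu W <= nu B)%E by apply: le_measure; rewrite ?inE// => x Wx; exists 0%N.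
by rewrite nBC C0 leNgt W0.
Qed.

End ergodic_visits.

(** * Countably many blocks that suffice for almost every point *)

Section coded.
Context {R : realType} {X : ptopologicalType} (T : X -> X) (dd : X -> X -> R) (D : nat -> X).
Hypotheses (cT : continuous T) (dd0 : forall x y, 0 <= dd x y) (ddc : forall y, continuous (dd^~ y)).
Hypotheses (ddtri : forall y x z, dd x z <= dd x y + dd y z)
  (hD : forall x e, 0 < e -> exists n, dd x (D n) < e).
Variables (eps kappa : R) (Sk : seq (R * seq X)).
Hypotheses (eps0 : 0 < eps) (vSk : valid Sk 1) (kappa0 : 0 <= kappa)
  (hk : forall x, expR (- kappa) <= pot T dd eps Sk x).

(** With dyadic weights and letters from a dense sequence there are countably many
    sub-probabilities, so the good sets below are a countable family of open sets. *)
Definition decode (q : seq (nat * seq nat)) : seq (R * seq X) :=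
  [seq (2^-1 ^+ p.1, [seq D n | n <- p.2]) | p <- q].

Lemma dyadic_approx (w : R) : 0 < w <= 1 -> exists k, 2^-1 ^+ k <= w /\ w <= 2 * 2^-1 ^+ k.
Proof.
move=> /andP[w0 w1].
have ex : exists k, 2^-1 ^+ k <= w.
  exists (Num.truncn w^-1).+1; rewrite exprVn invf_ple ?posrE ?exprn_gt0//.
  rewrite ltW// (lt_le_trans (truncnS_gt _))// -natrX ler_nat ltnW// ltn_expl//.
case: (ex_minnP ex) => k hkk kmin; exists k; split=> //.
case: k hkk kmin => [|k] hkk kmin; first by rewrite expr0 mulr1 (le_trans w1)// ler1n.
rewrite exprS mulVKf//; rewrite leNgt; apply/negP => /ltW/kmin.
by rewrite ltnn.
Qed.

Lemma word_approx (l : seq X) : exists c : seq nat, size c = size l /\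
  forall x, cost T dd [seq D n | n <- c] x <= cost T dd l x + (size l)%:R * eps.
Proof.
elim: l => [|y l [c [cl hc]]]; first by exists [::]; split=> // x /=; rewrite mul0r addr0.
have [n hn] := hD y eps0; exists (n :: c); split; first by rewrite /= cl.
move=> x /=; rewrite -natr1 mulrDl mul1r.
have := ddtri y x (D n); have := hc (T x); move: hn.
set a := dd y _; set b := cost _ _ _ _; set b' := cost _ _ _ _; set c1 := dd x _; set c2 := dd x _.
by set e := _ * eps; clear; lra.
Qed.

(** Rounding a weight to a power of 1/2 costs a factor 2, and moving each of [n] letters by less
    than [eps] costs [exp (- n)]; together at most [exp (- (n + 1))]. *)
Lemma code_approx n Q : (forall q, q \in Q -> 0 <= q.1 <= 1 /\ size q.2 = n) ->
  exists c, [/\ forall q, q \in decode c -> 0 <= q.1 /\ size q.2 = n,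
    \sum_(q <- decode c) q.1 <= \sum_(q <- Q) q.1 &
    forall x, expR (- n.+1%:R) * pot T dd eps Q x <= pot T dd eps (decode c) x].
Proof.
elim: Q => [|[w l] Q IH] hQ.
  by exists [::]; split=> // x; rewrite /pot !big_nil mulr0.
have [q qQ|c [h1 h2 h3]] := IH; first by apply: hQ; rewrite inE qQ orbT.
have [/= w01 szl] := hQ (w, l) (mem_head _ _).
have [w0|wn0] := eqVneq w 0.
  exists c; split=> // [|x]; first by rewrite big_cons/= w0 add0r.
  by rewrite /pot big_cons/= w0 mul0r add0r; exact: h3.
have [|k [k1 k2]] := @dyadic_approx w.
  by case/andP: w01 => w0 ->; rewrite lt_neqAle eq_sym wn0 w0.
have [c' [c'l hc']] := word_approx l.
exists ((k, c') :: c); split.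
- move=> q; rewrite inE => /orP[/eqP -> /=|]; last exact: h1.
  by rewrite size_map c'l szl exprn_ge0.
- by rewrite /= !big_cons/= lerD.
- move=> x; rewrite /pot /= !big_cons/= mulrDr; apply: lerD; last exact: h3.
  rewrite -natr1 opprD expRD.
  have e1 : expR (- (1 : R)) * w <= 2^-1 ^+ k.
    apply: (@le_trans _ _ (2^-1 * w)); last by rewrite -[leRHS](mulKf (_ : 2 != 0 :> R))// ler_wpM2l.
    by apply: ler_wpM2r; [case/andP: w01|exact: expR1_ge2].
  have e2 : expR (- n%:R) * expR (- (cost T dd l x / eps)) <= expR (- (cost T dd [seq D n | n <- c'] x / eps)).
    rewrite -expRD ler_expR -opprD lerN2 ler_pdivrMr// mulrDl divfK ?gt_eqF//.
    by rewrite addrC -szl; exact: hc'.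
  rewrite [X in X <= _](_ : _ = (expR (- (1 : R)) * w) * (expR (- n%:R) * expR (- (cost T dd l x / eps)))); last by ring.
  by apply: ler_pM => //; rewrite mulr_ge0 ?expR_ge0//; case/andP: w01.
Qed.

(** The index encodes a word length [n], a number [k] of letters skipped first, and the code of a
    sub-probability on words of length [n]. *)
Definition dec (i : nat) : nat * nat * seq (nat * seq nat) :=
  odflt (0%N, 0%N, [::]) (choice.unpickle i).

Definition okb i := `[< (0 < (dec i).1.1)%N /\ valid (decode (dec i).2) (dec i).1.1 >].

(** The [L + i + 2] repetitions make the block so long that its weight [2 ^ - (i + L + 2)] in the
    tiling costs at most 1 per letter. Indices that decode badly get the harmless block [Sk],
    together with an empty good set. *)
Definition blkQ i L := if okb i
  then iter (dec i).1.2 (pprod Sk) (Qpow (decode (dec i).2) (L + i + 2)) else Sk.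

Definition blkn i L := if okb i then ((dec i).1.2 + (L + i + 2) * (dec i).1.1)%N else 1%N.

Definition Gset c i L : set X :=
  if okb i then [set x | expR (- ((blkn i L)%:R * c)) < pot T dd eps (blkQ i L) x] else set0.

Lemma Gset_open c i L : open (Gset c i L).
Proof.
rewrite /Gset; case: ifP => _; last exact: open0.
rewrite [X in open X](_ : _ = pot T dd eps (blkQ i L) @^-1` [set t : R | expR (- ((blkn i L)%:R * c)) < t])//.
apply: open_comp; last exact: open_gt.
by move=> x _; exact: pot_continuous.
Qed.

Lemma valid_skips k Q n : valid Q n -> valid (iter k (pprod Sk) Q) (k + n).
Proof.
by move=> vQ; elim: k => [//|k IH]; rewrite iterS addSn -add1n; exact: valid_prod.
Qed.

Lemma pot_skips k Q n x : valid Q n ->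
  expR (- (k%:R * kappa)) * pot T dd eps Q (iter k T x) <= pot T dd eps (iter k (pprod Sk) Q) x.
Proof.
move=> vQ; elim: k x => [|k IH] x; first by rewrite mul0r oppr0 expR0 mul1r.
change (iter k.+1 (pprod Sk) Q) with (pprod Sk (iter k (pprod Sk) Q)).
rewrite (pot_prod _ _ _ _ _ vSk) -natr1 mulrDl mul1r addrC opprD expRD -mulrA.
rewrite iterSr; change (iter 1 T x) with (T x).
by apply: ler_pM => //; rewrite ?mulr_ge0 ?expR_ge0//; exact: pot_ge0 vQ.
Qed.

Lemma blk_valid i L : valid (blkQ i L) (blkn i L) /\ (0 < blkn i L)%N.
Proof.
rewrite /blkQ /blkn; case: ifP => // /asboolP[n0 vQ]; split.
  by apply: valid_skips; exact: valid_Qpow.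
by rewrite addn_gt0 muln_gt0 n0 addn2 orbT.
Qed.

Lemma Gset_weight c i L x : Gset c i L x ->
  expR (- ((blkn i L)%:R * (c + 1))) <= 2^-1 ^+ (i + L + 2) * pot T dd eps (blkQ i L) x.
Proof.
rewrite /Gset; case: ifP => // ok /= /ltW h.
rewrite mulrDr mulr1 addrC opprD expRD; apply: ler_pM => //; rewrite ?expR_ge0//.
apply: (@le_trans _ _ (expR (-1) ^+ (i + L + 2))); last first.
  by apply: lerXn2r; rewrite ?nnegrE ?expR_ge0 ?invr_ge0//; exact: expR1_ge2.
rewrite -expRM_natl mulrN mulr1 ler_expR lerN2 ler_nat /blkn ok.
move: ok => /asboolP[n0 _]; rewrite (addnC i L).
by apply: leq_trans (leq_addl _ _); exact: leq_pmulr.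
Qed.

Hypothesis mT : measurable_fun setT (T : borel X -> borel X).

(** Means of [v] over multiples of [n] need not converge to its expectation, because the [n]-th
    iterate may fail to be ergodic. Markov's inequality still gives a set of positive measure where
    infinitely many of them are below [n c], and ergodicity of [T] brings almost every point there
    after [k] skipped letters. *)
Lemma compressible_ae (nu : probability (borel X) R) c : ergodic_measure T nu -> compressible T dd eps nu c ->
  nu (~` \bigcup_i \bigcup_L Gset (c + 3) i L) = 0%E.
Proof.
move=> enu [n [Q [kap [n0 vQ hkap EQ]]]].
have [bv v0k] := bm_pot cT dd0 ddc eps0 vQ hkap.
set v := fun x : borel X => - ln (pot T dd eps Q x) in bv.
have v0 x : 0 <= v x by case/andP: (v0k x).
have vE x : pot T dd eps Q x = expR (- v x).
  by rewrite opprK lnK// posrE; apply: lt_le_trans (hkap x); exact: expR_gt0.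
have [q [q1 q2 q3]] : exists q, [/\ forall p, p \in decode q -> 0 <= p.1 /\ size p.2 = n,
    \sum_(p <- decode q) p.1 <= \sum_(p <- Q) p.1 &
    forall x, expR (- n.+1%:R) * pot T dd eps Q x <= pot T dd eps (decode q) x].
  apply: code_approx => p pQ; have [/(_ p pQ)[p0 pn] sQ] := vQ; split=> //; rewrite p0/=.
  apply: le_trans sQ; rewrite (big_rem p)//= lerDl big_seq sumr_ge0// => p' /mem_rem p'Q.
  by case: vQ => /(_ p' p'Q)[].
have vq : valid (decode q) n by split=> //; apply: le_trans q2 _; case: vQ.
pose u x := v x + n.*2%:R.
have hu x : expR (- u x) <= pot T dd eps (decode q) x.
  apply: le_trans (q3 x); rewrite vE -expRD ler_expR /u opprD addrC lerD2r lerN2 ler_nat.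
  by rewrite -addnn -addn1 leq_add2l.
have nR : (1 : R) <= n%:R by rewrite ler1n.
have c0 : 0 < c.
  have : 0 < n%:R * c by apply: le_lt_trans EQ; apply: Ex_ge0.
  by rewrite pmulr_rgt0// (lt_le_trans ltr01).
have nc0 : 0 < n%:R * c by rewrite mulr_gt0// (lt_le_trans ltr01).
pose theta := 1 - Ex nu v / (n%:R * c).
have th0 : 0 < theta by rewrite subr_gt0 ltr_pdivrMr// mul1r.
pose S L x := \sum_(j < L) v (iter (j * n) T x).
have inu := enu.1.
have bS L : bm (S L : borel X -> R) by apply: bm_sum => j _; exact: (bm_iter mT).
pose A L : set (borel X) := [set x | ~ (L.+1%:R * (n%:R * c) <= S L.+1 x)].
have mA L : measurable (A L) by apply: measurableC; apply: measurable_le_set; case: (bS L.+1).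
have nuA L : (theta%:E <= nu (A L))%E.
  have L0 : 0 < L.+1%:R * (n%:R * c) by rewrite mulr_gt0.
  have S0 x : 0 <= S L.+1 x by apply: sumr_ge0 => j _; exact: v0.
  have := Ex_markov nu (bS L.+1) S0 L0.
  have mB := measurable_le_set (L.+1%:R * (n%:R * c)) (bS L.+1).1.
  have ES : Ex nu (S L.+1) = L.+1%:R * Ex nu v.
    rewrite /S Ex_sum; last by move=> j _; exact: (bm_iter mT).
    rewrite (eq_bigr (fun=> Ex nu v)) => [|j _]; last exact: (Ex_iter mT inu).
    by rewrite big_const_ord iter_addr addr0 mulr_natl.
  rewrite ES invfM mulrACA mulfV ?mul1r ?pnatr_eq0// => hM.
  rewrite (_ : A L = ~` [set x | L.+1%:R * (n%:R * c) <= S L.+1 x])//.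
  rewrite probability_setC//= (mu_fin nu mB) -EFinB lee_fin lerB//.
pose W := \bigcap_m \bigcup_k A (m + k)%N.
have W0 : (0 < nu W)%E.
  apply: (@lt_le_trans _ _ theta%:E); first by rewrite lte_fin.
  by apply: (@limsup_set_ge _ _ _ nu A) => // k; exists 0%N.
have mW : measurable (W : set (borel X)) by apply: bigcapT_measurable => k; exact: bigcupT_measurable.
have B1 := ergodic_visits mT enu mW W0.
set B := \bigcup_k _ in B1.
have mB : measurable (B : set (borel X)) by apply: bigcupT_measurable => k; exact: (inv_iter mT enu k mW).1.
have BG : B `<=` \bigcup_i \bigcup_L Gset (c + 3) i L.
  move=> x [k _ /= Wx].
  pose i := choice.pickle (n, k, q).
  have di : dec i = (n, k, q) by rewrite /dec /i choice.pickleK.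
  (* Large enough that the cost [k kappa] of the skips is at most the number [L'] of repetitions.
     The 3 in [c + 3] is this 1 plus the 2 lost by rounding, since [n + 1 <= 2 n]. *)
  pose M := (i + 2 + Num.truncn (k%:R * kappa)).+1.
  have [r _] := Wx M Logic.I; set L' := (M + r).+1 => hA.
  exists i => //; exists (L' - (i + 2))%N => //.
  have ok : okb i by apply/asboolP; rewrite di.
  have LE : (L' - (i + 2) + i + 2 = L')%N by rewrite /L' /M; move: (Num.truncn _) (i) => t i'; clear; lia.
  rewrite /Gset ok /= /blkQ /blkn ok di /= LE.
  have kL : k%:R * kappa <= L'%:R.
    apply: (le_trans (ltW (truncnS_gt _))); rewrite ler_nat /L' /M; move: (Num.truncn _) (i) => t i'; clear; lia.
  have Sx : S L' (iter k T x) < L'%:R * (n%:R * c) by rewrite ltNge; apply/negP.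
  apply: (@lt_le_trans _ _ (expR (- (k%:R * kappa)) * expR (- \sum_(j < L') u (iter (j * n) T (iter k T x))))); last first.
    apply: le_trans (pot_skips k x (valid_Qpow L' vq)).
    by apply: ler_wpM2l; [exact: expR_ge0|apply: (@pot_Qpow _ _ T dd eps (decode q) n L' (iter k T x) u)].
  rewrite -expRD ltr_expR -opprD ltrN2 /u big_split/= -/(S L' _).
  rewrite big_const_ord iter_addr addr0 -[n.*2%:R *+ L']mulr_natl natrD -mul2n !natrM.
  have k0 : 0 <= k%:R * (c + 3) by rewrite mulr_ge0// addr_ge0// ltW.
  have LR : L'%:R <= L'%:R * n%:R :> R by rewrite ler_peMr.
  move: Sx kL k0 LR; move: (L'%:R : R) (S _ _) => p a Sx kL k0 LR.
  apply: (@lt_le_trans _ _ (p + (p * (n%:R * c) + p * (2 * n%:R)))).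
    by apply: ler_ltD => //; rewrite ltrD2r.
  have -> : (k%:R + p * n%:R) * (c + 3) = k%:R * (c + 3) + p * (n%:R * c) + 3 * (p * n%:R) by ring.
  have -> : p * (2 * n%:R) = 2 * (p * n%:R) by ring.
  move: k0 LR; move: (k%:R * (c + 3)) (p * (n%:R * c)) (p * n%:R) => r1 r2 r3; lra.
have mG : measurable (\bigcup_i \bigcup_L Gset (c + 3) i L : set (borel X)).
  by apply: bigcupT_measurable => i; apply: bigcupT_measurable => L; apply: borel_open; exact: Gset_open.
apply/eqP; rewrite eq_le measure_ge0 andbT.
have z : nu (~` B) = 0%E by rewrite probability_setC// B1 subee.
rewrite -z; apply: le_measure; rewrite ?inE//; [exact: measurableC|exact: measurableC|exact: subsetC].
Qed.

End coded.

Lemma div_pair_sum {R : realType} (a b : nat -> R) (n B : nat) : (0 < B)%N ->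
  \sum_(j < n * B) a (j %/ B)%N * b (j %% B)%N = (\sum_(i < n) a i) * (\sum_(l < B) b l).
Proof.
move=> B0; elim: n => [|n IH]; first by rewrite mul0n !big_ord0 mul0r.
rewrite -(big_mkord xpredT (fun j => a (j %/ B)%N * b (j %% B)%N)).
rewrite mulSn addnC (@big_cat_nat _ _ _ (n * B))//=; last exact: leq_addr.
rewrite big_mkord IH big_ord_recr/= mulrDl; congr (_ + _).
rewrite -{1}[(n * B)%N]add0n big_addn addKn big_mkord mulr_sumr; apply: eq_bigr => j _.
by rewrite addnC divnMDl// modnMDl divn_small// modn_small// addn0.
Qed.

Lemma half_sum {R : realType} n : \sum_(i < n) 2^-1 ^+ i.+1 <= 1 :> R.
Proof.
have -> : \sum_(i < n) 2^-1 ^+ i.+1 = 1 - 2^-1 ^+ n :> R.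
  elim: n => [|n IH]; first by rewrite big_ord0 expr0 subrr.
  by rewrite big_ord_recr/= IH [X in _ = 1 - X]exprS exprS; lra.
by rewrite lerBlDr lerDl exprn_ge0.
Qed.

Lemma expR_small {R : realType} (A g : R) : 0 <= A -> 0 < g -> exists n : nat, A * expR (- (g * n%:R)) <= 2^-1.
Proof.
move=> A0 g0; exists (Num.truncn (2 * A / g)).+1.
rewrite expRN ler_pdivrMr ?expR_gt0//.
have h : 2 * A <= g * (Num.truncn (2 * A / g)).+1%:R.
  by rewrite [leRHS]mulrC -ler_pdivrMr// ltW// truncnS_gt.
have := expR_ge1Dx (g * (Num.truncn (2 * A / g)).+1%:R); lra.
Qed.

Section compare.
Context {R : realType} {X : ptopologicalType} (T : X -> X) (dd dd' : X -> X -> R) (L : R).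
Hypotheses (cT : continuous T) (dd0 : forall x y, 0 <= dd x y) (dd'0 : forall x y, 0 <= dd' x y)
 (ddc : forall y, continuous (dd^~ y)) (dd'c : forall y, continuous (dd'^~ y))
 (ddL : forall x y, dd x y <= L * dd' x y).

Lemma pot_compare eps eps' Q x : 0 < eps -> 0 < eps' -> L * eps' <= eps ->
  (forall q, q \in Q -> 0 <= q.1) ->
  pot T dd' eps' Q x <= pot T dd eps Q x.
Proof.
move=> e0 e'0 Le hQ; rewrite /pot !big_seq; apply: ler_sum => q /hQ q0.
apply: ler_wpM2l => //; rewrite ler_expR lerN2 ler_pdivrMr//.
have cL : forall l x, cost T dd l x <= L * cost T dd' l x.
  by elim=> [|y l IH] z /=; rewrite ?mulr0// mulrDr lerD.
apply: (le_trans (cL _ _)); apply: (@le_trans _ _ (cost T dd' q.2 x / eps' * (L * eps'))).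
  by rewrite mulrCA divfK ?gt_eqF.
by apply: ler_wpM2l => //; rewrite divr_ge0 ?(ltW e'0)//; exact: cost_ge0.
Qed.

Lemma compressible_compare eps eps' (nu : probability (borel X) R) c : 0 < eps -> 0 < eps' -> L * eps' <= eps ->
  compressible T dd' eps' nu c -> compressible T dd eps nu c.
Proof.
move=> e0 e'0 Le [n [Q [kap [n0 vQ hk EQ]]]].
have hle x : pot T dd' eps' Q x <= pot T dd eps Q x.
  by apply: pot_compare => // q qQ; case: vQ => /(_ q qQ)[].
have hk' x : expR (- kap) <= pot T dd eps Q x by apply: le_trans (hle x).
exists n, Q, kap; split; [exact: n0|exact: vQ|exact: hk'|]; apply: le_lt_trans EQ.
apply: Ex_le; [exact: (bm_pot cT dd0 ddc e0 vQ hk').1|exact: (bm_pot cT dd'0 dd'c e'0 vQ hk).1|].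
move=> x; rewrite lerN2 ler_ln ?posrE//; first exact: lt_le_trans (expR_gt0 _) (hk x).
exact: lt_le_trans (expR_gt0 _) (hk' x).
Qed.

End compare.

(** * From rates of ergodic measures to covers for all long orbits *)

Section main.
Context {R : realType} {X : ptopologicalType} (d : X -> X -> R) (T S : X -> X).
Hypotheses (cX : compact [set: X]) (cd : compatible_metric d) (cT : continuous T)
  (cS : continuous S) (TK : cancel T S) (SK : cancel S T).

Let mT : measurable_fun setT (T : borel X -> borel X).
Proof. exact: borel_map. Qed.

Section fixed_cover.
Variables (m : nat) (f : 'I_m -> X -> R) (L : R).
Hypotheses (f01 : forall i x, 0 <= f i x <= 1) (L0 : 0 < L)
  (fL : forall i x y, `|f i x - f i y| <= L * d x y) (f11 : forall x, exists i, f i x = 1).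

Let dd := fdist f.

Lemma fdist_tri y x z : dd x z <= dd x y + dd y z.
Proof.
apply: bigmax_le => [|i _]; first by rewrite addr_ge0 ?fdist_ge0.
by apply: (le_trans (ler_distD (f i y) _ _)); apply: lerD; exact: fdist_ge.
Qed.

Lemma fdist_le x y : dd x y <= L * d x y.
Proof.
by apply: bigmax_le => [|i _]; [rewrite mulr_ge0 ?(ltW L0)// (cm_ge0 cd)|exact: fL].
Qed.

Lemma fdist_cont y : continuous (dd^~ y).
Proof.
apply: (cm_lip_cont cd (L := L)) => x x'; rewrite ler_distl; apply/andP; split.
  by rewrite lerBlDr; apply: (le_trans (fdist_tri x x' y)); rewrite addrC lerD2l (cm_sym cd) fdist_le.
by apply: (le_trans (fdist_tri x' x y)); rewrite addrC lerD2l fdist_le.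
Qed.

(** Rounding the [m] coordinates to cells of side [exp (- lam)] gives at most [exp (m (1 + lam))]
    cells, and a letter from the right cell costs at most 1. What matters is that the exponent is
    linear in [lam]. *)
Lemma fdist_net (lam : R) : 0 <= lam -> exists Sk, valid Sk 1 /\
  forall x, expR (- (1 + m%:R * (1 + lam))) <= pot T dd (expR (- lam)) Sk x.
Proof.
move=> lam0; pose M := (Num.truncn (expR lam)).+1.
pose g x : {ffun 'I_m -> 'I_M} := [ffun i => inord (Num.truncn (f i x * expR lam))].
pose y (c : {ffun 'I_m -> 'I_M}) := xget point [set z | g z = c].
have gy x : g (y (g x)) = g x by apply: (@xgetPex _ point [set z | g z = g x]); exists x.
pose w : R := #|{ffun 'I_m -> 'I_M}|%:R^-1.
have w0 : 0 <= w by rewrite invr_ge0.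
have cM : #|{ffun 'I_m -> 'I_M}| = (M ^ m)%N by rewrite card_ffun !card_ord.
exists [seq (w, [:: y c]) | c <- enum {ffun 'I_m -> 'I_M}]; split.
  split; first by move=> q /mapP[c _ ->].
  rewrite big_map/= big_const_seq count_predT iter_addr addr0 -cardE -mulr_natr mulVf//.
  by rewrite cM pnatr_eq0 expn_eq0.
move=> x; rewrite /pot big_map.
rewrite (bigD1_seq (g x))/= ?mem_enum ?enum_uniq//.
apply: (@le_trans _ _ (w * expR (- (1 : R)))); last first.
  apply: (@le_trans _ _ (w * expR (- ((dd x (y (g x)) + 0) / expR (- lam))))); last first.
    by rewrite lerDl; apply: sumr_ge0 => c _; rewrite mulr_ge0// expR_ge0.
  rewrite ler_wpM2l// ler_expR lerN2 addr0 ler_pdivrMr ?expR_gt0// mul1r.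
  apply: bigmax_le => [|i _]; first exact: expR_ge0.
  have gE z : val (g z i) = Num.truncn (f i z * expR lam).
    rewrite ffunE/= inordK// ltnS le_truncn// ler_piMl ?expR_ge0//; by case/andP: (f01 i z).
  have e := congr1 (fun c : {ffun 'I_m -> 'I_M} => val (c i)) (gy x); rewrite !gE in e.
  have ge z : 0 <= f i z * expR lam by rewrite mulr_ge0 ?expR_ge0//; case/andP: (f01 i z).
  have := truncn_itv (ge x); have := truncn_itv (ge (y (g x))); rewrite e => /andP[a1 a2] /andP[b1 b2].
  rewrite -(ler_pM2r (expR_gt0 lam)) -expRD addNr expR0.
  rewrite (_ : _ * _ = `|f i x * expR lam - f i (y (g x)) * expR lam|); last first.
    by rewrite -mulrBl normrM (ger0_norm (expR_ge0 lam)).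
  move: a1 a2 b1 b2; rewrite -natr1.
  move: (f i x * _) (f i _ * _) (_%:R) => A1 A2 A3 a1 a2 b1 b2.
  by rewrite ler_norml; apply/andP; split; lra.
rewrite opprD expRD mulrC ler_wpM2r ?expR_ge0// /w cM expRN lef_pV2 ?posrE ?expR_gt0 ?ltr0n ?expn_gt0//.
rewrite natrX expRM_natl; apply: lerXn2r; rewrite ?nnegrE ?expR_ge0//.
rewrite expRD; apply: (@le_trans _ _ (2 * expR lam)).
  rewrite /M -natr1 mulrDl mul1r lerD//; first by rewrite truncn_le// expR_ge0.
  by rewrite -expR0 ler_expR.
by rewrite ler_wpM2r ?expR_ge0//; have := expR_ge1Dx (1 : R); lra.
Qed.


Variables (s : R) (D : nat -> X).
Hypotheses (s0 : 0 <= s) (hD : forall x e, 0 < e -> exists n, d (D n) x < e).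
Hypothesis hgood : forall nu : probability (borel X) R, ergodic_measure T nu ->
  exists e0, forall e, (e0 <= e)%N -> compressible T d (expR (- e%:R)) nu (s * e%:R).

(** Since [L <= exp a], scale [exp (- e)] for [fdist] is controlled by scale [exp (- (e + a))] for
    [d]. *)
Let a := (Num.truncn L).+1.
Let cc e : R := s * (e + a)%:R + 3.
Let kap (e : nat) : R := 1 + m%:R * (1 + e%:R).

Variable Sk : nat -> seq (R * seq X).
Hypothesis hSk : forall e, valid (Sk e) 1 /\ forall x, expR (- kap e) <= pot T dd (expR (- e%:R)) (Sk e) x.

Let GJ e J := \bigcup_(i in `I_J) \bigcup_(l in `I_J) Gset T dd D (expR (- e%:R)) (Sk e) (cc e) i l.

Let GJ_open e J : open (GJ e J).
Proof.
apply: bigcup_open => i _; apply: bigcup_open => l _.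
by apply: Gset_open => //; exact: fdist_cont.
Qed.

Let GJ_mono e J J' : (J <= J')%N -> GJ e J `<=` GJ e J'.
Proof.
move=> JJ x [i /= iJ [l /= lJ h]]; exists i; first exact: leq_trans JJ.
by exists l => //=; exact: leq_trans JJ.
Qed.

Lemma freq_le (A B : set X) x N : A `<=` B -> freq T A x N <= freq T B x N :> R.
Proof.
move=> AB; rewrite /freq ler_wpM2l ?invr_ge0//; apply: ler_sum => t _.
rewrite !indicE; case: (boolP (_ \in A)) => [/set_mem/AB/mem_set -> //|_].
by rewrite ler0n.
Qed.

(** Otherwise some long segments violate the bound at all scales from [e0] to [e0 + k]. A limit
    measure then gives mass at least [tau] to each closed set of points good for no block at scale
    [e], and some ergodic measure charges these sets for arbitrarily large [e], against
    [compressible_ae]. The scale depends on the segment but stays in a finite range. *)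
Lemma uniform_frequency tau e0 : 0 < tau -> exists e1 J N0, forall N x, (N0 <= N)%N ->
  exists2 e, (e0 <= e <= e1)%N & freq T (~` GJ e J) x N < tau :> R.
Proof.
move=> tau0; apply: contrapT => H.
have /choice[Nx hNx] k : exists Nx : nat * X, (k < Nx.1)%N /\
    forall e, (e0 <= e <= e0 + k)%N -> tau <= freq T (~` GJ e k) Nx.2 Nx.1.
  apply: contrapT => Hk; apply: H; exists (e0 + k)%N, k, k.+1 => N x kN.
  apply: contrapT => H2; apply: Hk; exists (N, x); split=> // e he /=.
  by rewrite leNgt; apply/negP => h; apply: H2; exists e.
have [mu [imu muC _ _]] := weak_limit cX cd cT cS TK SK (fun k => (Nx k).2) (fun k => (hNx k).1).
have cK e J : closed (~` GJ e J) by exact: open_closedC.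
have muK e J : (e0 <= e)%N -> (tau%:E <= mu (~` GJ e J))%E.
  move=> e0e; apply: (muC _ tau (maxn (e - e0) J)) => // k; rewrite geq_max => /andP[ek Jk].
  apply: (@le_trans _ _ (freq T (~` GJ e k) (Nx k).2 (Nx k).1)).
    by apply: (hNx k).2; rewrite e0e/= -leq_subLR.
  by apply: freq_le; apply: subsetC; exact: GJ_mono.
pose K e := ~` \bigcup_J GJ e J.
have cKe e : closed (K e) by apply: open_closedC; apply: bigcup_open => J _.
have mK e J : measurable (~` GJ e J : set (borel X)) by exact: borel_closed.
have muKe e : (e0 <= e)%N -> (tau%:E <= mu (K e))%E.
  move=> e0e; have h := @limsup_set_ge _ _ _ mu (fun J => ~` GJ e J) tau%:E (mK e) (fun J => ex_intro _ 0%N (muK e (J + 0)%N e0e)).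
  apply: (le_trans h); apply: le_measure; rewrite ?inE.
  - by apply: bigcapT_measurable => J; exact: bigcupT_measurable.
  - exact: borel_closed.
  - move=> x hx [J _ GJx]; have [k _] := hx J Logic.I; apply; apply: GJ_mono GJx; exact: leq_addr.
have [nu enu nuK] := ergodic_component cX cd cT cS TK SK imu cKe tau0 muKe.
have [e1 he1] := hgood enu.
have [e e1e] := nuK e1; apply/negP; rewrite -leNgt.
have gf : compressible T dd (expR (- e%:R)) nu (s * (e + a)%:R).
  apply: (@compressible_compare _ _ T dd d L cT _ _ _ _ fdist_le _ (expR (- (e + a)%:R))).
  - exact: fdist_ge0.
  - exact: cm_ge0 cd.
  - exact: fdist_cont.
  - exact: cm_dist_cont cd.
  - exact: expR_gt0.
  - exact: expR_gt0.
  - rewrite natrD opprD expRD mulrCA ler_piMr ?expR_ge0// expRN ler_pdivrMr ?expR_gt0// mul1r.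
    by have := expR_ge1Dx (a%:R : R); have := truncnS_gt L; rewrite -/a; move: (a%:R : R) => a'; lra.
  - by apply: he1; exact: leq_trans (leq_addr _ _).
have hDd x eps : 0 < eps -> exists n, dd x (D n) < eps.
  move=> eps0; have [n hn] := hD x (divr_gt0 eps0 L0); exists n.
  by apply: (le_lt_trans (fdist_le _ _)); rewrite mulrC -ltr_pdivlMr// (cm_sym cd).
have z : nu (~` \bigcup_i \bigcup_l Gset T dd D (expR (- e%:R)) (Sk e) (cc e) i l) = 0%E.
  have eps0 : 0 < expR (- e%:R) :> R by exact: expR_gt0.
  apply: compressible_ae gf => //.
  - exact: fdist_ge0.
  - exact: fdist_cont.
  - exact: fdist_tri.
  - exact: (hSk e).1.
  - exact: (hSk e).2.
rewrite -z; apply: le_measure; rewrite ?inE.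
- exact: borel_closed.
- apply: measurableC; apply: bigcupT_measurable => i; apply: bigcupT_measurable => l.
  by apply: borel_open; by apply: Gset_open => //; exact: fdist_cont.
- apply: subsetC => x [i _ [l _ h]]; exists (maxn i l).+1 => //.
  by exists i => /=; [rewrite ltnS leq_maxl|exists l => //=; rewrite ltnS leq_maxr].
Qed.

Lemma uniform_cover (U : {fset set X}) (g : R) : (0 < m)%N -> 0 < g ->
  (forall i, exists2 A, A \in U & forall x, 0 < f i x -> A x) ->
  exists N0, forall N, (N0 <= N)%N -> exists V p,
     [/\ finite_open_cover V, refines V (cover_iter T U N),
       forall x, (multiplicity V x <= p.+1)%N & p%:R <= (s + g + g) * N%:R].
Proof.
move=> m0 g0 fU.
(* The part of the rate that does not grow with the scale: [s a] from the shift of scales, 3 from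
   the good blocks, 1 each from their weights, from the mixture and from the tail of the tiling, and
   [g] for the constant part of the bad times. *)
pose C := s * a%:R + 6 + g.
have C0 : 0 <= C by rewrite !addr_ge0 ?mulr_ge0// ltW.
have [e0 he0] := @expR_small R (2 ^+ m * expR C * (6 * expR 2 * m%:R) ^+ m) g
  ltac:(by rewrite !mulr_ge0 ?exprn_ge0 ?mulr_ge0 ?expR_ge0) g0.
(* Bad times cost at most [tau N kap e <= N g (1 + e) / 2], linear in [e] with slope below [g], so
   they fit into the rate [s + g]. *)
pose tau := g / (2 * (1 + m%:R)).
have m1 : 0 < 1 + m%:R :> R by rewrite ltr_pwDl.
have tau0 : 0 < tau by rewrite divr_gt0// mulr_gt0.
have [e1 [J0 [N0 hN0]]] := uniform_frequency e0 tau0.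
pose J := J0.+1.
pose n_ j := blkn (R := R) D (j %/ J)%N (j %% J)%N.
pose w_ j : R := 2^-1 ^+ (j %/ J).+1 * 2^-1 ^+ (j %% J).+1.
pose nmax := (\max_(j < J * J) n_ j)%N.
pose Q_ e j := blkQ D (Sk e) (j %/ J)%N (j %% J)%N.
have n_gt0 j : (j < J * J)%N -> (0 < n_ j)%N by move=> _; exact: (blk_valid D (hSk 0%N).1 _ _).2.
have vQ e j : (j < J * J)%N -> valid (Q_ e j) (n_ j) by move=> _; exact: (blk_valid D (hSk e).1 _ _).1.
have w_ge0 j : (j < J * J)%N -> 0 <= w_ j by move=> _; rewrite mulr_ge0 ?exprn_ge0.
have w_sum : \sum_(j < J * J) w_ j <= 1.
  rewrite (div_pair_sum (fun i => 2^-1 ^+ i.+1 : R) (fun i => 2^-1 ^+ i.+1 : R))//.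
  by rewrite mulr_ile1 ?half_sum ?sumr_ge0// => i _; rewrite exprn_ge0.
have n_max j : (j < J * J)%N -> (n_ j <= nmax)%N by move=> jJ; exact: (leq_bigmax (Ordinal jJ)).
pose G e j := Gset T dd D (expR (- e%:R)) (Sk e) (cc e) (j %/ J)%N (j %% J)%N.
have hG e j x : (j < J * J)%N -> G e j x ->
    expR (- ((n_ j)%:R * (cc e + 1))) <= w_ j * pot T dd (expR (- e%:R)) (Q_ e j) x.
  move=> _ /Gset_weight; rewrite /w_ -exprD; rewrite (_ : (_.+1 + _.+1 = j %/ J + j %% J + 2)%N)//.
  by rewrite addSn addnS -addn2.
have kap0 e : 0 <= kap e by rewrite addr_ge0// mulr_ge0// addr_ge0.
have cc0 e : 0 <= cc e + 1 by rewrite !addr_ge0// mulr_ge0.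
pose QQ e N := tiling (J * J) n_ (Q_ e) w_ (Sk e) N.
have vQQ e N : valid (QQ e N) N.
  by apply: valid_tiling => //; [exact: (hSk e).1|exact: vQ].
have hQQ e N x := tiling_greedy (hSk e).1 n_gt0 (@vQ e) w_ge0 w_sum (kap0 e)
  (hSk e).2 (cc0 e) n_max (@hG e) N x.
(* Long enough for the frequency bound, for the number of scales to be at most [N], and for the tail
   cost [nmax * kap e1] to be at most [N]. *)
exists (N0 + e1.+1 + Num.truncn (nmax%:R * kap e1)).+1 => N hN.
have NN0 : (N0 <= N)%N by lia.
have Ne1 : ((e1 - e0).+1 <= N)%N by lia.
have Nk : nmax%:R * kap e1 <= N%:R.
  apply: (le_trans (ltW (truncnS_gt _))); rewrite ler_nat; move: hN; move: (Num.truncn _) => t; lia.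
have N0R : 0 < N%:R :> R by rewrite ltr0n; lia.
have sg0 : 0 <= s + g by rewrite addr_ge0// ltW.
have cf i : continuous (f i) by apply: (cm_lip_cont cd (L := L)) => x y; exact: fL.
apply: (@volume_bound _ _ T cT m f cf f11 U (s + g) g C e0%:R (e1 - e0).+1 N
  (fun i => (e0 + i)%:R) (fun i => QQ (e0 + i)%N N)) => //.
  by move=> e; rewrite ler_nat leq_addr.
move=> x; have [e /andP[e0e ee1] hfreq] := hN0 N x NN0.
have ei : (e - e0 < (e1 - e0).+1)%N by rewrite ltnS leq_sub2r.
exists (Ordinal ei) => /=; rewrite subnKC//.
apply: le_trans (hQQ e N x); rewrite ler_expR lerN2.
set bad := (\sum_(t < N) _)%N.
have badle : bad%:R <= tau * N%:R.
  have -> : bad%:R = N%:R * freq T (~` GJ e J0) x N - (N%:R * freq T (~` GJ e J0) x N - bad%:R) :> R by rewrite subKr.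
  rewrite lerBlDr; apply: (@le_trans _ _ (tau * N%:R)); first by rewrite mulrC ler_wpM2r// ltW.
  rewrite lerDl subr_ge0 /freq mulrA mulfV ?gt_eqF// mul1r /bad natr_sum; apply: ler_sum => t _.
  rewrite indicE; case: (boolP (_ \in _)) => [_|/negP nin]; first by case: (~~ _).
  rewrite asboolT//; have [i /= iJ [l /= lJ h]] : GJ e J0 (iter t T x).
    by apply: contrapT => H; apply: nin; exact/mem_set.
  have lJ' : (l < J)%N by exact: leq_trans lJ _.
  exists (i * J + l)%N; last by rewrite /G divnMDl// modnMDl divn_small// modn_small// addn0.
  have : (i * J + l < i.+1 * J)%N by rewrite mulSn addnC ltn_add2r.
  by move=> /leq_trans; apply; rewrite leq_mul2r (leq_trans iJ) ?orbT.
have ke1 : kap e <= kap e1 by rewrite lerD2l ler_wpM2l// lerD2l ler_nat.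
have mtau : tau * (1 + m%:R) = g / 2.
  by rewrite /tau invfM mulrA -mulrA mulVf ?gt_eqF// mulr1.
have kle : kap e <= (1 + m%:R) * (1 + e%:R).
  by rewrite /kap mulrDl mul1r lerD2r lerDl.
have h1 : bad%:R * kap e <= N%:R * (g / 2 * (1 + e%:R)).
  apply: (@le_trans _ _ ((tau * N%:R) * ((1 + m%:R) * (1 + e%:R)))); first by apply: ler_pM.
  by rewrite mulrACA mtau mulrCA.
have h2 : nmax%:R * kap e <= N%:R by apply: le_trans Nk; rewrite ler_wpM2l.
rewrite natrD mulrDl /cc natrD.
apply: (@le_trans _ _ (N%:R * (s * (e%:R + a%:R) + 3 + 1 + 1) + (N%:R * (g / 2 * (1 + e%:R)) + N%:R))).
  by rewrite lerD2l lerD.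
rewrite -[X in _ + (_ + X)]mulr1 -!mulrDr ler_wpM2l// /C.
have : 0 <= g * e%:R by rewrite mulr_ge0// ltW.
rewrite !mulrDr !mulrDl mulr1 (mulrAC g); move: (s * _) (s * _) (g * _) g0 => A1 A2 A3 g0' A30.
have -> : A3 / 2 = A3 - A3 / 2 by rewrite {2}(splitr A3) addrK.
have := divr_ge0 A30 (ler0n R 2); have := splitr g; have := divr_gt0 g0' (ltr0n R 2).
by move: (A3 / 2) (g / 2) => B1 B2; lra.
Qed.

End fixed_cover.

Theorem mdim_le_of_compressible (s : R) : 0 <= s ->
  (forall nu : probability (borel X) R, ergodic_measure T nu ->
    exists e0, forall e, (e0 <= e)%N -> compressible T d (expR (- e%:R)) nu (s * e%:R)) ->
  (mdim R T <= s%:E)%E.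
Proof.
move=> s0 hgood; apply/lee_addgt0Pr => g g0.
have g20 : 0 < g / 2 by rewrite divr_gt0.
(* Half of the margin goes to the bad times, half to the volume bound. *)
rewrite -EFinD (_ : s + g = s + g / 2 + g / 2); last by rewrite -addrA -splitr.
have [D hD] := cm_dense cX cd.
apply: (@mdim_leP R X d T cX cd cT) => // U [oU cU].
pose m := size (enum_fset U).
pose V (i : 'I_m) : set X := nth set0 (enum_fset U) i.
have VU i : V i \in U by apply: mem_nth.
have oV i : open (V i) by exact: oU.
have cV x : exists i, V i x.
  have : [set: X] x by []. rewrite -cU => -[A AU Ax].
  have iA : (index A (enum_fset U) < m)%N by rewrite index_mem.
  by exists (Ordinal iA); rewrite /V /= nth_index.
have [f [L [L0 [f01 fL fV f11]]]] := cm_soft_cover cX cd oV cV.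
have /choice[Sk hSk] : forall e : nat, exists Sk, valid Sk 1 /\
    forall x, expR (- (1 + m%:R * (1 + e%:R))) <= pot T (fdist f) (expR (- e%:R)) Sk x.
  by move=> e; apply: fdist_net.
eapply uniform_cover; try eassumption.
- by have [[i im] _] := f11 point; exact: leq_ltn_trans im.
- by move=> i; exists (V i); [exact: VU|exact: fV].
Qed.

End main.

(** * Katok entropies *)

Section star.
Context {R : realType} {X : ptopologicalType} (d : X -> X -> R) (T : X -> X).
Hypotheses (cX : compact [set: X]) (cd : compatible_metric d) (cT : continuous T).

Let mT : measurable_fun setT (T : borel X -> borel X).
Proof. exact: borel_map. Qed.

Variable eps : R.
Hypothesis eps0 : 0 < eps.

Lemma metric_net : exists Sk kappa, [/\ 0 <= kappa, valid Sk 1 &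
  forall x, expR (- kappa) <= pot T d eps Sk x].
Proof.
have [s hs] := cm_ball_cover cX cd (fun=> eps0).
have sz : (0 < size s)%N by have [y] := hs point; case: s {hs}.
have szR : 1 <= (size s)%:R :> R by rewrite ler1n.
exists [seq ((size s)%:R^-1, [:: y]) | y <- s], (1 + ln (size s)%:R).
have l0 : 0 <= ln (size s)%:R :> R by rewrite ln_ge0.
split; first by rewrite addr_ge0.
  split; first by move=> q /mapP[y _ ->] /=; rewrite invr_ge0.
  by rewrite big_map/= big_const_seq count_predT iter_addr addr0 -[_ *+ _]mulr_natl mulfV// pnatr_eq0 -lt0n.
move=> x; have [y ys xy] := hs x.
rewrite /pot big_map (big_rem y)//=; apply: (@le_trans _ _ ((size s)%:R^-1 * expR (- ((d x y + 0) / eps)))).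
  rewrite opprD expRD mulrC [expR (- ln _)]expRN lnK ?posrE ?(lt_le_trans ltr01)//.
  rewrite ler_wpM2l ?invr_ge0// ler_expR lerN2 addr0 ler_pdivrMr// mul1r.
  by apply: ltW; move: xy; rewrite /= (cm_sym cd).
by rewrite lerDl; apply: sumr_ge0 => z _; rewrite mulr_ge0 ?invr_ge0// expR_ge0.
Qed.

Variable nu : probability (borel X) R.
Hypothesis enu : ergodic_measure T nu.

(** Almost every point reaches [W] after [k] skips and then meets a good block of some length
    [M >= k kappa]. Finitely many pairs [(k, M)] serve all points outside a set of measure below
    [tau], and tiling with their blocks yields the mean rate. At a fixed scale the net constant
    [kappa] is just a number, so [d] itself can be used. *)
Lemma compressible_of_often (Q : nat -> seq (R * seq X)) (W : set (borel X)) c : 0 <= c ->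
  (forall M, valid (Q M) M) -> measurable W -> (0 < nu W)%E ->
  (forall x, W x -> forall M0, exists2 M, (M0 <= M)%N & expR (- (M%:R * c)) < pot T d eps (Q M) x) ->
  compressible T d eps nu (c + 7).
Proof.
move=> c0 vQ mW W0 hW.
have [Sk [kappa [kappa0 vSk hk]]] := metric_net.
have dc y := cm_dist_cont cd y.
pose A M : set X := pot T d eps (Q M) @^-1` [set t : R | expR (- (M%:R * c)) < t].
have oA M : open (A M).
  by apply: open_comp; [move=> x _; exact: pot_continuous|exact: open_gt].
pose G k M : set X := if [&& (0 < M)%N & k%:R * kappa <= M%:R] then iter k T @^-1` A M else set0.
have oG k M : open (G k M).
  rewrite /G; case: ifP => _; last exact: open0.
  by apply: open_comp => // x _; exact: continuous_iter.
pose GG := \bigcup_k \bigcup_M G k M.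
have mG k M : measurable (G k M : set (borel X)) by exact: borel_open.
have B1 := ergodic_visits mT enu mW W0.
have BG : \bigcup_k (iter k T @^-1` W) `<=` GG.
  move=> x [k _ /= Wx]; have [M hM AM] := hW _ Wx (Num.truncn (k%:R * kappa)).+1.
  exists k => //; exists M => //; rewrite /G ifT//; apply/andP; split; first exact: leq_ltn_trans hM.
  by apply: (le_trans (ltW (truncnS_gt _))); rewrite ler_nat.
pose GJ J : set (borel X) := \bigcup_(k in `I_J) \bigcup_(M in `I_J) G k M.
have mGJ J : measurable (GJ J) by apply: bigcup_measurable => k _; apply: bigcup_measurable.
(* Makes the expected cost of the bad times, at most [kappa tau N], no larger than [N]. *)
pose tau := (2 * (1 + kappa))^-1.
have k1 : 0 < 1 + kappa by rewrite ltr_pwDl.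
have tau0 : 0 < tau by rewrite invr_gt0 mulr_gt0.
have [J0 hJ0] : exists J, fine (nu (~` GJ J)) < tau.
  have Z0 : nu (~` (\bigcup_k (iter k T @^-1` W))) = 0%E.
    have mB : measurable (\bigcup_k (iter k T @^-1` W) : set (borel X)).
      by apply: bigcupT_measurable => k; exact: (inv_iter mT enu k mW).1.
    by rewrite probability_setC// B1 subee.
  apply: (@mu_lt_of_null _ _ _ nu (fun J => ~` GJ J) (~` (\bigcup_k (iter k T @^-1` W)))) => //.
  - by move=> J; exact: measurableC.
  - move=> i j ij; apply: subsetC => x [k /= ki [M /= Mi h]]; exists k; first exact: leq_trans ij.
    by exists M => //=; exact: leq_trans ij.
  - by apply: measurableC; apply: bigcupT_measurable => k; exact: (inv_iter mT enu k mW).1.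
  - move=> x hx /BG [k _ [M _ h]]; apply: (hx (maxn k M).+1 Logic.I); exists k => /=; first by rewrite ltnS leq_maxl.
    by exists M => //=; rewrite ltnS leq_maxr.
pose J := J0.+1.
pose okj j := [&& (0 < j %% J)%N & (j %/ J)%N%:R * kappa <= (j %% J)%N%:R].
pose n_ j := if okj j then (j %/ J + j %% J)%N else 1%N.
pose w_ j : R := 2^-1 ^+ (j %/ J).+1 * 2^-1 ^+ (j %% J).+1.
pose nmax := (\max_(j < J * J) n_ j)%N.
pose Q_ j := if okj j then iter (j %/ J) (pprod Sk) (Q (j %% J)%N) else Sk.
have n_gt0 j : (j < J * J)%N -> (0 < n_ j)%N.
  by move=> _; rewrite /n_; case: ifP => // /andP[h _]; rewrite addn_gt0 h orbT.
have vQ_ j : (j < J * J)%N -> valid (Q_ j) (n_ j).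
  by move=> _; rewrite /Q_ /n_; case: ifP => // _; apply: valid_skips.
have w_ge0 j : (j < J * J)%N -> 0 <= w_ j by move=> _; rewrite mulr_ge0 ?exprn_ge0.
have w_sum : \sum_(j < J * J) w_ j <= 1.
  rewrite (div_pair_sum (fun i => 2^-1 ^+ i.+1 : R) (fun i => 2^-1 ^+ i.+1 : R))//.
  by rewrite mulr_ile1 ?half_sum ?sumr_ge0// => i _; rewrite exprn_ge0.
have n_max j : (j < J * J)%N -> (n_ j <= nmax)%N by move=> jJ; exact: (leq_bigmax (Ordinal jJ)).
pose Gj j := G (j %/ J)%N (j %% J)%N.
have hG j x : (j < J * J)%N -> Gj j x ->
    expR (- ((n_ j)%:R * (c + 4))) <= w_ j * pot T d eps (Q_ j) x.
  move=> _; rewrite /Gj /G /n_ /Q_ -/(okj j); case: ifP => // /andP[M0 hM] /= Ax.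
  apply: (@le_trans _ _ (w_ j * (expR (- ((j %/ J)%N%:R * kappa)) * pot T d eps (Q (j %% J)%N) (iter (j %/ J)%N T x)))); last first.
    by rewrite ler_wpM2l ?mulr_ge0 ?exprn_ge0//; apply: pot_skips => //; exact: vQ.
  apply: (@le_trans _ _ (expR (-1) ^+ (j %/ J + j %% J + 2) * (expR (- ((j %/ J)%N%:R * kappa)) * expR (- ((j %% J)%N%:R * c))))); last first.
    apply: ler_pM; rewrite ?mulr_ge0 ?exprn_ge0 ?expR_ge0//.
      rewrite /w_ -exprD (_ : (_.+1 + _.+1 = j %/ J + j %% J + 2)%N); last by rewrite addSn addnS -addn2.
      by apply: lerXn2r; rewrite ?nnegrE ?expR_ge0 ?invr_ge0//; exact: expR1_ge2.
    by rewrite ler_wpM2l ?expR_ge0//; exact: ltW.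
  rewrite -expRM_natl -!expRD ler_expR.
  have M1 : 1 <= (j %% J)%N%:R :> R by rewrite ler1n.
  have kc : 0 <= (j %/ J)%N%:R * c by rewrite mulr_ge0.
  have kk : 0 <= (j %/ J)%N%:R :> R by [].
  rewrite !natrD; move: hM M1 kc kk.
  by move: ((j %/ J)%N%:R : R) ((j %% J)%N%:R : R) => a4 a5 hM M1 kc kk; lra.
have c40 : 0 <= c + 4 by rewrite addr_ge0.
pose QQ N := tiling (J * J) n_ Q_ w_ Sk N.
have vQQ N : valid (QQ N) N by exact: valid_tiling.
have hQQ N x := tiling_greedy vSk n_gt0 vQ_ w_ge0 w_sum kappa0 hk c40 n_max hG N x.
have kQQ N x : expR (- (N%:R * (1 + kappa))) <= pot T d eps (QQ N) x.
  exact: tiling_skips.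
(* The tail cost [nmax * kappa] is below [N]. The 7 is 4 for the weights and skips of the blocks, 1
   for the mixture, 1 for the bad times and 1 for the tail. *)
pose N := (Num.truncn (nmax%:R * kappa)).+1.
exists N, (QQ N), (N%:R * (1 + kappa)); split; [by []|exact: vQQ|exact: kQQ|].
have [bu _] := bm_pot cT (cm_ge0 cd) dc eps0 (vQQ N) (kQQ N).
pose bad x : R := \sum_(t < N) \1_(~` GJ J0) (iter t T x).
have mI : bm (\1_(~` GJ J0) : borel X -> R) by apply: bm_indic; exact: measurableC.
have bbad : bm (bad : borel X -> R) by apply: bm_sum => t _; exact: (bm_iter mT).
have inu := enu.1.
have Ebad : Ex nu bad = N%:R * fine (nu (~` GJ J0)).
  rewrite /bad (Ex_sum_iter mT inu)// Ex_indic//; exact: measurableC.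
have NR0 : 0 < N%:R :> R by [].
apply: (@le_lt_trans _ _ (Ex nu (fun x => N%:R * (c + 5) + nmax%:R * kappa + kappa * bad x))).
  apply: Ex_le => //; first by apply: bmD; [exact: bm_cst|exact: bmZ].
  move=> x; rewrite lerNl -[X in X <= _]expRK ler_ln ?posrE ?expR_gt0//; last first.
    by apply: lt_le_trans (kQQ N x); exact: expR_gt0.
  apply: le_trans (hQQ N x); rewrite ler_expR lerN2 -(addrA c) (_ : 4 + 1 = 5 :> R); last by ring.
  set B := (\sum_(t < N) _)%N; have hB : B%:R <= bad x.
    rewrite /bad /B natr_sum.
    apply: ler_sum => t _; rewrite indicE; case: (boolP (_ \in _)) => [_|/negP nin]; first by case: (~~ _).
    rewrite asboolT//; have [i /= iJ [l /= lJ h]] : GJ J0 (iter t T x).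
      by apply: contrapT => H; apply: nin; exact/mem_set.
    have lJ' : (l < J)%N by exact: leq_trans lJ _.
    exists (i * J + l)%N; last by rewrite /Gj divnMDl// modnMDl divn_small// modn_small// addn0.
    have : (i * J + l < i.+1 * J)%N by rewrite mulSn addnC ltn_add2r.
    by move=> /leq_trans; apply; rewrite leq_mul2r (leq_trans iJ) ?orbT.
  rewrite (natrD _ B nmax) mulrDl -[leRHS]addrA; apply: lerD => //.
  by rewrite addrC; apply: lerD => //; rewrite mulrC ler_wpM2l.
rewrite ExD; [|exact: bm_cst|exact: bmZ]; rewrite Ex_cst ExZ// Ebad.
have h1 : nmax%:R * kappa < N%:R by exact: truncnS_gt.
have h2 : kappa * (N%:R * fine (nu (~` GJ J0))) <= N%:R.
  rewrite mulrCA ger_pMr//; apply: (@le_trans _ _ (kappa * tau)); first by rewrite ler_wpM2l// ltW.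
  by rewrite /tau ler_pdivrMr ?mulr_gt0//; rewrite mul1r; move: kappa0; lra.
rewrite !mulrDr; move: h1 h2 NR0; move: (nmax%:R * _) (kappa * _) (N%:R * c) => a1 a2 a3; move: (N%:R : R) => a4 h1 h2 NR0; lra.
Qed.

Lemma cost_traject M x y r : (forall j, (j < M)%N -> d (iter j T y) (iter j T x) <= r) ->
  cost T d (traject T y M) x <= M%:R * r.
Proof.
elim: M x y => [|M IH] x y hr /=; first by rewrite mul0r.
rewrite -natr1 mulrDl mul1r addrC lerD//; last by rewrite (cm_sym cd); exact: (hr 0%N).
by apply: IH => j jM; rewrite -!iterSr; exact: hr.
Qed.

Lemma bowen_lt M x y r : 0 < r -> bowen_metric d T M x y < r <->
  forall j, (j < M)%N -> d (iter j T x) (iter j T y) < r.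
Proof.
move=> r0; split=> [h j jM|h].
  by apply: le_lt_trans h; exact: (le_bigmax _ _ (Ordinal jM)).
by apply: bigmax_lt => // i _; exact: h.
Qed.

Lemma bowen_ball_open M x r : open (bowen_ball d T M x r).
Proof.
have [r0|r0] := ltP 0 r; last first.
  rewrite (_ : bowen_ball _ _ _ _ _ = set0); first exact: open0.
  apply/seteqP; split=> // y /=; rewrite /bowen_ball /= ltNge (le_trans r0)//.
  exact: bigmax_ge0.
rewrite (_ : bowen_ball _ _ _ _ _ = \bigcap_(j in `I_M) iter j T @^-1` [set z | d (iter j T x) z < r]).
  rewrite bigcap_mkord; elim/big_ind : _ => [|A B|j _]; [exact: openT|exact: openI|].
  apply: open_comp; last exact: cm_open_ball.
  by move=> z _; exact: continuous_iter.
by apply/seteqP; split=> y /=; rewrite /bowen_ball /= bowen_lt.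
Qed.

Definition owords (E : seq X) M : seq (R * seq X) := [seq ((size E)%:R^-1, traject T y M) | y <- E].

Lemma valid_owords E M : E != [::] -> valid (owords E M) M.
Proof.
move=> E0; split; first by move=> q /mapP[y _ ->] /=; rewrite invr_ge0 size_traject.
rewrite /owords big_map/= big_const_seq count_predT iter_addr addr0 -[_ *+ _]mulr_natl mulfV//.
by rewrite pnatr_eq0 size_eq0.
Qed.

Lemma pot_owords (E : seq X) M x y r : y \in E -> bowen_metric d T M y x < r ->
  (size E)%:R^-1 * expR (- (M%:R * (r / eps))) <= pot T d eps (owords E M) x.
Proof.
move=> yE yx; have r0 : 0 < r by apply: le_lt_trans yx; exact: bigmax_ge0.
rewrite /pot /owords big_map (big_rem y)//=; apply: (@le_trans _ _ ((size E)%:R^-1 * expR (- (cost T d (traject T y M) x / eps)))).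
  rewrite ler_wpM2l ?invr_ge0// ler_expR lerN2 mulrA ler_pdivrMr// divfK ?gt_eqF//.
  by apply: cost_traject => j jM; apply/ltW; move/(bowen_lt _ _ _ r0): yx; exact.
by rewrite lerDl; apply: sumr_ge0 => z _; rewrite mulr_ge0 ?invr_ge0// expR_ge0.
Qed.

(** The words are the orbits of the centres with equal weights: their number costs [M c] and the
    radius [2 eps] costs [2 M]. The radius is doubled because disjoint [eps]-balls, when maximal,
    give covers by [2 eps]-balls. *)
Lemma compressible_of_cover (c theta : R) : 0 < theta ->
  (forall M0, exists M (E : seq X), [/\ (M0 <= M)%N, (size E)%:R <= expR (M%:R * c) &
     (theta%:E <= nu (\bigcup_(y in [set` E]) bowen_ball d T M y (2 * eps)))%E]) ->
  compressible T d eps nu (c + 10).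
Proof.
move=> th0 H.
pose UB M (E : seq X) : set (borel X) := \bigcup_(y in [set` E]) bowen_ball d T M y (2 * eps).
have mUB M E : measurable (UB M E).
  by apply: borel_open; apply: bigcup_open => y _; exact: bowen_ball_open.
pose ok M E := (size E)%:R <= expR (M%:R * c) /\ (theta%:E <= nu (UB M E))%E.
have nE M E : ok M E -> E != [::].
  move=> [_]; apply: contraPneq => ->; rewrite /UB (_ : [set` [::]] = set0); last by apply/seteqP; split.
  by rewrite bigcup_set0 measure0 lee_fin leNgt th0.
have c0 : 0 <= c.
  have [M [E [M0 sE hE]]] := H 1%N.
  have E1 := nE M E (conj sE hE).
  have : 1 <= expR (M%:R * c) by apply: le_trans sE; rewrite ler1n lt0n size_eq0.
  by rewrite -{1}expR0 ler_expR pmulr_rge0// ltr0n.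
(* One set of centres is fixed for each length; lengths without a suitable one get a dummy centre,
   so that every [M] has a valid sub-probability. *)
pose E_ M : seq X := if pselect (exists E, ok M E) is left h then projT1 (cid h) else [:: point].
have hE_ M : (exists E, ok M E) -> ok M (E_ M).
  by move=> h; rewrite /E_; case: pselect => // h'; case: cid.
have E_n M : E_ M != [::].
  by rewrite /E_; case: pselect => // h; case: cid => E /= /nE.
pose A M : set (borel X) := if pselect (exists E, ok M E) then UB M (E_ M) else set0.
have mA M : measurable (A M) by rewrite /A; case: pselect => h /=; [exact: mUB|exact: measurable0].
rewrite (_ : c + 10 = c + 3 + 7); last by ring.
apply: (@compressible_of_often (fun M => owords (E_ M) M) (\bigcap_m \bigcup_k A (m + k)%N)).
- by rewrite addr_ge0.
- by move=> M; exact: valid_owords.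
- by apply: bigcapT_measurable => m; exact: bigcupT_measurable.
- apply: (@lt_le_trans _ _ theta%:E); first by rewrite lte_fin.
  apply: limsup_set_ge => // m; have [M [E [mM sE hE]]] := H m.
  exists (M - m)%N; rewrite subnKC// /A.
  have ex : exists E, ok M E by exists E.
  by case: pselect => //= _; have [_] := hE_ M ex.
- move=> x Wx M0; have [k _] := Wx M0.+1 Logic.I; set M := (M0.+1 + k)%N => Ax.
  exists M; first by rewrite /M; lia.
  move: Ax; rewrite /A; case: pselect => //= ex [y yE hy].
  have [sE _] := hE_ M ex.
  apply: lt_le_trans (pot_owords yE hy).
  have s0 : 0 < (size (E_ M))%:R :> R by rewrite ltr0n lt0n size_eq0.
  apply: (@lt_le_trans _ _ (expR (- (M%:R * c)) * expR (- (M%:R * 2)))).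
    rewrite -expRD ltr_expR -opprD ltrN2 -mulrDr ltr_pM2l; last by rewrite ltr0n /M; lia.
    by rewrite ltrD2l ltr_nat.
  rewrite mulfK ?gt_eqF// ler_wpM2r ?expR_ge0// expRN lef_pV2 ?posrE ?expR_gt0//.
Qed.

End star.

Section log_rates.
Context {R : realType}.

Lemma lt_rate_exp (u : \bar R) n (c : R) : (0 < n)%N ->
  ((n%:R^-1)%:E * lne u < c%:E)%E -> (u < (expR (n%:R * c))%:E)%E.
Proof.
move=> n0; have n1 : 0 < (n%:R^-1 : R) by rewrite invr_gt0 ltr0n.
case: u => [r| |] h.
- rewrite lte_fin; have [r0|r0] := leP r 0; first exact: le_lt_trans (expR_gt0 _).
  move: h; rewrite lne_EFin// -EFinM lte_fin mulrC ltr_pdivrMr ?ltr0n// => h.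
  by rewrite -ltr_ln ?posrE ?expR_gt0// expRK mulrC.
- by move: h; rewrite /= mulry gtr0_sg// mul1e.
- by rewrite ltNyr.
Qed.

Lemma le_rate_exp (u : \bar R) n (c : R) : (0 < n)%N ->
  (u <= (expR (n%:R * c))%:E)%E -> ((n%:R^-1)%:E * lne u <= c%:E)%E.
Proof.
move=> n0; have n1 : 0 < (n%:R^-1 : R) by rewrite invr_gt0 ltr0n.
case: u => [r| |] h //.
  have [r0|r0] := leP r 0; first by rewrite le0_lneNy ?lee_fin// mulrNy gtr0_sg// mul1e leNye.
  rewrite lne_EFin// -EFinM lee_fin mulrC ler_pdivrMr ?ltr0n//.
  by rewrite -[leRHS]expRK mulrC ler_ln ?posrE ?expR_gt0.
by rewrite le0_lneNy ?leNye// mulrNy gtr0_sg// mul1e leNye.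
Qed.

Lemma lim_at_right_antitone (f : R -> \bar R) :
  (forall x y, 0 < x -> x <= y -> y < 1 -> (f y <= f x)%E) ->
  forall x, 0 < x < 1 -> (f x <= lim (f s @[s --> 0^'+]))%E.
Proof.
move=> hf x x01.
have cv : f s @[s --> 0^'+] --> ereal_sup (f @` `]0, 1[).
  apply: (@nonincreasing_at_right_cvge _ f 0 (BLeft 1)); first by rewrite bnd_simp ltr01.
  move=> y z; rewrite !in_itv/= => /andP[y0 y1] /andP[z0 z1] yz.
  exact: hf.
rewrite (cvg_lim _ cv)//; apply: ereal_sup_ubound; exists x => //=; rewrite in_itv/= //.
Qed.

Lemma lim_at_right_le (f : R -> \bar R) (l : \bar R) :
  (forall x y, 0 < x -> x <= y -> y < 1 -> (f y <= f x)%E) ->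
  (forall x, 0 < x < 1 -> (f x <= l)%E) -> (lim (f s @[s --> 0^'+]) <= l)%E.
Proof.
move=> hf hl.
have cv : f s @[s --> 0^'+] --> ereal_sup (f @` `]0, 1[).
  apply: (@nonincreasing_at_right_cvge _ f 0 (BLeft 1)); first by rewrite bnd_simp ltr01.
  move=> y z; rewrite !in_itv/= => /andP[y0 y1] /andP[z0 z1] yz.
  exact: hf.
rewrite (cvg_lim _ cv)//; apply: ub_ereal_sup => _ [x /= x01 <-]; apply: hl.
by move: x01; rewrite in_itv.
Qed.

End log_rates.

Section rate_mono.
Context {R : realType}.
Implicit Types u v : nat -> \bar R.
Local Open Scope ereal_scope.

Lemma lne_mono (x y : \bar R) : x <= y -> lne x <= lne y.
Proof.
move=> xy; have [x0|x0] := leP x 0; first by rewrite le0_lneNy// leNye.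
by rewrite lee_lne// in_itv/= leey andbT; [exact: ltW|exact: le_trans (ltW x0) xy].
Qed.

Lemma limn_einf_mono u v : (forall n, u n <= v n) -> limn_einf u <= limn_einf v.
Proof.
by move=> h; rewrite /limn_einf leeN2; apply: (limn_esup_mono (n0 := 0%N)) => n _; rewrite leeN2.
Qed.

Lemma log_rate_inf_mono u v : (forall n, u n <= v n) -> log_rate_inf u <= log_rate_inf v.
Proof.
by move=> h; apply: limn_einf_mono => n; rewrite lee_wpmul2l ?lne_mono// lee_fin invr_ge0.
Qed.

Lemma log_rate_sup_mono u v : (forall n, u n <= v n) -> log_rate_sup u <= log_rate_sup v.
Proof.
by move=> h; apply: (limn_esup_mono (n0 := 0%N)) => n _; rewrite lee_wpmul2l ?lne_mono// lee_fin invr_ge0.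
Qed.

Lemma log_rate_inf_le_sup u : log_rate_inf u <= log_rate_sup u.
Proof. exact: limn_einf_sup. Qed.

End rate_mono.

Section katok.
Context {R : realType} {X : ptopologicalType} (d : X -> X -> R) (T : X -> X).
Hypotheses (cX : compact [set: X]) (cd : compatible_metric d) (cT : continuous T).
Variable nu : probability (borel X) R.

Lemma katok_number_mono (delta delta' eps : R) n : delta <= delta' ->
  (katok_number T delta' d nu n eps <= katok_number T delta d nu n eps)%E.
Proof.
move=> h; apply: le_ereal_inf => _ [F hF <-]; exists F => //.
by apply: le_lt_trans hF; rewrite lee_fin lerD2l lerN2.
Qed.

Lemma katok_inf_mono (delta delta' eps : R) : delta <= delta' ->
  (katok_inf_at T delta' d nu eps <= katok_inf_at T delta d nu eps)%E.
Proof.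
by move=> h; apply: log_rate_inf_mono => n; exact: katok_number_mono.
Qed.

Lemma katok_sup_mono (delta delta' eps : R) : delta <= delta' ->
  (katok_sup_at T delta' d nu eps <= katok_sup_at T delta d nu eps)%E.
Proof. by move=> h; apply: log_rate_sup_mono => n; exact: katok_number_mono. Qed.

Hypothesis enu : ergodic_measure T nu.

Lemma katok_inf_at_compressible delta eps (c : R) : 0 < eps -> 0 < delta < 1 ->
  (katok_inf_at T delta d nu eps < c%:E)%E -> compressible T d eps nu (c + 10).
Proof.
move=> eps0 /andP[d0 d1] h.
apply: (compressible_of_cover cX cd cT eps0 enu (theta := 1 - delta)); first by rewrite subr_gt0.
move=> M0; have [n hn] := limn_einf_ltP (maxn M0 1) h; rewrite geq_max in hn.
move: hn => /andP[M0n n0] /(lt_rate_exp n0)/ereal_inf_lt[_ [F hF <-]].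
rewrite lte_fin => sF; exists n, (enum_fset F); split=> //; first exact: ltW.
apply: (le_trans (ltW hF)); apply: le_measure; rewrite ?inE.
- by apply: borel_open; apply: bigcup_open => y _; exact: bowen_ball_open.
- by apply: borel_open; apply: bigcup_open => y _; exact: bowen_ball_open.
- move=> x [y yF xy]; exists y => //; apply: lt_trans xy _.
  by rewrite mulrDl mul1r ltrDl.
Qed.

Lemma katok_sup_at_compressible delta eps (c : R) : 0 < eps -> 0 < delta < 1 ->
  (katok_sup_at T delta d nu eps < c%:E)%E -> compressible T d eps nu (c + 10).
Proof.
move=> eps0 d01 h; apply: (katok_inf_at_compressible eps0 d01).
by apply: le_lt_trans h; exact: log_rate_inf_le_sup.
Qed.

Lemma katok_inf_compressible eps (c : R) : 0 < eps ->
  (katok_inf T d nu eps < c%:E)%E -> compressible T d eps nu (c + 10).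
Proof.
move=> eps0 h; have d01 : 0 < (2^-1 : R) < 1 by rewrite invr_gt0 ltr0n/= invf_lt1// ltr1n.
apply: (katok_inf_at_compressible eps0 d01); apply: le_lt_trans h.
apply: (@lim_at_right_antitone _ (fun delta => katok_inf_at T delta d nu eps)) d01 => x y x0 xy _.
exact: katok_inf_mono.
Qed.

Lemma katok_sup_compressible eps (c : R) : 0 < eps ->
  (katok_sup T d nu eps < c%:E)%E -> compressible T d eps nu (c + 10).
Proof.
move=> eps0 h; have d01 : 0 < (2^-1 : R) < 1 by rewrite invr_gt0 ltr0n/= invf_lt1// ltr1n.
apply: (katok_sup_at_compressible eps0 d01); apply: le_lt_trans h.
apply: (@lim_at_right_antitone _ (fun delta => katok_sup_at T delta d nu eps)) d01 => x y x0 xy _.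
exact: katok_sup_mono.
Qed.

End katok.

(** * Finite codes, partitions and covers *)

Section gibbs.
Context {R : realType}.

(** The inequality [ln t <= t - 1] at [t = q / p]. *)
Lemma gibbs_term (p q : R) : 0 <= p -> 0 <= q -> (0 < p -> 0 < q) -> p * ln q - p * ln p <= q - p.
Proof.
move=> p0 q0 pq; have [->|pn0] := eqVneq p 0; first by rewrite !mul0r !subr0.
have p1 : 0 < p by rewrite lt_neqAle eq_sym pn0.
have q1 := pq p1.
rewrite -mulrBr -ln_div ?posrE// -[X in _ <= q - X]mulr1 -[q in X in _ <= X](divfK pn0) (mulrC _ p) -mulrBr.
rewrite ler_wpM2l//; have := expR_ge1Dx (ln (q / p)).
by rewrite lnK ?posrE ?divr_gt0//; lra.
Qed.

Lemma gibbs (F : finType) (p q : F -> R) : (forall i, 0 <= p i) -> (forall i, 0 <= q i) ->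
  (forall i, 0 < p i -> 0 < q i) -> \sum_i q i <= \sum_i p i ->
  \sum_i p i * ln (q i) <= \sum_i p i * ln (p i).
Proof.
move=> p0 q0 pq s; rewrite -subr_le0 -sumrB.
apply: (@le_trans _ _ (\sum_i (q i - p i))).
  by apply: ler_sum => i _; apply: gibbs_term => //; exact: pq.
by rewrite sumrB subr_le0.
Qed.

Lemma sum_inj_le (F G : finType) (rho : F -> G) (g : G -> R) : injective rho ->
  (forall z, 0 <= g z) -> \sum_w g (rho w) <= \sum_z g z.
Proof.
move=> ri g0; rewrite (eq_bigl (fun w => w \in [set: F]%SET)); last by move=> w; rewrite finset.in_setT.
rewrite -(big_imset (h := rho) g (A := [set: F]%SET))/=; last by move=> x y _ _; exact: ri.
by rewrite [leRHS](bigID (mem [set rho w | w in [set: F]]%SET))/= lerDl sumr_ge0.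
Qed.

End gibbs.

Section finite_maps.
Context {R : realType} {dY : measure_display} {Y : measurableType dY} (mu : probability Y R).

Definition mfin (F : finType) (a : Y -> F) := forall i, measurable (a @^-1` [set i]).

Definition pr (F : finType) (a : Y -> F) (i : F) : R := fine (mu (a @^-1` [set i])).

Definition ent (F : finType) (a : Y -> F) : R := - \sum_i pr a i * ln (pr a i).

Lemma pr_ge0 (F : finType) (a : Y -> F) i : 0 <= pr a i.
Proof. exact: fine_ge0. Qed.

Lemma code_indic (F : finType) (a : Y -> F) (B : F -> R) x :
  B (a x) = \sum_i B i * \1_(a @^-1` [set i]) x.
Proof.
rewrite (bigD1 (a x))//= indicE mem_set// mulr1 big1 ?addr0// => i ia.
by rewrite indicE memNset ?mulr0// => /esym/eqP; apply/negP.
Qed.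

Lemma bm_code (F : finType) (a : Y -> F) (B : F -> R) : mfin a -> bm (fun x => B (a x)).
Proof.
move=> ma; rewrite (_ : (fun x => _) = (fun x => \sum_i B i * \1_(a @^-1` [set i]) x)); last first.
  by apply/funext => x; exact: code_indic.
by apply: bm_sum => i _; apply: bmZ; exact: bm_indic.
Qed.

Lemma Ex_code (F : finType) (a : Y -> F) (B : F -> R) : mfin a ->
  Ex mu (fun x => B (a x)) = \sum_i pr a i * B i.
Proof.
move=> ma; rewrite (_ : (fun x => _) = (fun x => \sum_i B i * \1_(a @^-1` [set i]) x)); last first.
  by apply/funext => x; exact: code_indic.
rewrite Ex_sum; last by move=> i _; apply: bmZ; exact: bm_indic.
by apply: eq_bigr => i _; rewrite ExZ ?Ex_indic// 1?mulrC//; exact: bm_indic.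
Qed.

Lemma pr_sum (F : finType) (a : Y -> F) : mfin a -> \sum_i pr a i = 1.
Proof.
move=> ma; have := Ex_code (fun=> 1) ma; rewrite Ex_cst => ->.
by apply: eq_bigr => i _; rewrite mulr1.
Qed.

Lemma mfin_comp (F G : finType) (a : Y -> F) (g : F -> G) : mfin a -> mfin (g \o a).
Proof.
move=> ma j; rewrite (_ : _ @^-1` _ = \bigcup_(i in [set i | g i = j]) (a @^-1` [set i])).
  by apply: fin_bigcup_measurable => // i _; exact: ma.
by apply/seteqP; split=> x /=; [move=> <-; exists (a x)|move=> [i <- ->]].
Qed.

Lemma mfin_pair (F G : finType) (a : Y -> F) (b : Y -> G) : mfin a -> mfin b ->
  mfin (fun x => (a x, b x)).
Proof.
move=> ma mb [i j]; rewrite (_ : _ @^-1` _ = a @^-1` [set i] `&` b @^-1` [set j]).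
  exact: measurableI.
by apply/seteqP; split=> x /=; [move=> [-> ->]|move=> [-> ->]].
Qed.

Lemma pr_le_comp (F G : finType) (a : Y -> F) (g : F -> G) i : mfin a -> pr a i <= pr (g \o a) (g i).
Proof.
move=> ma; have mg := mfin_comp g ma.
rewrite /pr -lee_fin -(mu_fin mu (ma i)) -(mu_fin mu (mg (g i))).
by apply: le_measure; rewrite ?inE// => x /= ->.
Qed.

(** Gibbs' inequality against the product of the two image laws; injectivity of the pair [(r1, r2)]
    bounds the total mass of that product by 1. *)
Lemma ent_subadd (F G H : finType) (a : Y -> F) (r1 : F -> G) (r2 : F -> H) : mfin a ->
  (forall v w, r1 v = r1 w -> r2 v = r2 w -> v = w) ->
  ent a <= ent (r1 \o a) + ent (r2 \o a).
Proof.
move=> ma ri; rewrite /ent -opprD lerN2.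
have m1 := mfin_comp r1 ma; have m2 := mfin_comp r2 ma.
rewrite -(Ex_code (fun i => ln (pr (r1 \o a) i)) m1) -(Ex_code (fun i => ln (pr (r2 \o a) i)) m2).
rewrite (Ex_code (fun w => ln (pr (r1 \o a) (r1 w))) ma) (Ex_code (fun w => ln (pr (r2 \o a) (r2 w))) ma).
rewrite -big_split/=.
have pos i (p1 : 0 < pr a i) : 0 < pr (r1 \o a) (r1 i) /\ 0 < pr (r2 \o a) (r2 i).
  by split; apply: (lt_le_trans p1); exact: pr_le_comp.
apply: le_trans (gibbs (q := fun w => pr (r1 \o a) (r1 w) * pr (r2 \o a) (r2 w)) _ _ _ _).
- rewrite le_eqVlt; apply/orP; left; apply/eqP; apply: eq_bigr => i _.
  have [p1|p0] := ltP 0 (pr a i).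
    by have [q1 q2] := pos i p1; rewrite lnM ?posrE// mulrDr.
  by have -> : pr a i = 0 by [apply/le_anti/andP; split=> //; exact: pr_ge0]; rewrite !mul0r addr0.
- by move=> i; exact: pr_ge0.
- by move=> i; rewrite mulr_ge0 ?pr_ge0.
- by move=> i /pos[q1 q2]; rewrite mulr_gt0.
- rewrite pr_sum//.
  apply: le_trans (sum_inj_le (rho := fun w => (r1 w, r2 w))
     (g := fun z => pr (r1 \o a) z.1 * pr (r2 \o a) z.2) _ _) _.
  + by move=> v w [e1 e2]; exact: ri.
  + by move=> z; rewrite mulr_ge0 ?pr_ge0.
  + rewrite -(pair_bigA _ (fun i j => pr (r1 \o a) i * pr (r2 \o a) j))/=.
    under eq_bigr do rewrite -mulr_sumr pr_sum// mulr1.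
    by rewrite pr_sum.
Qed.

Lemma ent_ge0 (F : finType) (a : Y -> F) : mfin a -> 0 <= ent a.
Proof.
move=> ma; rewrite /ent -sumrN sumr_ge0// => i _; rewrite -mulrN mulr_ge0 ?pr_ge0// oppr_ge0.
apply: ln_le0; rewrite /pr -lee_fin fineK ?probability_le1//.
by rewrite fin_num_measure//; exact: ma.
Qed.

(** Gibbs' inequality against the uniform law on [S]. *)
Lemma ent_le_card (F : finType) (a : Y -> F) (S : {set F}) : mfin a -> (forall x, a x \in S) ->
  ent a <= ln #|S|%:R.
Proof.
move=> ma aS; have S0 : (0 < #|S|)%N.
  have [x _] : exists x : Y, True.
    apply: contrapT => H; have := mu_setT mu; rewrite (_ : setT = set0) ?measure0.
      by move=> /esym/eqP; rewrite onee_eq0.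
    by apply/seteqP; split=> // x _; apply: H; exists x.
  by apply/card_gt0P; exists (a x).
have SR : 0 < #|S|%:R :> R by rewrite ltr0n.
have z i : i \notin S -> pr a i = 0.
  move=> iS; rewrite /pr (_ : _ @^-1` _ = set0) ?measure0//.
  by apply/seteqP; split=> // x /= e; move: iS; rewrite -e aS.
rewrite /ent lerNl.
pose q i : R := if i \in S then #|S|%:R^-1 else 0.
have E : \sum_i pr a i * ln (q i) = - ln #|S|%:R.
  rewrite (eq_bigr (fun i => pr a i * - ln #|S|%:R)) -?mulr_suml ?pr_sum ?mul1r// => i _.
  by rewrite /q; case: ifP => [_|/negbT/z ->]; rewrite ?mul0r// lnV ?posrE.
rewrite -E; apply: gibbs; rewrite ?(pr_sum ma) /q.
- by move=> i; exact: pr_ge0.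
- by move=> i; case: ifP => // _; rewrite invr_ge0.
- by move=> i; case: ifP => [_ _|/negbT/z ->]; rewrite ?invr_gt0// ltxx.
- by rewrite -big_mkcond/= big_const iter_addr addr0 -[_ *+ _]mulr_natl mulfV ?gt_eqF.
Qed.

(** Distinct symbols may have the same empty fibre, which occurs at most once in the finite set [P];
    both sums agree because [phi] vanishes on the empty set. *)
Lemma fset_fibers (F : finType) (a : Y -> F) (P : {fset set Y}) (phi : set Y -> R) :
  phi set0 = 0 -> (forall x, a @^-1` [set a x] \in P) ->
  (forall C x, C \in P -> C x -> C = a @^-1` [set a x]) ->
  \sum_(C <- P) phi C = \sum_i phi (a @^-1` [set i]).
Proof.
move=> phi0 h1 h2.
pose ne (C : set Y) := C != set0.
have nez C : ~~ ne C -> phi C = 0 by rewrite negbK => /eqP ->.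
rewrite (bigID ne)/= [X in _ + X]big1 ?addr0//.
rewrite [RHS](bigID (fun i => ne (a @^-1` [set i])))/= [X in _ = _ + X]big1 ?addr0//; last by move=> i /nez.
rewrite -big_filter -[RHS]big_filter.
rewrite -(big_map (fun i => a @^-1` [set i]) xpredT phi).
apply: perm_big; apply: uniq_perm.
- by rewrite filter_uniq// fset_uniq.
- rewrite map_inj_in_uniq ?filter_uniq ?index_enum_uniq// => i j.
  rewrite !mem_filter => /andP[/set0P[x xi] _] _ e.
  have xj : (a @^-1` [set j]) x by rewrite -e.
  by move: xi xj => /= <- <-.
- move=> C; rewrite mem_filter; apply/andP/mapP.
    move=> [/set0P[x Cx] CP]; exists (a x); last exact: h2.
    by rewrite mem_filter mem_index_enum andbT; apply/set0P; exists x.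
  move=> [i]; rewrite mem_filter => /andP[ni _] ->; split=> //.
  by case/set0P: ni => x /= <-.
Qed.

Definition fibers (F : finType) (a : Y -> F) : {fset set Y} := [fset a @^-1` [set i] | i in F]%fset.

Lemma fibers_partition (F : finType) (a : Y -> F) : mfin a -> finite_partition (fibers a).
Proof.
move=> ma; split.
- by move=> _ /imfsetP[i _ ->].
- by move=> _ _ /imfsetP[i _ ->] /imfsetP[j _ ->] [x [/= <- <-]].
- by apply/seteqP; split=> // x _; exists (a @^-1` [set a x]) => //; apply/imfsetP; exists (a x).
Qed.

Lemma fibers_sum (F : finType) (a : Y -> F) (phi : set Y -> R) : phi set0 = 0 ->
  \sum_(C <- fibers a) phi C = \sum_i phi (a @^-1` [set i]).
Proof.
move=> phi0; apply: fset_fibers => // [x|C x /imfsetP[i _ ->] /= <-//].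
by apply/imfsetP; exists (a x).
Qed.

End finite_maps.

Section names.
Context {R : realType} {X : ptopologicalType} (T : X -> X).
Hypothesis mT : measurable_fun setT (T : borel X -> borel X).
Variables (mu : probability (borel X) R).
Hypothesis imu : invariant_measure T mu.

Definition name k (kap : X -> 'I_k) n (x : X) : {ffun 'I_n -> 'I_k} := [ffun t : 'I_n => kap (iter t T x)].

Lemma mfin_iter (F : finType) (a : borel X -> F) t : mfin a -> mfin (fun x : borel X => a (iter t T x)).
Proof.
elim: t a => [//|t IH] a ma.
have maT : mfin (a \o T : borel X -> F).
  by move=> i; rewrite comp_preimage -[X in measurable X]setTI; exact: mT.
by have := IH _ maT.
Qed.

Lemma mfin_name k (kap : X -> 'I_k) n : mfin (kap : borel X -> _) -> mfin (name kap n : borel X -> _).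
Proof.
move=> mk w; rewrite (_ : _ @^-1` _ = \bigcap_(t in [set: 'I_n]) ((fun x => kap (iter t T x)) @^-1` [set w t])).
  by apply: fin_bigcap_measurable => // t _; exact: (mfin_iter t mk).
apply/seteqP; split=> x /=; first by move=> <- t _ /=; rewrite ffunE.
by move=> h; apply/ffunP => t; rewrite ffunE; exact: h.
Qed.

Lemma pr_iter (F : finType) (a : borel X -> F) t i : mfin a -> pr mu (fun x => a (iter t T x)) i = pr mu a i.
Proof.
elim: t a => [//|t IH] a ma.
have maT : mfin (a \o T : borel X -> F).
  by move=> j; rewrite comp_preimage -[X in measurable X]setTI; exact: mT.
have := IH _ maT; rewrite /= => ->; rewrite /pr; congr fine.
by rewrite comp_preimage; exact: imu.
Qed.

Lemma ent_name_subadd k (kap : X -> 'I_k) n m : mfin (kap : borel X -> _) ->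
  ent mu (name kap (n + m)) <= ent mu (name kap n) + ent mu (name kap m).
Proof.
move=> mk.
pose r1 (w : {ffun 'I_(n + m) -> 'I_k}) : {ffun 'I_n -> 'I_k} := [ffun t => w (lshift m t)].
pose r2 (w : {ffun 'I_(n + m) -> 'I_k}) : {ffun 'I_m -> 'I_k} := [ffun t => w (rshift n t)].
have := @ent_subadd _ _ (borel X) mu _ _ _ (name kap (n + m)) r1 r2 (mfin_name mk).
have -> : r1 \o name kap (n + m) = name kap n.
  by apply/funext => x; apply/ffunP => t; rewrite /r1 /name /= !ffunE.
have -> : r2 \o name kap (n + m) = (fun x => name kap m (iter n T x)).
  by apply/funext => x; apply/ffunP => t; rewrite /r2 /name /= !ffunE /= addnC iterD.
move=> h; apply: (le_trans (h _)).
  move=> v w e1 e2; apply/ffunP => t; case: (split_ordP t) => [i|i] ->.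
    by have := congr1 (fun z : {ffun _} => z i) e1; rewrite /r1 !ffunE.
  by have := congr1 (fun z : {ffun _} => z i) e2; rewrite /r2 !ffunE.
rewrite lerD2l /ent lerN2 le_eqVlt; apply/orP; left; apply/eqP; apply: eq_bigr => w _.
by rewrite (pr_iter n w (mfin_name mk)).
Qed.

Lemma ent_name_cvg k (kap : X -> 'I_k) : mfin (kap : borel X -> _) -> exists l : R,
  (fun n => n%:R^-1 * ent mu (name kap n)) @ \oo --> l /\ forall n, l * n%:R <= ent mu (name kap n).
Proof.
move=> mk; apply: fekete => [n|n m]; first by apply: ent_ge0; exact: mfin_name.
exact: ent_name_subadd.
Qed.

(** Partitions become symbolic codes and iterated partitions become names, so entropies turn into
    sums over a finite type. *)
Lemma partition_code (alpha : {fset set X}) : finite_partition (X := borel X) alpha ->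
  exists k (kap : X -> 'I_k), [/\ mfin (kap : borel X -> _),
    forall x, exists2 A, A \in alpha & A = kap @^-1` [set kap x] &
    forall n, partition_entropy mu (cover_iter T alpha n) = ent mu (name kap n)].
Proof.
move=> [ma ta ca].
have /choice[kap hkap] x : exists i : 'I_(size (enum_fset alpha)), nth set0 (enum_fset alpha) i x.
  have : [set: X] x by []. rewrite -ca => -[A AU Ax].
  have iA : (index A (enum_fset alpha) < size (enum_fset alpha))%N by rewrite index_mem.
  by exists (Ordinal iA); rewrite /= nth_index.
have inA (i : 'I_(size (enum_fset alpha))) : nth set0 (enum_fset alpha) i \in alpha by exact: mem_nth.
have atom i : kap @^-1` [set i] = nth set0 (enum_fset alpha) i.
  apply/seteqP; split=> x /=; first by move=> <-.
  move=> xi; apply/val_inj => /=; apply/eqP.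
  rewrite -(nth_uniq set0 (ltn_ord _) (ltn_ord _) (fset_uniq _)); apply/eqP.
  by apply: ta => //; [exact: inA|exact: inA|exists x].
exists (size (enum_fset alpha)), kap; split.
- by move=> i; rewrite atom; apply: ma; exact: inA.
- by move=> x; exists (nth set0 (enum_fset alpha) (kap x)); rewrite ?inA// atom.
- move=> n; rewrite /partition_entropy /ent; congr (- _).
  rewrite (@fset_fibers R _ (borel X) _ (name kap n) _ (fun C => fine (mu C) * ln (fine (mu C))))//.
  + by rewrite measure0 mul0r.
  + move=> x; apply/cover_iterP; exists (fun t => nth set0 (enum_fset alpha) (kap (iter t T x))).
      by move=> t _; exact: inA.
    apply/seteqP; split=> y /=.
      move=> e t tn; have := congr1 (fun z : {ffun _} => z (Ordinal tn)) e; rewrite !ffunE /= => <-.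
      exact: hkap.
    move=> h; apply/ffunP => t; rewrite !ffunE.
    by have := h t (ltn_ord t); rewrite -atom.
  + move=> C x /cover_iterP[g hg ->] /= hx; apply/seteqP; split=> y /= hy.
      apply/ffunP => t; rewrite !ffunE.
      have := hy t (ltn_ord t); rewrite (_ : g t = nth set0 (enum_fset alpha) (kap (iter t T x))) -?atom//.
      apply: ta; [exact: hg|rewrite atom; exact: inA|].
      by exists (iter t T x); split; [exact: hx|].
    move=> t tn; have := congr1 (fun z : {ffun _} => z (Ordinal tn)) hy; rewrite !ffunE /= => e.
    rewrite (_ : g t = nth set0 (enum_fset alpha) (kap (iter t T x))); first by rewrite -e; exact: hkap.
    apply: ta; [exact: hg|exact: inA|].
    by exists (iter t T x); split; [exact: hx|exact: hkap].
Qed.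

Lemma entropy_of_partition_cvg (alpha : {fset set X}) : finite_partition (X := borel X) alpha ->
  exists l : R, entropy_of_partition T mu alpha = l%:E /\
   (fun n => n%:R^-1 * partition_entropy mu (cover_iter T alpha n)) @ \oo --> l.
Proof.
move=> /partition_code[k [kap [mk _ he]]].
have [l [cl _]] := ent_name_cvg mk.
have cl' : (fun n => n%:R^-1 * partition_entropy mu (cover_iter T alpha n)) @ \oo --> l.
  by under eq_fun do rewrite he.
exists l; split=> //; rewrite /entropy_of_partition; apply/cvg_lim => //.
by apply: cvg_EFin => //; exact: nearW.
Qed.

End names.

(** No measurability is involved: the integral of a nonnegative function is a supremum over simple
    functions below it. This serves for distortion costs and local entropies. *)
Lemma ge0_le_integralT d (Y : measurableType d) (R : realType) (mu : {measure set Y -> \bar R})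
  (f g : Y -> \bar R) : (forall x, (0 <= f x)%E) -> (forall x, (f x <= g x)%E) ->
  (\int[mu]_x f x <= \int[mu]_x g x)%E.
Proof.
move=> f0 fg; rewrite !ge0_integralTE//; last by move=> x; exact: le_trans (fg x).
by apply: le_ereal_sup => _ [h hf <-]; exists h => // x; exact: le_trans (fg x).
Qed.

Section fine_codes.
Context {R : realType} {X : ptopologicalType} (d : X -> X -> R) (T : X -> X).
Hypotheses (cX : compact [set: X]) (cd : compatible_metric d) (cT : continuous T).

Lemma fine_code (r : R) : 0 < r -> exists k (kap : X -> 'I_k) (b : 'I_k -> X),
  mfin (kap : borel X -> _) /\ forall x, d x (b (kap x)) <= r.
Proof.
move=> r0; have [s hs] := cm_ball_cover cX cd (fun=> r0).
have ex x : has (fun y => d x y < r) s.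
  by apply/hasP; have [y ys h] := hs x; exists y => //; rewrite (cm_sym cd).
have ix x : (find (fun y => (d x y < r)%R) s < size s)%N by rewrite -has_find.
exists (size s), (fun x => Ordinal (ix x)), (fun i => nth point s i); split; last first.
  by move=> x; apply/ltW; exact: (nth_find point (ex x)).
have mb y : measurable ([set x | d x y < r] : set (borel X)).
  apply: borel_open; rewrite (_ : [set x | _] = [set x | d y x < r]); first exact: cm_open_ball.
  by apply/seteqP; split=> x /=; rewrite (cm_sym cd).
move=> j; rewrite (_ : _ @^-1` _ = [set x | d x (nth point s j) < r] `&`
   \bigcap_(i in `I_j) ~` [set x | d x (nth point s i) < r]); last first.
  apply/seteqP; split=> x /=.
    move=> <- /=; split; first exact: (nth_find point (ex x)).
    by move=> i /= ij /= h; have := before_find point ij; rewrite h.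
  move=> [h1 h2]; apply/val_inj/eqP => /=; rewrite eqn_leq leqNgt; apply/andP; split.
    by apply/negP => /(before_find point); rewrite h1.
  rewrite leqNgt; apply/negP => h; apply: (h2 _ h); exact: (nth_find point (ex x)).
apply: measurableI => //; apply: fin_bigcap_measurable => // i _; exact: measurableC.
Qed.


Variable nu : probability (borel X) R.
Hypothesis inu : invariant_measure T nu.

Let mT : measurable_fun setT (T : borel X -> borel X).
Proof. exact: borel_map. Qed.

Variable eps : R.
Hypothesis eps0 : 0 < eps.

Lemma pot_mem (Q : seq (R * seq X)) n (q : R * seq X) x r : valid Q n -> q \in Q ->
  cost T d q.2 x <= n%:R * r -> q.1 * expR (- (n%:R * (r / eps))) <= pot T d eps Q x.
Proof.
move=> [vQ _] qQ cr; rewrite /pot (big_rem q)//=; have [q0 _] := vQ q qQ.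
apply: (@le_trans _ _ (q.1 * expR (- (cost T d q.2 x / eps)))).
  by rewrite ler_wpM2l// ler_expR lerN2 mulrA ler_pdivrMr// divfK ?gt_eqF.
rewrite lerDl big_seq; apply: sumr_ge0 => q' /mem_rem/vQ[q'0 _].
by rewrite mulr_ge0// expR_ge0.
Qed.

Lemma compressible_code_bound (F : finType) (a : borel X -> F) (B : F -> R) Q n kap c : (0 < n)%N -> valid Q n ->
  (forall x, expR (- kap) <= pot T d eps Q x) -> mfin a ->
  (forall x, - ln (pot T d eps Q x) <= B (a x)) -> \sum_i pr nu a i * B i < n%:R * c ->
  compressible T d eps nu c.
Proof.
move=> n0 vQ hk ma hB hE; exists n, Q, kap; split; [exact: n0|exact: vQ|exact: hk|].
apply: le_lt_trans hE; rewrite -(Ex_code nu B ma); apply: Ex_le => //; last exact: bm_code.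
exact: (bm_pot cT (cm_ge0 cd) (cm_dist_cont cd) eps0 vQ hk).1.
Qed.

Lemma compressible_of_entropy k (kap : X -> 'I_k) n c : mfin (kap : borel X -> _) ->
  (forall x y, kap x = kap y -> d x y <= eps) -> (0 < n)%N -> ent nu (name T kap n) < n%:R * c ->
  compressible T d eps nu (c + 2).
Proof.
move=> mk hkap n0 hE; pose F : finType := {ffun 'I_n -> 'I_k}.
have ma := mfin_name (n := n) mT mk; set a : borel X -> F := name T kap n in ma hE.
have F0 : (0 < #|F|)%N by apply/card_gt0P; exists (a point).
have FR : 1 <= #|F|%:R :> R by rewrite ler1n.
have FR0 : 0 < #|F|%:R :> R by apply: lt_le_trans FR.
pose w i : R := (pr nu a i + #|F|%:R^-1) / 2.
pose y i := xget point (a @^-1` [set i]).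
have ay x : a (y (a x)) = a x by apply: (@xgetPex _ point (a @^-1` [set a x])); exists x.
pose Q := [seq (w i, traject T (y i) n) | i <- enum F].
have w0 i : 0 < w i by rewrite divr_gt0// ltr_wpDl ?pr_ge0// invr_gt0.
have vQ : valid Q n.
  split; first by move=> q /mapP[i _ ->] /=; rewrite size_traject ltW.
  rewrite big_map big_enum/= -mulr_suml big_split/= pr_sum// big_const iter_addr addr0.
  by rewrite -[_ *+ _]mulr_natl mulfV ?gt_eqF// divff.
have hc x : cost T d (traject T (y (a x)) n) x <= n%:R * eps.
  apply: (cost_traject cd) => j jn; apply: hkap.
  by have := congr1 (fun z : F => z (Ordinal jn)) (ay x); rewrite !ffunE.
have hp x : w (a x) * expR (- n%:R) <= pot T d eps Q x.
  have -> : (n%:R : R) = n%:R * (eps / eps) by rewrite divff ?mulr1// gt_eqF.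
  apply: (@pot_mem Q n (w (a x), traject T (y (a x)) n) x eps vQ); last exact: hc.
  by apply: map_f; rewrite mem_enum.
have hk x : expR (- (n%:R + ln (2 * #|F|%:R))) <= pot T d eps Q x.
  apply: le_trans (hp x); rewrite opprD expRD mulrC ler_wpM2r ?expR_ge0// expRN lnK ?posrE ?mulr_gt0//.
  by rewrite invfM mulrC /w ler_wpM2r ?invr_ge0// lerDr pr_ge0.
apply: (@compressible_code_bound F a (fun i => - ln (w i) + n%:R) Q n _ _ n0 vQ hk ma).
  move=> x; rewrite lerNl opprD opprK -[X in _ + X]expRK -lnM ?posrE ?expR_gt0//.
  rewrite ler_ln ?posrE; [exact: hp|by rewrite mulr_gt0 ?expR_gt0|].
  by apply: lt_le_trans (hk x); exact: expR_gt0.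
apply: (@le_lt_trans _ _ (ent nu a + ln 2 + n%:R)).
  rewrite (eq_bigr (fun i => pr nu a i * - ln (w i) + pr nu a i * n%:R)); last by move=> i _; rewrite mulrDr.
  rewrite big_split/= -mulr_suml pr_sum// mul1r lerD2r.
  have -> : ln (2 : R) = \sum_i pr nu a i * ln 2 by rewrite -mulr_suml pr_sum// mul1r.
  rewrite /ent -sumrN -big_split/=; apply: ler_sum => i _.
  have [p1|] := ltP 0 (pr nu a i); last first.
    move=> p0; have -> : pr nu a i = 0 by [apply/le_anti/andP; split=> //; exact: pr_ge0].
    by rewrite !mul0r oppr0 addr0.
  rewrite -mulrN -mulrDr ler_wpM2l ?pr_ge0// -[leRHS]opprK lerN2 opprD opprK -ln_div ?posrE//.
  have h : pr nu a i / 2 <= w i by rewrite /w ler_wpM2r ?invr_ge0// lerDl invr_ge0.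
  by rewrite ler_ln ?posrE// divr_gt0.
have nR : 1 <= n%:R :> R by rewrite ler1n.
have l2 : ln (2 : R) <= 1 by rewrite -[leRHS]expRK ler_ln ?posrE ?expR_gt0//; have := expR_ge1Dx (1 : R); lra.
move: hE nR l2; rewrite mulrDr; move: (ent _ _) (ln 2) (n%:R * c) => e1 e2 e3; lra.
Qed.

Lemma mesh_le (alpha : {fset set X}) : (mesh d alpha <= eps%:E)%E ->
  forall A x y, A \in alpha -> A x -> A y -> d x y <= eps.
Proof.
move=> h A x y Aa Ax Ay; rewrite -lee_fin; apply: le_trans h.
apply: (@le_trans _ _ (diam d A)); last by apply: ereal_sup_ubound; exists A.
by apply: ereal_sup_ubound; exists (x, y).
Qed.

Lemma entropy_of_partition_compressible (alpha : {fset set X}) (c : R) : finite_partition (X := borel X) alpha ->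
  (forall A x y, A \in alpha -> A x -> A y -> d x y <= eps) ->
  (entropy_of_partition T nu alpha < c%:E)%E -> compressible T d eps nu (c + 2).
Proof.
move=> pa ha hE; have [k [kap [mk hk he]]] := partition_code T nu pa.
have [l [El cl]] := entropy_of_partition_cvg mT inu pa.
move: hE; rewrite El lte_fin => lc.
have [N _ hN] := cvgr_lt _ cl c lc.
have h : N.+1%:R^-1 * partition_entropy nu (cover_iter T alpha N.+1) < c := hN N.+1 (leqnSn N).
rewrite he in h.
apply: (compressible_of_entropy (n := N.+1) mk) => //.
- move=> x y e; have [A Aa EA] := hk x; apply: (ha A) => //; rewrite EA //=.
- by rewrite -ltr_pdivrMl.
Qed.

Lemma inf_partition_entropy_compressible (c : R) :
  (inf_partition_entropy T d nu eps < c%:E)%E -> compressible T d eps nu (c + 2).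
Proof.
move=> /ereal_inf_lt[_ [alpha [pa ma] <-]] h.
by apply: (entropy_of_partition_compressible pa) => //; exact: mesh_le.
Qed.

Lemma inf_cover_entropy_compressible (c : R) :
  (inf_cover_entropy T d nu eps < c%:E)%E -> compressible T d eps nu (c + 2).
Proof.
move=> /ereal_inf_lt[_ [U [_ mU] <-]] /ereal_inf_lt[_ [alpha [pa ra] <-]] h.
apply: (entropy_of_partition_compressible pa) => // A x y /ra[B BU AB] Ax Ay.
by apply: (mesh_le mU BU); exact: AB.
Qed.

End fine_codes.

(** * Couplings and mutual information *)

Section couplings.
Context {R : realType} {X : ptopologicalType} (d : X -> X -> R) (T : X -> X).
Hypotheses (cX : compact [set: X]) (cd : compatible_metric d) (cT : continuous T).
Variable nu : probability (borel X) R.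
Hypothesis inu : invariant_measure T nu.

Let mT : measurable_fun setT (T : borel X -> borel X).
Proof. exact: borel_map. Qed.

Context {dO : measure_display} {Omega : measurableType dO} (P : probability Omega R).

Lemma expectation_ge_code (F : finType) (a : Omega -> F) (g : F -> R) (f : Omega -> R) : mfin a ->
  (forall i, 0 <= g i) -> (forall w, g (a w) <= f w) -> ((\sum_i pr P a i * g i)%:E <= 'E_P[f])%E.
Proof.
move=> ma g0 gf; have -> : ('E_P[f] = \int[P]_w (f w)%:E)%E by rewrite unlock.
apply: (@le_trans _ _ (\int[P]_w (g (a w))%:E)%E).
  by rewrite Ex_EFin ?Ex_code//; exact: bm_code.
by apply: ge0_le_integralT => w; rewrite lee_fin.
Qed.

Variables (n : nat) (xi : {RV P >-> borel X}) (eta : {RV P >-> n.-tuple (borel X)}).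
Hypotheses (n0 : (0 < n)%N) (law : forall A : set (borel X), measurable A -> P (xi @^-1` A) = nu A).

Variables (eps : R).
Hypothesis eps0 : 0 < eps.

Variables (k : nat) (kap : X -> 'I_k) (b : 'I_k -> X).
Hypotheses (mk : mfin (kap : borel X -> _)) (hb : forall x, d x (b (kap x)) <= eps).

Let F : finType := {ffun 'I_n -> 'I_k}.
Let a : borel X -> F := name T kap n.
Let a' (y : n.-tuple (borel X)) : F := [ffun t : 'I_n => kap (tnth y t)].
Definition word_dist (v w : F) : R := \sum_t d (b (v t)) (b (w t)).

Let ma : mfin a. Proof. exact: mfin_name. Qed.

Let ma' : mfin a'.
Proof.
move=> w; rewrite (_ : _ @^-1` _ = \bigcap_(t in [set: 'I_n]) ((fun y : n.-tuple (borel X) => tnth y t) @^-1` (kap @^-1` [set w t]))).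
  apply: fin_bigcap_measurable => // t _; rewrite -[X in measurable X]setTI; apply: measurable_tnth => //; exact: mk.
apply/seteqP; split=> y /=; first by move=> <- t _ /=; rewrite ffunE.
by move=> h; apply/ffunP => t; rewrite ffunE; exact: h.
Qed.

Let mxi : mfin (a \o xi).
Proof. by move=> w; rewrite comp_preimage -[X in measurable X]setTI; apply: measurable_funPT. Qed.

Let meta : mfin (a' \o eta).
Proof. by move=> w; rewrite comp_preimage -[X in measurable X]setTI; apply: measurable_funPT. Qed.

Let V w := (a (xi w), a' (eta w)).
Let mV : mfin V. Proof. exact: mfin_pair. Qed.

Let pv v := pr P (a \o xi) v.
Let pw w := pr P (a' \o eta) w.
Let pvw z := pr P V z.

Let pvE v : pv v = pr nu a v.
Proof. by rewrite /pv /pr comp_preimage law//; exact: ma. Qed.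

Lemma mutual_information_ge :
  ((\sum_z pvw z * ln (pvw z / (pv z.1 * pw z.2)))%:E <= mutual_information xi eta)%E.
Proof.
apply: (@le_trans _ _ (\sum_(A <- fibers a) \sum_(B <- fibers a')
      let pA := fine (P (xi @^-1` A)) in
      let pB := fine (P (eta @^-1` B)) in
      let pAB := fine (P (xi @^-1` A `&` eta @^-1` B)) in
      pAB * ln (pAB / (pA * pB)))%:E); last first.
  apply: ereal_sup_ubound; exists (fibers a, fibers a') => //.
  by split; exact: fibers_partition.
rewrite lee_fin /=.
rewrite (fibers_sum a (phi := fun A => \sum_(B <- fibers a') fine (P (xi @^-1` A `&` eta @^-1` B)) *
  ln (fine (P (xi @^-1` A `&` eta @^-1` B)) / (fine (P (xi @^-1` A)) * fine (P (eta @^-1` B)))))); last first.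
  by rewrite big1// => B _; rewrite preimage_set0 set0I measure0 mul0r.
rewrite (_ : \sum_z _ = \sum_i \sum_j pvw (i, j) * ln (pvw (i, j) / (pv i * pw j))); last first.
  by rewrite pair_bigA; apply: eq_bigr => -[i j].
rewrite le_eqVlt; apply/orP; left; apply/eqP; apply: eq_bigr => i _.
rewrite (fibers_sum a' (phi := fun B => fine (P (xi @^-1` (a @^-1` [set i]) `&` eta @^-1` B)) *
  ln (fine (P (xi @^-1` (a @^-1` [set i]) `&` eta @^-1` B)) / (fine (P (xi @^-1` (a @^-1` [set i]))) * fine (P (eta @^-1` B)))))); last first.
  by rewrite preimage_set0 setI0 measure0 mul0r.
apply: eq_bigr => j _.
have -> : pvw (i, j) = fine (P (xi @^-1` (a @^-1` [set i]) `&` eta @^-1` (a' @^-1` [set j]))) => //.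
rewrite /pvw /pr; congr (fine (P _)); apply/seteqP; split=> w /=.
  by move=> [<- <-].
by move=> [<- <-].
Qed.

(** The words of [Q] are those of the quantised [eta], weighted by their law. By the Gibbs
    variational principle, the mean of [- ln] of the partition function [Z] is at most the mutual
    information plus the mean cost under the coupling. The bound [A + B g] converts the given
    distortion into a linear cost. *)
Lemma coupling_compressible (c A C B tau : R) (g : F * F -> R) (f : Omega -> R) :
  (mutual_information xi eta < (n%:R * c)%:E)%E -> 0 <= B ->
  (forall z, 0 <= g z) -> (forall w, g (V w) <= f w) -> ('E_P[f] < tau%:E)%E ->
  (forall z, word_dist z.1 z.2 / eps <= A + B * g z) -> A + B * tau <= n%:R * C ->
  compressible T d eps nu (c + C + 2).
Proof.
move=> hI B0 g0 gf hE hd hAB.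
have [D D0 hD] := cm_bounded cX cd.
have vV : pv = pr P (fst \o V) by [].
have wV : pw = pr P (snd \o V) by [].
have sw : \sum_w pw w = 1 by rewrite /pw pr_sum.
have sv : \sum_v pv v = 1 by rewrite /pv pr_sum.
have pw0 w : 0 <= pw w by exact: pr_ge0.
have pv0 v : 0 <= pv v by exact: pr_ge0.
have pvw0 z : 0 <= pvw z by exact: pr_ge0.
pose Q := [seq (pw w, [seq b (w t) | t <- enum 'I_n]) | w <- enum F].
have vQ : valid Q n.
  split; first by move=> q /mapP[w _ ->] /=; rewrite size_map size_enum_ord.
  by rewrite big_map big_enum/= sw.
have costE (l : seq X) x : cost T d l x = \sum_(t < size l) d (iter t T x) (nth point l t).
  elim: l x => [|y l IH] x /=; first by rewrite big_ord0.
  by rewrite big_ord_recl /= IH; congr (_ + _); apply: eq_bigr => t _; rewrite -iterSr.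
pose cst (v w : F) := word_dist v w / eps + n%:R.
have hcost x (w : F) : cost T d [seq b (w t) | t <- enum 'I_n] x / eps <= cst (a x) w.
  rewrite /cst ler_pdivrMr// mulrDl divfK ?gt_eqF// costE size_map size_enum_ord /word_dist.
  rewrite -[n in n%:R](card_ord n) -sum1_card natr_sum mulr_suml -big_split/=.
  rewrite (eq_bigr (fun t : 'I_n => d (iter t T x) (b (w t)))); last first.
    by move=> t _; rewrite (nth_map t) ?size_enum_ord// nth_ord_enum.
  apply: ler_sum => t _; rewrite mul1r ffunE addrC.
  by apply: (le_trans (cm_tri cd (b (kap (iter t T x))) _ _)); rewrite lerD2r.
pose Z v := \sum_w pw w * expR (- cst v w).
have cst0 v w : 0 <= cst v w <= n%:R * (D / eps) + n%:R.
  rewrite addr_ge0 ?divr_ge0 ?(ltW eps0)//=; last by apply: sumr_ge0 => t _; exact: cm_ge0.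
  rewrite lerD2r mulrA ler_wpM2r ?invr_ge0 ?(ltW eps0)// /word_dist.
  apply: (@le_trans _ _ (\sum_(t < n) D)); first by apply: ler_sum => t _; exact: hD.
  by rewrite big_const_ord iter_addr addr0 mulr_natl.
pose K := n%:R * (D / eps) + n%:R.
have ZK v : expR (- K) <= Z v.
  rewrite -[leLHS]mul1r -sw mulr_suml; apply: ler_sum => w _.
  by rewrite ler_wpM2l// ler_expR lerN2; case/andP: (cst0 v w).
have Z0 v : 0 < Z v by apply: lt_le_trans (ZK v); exact: expR_gt0.
have Zp x : Z (a x) <= pot T d eps Q x.
  rewrite /pot /Q big_map big_enum/=; apply: ler_sum => w _.
  by rewrite ler_wpM2l// ler_expR lerN2.
have hk x : expR (- K) <= pot T d eps Q x by apply: le_trans (Zp x).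
apply: (@compressible_code_bound _ _ d T cd cT nu eps eps0 F a (fun v => - ln (Z v)) Q n _ _ n0 vQ hk ma).
  move=> x; rewrite lerN2 ler_ln ?posrE//.
  by apply: lt_le_trans (hk x); exact: expR_gt0.
pose I0 := \sum_z pvw z * ln (pvw z / (pv z.1 * pw z.2)).
have I0n : I0 < n%:R * c by rewrite -lte_fin; apply: le_lt_trans hI; exact: mutual_information_ge.
have Eg : \sum_z pvw z * g z < tau.
  by rewrite -lte_fin; apply: le_lt_trans hE; exact: expectation_ge_code.
have sz : \sum_z pvw z = 1 by rewrite /pvw pr_sum.
have marg (h : F -> R) : \sum_v pv v * h v = \sum_z pvw z * h z.1.
  by rewrite -(Ex_code P h mxi) -(Ex_code P (fun z => h z.1) mV).
have pos z : 0 < pvw z -> 0 < pv z.1 /\ 0 < pw z.2.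
  move=> p1; split; apply: (lt_le_trans p1); [rewrite vV|rewrite wV]; case: z p1 => z1 z2 _.
    exact: (pr_le_comp P fst (z1, z2) mV).
  exact: (pr_le_comp P snd (z1, z2) mV).
rewrite (eq_bigr (fun v => pv v * - ln (Z v))); last by move=> v _; rewrite pvE.
rewrite (marg (fun v => - ln (Z v))).
apply: (@le_lt_trans _ _ (I0 + \sum_z pvw z * cst z.1 z.2)).
  rewrite /I0 -big_split/= -subr_ge0 -sumrB.
  (* The product law tilted by the cost; its first marginal is [pv], so its mass is 1, and Gibbs'
     inequality against it is the claim. *)
  pose q (z : F * F) := pv z.1 * pw z.2 * expR (- cst z.1 z.2) / Z z.1.
  have q0 z : 0 <= q z by rewrite /q !mulr_ge0 ?invr_ge0 ?expR_ge0 ?(ltW (Z0 _)).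
  apply: (@le_trans _ _ (\sum_z (pvw z - q z))); last first.
    apply: ler_sum => z _; have [p1|] := ltP 0 (pvw z); last first.
      move=> p0; have -> : pvw z = 0 by [apply/le_anti/andP; split].
      by rewrite !mul0r sub0r !addr0 subr0 oppr_le0.
    have [v1 w1] := pos z p1.
    have := @gibbs_term R (pvw z) (q z) (pvw0 z) (q0 z).
    have q1 : 0 < q z by rewrite /q divr_gt0// !mulr_gt0// expR_gt0.
    move=> /(_ (fun=> q1)).
    rewrite /q ln_div ?posrE ?mulr_gt0 ?expR_gt0// (@lnM _ (_ * _)) ?posrE ?mulr_gt0 ?expR_gt0// expRK.
    rewrite [ln (pvw z / _)]ln_div ?posrE ?mulr_gt0//.
    by move: (ln (pvw z)) (ln (_ * _)) (cst _ _) (ln (Z _)) (_ / Z _) (pvw z) => e1 e2 e3 e4 e5 e6; lra.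
  rewrite sumrB sz subr_ge0 /q -(pair_bigA _ (fun i j => pv i * pw j * expR (- cst i j) / Z i))/=.
  rewrite -sv; apply: ler_sum => v _; rewrite -mulr_suml.
  rewrite (eq_bigr (fun w => pv v * (pw w * expR (- cst v w)))); last by move=> w _; rewrite mulrA.
  by rewrite -mulr_sumr -/(Z v) -mulrA mulfV ?gt_eqF// mulr1.
have E2 : \sum_z pvw z * cst z.1 z.2 <= A + B * tau + n%:R.
  rewrite /cst (eq_bigr (fun z => pvw z * (word_dist z.1 z.2 / eps) + pvw z * n%:R)); last by move=> z _; rewrite mulrDr.
  rewrite big_split/= -mulr_suml sz mul1r lerD2r.
  apply: (@le_trans _ _ (\sum_z (pvw z * A + B * (pvw z * g z)))).
    apply: ler_sum => z _; apply: (@le_trans _ _ (pvw z * (A + B * g z))); first by rewrite ler_wpM2l.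
    by rewrite mulrDr [B * (_ * _)]mulrCA.
  rewrite big_split/= -mulr_suml sz mul1r lerD2l -mulr_sumr ler_wpM2l//; exact: ltW.
have nR : 0 < n%:R :> R by rewrite ltr0n.
move: I0n E2 hAB nR; rewrite !mulrDr; move: (B * tau) (n%:R * c) (n%:R * C) (\sum_z _) I0 => e1 e2 e3 e4 e5; lra.
Qed.

End couplings.

(** * Rate distortion, Brin-Katok and Pfister-Sullivan entropies *)

Section rates.
Context {R : realType} {X : ptopologicalType} (d : X -> X -> R) (T : X -> X).
Hypotheses (cX : compact [set: X]) (cd : compatible_metric d) (cT : continuous T).
Variable nu : probability (borel X) R.
Hypothesis inu : invariant_measure T nu.

Lemma le_one_powR (t p : R) : 0 <= t -> 1 <= p -> t <= 1 + t `^ p.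
Proof.
move=> t0 p1; have [t1|t1] := leP t 1; first by rewrite (le_trans t1)// lerDl powR_ge0.
by rewrite -[leLHS]powRr1// ler_wpDl// ler_powR// ltW.
Qed.

(** Quantising both words changes each distance by at most [2 eps], whence the truncated distance in
    [g]; then [t <= 1 + t ^ p] turns the moment into a linear cost. *)
Lemma rate_Lp_compressible (p eps c : R) : 1 <= p -> 0 < eps ->
  (rate_Lp T p d nu eps < c%:E)%E -> compressible T d eps nu (c + 6).
Proof.
move=> p1 eps0 /ereal_inf_lt[r]; case=> dO; case=> Omega; case=> P; case=> n; case=> xi; case=> zt; case=> n0 law hE -> hI.
have p0 : 0 <= p by apply: le_trans p1.
have nR : 0 < n%:R :> R by rewrite ltr0n.
have [k [kap [b [mk hb]]]] := fine_code cX cd eps0.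
rewrite lte_pdivrMl// -EFinM in hI.
pose F : finType := {ffun 'I_n -> 'I_k}.
pose g (z : F * F) : R := n%:R^-1 * \sum_(t < n) (Num.max 0 (d (b (z.1 t)) (b (z.2 t)) - 2 * eps)) `^ p.
rewrite (_ : c + 6 = c + 4 + 2); last by ring.
apply: (@coupling_compressible _ _ d T cX cd cT nu _ _ P n xi zt n0 law eps eps0 k kap b mk hb c
   (n%:R * 3) 4 (n%:R / eps `^ p) (eps `^ p) g _ hI _ _ _ hE).
- by rewrite divr_ge0 ?powR_ge0// ltW.
- by move=> z; rewrite mulr_ge0 ?invr_ge0// sumr_ge0// => t _; exact: powR_ge0.
- move=> w; rewrite /g ler_wpM2l ?invr_ge0//; apply: ler_sum => t _ /=; rewrite !ffunE.
  apply: ge0_ler_powR => //; rewrite ?nnegrE ?le_max ?lexx// ?(cm_ge0 cd)//.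
  rewrite ge_max (cm_ge0 cd)/= lerBlDr.
  set x := iter t T (xi w); set y := tnth (zt w) t.
  have h1 := cm_tri cd x (b (kap x)) (b (kap y)); have h2 := cm_tri cd y x (b (kap y)).
  have h3 := hb x; have h4 := hb y; rewrite (cm_sym cd) in h3.
  by apply: (le_trans h1); move: h2 h3 h4; move: (d _ _) (d x y) (d _ _) (d _ _) => e1 e2 e3 e4; lra.
- move=> z; rewrite /g /word_dist mulrACA mulfV ?gt_eqF// mul1r mulr_suml mulr_sumr.
  rewrite mulr_natl -[n in _ *+ n]card_ord -sumr_const -big_split/=; apply: ler_sum => t _.
  set m := Num.max _ _; have m0 : 0 <= m by rewrite le_max lexx.
  have hm : d (b (z.1 t)) (b (z.2 t)) <= 2 * eps + m by rewrite -lerBlDl le_max lexx orbT.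
  have epi : 0 <= eps^-1 by rewrite invr_ge0 ltW.
  have h := le_one_powR (mulr_ge0 m0 epi) p1.
  have e1 : (m / eps) `^ p = (eps `^ p)^-1 * m `^ p.
    by rewrite powRM// mulrC; congr (_ * _); rewrite -powR_inv1 ?(ltW eps0)// -powRrM mulrC powRrM powR_inv1 ?powR_ge0.
  apply: (@le_trans _ _ (2 + m / eps)); first by rewrite ler_pdivrMr// mulrDl divfK ?gt_eqF.
  rewrite -e1; move: h; move: (m / eps) (_ `^ p) => a1 a2; lra.
- have -> : n%:R * 4 = n%:R * 3 + n%:R :> R by ring.
  by rewrite divfK// gt_eqF// powR_gt0.
Qed.

Lemma rate_Loo_compressible (eps c : R) : 0 < eps ->
  (rate_Loo T d nu eps < c%:E)%E -> compressible T d eps nu (c + 6).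
Proof.
move=> eps0 hc; have [D D0 hD] := cm_bounded cX cd.
(* A wrong letter costs at most [D / eps], so a proportion [s] of wrong letters adds at most 1 per
   letter. *)
pose s := Num.min (2^-1) (eps / D).
have s01 : 0 < s < 1.
  by rewrite lt_min invr_gt0 ltr0n divr_gt0//= gt_min invf_lt1 ?ltr1n.
have sD : s * D <= eps by rewrite -ler_pdivlMr// ge_min lexx orbT.
have : (rate_Loo_at T d nu eps s < c%:E)%E.
  apply: le_lt_trans hc; apply: (@lim_at_right_antitone _ (fun s => rate_Loo_at T d nu eps s)) s01 => x y x0 xy _.
  apply: le_ereal_inf => r; case=> dO; case=> Omega; case=> P; case=> n; case=> xi; case=> zt; case=> n0 law hE ->.
  exists dO, Omega, P, n, xi, zt; split=> //; apply: (lt_le_trans hE).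
  by rewrite lee_fin ler_wpM2r.
move=> /ereal_inf_lt[r]; case=> dO; case=> Omega; case=> P; case=> n; case=> xi; case=> zt; case=> n0 law hE -> hI.
have nR : 0 < n%:R :> R by rewrite ltr0n.
have [k [kap [b [mk hb]]]] := fine_code cX cd eps0.
rewrite lte_pdivrMl// -EFinM in hI.
pose F : finType := {ffun 'I_n -> 'I_k}.
pose g (z : F * F) : R := \sum_(t < n) (3 * eps <= d (b (z.1 t)) (b (z.2 t)))%R%:R.
rewrite (_ : c + 6 = c + 4 + 2); last by ring.
apply: (@coupling_compressible _ _ d T cX cd cT nu _ _ P n xi zt n0 law eps eps0 k kap b mk hb c
   (n%:R * 3) 4 (D / eps) (s * n%:R) g _ hI _ _ _ hE).
- by rewrite divr_ge0// ltW.
- by move=> z; rewrite sumr_ge0.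
- move=> w; rewrite /g -sum1_card natr_sum [leRHS]big_mkcond/=; apply: ler_sum => t _ /=; rewrite !ffunE inE.
  set x := iter t T (xi w); set y := tnth (zt w) t.
  case: (leP (3 * eps) _) => h; last by case: ifP.
  rewrite ifT//; have h1 := cm_tri cd x (b (kap x)) (b (kap y)); have h2 := cm_tri cd y x (b (kap y)).
  have h3 := hb x; have h4 := hb y; rewrite (cm_sym cd) in h3.
  by move: h h1 h2 h3 h4; move: (d _ _) (d _ _) (d _ _) (d x y) (d _ _) => e1 e2 e3 e4 e5; lra.
- move=> z; rewrite /g /word_dist mulr_suml mulr_sumr.
  rewrite mulr_natl -[n in _ *+ n]card_ord -sumr_const -big_split/=; apply: ler_sum => t _.
  case: (leP (3 * eps) _) => h; last by rewrite mulr0 addr0 ler_pdivrMr// ltW.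
  by rewrite mulr1 ler_wpDl// ler_wpM2r ?invr_ge0 ?(ltW eps0).
- have -> : n%:R * 4 = n%:R * 3 + n%:R * (1 : R) by ring.
  have -> : D / eps * (s * n%:R) = n%:R * (s * D / eps) by ring.
  by rewrite lerD2l ler_wpM2l// ler_pdivrMr// mul1r.
Qed.

End rates.

(** * Separated sets and the mass of Bowen balls *)

Section separated.
Context {R : realType} {X : ptopologicalType} (d : X -> X -> R) (T : X -> X).
Hypotheses (cX : compact [set: X]) (cd : compatible_metric d) (cT : continuous T).

Definition separated n r (F : {fset X}) :=
  forall x y, x \in F -> y \in F -> x != y -> r <= bowen_metric d T n x y.

Lemma bowen_sym n x y : bowen_metric d T n x y = bowen_metric d T n y x.
Proof. by apply: eq_bigr => j _; rewrite (cm_sym cd). Qed.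

Lemma bowen_xx n x : bowen_metric d T n x x = 0.
Proof.
apply/le_anti/andP; split; last exact: bigmax_ge0.
by apply: bigmax_le => // j _; rewrite (cm_xx cd).
Qed.

(** Cardinalities are bounded, so a separated set of maximal size exists; if its balls missed a
    point, that point could be added. *)
Lemma max_separated (S : set X) n r (K : nat) : 0 < r ->
  (forall F : {fset X}, [set` F] `<=` S -> separated n r F -> (#|` F| <= K)%N) ->
  exists E : {fset X}, [/\ [set` E] `<=` S, separated n r E &
    S `<=` \bigcup_(y in [set` E]) bowen_ball d T n y r].
Proof.
move=> r0 hK.
pose P k := `[< exists F : {fset X}, [/\ [set` F] `<=` S, separated n r F & #|` F| = k] >].
have P0 : exists k, P k.
  exists 0%N; apply/asboolP; exists fset0; split; rewrite ?cardfs0//.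
have Pb k : P k -> (k <= K)%N by move=> /asboolP[F [FS sF <-]]; exact: hK.
case: (ex_maxnP P0 Pb) => k /asboolP[E [ES sE Ek]] kmax; exists E; split=> // x Sx.
apply: contrapT => nx.
have xr y : y \in E -> r <= bowen_metric d T n y x.
  by move=> yE; rewrite leNgt; apply/negP => h; apply: nx; exists y.
have xE : x \notin E.
  by apply/negP => xE; have := xr x xE; rewrite bowen_xx leNgt r0.
suff : (k.+1 <= k)%N by rewrite ltnn.
apply: kmax; apply/asboolP; exists (x |` E)%fset; split; last by rewrite cardfsU1 xE Ek.
- by move=> y /=; rewrite in_fset1U => /orP[/eqP -> //|/ES].
- move=> y z; rewrite !in_fset1U => /orP[/eqP ->|yE] /orP[/eqP ->|zE]; rewrite ?eqxx//.
  + by move=> _; rewrite bowen_sym; exact: xr.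
  + by move=> _; exact: xr.
  + exact: sE.
Qed.

Variable nu : probability (borel X) R.

Lemma disjoint_balls_card n (eps t : R) (E : {fset X}) : 0 < eps -> separated n (2 * eps) E ->
  (forall y, y \in E -> (t%:E <= nu (bowen_ball d T n y eps))%E) -> #|` E|%:R * t <= 1.
Proof.
move=> eps0 sE hE.
have mB y : measurable (bowen_ball d T n y eps : set (borel X)).
  by apply: borel_open; exact: bowen_ball_open.
have bB y : bm (\1_(bowen_ball d T n y eps) : borel X -> R) by exact: bm_indic.
apply: (@le_trans _ _ (Ex nu (fun x => \sum_(y <- E) \1_(bowen_ball d T n y eps) x))).
  rewrite Ex_sum; last by move=> y _; exact: bB.
  have -> : #|` E|%:R * t = \sum_(y <- E) t.
    by rewrite big_const_seq count_predT iter_addr addr0 mulr_natl.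
  rewrite !big_seq; apply: ler_sum => y yE; rewrite Ex_indic//.
  by rewrite -lee_fin -(mu_fin nu (mB y)); exact: hE.
rewrite -[leRHS](Ex_cst nu); apply: Ex_le; [by apply: bm_sum => y _; exact: bB|exact: bm_cst|].
move=> x; have [[y yE yx]|nex] := pselect (exists2 y, y \in E & bowen_ball d T n y eps x); last first.
  rewrite big_seq big1 ?ler01// => y yE; rewrite indicE memNset// => yx; apply: nex; by exists y.
rewrite (bigD1_seq y) ?fset_uniq//= big_seq_cond big1 => [|z /andP[zE zy]].
  by rewrite addr0 indicE; case: (_ \in _); rewrite ?ler01.
rewrite indicE memNset// => zx; have := sE z y zE yE zy; rewrite leNgt => /negP; apply.
have e2 : 0 < 2 * eps by rewrite mulr_gt0.
apply/(bowen_lt _ _ _ _ _ e2) => j jn.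
move: zx yx; rewrite /bowen_ball /= => /(bowen_lt _ _ _ _ _ eps0) /(_ j jn) h1 /(bowen_lt _ _ _ _ _ eps0) /(_ j jn) h2.
apply: (le_lt_trans (cm_tri cd (iter j T x) _ _)); rewrite (cm_sym cd (iter j T x)).
by rewrite mulrDl mul1r; exact: ltrD.
Qed.

Hypothesis enu : ergodic_measure T nu.

Lemma brin_katok_compressible (eps c : R) : 0 < eps ->
  (brin_katok_sup T d nu eps < c%:E)%E -> compressible T d eps nu (c + 10).
Proof.
move=> eps0; rewrite /brin_katok_sup; set f := (X in (\int[_]_x X x)%E) => hf.
have mB n x : measurable (bowen_ball d T n x eps : set (borel X)).
  by apply: borel_open; exact: bowen_ball_open.
have f0 x : (0 <= f x)%E.
  apply: limn_esup_geP => n0; exists n0 => //; apply: mule_ge0; first by rewrite lee_fin invr_ge0.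
  by rewrite oppe_ge0 lne_le0; exact: probability_le1.
have c0 : 0 <= c.
  rewrite leNgt; apply/negP => c0; move: hf; apply/negP; rewrite -leNgt.
  apply: (@le_trans _ _ (\int[nu]_x 0)%E); first by rewrite integral0 lee_fin ltW.
  exact: ge0_le_integralT.
have W n m : exists E : {fset X}, (#|` E|%:R : R) <= expR (n%:R * c) /\
    [set x | forall n, (m <= n)%N -> (0 < n)%N -> ((expR (- (n%:R * c)))%:E <= nu (bowen_ball d T n x eps))%E]
      `<=` (if (m <= n)%N && (0 < n)%N then \bigcup_(y in [set` E]) bowen_ball d T n y (2 * eps) else setT).
  case: (boolP ((m <= n)%N && (0 < n)%N)) => [/andP[mn n0]|_]; last by exists fset0; split=> //; rewrite cardfs0 expR_ge0.
  set S := [set x | _].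
  have hb (F : {fset X}) : [set` F] `<=` S -> separated n (2 * eps) F -> #|` F|%:R <= expR (n%:R * c).
    move=> FS sF; have := @disjoint_balls_card n eps (expR (- (n%:R * c))) F eps0 sF.
    rewrite expRN ler_pdivrMr ?expR_gt0// mul1r; apply => y yF.
    by rewrite -expRN; apply: (FS y yF).
  have [||E [ES sE EC]] := @max_separated S n (2 * eps) (Num.truncn (expR (n%:R * c))).
  - by rewrite mulr_gt0.
  - move=> F FS sF; rewrite -(ler_nat R); have := hb F FS sF => h.
    by have := truncnS_gt (expR (n%:R * c)) => /(le_lt_trans h); rewrite ltr_nat ltnS ler_nat.
  by exists E; split=> //; exact: hb.
pose hW m := choice (W^~ m); pose E_ m := projT1 (hW m).
have hE m := projT2 (hW m).
pose OO m n : set (borel X) := if (m <= n)%N && (0 < n)%N then \bigcup_(y in [set` E_ m n]) bowen_ball d T n y (2 * eps) else setT.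
have mO m n : measurable (OO m n).
  rewrite /OO; case: ifP => // _.
  by apply: borel_open; apply: bigcup_open => y _; exact: bowen_ball_open.
pose A m : set (borel X) := \bigcap_n OO m n.
have mA m : measurable (A m) by exact: bigcapT_measurable.
have [m Am] : exists m, (0 < nu (A m))%E.
  apply: contrapT => H.
  have A0 m : nu (A m) = 0%E.
    by apply/eqP; rewrite eq_le measure_ge0 andbT leNgt; apply/negP => h; apply: H; exists m.
  have ZA : nu (\bigcup_m A m) = 0%E by exact: null_bigcup.
  have mZ : measurable (\bigcup_m A m : set (borel X)) by exact: bigcupT_measurable.
  have fc x : ~ (\bigcup_m A m) x -> (c%:E <= f x)%E.
    move=> nA; rewrite leNgt; apply/negP => /limn_esup_ltP[n0 hn0]; apply: nA; exists n0 => // n _.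
    apply: (hE n0 n).2 => {}n n0n n1; have := hn0 n n0n; have := mu_fin nu (mB n x).
    set r := fine _ => ->; rewrite lee_fin.
    have n1R : 0 < (n%:R^-1 : R) by rewrite invr_gt0 ltr0n.
    have [r0|r0] := leP r 0; first by rewrite le0_lneNy ?lee_fin// mulry gtr0_sg// mul1e.
    rewrite lne_EFin// -EFinN -EFinM lte_fin mulrC ltr_pdivrMr ?ltr0n// => h.
    rewrite -[leRHS](@lnK _ r) ?posrE// ler_expR ltW// ltrNl mulrC; exact: h.
  move: hf; apply/negP; rewrite -leNgt.
  have mcZ : measurable (~` (\bigcup_m A m) : set (borel X)) by exact: measurableC.
  apply: (@le_trans _ _ (\int[nu]_x (c * \1_(~` (\bigcup_m A m)) x)%:E)%E).
    have bI : bm (\1_(~` (\bigcup_m A m)) : borel X -> R) by exact: bm_indic.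
    rewrite (Ex_EFin nu (bmZ c bI)) ExZ// Ex_indic//.
    by rewrite probability_setC// ZA sube0 /= mulr1.
  apply: ge0_le_integralT => x; first by rewrite lee_fin mulr_ge0// indicE.
  rewrite indicE; case: (boolP (_ \in _)) => [/set_mem nx|_]; first by rewrite mulr1; exact: fc.
  by rewrite mulr0; exact: f0.
have Af := mu_fin nu (mA m).
apply: (compressible_of_cover cX cd cT eps0 enu (theta := fine (nu (A m)))); first by rewrite -lte_fin -Af.
move=> M0; pose n := maxn M0 (maxn m 1); exists n, (E_ m n); split.
- exact: leq_maxl.
- exact: (hE m n).1.
- have mn : (m <= n)%N && (0 < n)%N by rewrite /n; apply/andP; split; lia.
  rewrite -Af; apply: le_measure; rewrite ?inE//.
    by apply: borel_open; apply: bigcup_open => y _; exact: bowen_ball_open.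
  by move=> x /(_ n Logic.I); rewrite /OO mn.
Qed.

End separated.

(** * Generic points and neighbourhoods of an ergodic measure *)

Section pfister_sullivan.
Context {R : realType} {X : ptopologicalType} (d : X -> X -> R) (T : X -> X).
Hypotheses (cX : compact [set: X]) (cd : compatible_metric d) (cT : continuous T).
Variable nu : probability (borel X) R.
Hypothesis enu : ergodic_measure T nu.

Let mT : measurable_fun setT (T : borel X -> borel X).
Proof. exact: borel_map. Qed.

Lemma ptws_seq_cvg (U : choiceType) (u : nat -> {ptws U -> R}) (l : {ptws U -> R}) :
  (forall f, u n f @[n --> \oo] --> l f) -> u @ \oo --> l.
Proof.
move=> h; apply/cvg_sup => f A; rewrite nbhsE => -[W [[B oB <-] Bl] WA].
have nB : nbhs (l f) B by apply: open_nbhs_nbhs; split.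
by have := h f B nB; rewrite !nbhs_simpl /=; apply: filterS => n; exact: WA.
Qed.

Lemma weak_star_cvg (mu : nat -> probability (borel X) R) :
  (forall f : X -> R, continuous f -> Ex (mu n) f @[n --> \oo] --> Ex nu f) ->
  forall F : set (probability (borel X) R), nbhs (nu : weak_star R X) F -> \forall n \near \oo, F (mu n).
Proof.
move=> h F; rewrite nbhsE => -[V [[B oB BV] Vnu] VF].
have Bnu : B (integral_map nu) by rewrite -[B _]/((@integral_map R X @^-1` B) nu) BV.
have cv : (fun n => integral_map (mu n)) @ \oo --> integral_map nu.
  apply: ptws_seq_cvg => f; apply: (h f); exact: cts_fun.
have : nbhs (integral_map nu) B by apply: open_nbhs_nbhs; split.
move=> /cv [n0 _ hn]; exists n0 => // n n0n; apply: VF; rewrite -BV; exact: hn.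
Qed.

Lemma empirical_freq n x (A : set (borel X)) : fine (empirical T n x A) = freq T A x n.+1 :> R.
Proof.
have -> : empirical T n x A = ((n.+1%:R^-1)%:E * \sum_(j < n.+1) (\1_A (iter j T x))%:E)%E by [].
by rewrite sumEFin.
Qed.

(** The set where an invariant function exceeds its mean by [e] has measure 0 or 1, and measure 1
    would raise the mean. *)
Lemma ergodic_bound (g : borel X -> R) e : bm g -> (forall x, 0 <= g x) -> (forall x, g (T x) = g x) ->
  0 < e -> nu [set x | Ex nu g + e < g x] = 0%E.
Proof.
move=> bg g0 gT e0.
have mA : measurable [set x | Ex nu g + e < g x] by apply: measurable_lt_set; case: bg.
have E0 : 0 <= Ex nu g by exact: Ex_ge0.
have TA : T @^-1` [set x | Ex nu g + e < g x] = [set x | Ex nu g + e < g x].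
  by apply/seteqP; split=> x /=; rewrite gT.
have [//|h1] := enu.2 _ mA TA.
have bI : bm (\1_[set x | Ex nu g + e < g x] : borel X -> R) by exact: bm_indic.
have : (Ex nu g + e) * 1 <= Ex nu g.
  rewrite -[X in _ * X]/(fine 1%:E) -h1 -(Ex_indic nu mA) -ExZ//; apply: Ex_le => //; first exact: bmZ.
  move=> x; rewrite indicE; case: (boolP (_ \in _)) => [/set_mem /ltW|_]; first by rewrite mulr1.
  by rewrite mulr0.
by rewrite mulr1 gerDl leNgt e0.
Qed.

Lemma ergodic_freq (A : set (borel X)) : measurable A -> exists Z : set (borel X),
  [/\ measurable Z, nu Z = 0%E & forall x, ~ Z x -> forall e, 0 < e ->
    exists n0, forall n, (n0 <= n)%N -> `|freq T A x n - fine (nu A)| < e].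
Proof.
move=> mA; have bI : bm (\1_A : borel X -> R) by exact: bm_indic.
have [gb [bgb gb01 gbT Egb [Z [mZ Z0 hZ]]]] := birkhoff mT enu.1 bI (indic01 A).
rewrite Ex_indic// in Egb.
have gb0 x : 0 <= gb x by case/andP: (gb01 x).
have bgb' : bm (fun x => 1 - gb x) by apply: bmB => //; exact: bm_cst.
have gb'0 x : 0 <= 1 - gb x by rewrite subr_ge0; case/andP: (gb01 x).
pose U1 k := [set x | Ex nu gb + k.+1%:R^-1 < gb x].
pose U2 k := [set x | Ex nu (fun x => 1 - gb x) + k.+1%:R^-1 < 1 - gb x].
have k0 k : 0 < (k.+1%:R^-1 : R) by [].
have mU1 k : measurable (U1 k) by apply: measurable_lt_set; case: bgb.
have mU2 k : measurable (U2 k) by apply: measurable_lt_set; case: bgb'.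
have U10 k : nu (U1 k) = 0%E by exact: ergodic_bound.
have U20 k : nu (U2 k) = 0%E by apply: ergodic_bound => // x; rewrite gbT.
have mm1 : measurable (\bigcup_k U1 k : set (borel X)) by exact: bigcupT_measurable.
have mm2 : measurable (\bigcup_k U2 k : set (borel X)) by exact: bigcupT_measurable.
have z1 : nu (\bigcup_k U1 k) = 0%E by exact: null_bigcup.
have z2 : nu (\bigcup_k U2 k) = 0%E by exact: null_bigcup.
exists (Z `|` (\bigcup_k U1 k `|` \bigcup_k U2 k)); split.
- by apply: measurableU => //; exact: measurableU.
- by apply: null_setU => //; [exact: measurableU|exact: null_setU].
move=> x nx e e0.
have nZ : ~ Z x by move=> h; apply: nx; left.
have gc : gb x = fine (nu A).
  rewrite -Egb; apply/le_anti/andP; split.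
    apply/ler_addgt0Pr => e' e'0; rewrite leNgt; apply/negP => h; apply: nx; right; left.
    exists (Num.truncn e'^-1) => //; rewrite /U1 /=; apply: le_lt_trans h; rewrite lerD2l.
    by rewrite invf_ple ?posrE// ltW// truncnS_gt.
  apply/ler_addgt0Pr => e' e'0; rewrite leNgt; apply/negP => h; apply: nx; right; right.
  exists (Num.truncn e'^-1) => //; rewrite /U2 /= ExB ?Ex_cst//; last exact: bm_cst.
  have : (Num.truncn e'^-1).+1%:R^-1 <= e' by rewrite invf_ple ?posrE// ltW// truncnS_gt.
  by move: h; move: (Ex nu gb) (gb x) (_^-1) => e1 e2 e3; lra.
have [n0 hn] := hZ x nZ e e0; exists n0 => n n0n.
by rewrite -gc; exact: hn.
Qed.

Lemma Ex_code_near (mu : probability (borel X) R) k (kap : X -> 'I_k) (b : 'I_k -> X) (f : X -> R) e :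
  continuous f -> mfin (kap : borel X -> _) -> (forall x, `|f x - f (b (kap x))| <= e) ->
  `|Ex mu f - \sum_i pr mu kap i * f (b i)| <= e.
Proof.
move=> cf mk hf; rewrite -(Ex_code mu (fun i => f (b i)) mk).
have bk : bm (fun x : borel X => f (b (kap x))) by exact: (bm_code (fun i => f (b i)) mk).
have [C hC] := bk.2.
have bf : bm (f : borel X -> R).
  split; first exact: borel_continuous.
  exists (C + e) => x; have := ler_distD 0 (f x) (f (b (kap x))).
  rewrite -[f x](subrK (f (b (kap x)))) => _; apply: (le_trans (ler_normD _ _)); rewrite addrC.
  by apply: lerD => //; exact: hf.
rewrite -ExB// ler_norml; apply/andP; split.
  rewrite -[X in X <= _](Ex_cst mu); apply: Ex_le; [exact: bm_cst|exact: bmB|].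
  by move=> x; have := hf x; rewrite ler_norml => /andP[].
rewrite -[X in _ <= X](Ex_cst mu); apply: Ex_le; [exact: bmB|exact: bm_cst|].
by move=> x; have := hf x; rewrite ler_norml => /andP[].
Qed.

Lemma norm_chain (a b a' b' e : R) : `|a - a'| <= e -> `|b - b'| <= e -> `|a' - b'| <= e ->
  `|a - b| <= 3 * e.
Proof.
rewrite !ler_norml => /andP[b1 b2] /andP[b3 b4] /andP[b5 b6].
by apply/andP; split; lra.
Qed.

(** One null set must serve all continuous functions. Frequencies converge on the countably many
    cells of codes of radius [1 / (k + 1)], and uniform continuity does the rest. *)
Lemma empirical_cvg : exists Z : set (borel X), [/\ measurable Z, nu Z = 0%E &
  forall x, ~ Z x -> forall f : X -> R, continuous f ->
    Ex (empirical T n x) f @[n --> \oo] --> Ex nu f].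
Proof.
have hr k : 0 < (k.+1%:R^-1 : R) by [].
have /choice[K hK] k : exists K : {m : nat & ((X -> 'I_m) * ('I_m -> X))%type},
    mfin ((projT2 K).1 : borel X -> _) /\ forall x, d x ((projT2 K).2 ((projT2 K).1 x)) <= k.+1%:R^-1.
  by have [m [kap [b h]]] := fine_code cX cd (hr k); exists (existT _ m (kap, b)).
pose A k i : set (borel X) := [set x | val ((projT2 (K k)).1 x) = i].
have mA k i : measurable (A k i).
  have [im|mi] := ltnP i (projT1 (K k)).
    rewrite (_ : A k i = (projT2 (K k)).1 @^-1` [set Ordinal im]); first exact: (hK k).1.
    by apply/seteqP; split=> x /= h; [exact/val_inj|rewrite /A /= h].
  rewrite (_ : A k i = set0)//; apply/seteqP; split=> // x /= h.
  by have := ltn_ord ((projT2 (K k)).1 x); rewrite /A /= in h; rewrite h ltnNge mi.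
have /choice[Z hZ] ki := ergodic_freq (mA ki.1 ki.2).
pose dc n : nat * nat := odflt (0%N, 0%N) (choice.unpickle n).
exists (\bigcup_n Z (dc n)); split.
- by apply: bigcupT_measurable => n; case: (hZ (dc n)).
- by apply: null_bigcup => n; case: (hZ (dc n)).
move=> x nx f cf; apply/cvgrPdist_le => e e0.
have nZ k i : ~ Z (k, i) x.
  by move=> h; apply: nx; exists (choice.pickle (k, i)) => //; rewrite /dc choice.pickleK.
have e3 : 0 < e / 3 by rewrite divr_gt0.
have [r r0 hr'] := cm_ucont cX cd cf e3.
pose k := Num.truncn r^-1.
have kr : k.+1%:R^-1 < r by rewrite invf_plt ?posrE//; exact: truncnS_gt.
have [mk hb] := hK k; set kap := (projT2 (K k)).1 in mk hb; set b := (projT2 (K k)).2 in hb.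
have hf y : `|f y - f (b (kap y))| <= e / 3 by apply/ltW/hr'; apply: le_lt_trans kr.
pose B := \sum_i `|f (b i)|.
have B0 : 0 <= B by apply: sumr_ge0.
have e4 : 0 < e / 3 / (1 + B) by rewrite divr_gt0// ltr_pwDl.
have /choice[N hN] (i : 'I_(projT1 (K k))) : exists n0, forall n, (n0 <= n)%N ->
    `|freq T (A k i) x n - fine (nu (A k i))| < e / 3 / (1 + B).
  by have [_ _ h] := hZ (k, val i); exact: h.
have kA (i : 'I_(projT1 (K k))) : kap @^-1` [set i] = A k i.
  by apply/seteqP; split=> y /=; [move=> <-|move=> h; apply/val_inj].
exists (\max_i N i)%N => // n /= hn.
have h1 := Ex_code_near nu cf mk hf; have h2 := Ex_code_near (empirical T n x) cf mk hf.
have h3 : `|\sum_i pr nu kap i * f (b i) - \sum_i pr (empirical T n x) kap i * f (b i)| <= e / 3.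
  rewrite -sumrB; apply: (@le_trans _ _ (\sum_i (e / 3 / (1 + B)) * `|f (b i)|)).
    apply: (le_trans (ler_norm_sum _ _ _)); apply: ler_sum => i _; rewrite -mulrBl normrM ler_wpM2r//.
    rewrite distrC /pr kA empirical_freq; apply/ltW/hN.
    by apply: leqW; apply: leq_trans hn; exact: (leq_bigmax i).
  rewrite -mulr_sumr -/B -mulrA ler_piMr ?(ltW e3)// mulrC ler_pdivrMr ?ltr_pwDl// mul1r lerDr ler01//.
by apply: (le_trans (norm_chain h1 h2 h3)); rewrite mulrC divfK.
Qed.

(** Almost every point eventually lies in the sets [empirical_in T F n], and maximal separated
    subsets of these provide the covers. *)
Lemma pfister_sullivan_compressible (eps c : R) : 0 < eps ->
  (pfister_sullivan T d nu eps < c%:E)%E -> compressible T d eps nu (c + 10).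
Proof.
move=> eps0 /ereal_inf_lt[_ [F hF <-]] /limn_esup_ltP[n0 hn0].
have [Z [mZ Z0 hZ]] := empirical_cvg.
have /choice[E_ hE] n : exists E : {fset X}, (maxn n0 1 <= n)%N -> (#|` E|%:R : R) <= expR (n%:R * c) /\
    empirical_in T F n `<=` \bigcup_(y in [set` E]) bowen_ball d T n y eps.
  have [|nn] := leqP (maxn n0 1) n; last by exists fset0.
  rewrite geq_max => /andP[n0n n1]; have /(lt_rate_exp n1) h := hn0 n n0n.
  have hb (F' : {fset X}) : [set` F'] `<=` empirical_in T F n -> separated d T n eps F' -> #|` F'|%:R <= expR (n%:R * c).
    move=> FS sF; rewrite -lee_fin; apply: le_trans (ltW h); apply: ereal_sup_ubound.
    by exists F'.
  have [||E [ES sE EC]] := @max_separated _ _ d T cd (empirical_in T F n) n eps (Num.truncn (expR (n%:R * c))).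
  - by [].
  - move=> F' FS sF; have := hb F' FS sF => h'.
    by have := truncnS_gt (expR (n%:R * c)) => /(le_lt_trans h'); rewrite ltr_nat ltnS.
  by exists E => _; split=> //; exact: hb.
pose OO n : set (borel X) := \bigcup_(y in [set` E_ n]) bowen_ball d T n y eps.
have mO n : measurable (OO n).
  by apply: borel_open; apply: bigcup_open => y _; exact: bowen_ball_open.
pose A m : set (borel X) := \bigcap_k OO (m + k)%N.
have mA m : measurable (A m) by exact: bigcapT_measurable.
have [m n0m Am] : exists2 m, (maxn n0 1 <= m)%N & (0 < nu (A m))%E.
  apply: contrapT => H.
  pose A' m := A (m + maxn n0 1)%N.
  have A0 m : nu (A' m) = 0%E.
    apply/eqP; rewrite eq_le measure_ge0 andbT leNgt; apply/negP => h; apply: H.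
    by exists (m + maxn n0 1)%N => //; exact: leq_addl.
  have ZA : nu (\bigcup_m A' m) = 0%E by apply: null_bigcup => // m; exact: mA.
  have mA' : measurable (\bigcup_m A' m : set (borel X)) by apply: bigcupT_measurable => m; exact: mA.
  have full : setT `<=` Z `|` \bigcup_m A' m.
    move=> x _; have [Zx|nZ] := pselect (Z x); [by left|right].
    have [n1 _ hn1] := weak_star_cvg (hZ x nZ) hF.
    (* The shift by one compensates the index [n - 1] in [empirical_in]. *)
    exists n1.+1 => // k _; rewrite /OO; set n := (_ + k)%N.
    have nn : (maxn n0 1 <= n)%N by rewrite /n; lia.
    apply: (hE n nn).2; rewrite /empirical_in /=; apply: hn1 => /=; rewrite /n; lia.
  have : nu (Z `|` \bigcup_m A' m) = 0%E by exact: null_setU.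
  have h : (nu setT <= nu (Z `|` \bigcup_m A' m))%E by apply: le_measure; rewrite ?inE//; exact: measurableU.
  by move=> z; move: h; rewrite z mu_setT lee_fin ler10.
have Af := mu_fin nu (mA m).
apply: (compressible_of_cover cX cd cT eps0 enu (theta := fine (nu (A m)))); first by rewrite -lte_fin -Af.
move=> M0; pose n := (m + M0)%N; exists n, (E_ n); split.
- exact: leq_addl.
- by apply: (hE n _).1; rewrite /n; apply: leq_trans n0m _; exact: leq_addr.
- rewrite -Af; apply: le_measure; rewrite ?inE//.
    by apply: borel_open; apply: bigcup_open => y _; exact: bowen_ball_open.
  move=> x /(_ M0 Logic.I)[y yE xy]; exists y => //; apply: lt_trans xy _.
  by rewrite mulrDl mul1r ltrDl.
Qed.

End pfister_sullivan.

(** * Block codes from markers *)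

Section formula.
Context {R : realType} {X : Type} (T S : X -> X).
Hypotheses (TK : cancel T S) (SK : cancel S T).

Lemma iterTS n x : iter n T (iter n S x) = x.
Proof. by elim: n x => [//|n IH] x; rewrite iterSr /= SK IH. Qed.

Lemma iterST n x : iter n S (iter n T x) = x.
Proof. by elim: n x => [//|n IH] x; rewrite iterSr /= TK IH. Qed.

Lemma iterST_le n m x : (n <= m)%N -> iter n S (iter m T x) = iter (m - n) T x.
Proof. by move=> nm; rewrite -{1}(subnKC nm) iterD iterST. Qed.

Lemma iterTS_le n m x : (n <= m)%N -> iter n T (iter m S x) = iter (m - n) S x.
Proof. by move=> nm; rewrite -{1}(subnKC nm) iterD iterTS. Qed.

Lemma iterST_ge n m x : (m <= n)%N -> iter n S (iter m T x) = iter (n - m) S x.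
Proof. by move=> mn; rewrite -{1}(subnK mn) iterD iterST. Qed.

Variables (N K p : nat) (Vi : nat -> nat -> nat).
Hypothesis N0 : (0 < N)%N.

Section defs.
Variables (w : X -> R) (rho : nat -> X -> R).

(* A marker at [z] claims the times from [0] to [K w(z)] after it and launches a block of length [N] every [N] steps;
   [block_weight i z] is the weight of the [i]-th one, and vanishes if a later marker claims part of it. *)
Definition block_weight (i : nat) (z : X) : R :=
  Num.min (clamp (K%:R * w z - (i * N + N)%:R))
    (clamp (1 - \big[Num.max/0]_(j < i * N + N | (0 < j)%N) (K%:R * w (iter j T z) - (i * N - j)%:R))).

Definition reach := (K.+1 * N)%N.
(** With a marker [tau] steps back, the current point is at offset [tau %% N] in block number
    [tau %/ N]. *)
Definition block_weight_at (tau : nat) (x : X) : R := block_weight (tau %/ N) (iter tau S x).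
Definition max_weight (x : X) : R := \big[Num.max/0]_(tau < reach) block_weight_at tau x.
Definition cover_value (i v : nat) (y : X) : R := \big[Num.max/0]_(a < p | Vi a i == v) rho a y.
(** At every point [clamp (2 b)] for some block weight [b], or else [clamp (2 - 2 max_weight)],
    equals 1, so some value of the code is 1. Where a block has weight 1 the default term vanishes
    and only the start of the block is read. *)
Definition block_code (x : X) (v : nat) : R :=
  Num.max (\big[Num.max/0]_(tau < reach) Num.min (clamp (2 * block_weight_at tau x)) (cover_value (tau %% N) v (iter (tau %% N) S x)))
    (Num.min (clamp (2 - 2 * max_weight x)) (cover_value 0 v x)).

Definition block_start (s : X) : Prop := exists2 i, (i <= K)%N & block_weight i (iter (i * N) S s) = 1.

Lemma block_weight_le1 i z : block_weight i z <= 1.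
Proof. by rewrite /block_weight ge_min clamp_le1. Qed.

Lemma max_weight_itv x : 0 <= max_weight x <= 1.
Proof.
by rewrite bigmax_ge0/=; apply: bigmax_le => // tau _; exact: block_weight_le1.
Qed.

Hypotheses (w01 : forall x, 0 <= w x <= 1) (rho01 : forall a x, 0 <= rho a x <= 1).

Lemma cover_value_itv i v y : 0 <= cover_value i v y <= 1.
Proof.
by rewrite bigmax_ge0/=; apply: bigmax_le => // a _; case/andP: (rho01 a y).
Qed.

Lemma block_code_itv x v : 0 <= block_code x v <= 1.
Proof.
apply/andP; split; first by rewrite /block_code le_max bigmax_ge0.
rewrite /block_code ge_max ge_min clamp_le1 andbT; apply: bigmax_le => // tau _.
by rewrite ge_min clamp_le1.
Qed.

Lemma block_code_full x :
  (forall y, exists2 a, (a < p)%N & rho a y = 1) ->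
  exists a i, [/\ (a < p)%N, (i < N)%N & block_code x (Vi a i) = 1].
Proof.
move=> full.
have rr1 a i y : (a < p)%N -> rho a y = 1 -> cover_value i (Vi a i) y = 1.
  move=> ap h; apply/le_anti/andP; split; first by case/andP: (cover_value_itv i (Vi a i) y).
  rewrite -h; exact: (@le_bigmax_cond _ _ _ _ (Ordinal ap) (fun b : 'I_p => Vi b i == Vi a i) (fun a : 'I_p => rho a y) (eqxx _)).
have [t2|t2] := leP (2^-1) (max_weight x).
  have [tau htau] : exists tau : 'I_reach, 2^-1 <= block_weight_at tau x.
    apply: contrapT => H; move: t2; rewrite leNgt => /negP; apply.
    apply: bigmax_lt => [|tau _]; first by rewrite invr_gt0.
    by rewrite ltNge; apply/negP => h; apply: H; exists tau.
  have [a ap ha] := full (iter (tau %% N) S x).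
  exists a, (tau %% N)%N; split=> //; first exact: ltn_pmod.
  apply/le_anti/andP; split; first by case/andP: (block_code_itv x (Vi a (tau %% N)%N)).
  rewrite le_max; apply/orP; left.
  apply: le_trans (le_bigmax _ _ tau); rewrite le_min rr1// lexx andbT clamp_ge1//.
  by rewrite -ler_pdivrMl// mulr1.
have [a ap ha] := full x; exists a, 0%N; split=> //.
apply/le_anti/andP; split; first by case/andP: (block_code_itv x (Vi a 0%N)).
rewrite le_max; apply/orP; right; rewrite le_min rr1// lexx andbT clamp_ge1//.
by rewrite lerBrDl -lerBrDr; move: t2; lra.
Qed.

Lemma block_code_supp x v : 0 < block_code x v -> exists a i, [/\ (a < p)%N, (i < N)%N, Vi a i = v & 0 < rho a (iter i S x)].
Proof.
have rrs i y : 0 < cover_value i v y -> exists2 a, (a < p)%N & Vi a i = v /\ 0 < rho a y.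
  by move=> /(@bigmax_gt0P R _ _ _ _ 0 (lexx 0))[a [_ /eqP e h]]; exists (val a); first exact: ltn_ord.
rewrite /block_code lt_max => /orP[|].
  move=> /(@bigmax_gt0P R _ _ _ _ 0 (lexx 0))[tau [_ _]]; rewrite lt_min => /andP[_ /rrs[a ap [e h]]].
  by exists a, (tau %% N)%N; split=> //; exact: ltn_pmod.
by rewrite lt_min => /andP[_ /rrs[a ap [e h]]]; exists a, 0%N.
Qed.

Lemma block_weight_gt0 i z : 0 < block_weight i z -> (i * N + N)%:R < K%:R * w z /\
  forall j, (0 < j < i * N + N)%N -> K%:R * w (iter j T z) < 1 + (i * N - j)%:R.
Proof.
rewrite /block_weight lt_min => /andP[/clamp_gt0 h1 /clamp_gt0 h2]; split; first by rewrite -subr_gt0.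
move=> j /andP[j0 jN]; rewrite -ltrBlDr; move: h2; rewrite subr_gt0; apply: le_lt_trans.
exact: (@le_bigmax_cond _ _ _ _ (Ordinal jN) (fun j : 'I__ => 0 < j)%N (fun j : 'I__ => K%:R * w (iter j T z) - (i * N - j)%:R) j0).
Qed.

(** For one marker, blocks are consecutive. For two markers, an overlap would need the claim of the
    later one to reach beyond the start of the block of the earlier one, which the second factor of
    [block_weight] forbids. *)
Lemma blocks_disjoint i z i' k : 0 < block_weight i z -> 0 < block_weight i' (iter k T z) ->
  (i * N < k + i' * N + N)%N -> (k + i' * N < i * N + N)%N -> (k + i' * N = i * N)%N.
Proof.
move=> h h'; case: k h' => [|k] h' l1 l2.
  rewrite add0n in l1 l2 *; rewrite -mulSnr in l1; rewrite -mulSnr in l2.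
  rewrite !ltn_mul2r N0/= !ltnS in l1 l2; congr (_ * _)%N; apply/eqP; rewrite eqn_leq l2 l1//.
exfalso; have [_ H] := block_weight_gt0 h; have [H' _] := block_weight_gt0 h'.
have kN : (0 < k.+1 < i * N + N)%N by apply/andP; split=> //; exact: leq_ltn_trans (leq_addr _ _) l2.
have := lt_trans H' (H _ kN); rewrite -[1 + _]/(1%:R + _) -natrD ltr_nat; lia.
Qed.

(** Every block of positive weight through this point has the same start, so all surviving terms of
    the maximum read the same point [s] at the same offset [i]. *)
Lemma block_code_start s i v : block_start s -> (i < N)%N -> block_code (iter i T s) v = cover_value i v s.
Proof.
move=> [i0 i0K h0] iN; set x := iter i T s.
have tau0 : (i0 * N + i < reach)%N.
  by apply: (@leq_trans (i0 * N + N)); rewrite ?ltn_add2l// -mulSnr leq_mul2r orbC ltnS i0K.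
have b0 : block_weight_at (i0 * N + i) x = 1.
  by rewrite /block_weight_at divnMDl// divn_small// addn0 iterD iterST.
have md : ((i0 * N + i) %% N = i)%N by rewrite modnMDl modn_small.
have t1 : max_weight x = 1.
  apply/le_anti/andP; split; first by case/andP: (max_weight_itv x).
  by rewrite -b0; exact: (le_bigmax _ (fun tau : 'I_reach => block_weight_at tau x) (Ordinal tau0)).
apply/le_anti/andP; split; last first.
  rewrite le_max; apply/orP; left.
  apply: le_trans (le_bigmax _ _ (Ordinal tau0)) => /=; rewrite b0 md iterST.
  by rewrite le_min lexx andbT clamp_ge1 ?mulr1 ?ler1n//; case/andP: (cover_value_itv i v s).
have r0 : 0 <= cover_value i v s by case/andP: (cover_value_itv i v s).
rewrite /block_code ge_max; apply/andP; split; last first.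
  by rewrite t1 mulr1 subrr clamp_le0// ge_min r0.
apply: bigmax_le => // tau _; rewrite ge_min.
have [b1|b1] := ltP 0 (block_weight_at tau x); last by rewrite clamp_le0 ?r0// mulr_ge0_le0.
apply/orP; right; suff -> : (tau %% N = i)%N by rewrite iterST.
have e1 : iter tau S x = iter (tau %/ N * N) S (iter (tau %% N) S x).
  by rewrite -iterD -divn_eq.
have h0' : 0 < block_weight i0 (iter (i0 * N + i) S x) by rewrite iterD iterST h0.
have b1' : 0 < block_weight (tau %/ N) (iter tau S x) by [].
have td := divn_eq tau N; have tm := ltn_pmod tau N0.
have [le|/ltnW le] := leqP tau (i0 * N + i).
  have e2 : iter tau S x = iter (i0 * N + i - tau) T (iter (i0 * N + i) S x).
    by rewrite iterTS_le ?leq_subr// subKn.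
  rewrite e2 in b1'.
  by have := blocks_disjoint h0' b1' _ _; lia.
have e2 : iter (i0 * N + i) S x = iter (tau - (i0 * N + i)) T (iter tau S x).
  by rewrite iterTS_le ?leq_subr// subKn.
rewrite e2 in h0'.
by have := blocks_disjoint b1' h0' _ _; lia.
Qed.

Lemma block_start_disjoint s l : block_start s -> block_start (iter l T s) -> (l < N)%N -> l = 0%N.
Proof.
move=> [i iK h] [i' i'K h'] lN.
have h0 : 0 < block_weight i (iter (i * N) S s) by rewrite h.
have h0' : 0 < block_weight i' (iter (i' * N) S (iter l T s)) by rewrite h'.
have [le|/ltnW le] := leqP (i' * N) (i * N + l).
  have e : iter (i' * N) S (iter l T s) = iter (i * N + l - i' * N) T (iter (i * N) S s).
    have [c|/ltnW c] := leqP (i' * N) l.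
      by rewrite iterST_le// (_ : i * N + l - i' * N = (l - i' * N) + i * N)%N; [rewrite iterD iterTS|lia].
    rewrite iterST_ge// iterTS_le; last by lia.
    by congr (iter _ S s); lia.
  rewrite e in h0'; have := blocks_disjoint h0 h0' _ _; lia.
have e : iter (i * N) S s = iter (i' * N - (i * N + l)) T (iter (i' * N) S (iter l T s)).
  rewrite (iterST_ge s (_ : l <= i' * N)%N); last by lia.
  by rewrite iterTS_le; [congr (iter _ S s); lia|lia].
rewrite e in h0; have := blocks_disjoint h0' h0 _ _; lia.
Qed.

Definition wasted x := forall i, (i < N)%N -> ~ block_start (iter i S x).

(** Take the last marker [j] up to [u] whose claim contains [u]. Its block through [u] is not full:
    either the claim of [j] ends near that block, or a later marker [j'] claims part of it, and by
    maximality [j'] comes after [u] or its claim has ended by then. So wasted times lie near markers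
    or near ends of claims. *)
Lemma wasted_marker y u : (forall x, exists2 i, (i < K)%N & w (iter i S x) = 1) -> (K <= u)%N ->
  wasted (iter u T y) -> exists2 u', 0 < w (iter u' T y) &
   (u < u' < u + N)%N \/ let f := Num.truncn (K%:R * w (iter u' T y)) in
     [/\ (u' < u + N)%N, (u <= u' + f + N)%N & (u' + f <= u + N.+1)%N].
Proof.
move=> core Ku wst.
have kw x : 0 <= K%:R * w x by rewrite mulr_ge0//; case/andP: (w01 x).
pose P j := (j <= u)%N && ((u - j)%:R < K%:R * w (iter j T y)).
have P0 : exists j, P j.
  have [i iK hi] := core (iter u T y).
  have iu : (i <= u)%N by apply: ltnW; exact: leq_trans Ku.
  exists (u - i)%N; rewrite /P leq_subr/= subKn// -(iterST_le _ iu) hi mulr1 ltr_nat//.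
have Pb j : P j -> (j <= u)%N by case/andP.
case: (ex_maxnP P0 Pb) => j /andP[ju hj] jmax.
pose i := ((u - j) %/ N)%N.
have iN : (i * N <= u - j)%N by exact: leq_trunc_div.
have uN : (u - j < i * N + N)%N by rewrite -mulSnr -ltn_divLR.
have uK : (u - j < K)%N.
  rewrite -(ltr_nat R); apply: (lt_le_trans hj); rewrite ler_piMr//; by case/andP: (w01 (iter j T y)).
have iK : (i <= K)%N.
  by apply: leq_trans (ltnW uK); apply: leq_div.
have ns : ~ block_start (iter (j + i * N) T y).
  have h := wst (u - (j + i * N))%N; rewrite iterST_le in h; last by lia.
  by rewrite subKn in h; [apply: h; lia|lia].
have nb : block_weight i (iter j T y) != 1.
  apply/negP => /eqP e; apply: ns; exists i => //.
  by rewrite addnC iterD iterST.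
have [h1|h1] := ltP (K%:R * w (iter j T y) - (i * N + N)%:R) 1.
  exists j; first by have := le_lt_trans (ler0n R (u - j)) hj; rewrite pmulr_rgt0// ltr0n; lia.
  right => /=; have f1 : (Num.truncn (K%:R * w (iter j T y)) < i * N + N + 1)%N.
    rewrite -(ltr_nat R) natrD; apply: le_lt_trans (_ : K%:R * w (iter j T y) < _); last by move: h1; rewrite ltrBlDl.
    by rewrite truncn_le.
  have f2 : (u - j <= Num.truncn (K%:R * w (iter j T y)))%N by rewrite -ltnS -(ltr_nat R) (lt_trans hj)// truncnS_gt.
  by move: f1 f2; move: (Num.truncn _) => f f1 f2; split; lia.
have [j' j'0 hj'] : exists2 j', (0 < j' < i * N + N)%N & (i * N - j')%:R < K%:R * w (iter (j + j') T y).
  apply: contrapT => H; move/negP: nb; apply; rewrite /block_weight clamp_ge1//.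
  rewrite [X in clamp (1 - X)](_ : _ = 0) ?subr0 ?clamp_ge1 ?minxx//.
  apply/le_anti/andP; split; last exact: bigmax_ge0.
  apply: bigmax_le => // l l0; rewrite subr_le0 leNgt; apply/negP => h; apply: H; exists l => //.
    by rewrite l0 ltn_ord.
  by rewrite (addnC j (nat_of_ord l)) iterD.
exists (j + j')%N; first by have := le_lt_trans (ler0n R _) hj'; rewrite pmulr_rgt0// ltr0n; lia.
have [lt|ge] := ltnP u (j + j'); first by left; lia.
right => /=; have nP : ~ P (j + j')%N by move=> /jmax; lia.
have f1 : (Num.truncn (K%:R * w (iter (j + j') T y)) <= u - (j + j'))%N.
  rewrite -(ler_nat R); apply: le_trans (_ : K%:R * w (iter (j + j') T y) <= _); first by rewrite truncn_le.
  by rewrite leNgt; apply/negP => h; apply: nP; rewrite /P ge.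
have f2 : (i * N - j' <= Num.truncn (K%:R * w (iter (j + j') T y)))%N by rewrite -ltnS -(ltr_nat R) (lt_trans hj')// truncnS_gt.
by move: f1 f2; move: (Num.truncn _) => f f1 f2; split; lia.
Qed.

End defs.

(** Only values in a window of size [reach] enter, through maxima, minima and clamps, none of which
    expands; the factor comes from [K w] and from the 2 before the weights. *)
Lemma block_code_near (w w' : X -> R) (rho rho' : nat -> X -> R) x x' v e : (1 <= K)%N ->
  (forall a x, 0 <= rho a x <= 1) -> (forall a x, 0 <= rho' a x <= 1) ->
  (forall t j, (t <= reach)%N -> (j <= reach)%N -> `|w (iter j T (iter t S x)) - w' (iter j T (iter t S x'))| <= e) ->
  (forall a t, (a < p)%N -> (t <= reach)%N -> `|rho a (iter t S x) - rho' a (iter t S x')| <= e) ->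
  `|block_code w rho x v - block_code w' rho' x' v| <= 2 * K%:R * e.
Proof.
move=> K1 r01 r01' hw hr.
have e0 : 0 <= e by apply: le_trans (hw 0%N 0%N isT isT).
have KR : 1 <= K%:R :> R by rewrite ler1n.
have Ke : e <= K%:R * e by rewrite ler_peMl.
have Ke2 : K%:R * e <= 2 * K%:R * e by rewrite -mulrA ler_peMl ?mulr_ge0// ler1n.
have nb (t : 'I_reach) : `|block_weight_at w t x - block_weight_at w' t x'| <= K%:R * e.
  have tN : (t %/ N * N + N <= reach)%N.
    by rewrite -mulSnr leq_mul2r ltn_divLR// ltn_ord orbT.
  have tT : (t <= reach)%N by exact: ltnW.
  apply: min_near; apply: clamp_near.
    rewrite (_ : _ - _ = K%:R * (w (iter t S x) - w' (iter t S x'))); last by ring.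
    by rewrite normrM ger0_norm// ler_wpM2l// (hw t 0%N).
  rewrite opprB addrC addrA subrK distrC; apply: bigmax_near; first by rewrite mulr_ge0.
  move=> j _; rewrite (_ : _ - _ - _ = K%:R * (w (iter j T (iter t S x)) - w' (iter j T (iter t S x')))); last by ring.
  rewrite normrM ger0_norm// ler_wpM2l//.
  by apply: hw => //; apply: ltnW; exact: leq_trans tN.
have nt : `|max_weight w x - max_weight w' x'| <= K%:R * e by apply: bigmax_near => [|t _]; rewrite ?mulr_ge0.
have nr i t : (t <= reach)%N -> `|cover_value rho i v (iter t S x) - cover_value rho' i v (iter t S x')| <= 2 * K%:R * e.
  move=> tT; apply: bigmax_near => [|a _]; first by rewrite !mulr_ge0.
  by apply: (le_trans (hr a t (ltn_ord a) tT)); exact: le_trans Ke Ke2.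
apply: max_near.
  apply: bigmax_near => [|t _]; first by rewrite !mulr_ge0.
  apply: min_near; last first.
    by apply: nr; apply: (leq_trans (leq_mod _ _)); exact: ltnW.
  by apply: clamp_near; rewrite -mulrBr normrM ger0_norm// -mulrA ler_wpM2l.
apply: min_near; last exact: (nr 0%N 0%N).
apply: clamp_near; rewrite (_ : _ - _ = 2 * (max_weight w' x' - max_weight w x)); last by ring.
by rewrite normrM ger0_norm// -mulrA ler_wpM2l// distrC.
Qed.

End formula.

(** * Counting the words of a block code *)

Section parse.
Variables (A : eqType) (B : seq (seq A)).

(** The number bounds the letters lying outside blocks of [B]; the slack allowed in [parse_nil]
    makes the relation monotone in it. *)
Inductive parse : nat -> seq A -> Prop :=
| parse_nil s : parse s [::]
| parse_block s b w : b \in B -> parse s w -> parse s (b ++ w)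
| parse_single s a w : parse s w -> parse s.+1 (a :: w).

Lemma parse_le s s' w : parse s w -> (s <= s')%N -> parse s' w.
Proof.
move=> h; elim: h s' => [s0 s' _|s0 b w' bB _ IH s' le|s0 a w' _ IH [|s']// le].
- exact: parse_nil.
- by apply: parse_block => //; exact: IH.
- by apply: parse_single; exact: IH.
Qed.

Lemma parse_singles s u w : parse s w -> parse (size u + s) (u ++ w).
Proof. by move=> h; elim: u => [//|a u IH] /=; rewrite addSn; exact: parse_single. Qed.

End parse.

(** The first piece is a block or a single letter; the factors 2 in the hypotheses pay for this
    choice at every piece. *)
Lemma parse_count (R : realType) (A : finType) (B : seq (seq A)) (N : nat) (a b : R) : (0 < N)%N ->
  (forall w, w \in B -> size w = N) -> 0 <= a -> 0 <= b ->
  2 * (size B)%:R <= expR (a * N%:R) -> 2 * #|A|%:R <= expR b ->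
  forall n s, exists ws : seq (seq A), (size ws)%:R <= expR (a * n%:R + b * s%:R) /\
    forall w, size w = n -> parse B s w -> w \in ws.
Proof.
move=> N0 hB a0 b0 hb hA; elim/ltn_ind => -[|n] IH s.
  exists [:: [::]]; split; last by move=> w /size0nil ->.
  by rewrite mulr0 add0r -expR0 ler_expR mulr_ge0.
have [ws1 [h1 H1]] : exists ws : seq (seq A), 2 * (size ws)%:R <= expR (a * n.+1%:R + b * s%:R) /\
    forall u w, size (u ++ w) = n.+1 -> u \in B -> parse B s w -> u ++ w \in ws.
  have [nN|Nn] := ltnP n.+1 N.
    exists [::]; split; first by rewrite mulr0 expR_ge0.
    by move=> u w; rewrite size_cat => + /hB uN _; rewrite uN; lia.
  have [ws [h H]] := IH (n.+1 - N)%N ltac:(lia) s.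
  exists [seq u ++ w | u <- B, w <- ws]; split; last first.
    move=> u w; rewrite size_cat => sz uB pw; apply/allpairsP; exists (u, w) => /=; split => //.
    by apply: H => //; have := hB _ uB; lia.
  rewrite size_allpairs natrM mulrA; apply: (le_trans (ler_pM (mulr_ge0 _ _) _ hb h)) => //.
  rewrite -expRD ler_expR natrB//; lra.
have [ws2 [h2 H2]] : exists ws : seq (seq A), 2 * (size ws)%:R <= expR (a * n.+1%:R + b * s%:R) /\
    forall c w s', size (c :: w) = n.+1 -> parse B s' w -> s = s'.+1 -> c :: w \in ws.
  case: s {ws1 h1 H1} => [|s]; first by exists [::]; split; [rewrite mulr0 expR_ge0|].
  have [ws [h H]] := IH n (ltnSn n) s.
  exists [seq c :: w | c <- enum A, w <- ws]; split; last first.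
    move=> c w s' [sz] pw [e]; apply/allpairsP; exists (c, w) => /=; split => //; first by rewrite mem_enum.
    by apply: H => //; rewrite e.
  rewrite size_allpairs natrM -cardE mulrA; apply: (le_trans (ler_pM (mulr_ge0 _ _) _ hA h)) => //.
  rewrite -expRD ler_expR -!natr1; lra.
exists (ws1 ++ ws2); split; first by rewrite size_cat natrD; lra.
move=> w sz pw; rewrite mem_cat; case: pw sz => [//|s0 u w' uB pw sz|s0 c w' pw sz] in H1 H2 *.
  by rewrite H1.
by rewrite (H2 _ _ _ sz pw) ?orbT.
Qed.

Section orbit_parse.
Context {X : Type} (T S : X -> X) (TK : cancel T S) (SK : cancel S T).
Context {A : eqType} (g : X -> A) (G : X -> Prop) (N : nat) (B : seq (seq A)).

Definition word (n : nat) (y : X) : seq A := [seq g (iter i T y) | i <- iota 0 n].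

Hypotheses (N0 : (0 < N)%N)
  (Gd : forall s l, G s -> G (iter l T s) -> (l < N)%N -> l = 0%N)
  (GB : forall s, G s -> word N s \in B).

Lemma word_cat m n y : word (m + n) y = word m y ++ word n (iter m T y).
Proof.
rewrite /word iotaD map_cat add0n -{2}(addn0 m) iotaDl -map_comp; congr (_ ++ _).
by apply: eq_map => i /=; rewrite addnC iterD.
Qed.

Lemma size_word n y : size (word n y) = n.
Proof. by rewrite size_map size_iota. Qed.

Definition waste (n : nat) (y : X) : nat :=
  count (fun t => `[< forall i, (i < N)%N -> ~ G (iter i S (iter t T y)) >]) (iota 0 n).

Lemma waste_cat m n y : waste (m + n) y = (waste m y + waste n (iter m T y))%N.
Proof.
rewrite /waste iotaD count_cat add0n -{2}(addn0 m) iotaDl count_map; congr (_ + _)%N.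
by apply: eq_count => i /=; rewrite (addnC m) iterD.
Qed.

(** Times in no full block become single letters, and at most [N] more come from a last block cut by
    the end of the word. *)
Lemma parse_boundary n y : (forall l, (0 < l < N)%N -> ~ G (iter l S y)) ->
  parse B (waste n y + N) (word n y).
Proof.
elim/ltn_ind: n y => n IH y inner.
have short : (n < N)%N -> parse B (waste n y + N) (word n y).
  move=> nN; rewrite -[word n y]cats0; apply: (@parse_le _ _ (size (word n y) + 0)).
    by apply: parse_singles; exact: parse_nil.
  by rewrite size_word; lia.
have [//|Nn] := ltnP n N.
have [Gy|nG] := pselect (G y).
  rewrite -(subnKC Nn) word_cat waste_cat; apply: parse_block; first exact: GB.
  apply: (@parse_le _ _ (waste (n - N) (iter N T y) + N)); last by lia.
  apply: IH; first by lia.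
  move=> l lN; rewrite (iterST_le TK); last by lia.
  by move=> G2; have := Gd Gy G2; lia.
have wy : waste n y = (waste n.-1 (T y)).+1.
  rewrite -{1}(prednK (leq_trans N0 Nn)) -(add1n n.-1) waste_cat -[RHS]add1n; congr (_ + _)%N.
  rewrite /waste /= addn0; suff -> : `[< forall i, (i < N)%N -> ~ G (iter i S y) >] by [].
  by apply/asboolP => -[//|i] iN; apply: inner.
rewrite wy -{2}(prednK (leq_trans N0 Nn)) -(add1n n.-1) word_cat /= addSn; apply: parse_single.
apply: IH; first by lia.
move=> [//|l] lN; rewrite iterSr TK; case: l lN => [//|l] lN; apply: inner; lia.
Qed.

(** A first block cut by the beginning of the word costs a further [N] letters. *)
Lemma parse_word n y : parse B (waste n y + 2 * N) (word n y).
Proof.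
have [[l lN Gl]|H] := pselect (exists2 l, (0 < l < N)%N & G (iter l S y)); last first.
  apply: (@parse_le _ _ (waste n y + N)); last by lia.
  by apply: parse_boundary => l lN Gl; apply: H; exists l.
have [lt|ge] := ltnP n (N - l).
  rewrite -[word n y]cats0; apply: (@parse_le _ _ (size (word n y) + 0)).
    by apply: parse_singles; exact: parse_nil.
  by rewrite size_word; lia.
rewrite -(subnKC ge) word_cat waste_cat.
apply: (@parse_le _ _ (size (word (N - l) y) + (waste (n - (N - l)) (iter (N - l) T y) + N))).
  apply: parse_singles; apply: parse_boundary => k kN.
  have -> : iter (N - l) T y = iter N T (iter l S y) by rewrite -(subnK (_ : l <= N)%N) ?iterD ?(iterTS SK) ?addnK//; lia.
  by rewrite (iterST_le TK); [move=> G2; have := Gd Gl G2; lia|lia].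
by rewrite size_word; lia.
Qed.

End orbit_parse.

Lemma separated_count (mk : pred nat) M n : (0 < M)%N ->
  (forall u u', mk u -> mk u' -> (u < u')%N -> (u + M <= u')%N) ->
  (count mk (iota 0 n) <= n %/ M + 1)%N.
Proof.
move=> M0 sep; rewrite -size_filter -(size_map (fun u => u %/ M)%N) -(size_iota 0 (n %/ M + 1)).
apply: uniq_leq_size.
  rewrite map_inj_in_uniq ?filter_uniq ?iota_uniq// => u u'; rewrite !mem_filter => /andP[hu _] /andP[hu' _] e.
  have H v v' : mk v -> mk v' -> (v < v')%N -> (v %/ M < v' %/ M)%N.
    by move=> hv hv' /(sep _ _ hv hv') le; apply: leq_trans (leq_div2r M le); rewrite divnDr// divnn M0 addn1.
  case: (ltngtP u u') => // lt; [have := H _ _ hu hu' lt|have := H _ _ hu' hu lt]; lia.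
move=> v /mapP[u]; rewrite mem_filter !mem_iota => /andP[_ un] ->; rewrite !add0n/= addn1 ltnS.
by apply: leq_div2r; lia.
Qed.

(** Each marker spoils [N] times before it and [2 N + 2] times around the end of its claim. *)
Lemma windows_count (P mk : pred nat) (f : nat -> nat) K M N n : (0 < M)%N ->
  (forall u u', mk u -> mk u' -> (u < u')%N -> (u + M <= u')%N) ->
  (forall u, (K <= u)%N -> P u -> exists2 u', mk u' & (u < u' < u + N)%N \/
     [/\ (u' < u + N)%N, (u <= u' + f u' + N)%N & (u' + f u' <= u + N.+1)%N]) ->
  (count P (iota 0 n) <= K + ((n + N) %/ M + 1) * (3 * N + 2))%N.
Proof.
move=> M0 sep H; set ms := seq.filter mk (iota 0 (n + N)).
pose win u' := iota (u' - N) N ++ iota (u' + f u' - N.+1) (2 * N + 2).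
have szf : size (flatten [seq win u' | u' <- ms]) = (size ms * (3 * N + 2))%N.
  elim: ms => [//|u ms IH] /=; rewrite size_cat IH size_cat !size_iota mulSn; lia.
have sm : (size ms <= (n + N) %/ M + 1)%N by rewrite size_filter; exact: separated_count.
apply: (@leq_trans (size (iota 0 K ++ flatten [seq win u' | u' <- ms]))); last first.
  by rewrite size_cat size_iota szf leq_add2l leq_mul2r sm orbT.
rewrite -size_filter; apply: uniq_leq_size; first by rewrite filter_uniq ?iota_uniq.
move=> u; rewrite mem_filter mem_iota add0n leq0n/= => /andP[Pu un].
rewrite mem_cat mem_iota add0n leq0n/=; have [//|Ku] := ltnP u K.
have [u' mu' hu'] := H u Ku Pu.
have u'n : (u' < n + N)%N by case: hu' => [|[]]; lia.
apply/flattenP; exists (win u').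
  by apply: map_f; rewrite mem_filter mu' mem_iota add0n.
rewrite mem_cat !mem_iota; case: hu' => [h|[h1 h2 h3]]; apply/orP; [left|right]; lia.
Qed.

Section quantizer.
Context {R : realType} (eta : R).
Hypothesis e0 : 0 < eta.

(* The level [0] is reserved for the value [0], so that codes see supports. *)
Definition quant (t : R) : nat := if t <= 0 then 0%N else (Num.truncn (t / eta)).+1.

Definition levels : nat := (Num.truncn eta^-1).+1.

Lemma quant_le t t' : t <= t' -> (quant t <= quant t')%N.
Proof.
move=> tt; rewrite /quant; case: (leP t 0) => // t0; rewrite leNgt (lt_le_trans t0 tt) /= ltnS.
by apply: le_truncn; rewrite ler_pM2r ?invr_gt0.
Qed.

(** Commuting with maxima, quantisation passes through [cover_value]: the quantised word of a block
    depends only on quantised values at its start. *)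
Lemma quant_max : {morph quant : x y / Num.max x y >-> maxn x y}.
Proof.
move=> x y; have [xy|yx] := leP x y; first by apply/esym/maxn_idPr; exact: quant_le.
by apply/esym/maxn_idPl; apply: quant_le; exact: ltW.
Qed.

Lemma quant0 : quant 0 = 0%N. Proof. by rewrite /quant lexx. Qed.

Lemma quant_gt0 t : (quant t == 0)%N = (t <= 0).
Proof. by rewrite /quant; case: ifP. Qed.

Lemma quant_levels t : t <= 1 -> (quant t <= levels)%N.
Proof.
move=> t1; rewrite /quant; case: ifP => // _; rewrite ltnS; apply: le_truncn.
by rewrite ler_pdivrMr// mulVf ?gt_eqF.
Qed.

Lemma quant_near t t' : 0 <= t -> 0 <= t' -> quant t = quant t' -> `|t - t'| <= eta.
Proof.
move=> t0 t0'; rewrite /quant.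
case: (leP t 0) => [a|a]; case: (leP t' 0) => [b|b] //.
  have -> : t = t' by lra.
  by rewrite subrr normr0 ltW.
move=> [e]; have h1 : 0 <= t / eta by rewrite divr_ge0// ltW.
have h2 : 0 <= t' / eta by rewrite divr_ge0// ltW.
have := truncn_itv h1; have := truncn_itv h2; rewrite -e -!natr1 => /andP[l1 l2] /andP[l3 l4].
have : `|t / eta - t' / eta| <= 1 by rewrite ler_norml; lra.
by rewrite -mulrBl normrM (gtr0_norm (_ : 0 < eta^-1)) ?invr_gt0// ler_pdivrMr// mul1r.
Qed.

Lemma levels_le : eta <= 1 -> levels%:R <= 2 / eta /\ levels.+1%:R <= 3 / eta.
Proof.
move=> e1; have h1 : 1 <= eta^-1 by rewrite invf_ge1.
have h : levels%:R <= eta^-1 + 1 :> R by rewrite /levels -natr1 lerD2r truncn_le// invr_ge0 ltW.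
by rewrite -natr1; split; lra.
Qed.

End quantizer.

(** Choose the support among all subsets, then one of [q] nonzero values at each of at most [r]
    places. *)
Lemma card_sparse (p q r : nat) : (0 < q)%N ->
  (#|[set c : {ffun 'I_p -> 'I_q.+1} | #|[set a | c a != ord0]| <= r]%SET|
    <= #|{set 'I_p}| * q ^ r)%N.
Proof.
move=> q0; rewrite -sum1_card (partition_big (fun c : {ffun 'I_p -> 'I_q.+1} => [set a | c a != ord0]%SET) predT)//=.
rewrite -sum_nat_const; apply: leq_sum => Z _.
have [Zr|Zr] := leqP #|Z| r; last first.
  by rewrite big1// => c; rewrite finset.inE => /andP[+ /eqP e]; rewrite e leqNgt Zr.
rewrite sum1_card; apply: (@leq_trans #|pffun_on (ord0 : 'I_q.+1) (mem Z) (predC1 (ord0 : 'I_q.+1))|).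
  apply: subset_leq_card; apply/fintype.subsetP => c; rewrite !inE => /andP[_ /eqP e].
  apply/pffun_onP; split.
    by apply/fintype.subsetP => a; rewrite inE => h; rewrite -e finset.inE.
  by move=> x /(@fintype.imageP _ _ c (mem Z)) [a]; rewrite -e /= finset.inE => ca ->.
rewrite card_pffun_on cardC1 card_ord /= cardE -cardE; apply: leq_pexp2l => //.
Qed.

Section level_count.
Context {R : realType} {X : Type} (T S : X -> X) (TK : cancel T S) (SK : cancel S T).
Variables (N K p M m r : nat) (Vi : nat -> nat -> nat) (w : X -> R) (rho : nat -> X -> R).
Hypotheses (N0 : (0 < N)%N) (M0 : (0 < M)%N)
  (w01 : forall x, 0 <= w x <= 1) (rho01 : forall a x, 0 <= rho a x <= 1)
  (sparse : forall x, (#|[set a : 'I_p | (0 < rho a x)%R]%SET| <= r)%N)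
  (sep : forall x j, 0 < w x -> 0 < w (iter j T x) -> (0 < j)%N -> (M <= j)%N)
  (core : forall x, exists2 i, (i < K)%N & w (iter i S x) = 1).

Definition qcode (F : X -> nat -> R) (eta : R) (x : X) : {ffun 'I_m -> 'I_(levels eta).+1} :=
  [ffun v : 'I_m => inord (quant eta (F x v))].

Let F := block_code T S N K p Vi w rho.

Lemma waste_le n y :
  (waste T S (block_start T S N K w) N n y <= K + ((n + N) %/ M + 1) * (3 * N + 2))%N.
Proof.
apply: (@windows_count _ (fun u => 0 < w (iter u T y)) (fun u => Num.truncn (K%:R * w (iter u T y)))) => //.
  move=> u u' h h' uu'; have := sep h (_ : 0 < w (iter (u' - u) T (iter u T y))) _.
  by rewrite -iterD subnK ?(ltnW uu')// => /(_ h'); rewrite subn_gt0 => /(_ uu'); lia.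
by move=> u Ku /asboolP wst; exact: (wasted_marker TK N0 w01 core Ku wst).
Qed.

Lemma word_count (eta : R) (a b : R) : 0 < eta -> 0 <= a -> 0 <= b ->
  2 * (#|{set 'I_p}| * levels eta ^ r)%:R <= expR (a * N%:R) ->
  2 * ((levels eta).+1 ^ m)%:R <= expR b -> forall n,
  exists ws : seq (seq {ffun 'I_m -> 'I_(levels eta).+1}),
   (size ws)%:R <= expR (a * n%:R + b * (K + ((n + N) %/ M + 1) * (3 * N + 2) + 2 * N)%:R) /\
   forall y, word T (qcode F eta) n y \in ws.
Proof.
move=> e0 a0 b0 ha hb n; set Q := levels eta.
pose Sp := [set c : {ffun 'I_p -> 'I_Q.+1} | #|[set a | c a != ord0]%SET| <= r]%SET%N.
pose bw (c : {ffun 'I_p -> 'I_Q.+1}) : seq {ffun 'I_m -> 'I_Q.+1} :=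
  [seq [ffun v : 'I_m => inord (\max_(a < p | Vi a i == v) c a)] | i <- iota 0 N].
pose B := [seq bw c | c <- enum Sp].
have szB u : u \in B -> size u = N by move=> /mapP[c _ ->]; rewrite size_map size_iota.
have hB : 2 * (size B)%:R <= expR (a * N%:R).
  apply: le_trans ha; rewrite ler_pM2l// ler_nat size_map -cardE; exact: card_sparse.
have hA : 2 * #|{ffun 'I_m -> 'I_Q.+1}|%:R <= expR b by rewrite card_ffun !card_ord.
have GB s : block_start T S N K w s -> word T (qcode F eta) N s \in B.
  move=> Gs; pose c := [ffun a : 'I_p => inord (quant eta (rho a s))] : {ffun 'I_p -> 'I_Q.+1}.
  have cE a' : c a' = quant eta (rho a' s) :> nat.
    by rewrite ffunE inordK// ltnS quant_levels//; case/andP: (rho01 a' s).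
  apply/mapP; exists c.
    rewrite mem_enum finset.inE; apply: leq_trans (sparse s); apply: subset_leq_card.
    apply/fintype.subsetP => a'; rewrite !finset.inE => h; rewrite ltNge; apply: contra h => h.
    by apply/eqP/val_inj; rewrite /= cE; apply/eqP; rewrite quant_gt0.
  rewrite /word /bw; apply/eq_in_map => i; rewrite mem_iota add0n => /andP[_ iN].
  apply/ffunP => v; rewrite !ffunE; congr inord; rewrite /F (block_code_start TK SK p Vi N0 rho01 v Gs iN) /cover_value.
  rewrite (big_morph (quant eta) (quant_max e0) (quant0 eta)).
  by apply: eq_bigr => a' _; rewrite cE.
have [ws [h1 h2]] := parse_count N0 szB a0 b0 hB hA n (K + ((n + N) %/ M + 1) * (3 * N + 2) + 2 * N).
exists ws; split => // y; apply: h2; first exact: size_word.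
apply: (parse_le (parse_word TK SK N0 _ GB n y)); last by rewrite leq_add2r waste_le.
move=> s l Gs Gs' lN; exact: (block_start_disjoint TK SK N0 Gs Gs' lN).
Qed.

(** Block words contribute [r / N] and wasted letters [m (3 N + 2) / M] to the coefficient of
    [ln (1/eta)]; the rest is independent of [eta] or negligible for long words. *)
Lemma level_count (D : R) : r%:R / N%:R + m%:R * (3 * N + 2)%:R / M%:R <= D ->
  exists2 C : R, 0 <= C & forall eta, 0 < eta <= 1 -> exists n0 : nat, forall n, (n0 <= n)%N ->
  exists ws : seq (seq {ffun 'I_m -> 'I_(levels eta).+1}),
   (size ws)%:R <= expR (n%:R * (D * ln eta^-1 + C)) /\ forall y, word T (qcode F eta) n y \in ws.
Proof.
move=> hD; set cp := #|{set 'I_p}|.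
have cp1 : (1 <= cp%:R :> R) by rewrite ler1n; apply/card_gt0P; exists finset.set0.
(* The parts independent of [eta], with at most [2 / eta] nonzero levels and [3 / eta] levels in
   all. *)
pose A0 : R := ln (2 * cp%:R) + r%:R * ln 2; pose B0 : R := ln 2 + m%:R * ln 3.
have NR : 0 < N%:R :> R by rewrite ltr0n.
have MR : 0 < M%:R :> R by rewrite ltr0n.
have A00 : 0 <= A0 by rewrite addr_ge0 ?mulr_ge0 ?ln_ge0//; lra.
have B00 : 0 <= B0 by rewrite addr_ge0 ?mulr_ge0 ?ln_ge0//; lra.
have W0 : 0 <= (3 * N + 2)%:R / M%:R :> R by rewrite divr_ge0.
exists (A0 / N%:R + B0 * ((3 * N + 2)%:R / M%:R) + 1); first by rewrite !addr_ge0 ?divr_ge0 ?mulr_ge0.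
move=> eta /andP[e0 e1]; set L := ln eta^-1.
have L0 : 0 <= L by rewrite ln_ge0// invf_ge1.
have [q1 q2] := levels_le e0 e1.
have lnq (c : R) : 0 < c -> c / eta = expR (ln c + L).
  by move=> c0; rewrite expRD !lnK// posrE ?invr_gt0.
pose a := (A0 + r%:R * L) / N%:R; pose b := B0 + m%:R * L.
have a0 : 0 <= a by rewrite divr_ge0// addr_ge0 ?mulr_ge0.
have b0 : 0 <= b by rewrite addr_ge0 ?mulr_ge0.
have ha : 2 * (cp * levels eta ^ r)%:R <= expR (a * N%:R).
  rewrite /a divfK ?gt_eqF// natrM natrX mulrA.
  rewrite (_ : A0 + _ = ln (2 * cp%:R) + (ln 2 + L) *+ r); last by rewrite /A0 -mulr_natl; ring.
  rewrite expRD lnK ?posrE; last by lra.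
  rewrite -[_ *+ r]mulr_natl expRM_natl -lnq// ler_pM2l; last by lra.
  by apply: lerXn2r => //; rewrite nnegrE// divr_ge0// ltW.
have hb : 2 * ((levels eta).+1 ^ m)%:R <= expR b.
  rewrite (_ : b = ln 2 + (ln 3 + L) *+ m); last by rewrite /b /B0 -[_ *+ m]mulr_natl; ring.
  rewrite expRD lnK ?posrE// -[_ *+ m]mulr_natl expRM_natl -lnq// ler_pM2l// natrX.
  by apply: lerXn2r => //; rewrite nnegrE// divr_ge0// ltW.
pose C0 : R := K%:R + N%:R * ((3 * N + 2)%:R / M%:R) + (3 * N + 2)%:R + 2 * N%:R.
have C00 : 0 <= C0 by rewrite !addr_ge0 ?mulr_ge0.
exists (Num.truncn (b * C0)).+1 => n nn.
have [ws [h1 h2]] := word_count e0 a0 b0 ha hb n; exists ws; split => //; apply: (le_trans h1).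
rewrite ler_expR.
have hn : b * C0 <= n%:R by apply/ltW/(lt_le_trans (truncnS_gt _)); rewrite ler_nat.
have hw : (K + ((n + N) %/ M + 1) * (3 * N + 2) + 2 * N)%:R <= C0 + n%:R * ((3 * N + 2)%:R / M%:R) :> R.
  have dv : ((n + N) %/ M)%:R <= (n%:R + N%:R) / M%:R :> R.
    by rewrite ler_pdivlMr// -natrM -natrD ler_nat leq_trunc_div.
  have dv2 : ((n + N) %/ M)%:R * (3 * N + 2)%:R <= (n%:R + N%:R) / M%:R * (3 * N + 2)%:R :> R by rewrite ler_wpM2r.
  rewrite (natrD _ (K + _)) (natrD _ K) (natrM _ _ (3 * N + 2)) (natrD _ _ 1) (natrM _ 2 N) mulrDl mul1r.
  have -> : (n%:R * ((3 * N + 2)%:R / M%:R) : R) = (n%:R + N%:R) / M%:R * (3 * N + 2)%:R - N%:R * ((3 * N + 2)%:R / M%:R) by ring.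
  by rewrite /C0; lra.
apply: (le_trans (lerD (lexx _) (ler_wpM2l b0 hw))).
have -> : a * n%:R + b * (C0 + n%:R * ((3 * N + 2)%:R / M%:R)) =
   b * C0 + n%:R * (A0 / N%:R + B0 * ((3 * N + 2)%:R / M%:R) + (r%:R / N%:R + m%:R * (3 * N + 2)%:R / M%:R) * L).
  by rewrite /a /b; ring.
have : n%:R * ((r%:R / N%:R + m%:R * (3 * N + 2)%:R / M%:R) * L) <= n%:R * (D * L).
  by rewrite ler_wpM2l// ler_wpM2r.
move: (A0 / _ + _) (_ * L) (D * L) (b * C0) n%:R hn => U V W t k hn h; rewrite !mulrDr mulr1.
by rewrite (addrC t) (addrC (k * W)) -!addrA lerD2l (addrC k) lerD.
Qed.

End level_count.

(** * Levels and their inverse limit *)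

Section continuity.
Context {R : realType} {X : topologicalType}.
Implicit Types f g : X -> R.

Lemma continuous_bigmax (I : Type) (s : seq I) (P : pred I) (F : I -> X -> R) :
  (forall i, continuous (F i)) -> continuous (fun x => \big[Num.max/0]_(i <- s | P i) F i x).
Proof. by move=> h; apply: continuous_big => // ; exact: max_continuous. Qed.

Lemma continuous_Max f g : continuous f -> continuous g -> continuous (fun x => Num.max (f x) (g x)).
Proof. by move=> cf cg x; apply: continuous_max; [exact: cf|exact: cg]. Qed.

Lemma continuous_Min f g : continuous f -> continuous g -> continuous (fun x => Num.min (f x) (g x)).
Proof. by move=> cf cg x; apply: continuous_min; [exact: cf|exact: cg]. Qed.

Lemma continuous_affine f (a b : R) : continuous f -> continuous (fun x => a + b * f x).
Proof.
move=> cf x; apply: (@continuousD _ _ _ (fun=> a) (fun x => b * f x)); first exact: cst_continuous.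
by apply: (@continuousM _ _ (fun=> b) f); [exact: cst_continuous|exact: cf].
Qed.

End continuity.

Section formula_continuity.
Context {R : realType} {X : ptopologicalType} (T S : X -> X) (cT : continuous T) (cS : continuous S).

Lemma continuous_orbit (f : X -> R) j t : continuous f -> continuous (fun x => f (iter j T (iter t S x))).
Proof.
move=> cf x; apply: (@continuous_comp _ _ _ (fun y => iter j T (iter t S y)) f); last exact: cf.
by apply: continuous_comp; exact: continuous_iter.
Qed.

Lemma block_code_cont N K p Vi (w : X -> R) (rho : nat -> X -> R) v : continuous w -> (forall a, continuous (rho a)) ->
  continuous (block_code T S N K p Vi w rho ^~ v).
Proof.
move=> cw cr.
have cb (t : nat) : continuous (block_weight_at T S N K w t).
  rewrite /block_weight_at /block_weight; apply: continuous_Min; apply: continuous_clamp.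
    rewrite (_ : (fun x => _) = (fun x => - (t %/ N * N + N)%:R + K%:R * w (iter 0 T (iter t S x)))); last first.
      by apply/funext => x; rewrite addrC.
    by apply: continuous_affine; exact: continuous_orbit.
  pose h x := \big[Num.max/0]_(j < t %/ N * N + N | (0 < j)%N) (K%:R * w (iter j T (iter t S x)) - (t %/ N * N - j)%:R).
  rewrite (_ : (fun x => _) = (fun x => 1 + -1 * h x)); last by apply/funext => x; rewrite mulN1r.
  apply: continuous_affine; apply: continuous_bigmax => j.
  rewrite (_ : (fun x => _) = (fun x => - (t %/ N * N - j)%:R + K%:R * w (iter j T (iter t S x)))); last first.
    by apply/funext => x; rewrite addrC.
  by apply: continuous_affine; exact: continuous_orbit.
have cR i t : continuous (fun x => cover_value p Vi rho i v (iter t S x)).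
  by apply: continuous_bigmax => a; exact: (@continuous_orbit _ 0 t (cr a)).
apply: continuous_Max.
  apply: continuous_bigmax => t; apply: continuous_Min => //; apply: continuous_clamp.
  rewrite (_ : (fun x => _) = (fun x => 0 + 2 * block_weight_at T S N K w t x)); last by apply/funext => x; rewrite add0r.
  exact: continuous_affine.
apply: continuous_Min; last exact: (cR 0%N 0%N).
apply: continuous_clamp.
rewrite (_ : (fun x => _) = (fun x => 2 + (-2) * max_weight T S N K w x)); last by apply/funext => x; rewrite mulNr.
by apply: continuous_affine; apply: continuous_bigmax => t.
Qed.

End formula_continuity.

Record level (R X : Type) := Level { lN : nat; lK : nat; lp : nat; lM : nat; lr : nat;
  lVi : nat -> nat -> nat; lw : X -> R; lrho : nat -> X -> R }.

Section levels.
Context {R : realType} {X : ptopologicalType} (d : X -> X -> R) (T S : X -> X).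
Hypotheses (cX : compact [set: X]) (cd : compatible_metric d) (cT : continuous T) (cS : continuous S).
Hypotheses (TK : cancel T S) (SK : cancel S T).

Record level_for (V : nat -> set X) (m : nat) (D : R) (l : level R X) : Prop := LevelFor {
  lN0 : (0 < lN l)%N;
  lK0 : (0 < lK l)%N;
  lM0 : (0 < lM l)%N;
  lw_itv : forall x, 0 <= lw l x <= 1;
  lw_cont : continuous (lw l);
  lw_sep : forall x j, 0 < lw l x -> 0 < lw l (iter j T x) -> (0 < j)%N -> (lM l <= j)%N;
  lw_core : forall x, exists2 i, (i < lK l)%N & lw l (iter i S x) = 1;
  lrho_itv : forall a x, 0 <= lrho l a x <= 1;
  lrho_cont : forall a, continuous (lrho l a);
  lrho_full : forall x, exists2 a, (a < lp l)%N & lrho l a x = 1;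
  lrho_supp : forall a x i, (a < lp l)%N -> 0 < lrho l a x -> (i < lN l)%N -> V (lVi l a i) (iter i T x);
  lVi_lt : forall a i, (a < lp l)%N -> (i < lN l)%N -> (lVi l a i < m)%N;
  lrho_sparse : forall x, (#|[set a : 'I_(lp l) | (0 < lrho l a x)%R]%SET| <= lr l)%N;
  l_rate : (lr l)%:R / (lN l)%:R + m%:R * (3 * lN l + 2)%:R / (lM l)%:R <= D }.

(** By compactness, translates of [U] by at most [R0] cover the space. The functions of a soft cover
    by these translates are all pulled back to [U], so [w] is supported in [U] and every orbit
    segment of [2 R0 + 1] points meets its value 1. *)
Lemma marker_function M : marker_property T -> (0 < M)%N -> exists (w : X -> R) (K : nat),
  [/\ (0 < K)%N, forall x, 0 <= w x <= 1, continuous w,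
    forall x j, 0 < w x -> 0 < w (iter j T x) -> (0 < j)%N -> (M <= j)%N &
    forall x, exists2 i, (i < K)%N & w (iter i S x) = 1].
Proof.
move=> mk M0; have [U [oU dU cU]] := mk M M0.
pose P (k : int) : set X := match k with Posz n => iter n S @^-1` U | Negz n => iter n.+1 T @^-1` U end.
have oP k : open (P k) by case: k => n; exact: open_iter.
have cP x : exists k, P k x.
  have : (\bigcup_(k : int) zimage T k U) x by rewrite cU.
  move=> [[n|n] _ /=]; last by exists (Negz n).
  by move=> [u Uu <-]; exists (Posz n); rewrite /P /= (iterST TK).
have [s hs] := cm_fin_cover cX oP cP.
pose R0 := \max_(k <- s) absz k.
pose W (i : 'I_(2 * R0).+1) : set X := [set x | U (iter i T (iter R0 S x))].
have oW i : open (W i).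
  have -> : W i = iter R0 S @^-1` (iter i T @^-1` U) by [].
  by apply: (open_iter cS); exact: (open_iter cT).
have cW x : exists i, W i x.
  have [k ks] := hs x; have kR : (absz k <= R0)%N by apply: (@leq_bigmax_seq _ s xpredT (fun k : int => absz k) k).
  case: k {ks} kR => n /= nR Ux.
    have lt : (R0 - n < (2 * R0).+1)%N by lia.
    by exists (Ordinal lt); rewrite /W /= (iterTS_le SK) ?leq_subr// subKn.
  have lt : (n.+1 + R0 < (2 * R0).+1)%N by move: nR; rewrite /absz; lia.
  by exists (Ordinal lt); rewrite /W /= -iterS -addSn iterD (iterTS SK).
have [f [L [L0 [f01 fL fU f1]]]] := cm_soft_cover cX cd oW cW.
have fc i : continuous (f i) by apply: (cm_lip_cont cd (L := L)) => x y; exact: fL.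
pose w y : R := \big[Num.max/0]_(i < (2 * R0).+1) f i (iter R0 T (iter i S y)).
have wU y : 0 < w y -> U y.
  by move=> /(@bigmax_gt0P R _ _ _ _ 0 (lexx 0))[i [_ _ /fU]]; rewrite /W /= (iterST TK) (iterTS SK).
exists w, (2 * R0).+1; split => //.
- by move=> y; rewrite bigmax_ge0/=; apply: bigmax_le => // i _; case/andP: (f01 i (iter R0 T (iter i S y))).
- apply: continuous_bigmax => i x.
  apply: (@continuous_comp _ _ _ (fun y => iter R0 T (iter i S y)) (f i)); last exact: fc.
  by apply: continuous_comp; exact: continuous_iter.
- move=> y j /wU Uy /wU Uj j0; rewrite leqNgt; apply/negP => jM.
  have : (U `&` (iter j T @` U)) (iter j T y) by split => //; exists y.
  by rewrite dU // j0 ltnW.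
- move=> x; have [i fi] := f1 (iter R0 S x); have iR := ltn_ord i.
  exists (2 * R0 - i)%N; first by lia.
  apply/le_anti/andP; split.
    by apply: bigmax_le => // i' _; case/andP: (f01 i' (iter R0 T (iter i' S (iter (2 * R0 - i) S x)))).
  rewrite -fi.
  suff {1}-> : iter R0 S x = iter R0 T (iter i S (iter (2 * R0 - i) S x)).
    exact: (@le_bigmax _ _ _ 0 (fun j : 'I__ => f j (iter R0 T (iter j S (iter (2 * R0 - i) S x)))) i).
  rewrite -iterD (_ : i + (2 * R0 - i) = R0 + R0)%N; last by lia.
  by rewrite (iterD R0 R0 S) (iterTS SK).
Qed.

(** [N >= 2 / g] makes the [+ 1] in the multiplicity cost at most [g / 2] per letter; then [M] is
    taken so large that wasted letters cost at most another [g / 2]. *)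
Lemma level_exists (V : nat -> set X) (m : nat) (D g : R) : marker_property T ->
  (forall v, open (V v)) -> (forall x, exists2 v, (v < m)%N & V v x) ->
  (mdim R T < D%:E)%E -> 0 <= D -> 0 < g -> exists l, level_for V m (D + g) l.
Proof.
move=> mk oV cV mD D0 g0.
pose U : {fset set X} := [fset V v | v in iota 0 m]%fset.
have UP A : A \in U -> exists2 v, (v < m)%N & A = V v.
  by move=> /imfsetP[v /=]; rewrite mem_iota add0n => /andP[_ vm] ->; exists v.
have fU : finite_open_cover U.
  split; first by move=> A /UP[v _ ->].
  apply/is_coverP => x; have [v vm Vx] := cV x; exists (V v) => //.
  by apply/imfsetP; exists v => //=; rewrite mem_iota.
have [N [Vc [NN N0 [oc cc] ref mult]]] := mdim_ltP cX cd cT (Num.truncn (2 / g)).+1 mD fU.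
have NR : 0 < N%:R :> R by rewrite ltr0n.
pose p := size Vc; pose W (a : nat) := nth set0 Vc a.
have oW (a : 'I_p) : open (W a) by apply: oc; exact: mem_nth.
have cW x : exists a : 'I_p, W a x.
  have /is_coverP/(_ x)[A AV Ax] := cc.
  have aV : (index A Vc < p)%N by rewrite index_mem.
  by exists (Ordinal aV); rewrite /W /= nth_index.
have [f [L [L0 [f01 fL fU' f1]]]] := cm_soft_cover cX cd oW cW.
have /choice[Vi hVi] : forall ai : nat * nat, exists v, (ai.1 < p)%N -> (ai.2 < N)%N ->
    (v < m)%N /\ forall x, W ai.1 x -> V v (iter ai.2 T x).
  move=> [a i] /=; have [ap|ap] := ltnP a p; last by exists 0%N.
  have [iN|iN] := ltnP i N; last by exists 0%N.
  have aV : W a \in Vc by exact: mem_nth.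
  have [B /UP[v vm ->] sub] := (refines_cover_iter T U Vc N).1 ref _ aV i iN.
  by exists v => _ _; split.
pose rho a x : R := if insub a is Some i then f (i : 'I_p) x else 0.
have rhoE (a : 'I_p) x : rho a x = f a x by rewrite /rho valK.
have rho_out a x : (p <= a)%N -> rho a x = 0 by move=> pa; rewrite /rho insubN// -leqNgt.
pose M := (Num.truncn (2 / g * (m%:R * (3 * N + 2)%:R) : R)).+1.
have MR : 0 < M%:R :> R by rewrite ltr0n.
have [w [K [K0 w01 wc wsep wcore]]] := marker_function mk (isT : (0 < M)%N).
exists (Level N K p M (Num.truncn (D * N%:R + 1)) (fun a i => Vi (a, i)) w rho).
split => //=.
- move=> a x; have [ap|pa] := ltnP a p; last by rewrite rho_out// lexx ler01.
  by have -> : rho a x = f (Ordinal ap) x by rewrite -rhoE.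
- move=> a; have [ap|pa] := ltnP a p.
    have -> : rho a = f (Ordinal ap) by apply/funext => x; rewrite -rhoE.
    by apply: (cm_lip_cont cd (L := L)) => x y; exact: fL.
  have -> : rho a = fun=> 0 by apply/funext => x; rewrite rho_out.
  exact: cst_continuous.
- by move=> x; have [a fa] := f1 x; exists a; [exact: ltn_ord|rewrite rhoE].
- move=> a x i ap; have -> : rho a x = f (Ordinal ap) x by rewrite -rhoE.
  by move=> /fU' Wa iN; have [_] := hVi (a, i) ap iN; apply.
- by move=> a i ap iN; have [] := hVi (a, i) ap iN.
- move=> x; rewrite truncn_ge_nat; last by rewrite addr_ge0// mulr_ge0.
  apply: le_trans (mult x); rewrite ler_nat -card_nth_count; apply: subset_leq_card.
  by apply/fintype.subsetP => a; rewrite !finset.inE rhoE => /fU' Wa; apply/asboolP.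
- have h1 : (Num.truncn (D * N%:R + 1))%:R <= D * N%:R + 1 by rewrite truncn_le addr_ge0// mulr_ge0.
  have h2 : (Num.truncn (D * N%:R + 1))%:R / N%:R <= D + g / 2.
    rewrite ler_pdivrMr// mulrDl; apply: (le_trans h1); rewrite lerD2l.
    have : 2 / g <= N%:R by apply/ltW/(lt_le_trans (truncnS_gt _)); rewrite ler_nat.
    by rewrite ler_pdivrMr// mulrAC ler_pdivlMr// mul1r mulrC.
  have h3 : m%:R * (3 * N + 2)%:R / M%:R <= g / 2.
    rewrite ler_pdivrMr//.
    have : 2 / g * (m%:R * (3 * N + 2)%:R) <= M%:R by apply/ltW; exact: truncnS_gt.
    by rewrite mulrAC ler_pdivrMr// mulrAC ler_pdivlMr// (mulrC 2) (mulrC g).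
  lra.
Qed.

End levels.

(** * Interpolation of a function from the values of a finer code *)

Section sharpen.
Context {R : realType} {X : Type}.

(* A function of the next level's values only, and close to [clamp (2 f - 1/2)] when [f] varies little on its cover. *)
Definition sharpen (m : nat) (c : nat -> X) (f : X -> R) (F : X -> nat -> R) (x : X) : R :=
  clamp (- 2^-1 + 2 * \big[Num.max/0]_(v < m) Num.min (f (c v)) (F x v)).

Lemma sharpen_itv m c f F x : 0 <= sharpen m c f F x <= 1.
Proof. by rewrite clamp_ge0 clamp_le1. Qed.

Lemma sharpen_near m c f F F' x x' e : 0 <= e ->
  (forall v, (v < m)%N -> `|F x v - F' x' v| <= e) ->
  `|sharpen m c f F x - sharpen m c f F' x'| <= 2 * e.
Proof.
move=> e0 h; apply: clamp_near; rewrite opprD addrACA subrr add0r -mulrBr normrM ger0_norm// ler_wpM2l//.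
by apply: bigmax_near => // v _; apply: min_near; rewrite ?subrr ?normr0// h.
Qed.

Section approximation.
Variables (m : nat) (c : nat -> X) (f : X -> R) (F : X -> nat -> R) (V : nat -> set X) (o : R).
Hypotheses (o4 : 4 * o <= 1) (f01 : forall x, 0 <= f x <= 1) (F01 : forall x v, 0 <= F x v <= 1)
  (FV : forall x v, 0 < F x v -> V v x) (F1 : forall x, exists2 v, (v < m)%N & F x v = 1)
  (osc : forall v x, (v < m)%N -> V v x -> `|f x - f (c v)| <= o).

(** Only indices with [F x v > 0] count, and for them [f (c v)] is within [o] of [f x]; an index
    with [F x v = 1] leaves [f (c v)] intact. *)
Lemma interpolation_near x : `|\big[Num.max/0]_(v < m) Num.min (f (c v)) (F x v) - f x| <= o.
Proof.
have [v vm Fv] := F1 x; have Vv : V v x by apply: FV; rewrite Fv.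
have := osc vm Vv; rewrite ler_norml => /andP[h1 h2].
rewrite ler_norml; apply/andP; split.
  rewrite lerBrDl; apply: (@le_trans _ _ (f (c v))); first by lra.
  apply: le_trans (le_bigmax _ (fun v : 'I_m => Num.min (f (c v)) (F x v)) (Ordinal vm)).
  by rewrite /= Fv le_min lexx; case/andP: (f01 (c v)).
rewrite lerBlDr; apply: bigmax_le => [|i _].
  by case/andP: (f01 x) => ? _; rewrite addr_ge0//; lra.
have [Fi|Fi] := ltP 0 (F x i); last first.
  rewrite ge_min; apply/orP; right; apply: (le_trans Fi).
  by case/andP: (f01 x) => ? _; rewrite addr_ge0//; lra.
have := osc (ltn_ord i) (FV Fi); rewrite ler_norml => /andP[h3 h4].
by rewrite ge_min; apply/orP; left; lra.
Qed.

Lemma sharpen_approx x : `|sharpen m c f F x - clamp (- 2^-1 + 2 * f x)| <= 2 * o.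
Proof.
apply: clamp_near; rewrite opprD addrACA subrr add0r -mulrBr normrM ger0_norm// ler_wpM2l//.
exact: interpolation_near.
Qed.

(** The ramp [2 z - 1/2] reaches 1 at 3/4 and 0 at 1/4, so an error [o <= 1/4] is absorbed at both
    ends. *)
Lemma sharpen_eq1 x : f x = 1 -> sharpen m c f F x = 1.
Proof.
move=> fx; have := interpolation_near x; rewrite fx ler_norml => /andP[h _].
by rewrite /sharpen clamp_ge1//; move: (\big[_/_]_(_ < _) _) h o4 => z; lra.
Qed.

Lemma sharpen_gt0 x : 0 < sharpen m c f F x -> 0 < f x.
Proof.
have := interpolation_near x; rewrite ler_norml => /andP[_ h] /clamp_gt0 h2.
by move: h h2 o4; move: (\big[_/_]_(_ < _) _) => z; lra.
Qed.

End approximation.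
End sharpen.

Section level_operator.
Context {R : realType} {X : ptopologicalType} (T S : X -> X).
Hypotheses (cT : continuous T) (cS : continuous S) (TK : cancel T S) (SK : cancel S T).

Record soft (V : nat -> set X) (m : nat) (F : X -> nat -> R) : Prop := Soft {
  soft_itv : forall x v, 0 <= F x v <= 1;
  soft_cont : forall v, continuous (F ^~ v);
  soft_supp : forall x v, 0 < F x v -> V v x;
  soft_full : forall x, exists2 v, (v < m)%N & F x v = 1 }.

(* The marker function and the soft cover of a level may be replaced by functions with smaller support
   and a larger set where they equal [1]. *)
Record tightened (f g : X -> R) : Prop := Tightened {
  tight_itv : forall x, 0 <= g x <= 1;
  tight_cont : continuous g;
  tight_gt0 : forall x, 0 < g x -> 0 < f x;
  tight_eq1 : forall x, f x = 1 -> g x = 1 }.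

Variables (V : nat -> set X) (m : nat) (D : R) (l : level R X).
Hypothesis (lvl : level_for T S V m D l).

Definition level_code (w : X -> R) (rho : nat -> X -> R) : X -> nat -> R :=
  block_code T S (lN l) (lK l) (lp l) (lVi l) w rho.

Section tightened_level.
Variables (w : X -> R) (rho : nat -> X -> R).
Hypotheses (tw : tightened (lw l) w) (tr : forall a, (a < lp l)%N -> tightened (lrho l a) (rho a))
  (rho01 : forall a x, 0 <= rho a x <= 1) (rhoc : forall a, continuous (rho a)).

Lemma level_code_soft : soft V m (level_code w rho).
Proof.
have N0 := lN0 lvl.
split.
- by move=> x v; exact: block_code_itv.
- by move=> v; apply: block_code_cont => //; exact: (tight_cont tw).
- move=> x v Fx; have [a [i [ap iN <- ra]]] := block_code_supp N0 Fx; have h := tight_gt0 (tr ap) ra.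
  by rewrite -(iterTS SK i x); exact: (lrho_supp lvl).
- move=> x; have [|a [i [ap iN h]]] := block_code_full T S (lK l) (p := lp l) (lVi l) N0 w rho01 x.
    move=> y; have [a ap ha] := lrho_full lvl y; exists a => //.
    exact: (tight_eq1 (tr ap)).
  by exists (lVi l a i) => //; exact: (lVi_lt lvl).
Qed.

(** The count depends only on supports and on places where functions equal 1, and tightening moves
    both in the favourable direction. *)
Lemma level_code_count : exists2 C : R, 0 <= C & forall eta, 0 < eta <= 1 ->
  exists n0 : nat, forall n, (n0 <= n)%N ->
  exists ws : seq (seq {ffun 'I_m -> 'I_(levels eta).+1}),
   (size ws)%:R <= expR (n%:R * (D * ln eta^-1 + C)) /\
   forall y, word T (qcode m (level_code w rho) eta) n y \in ws.
Proof.
apply: (@level_count _ _ _ _ TK SK (lN l) (lK l) (lp l) (lM l) m (lr l)) => //.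
- exact: (lN0 lvl).
- exact: (lM0 lvl).
- exact: (tight_itv tw).
- move=> x; apply: leq_trans (lrho_sparse lvl x); apply: subset_leq_card.
  by apply/fintype.subsetP => a; rewrite !finset.inE => /(tight_gt0 (tr (ltn_ord a))).
- move=> x j /(tight_gt0 tw) h /(tight_gt0 tw) h' j0; exact: (lw_sep lvl h h' j0).
- move=> x; have [i iK h] := lw_core lvl x; exists i => //; exact: (tight_eq1 tw).
- exact: (l_rate lvl).
Qed.

End tightened_level.

Lemma level_code_near (w w' : X -> R) (rho rho' : nat -> X -> R) x x' v e :
  (forall a x, 0 <= rho a x <= 1) -> (forall a x, 0 <= rho' a x <= 1) ->
  (forall t j, (t <= reach (lN l) (lK l))%N -> (j <= reach (lN l) (lK l))%N ->
     `|w (iter j T (iter t S x)) - w' (iter j T (iter t S x'))| <= e) ->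
  (forall a t, (a < lp l)%N -> (t <= reach (lN l) (lK l))%N -> `|rho a (iter t S x) - rho' a (iter t S x')| <= e) ->
  `|level_code w rho x v - level_code w' rho' x' v| <= 2 * (lK l)%:R * e.
Proof. by move=> *; apply: block_code_near => //; [exact: (lN0 lvl)|exact: (lK0 lvl)]. Qed.

Lemma tightened_clamp (f : X -> R) : (forall x, 0 <= f x <= 1) -> continuous f ->
  tightened f (fun x => clamp (- 2^-1 + 2 * f x)).
Proof.
move=> f01 cf; split.
- by move=> x; rewrite clamp_ge0 clamp_le1.
- by apply: continuous_clamp; exact: continuous_affine.
- by move=> x /clamp_gt0; lra.
- by move=> x ->; rewrite clamp_ge1//; lra.
Qed.

(** What [level_op] approaches as the oscillation on the next cover tends to 0; it starts the
    approximations. *)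
Definition level_base : X -> nat -> R :=
  level_code (fun x => clamp (- 2^-1 + 2 * lw l x)) (fun a x => clamp (- 2^-1 + 2 * lrho l a x)).

Lemma level_base_soft : soft V m level_base.
Proof.
apply: level_code_soft.
- by apply: tightened_clamp; [exact: (lw_itv lvl)|exact: (lw_cont lvl)].
- by move=> a _; apply: tightened_clamp; [exact: (lrho_itv lvl a)|exact: (lrho_cont lvl)].
- by move=> a x; rewrite clamp_ge0 clamp_le1.
- by move=> a; apply: continuous_clamp; apply: continuous_affine; exact: (lrho_cont lvl).
Qed.

Section next_level.
Variables (V' : nat -> set X) (m' : nat) (c : nat -> X).

Definition level_op (F : X -> nat -> R) : X -> nat -> R :=
  level_code (sharpen m' c (lw l) F) (fun a => sharpen m' c (lrho l a) F).

(** The factor is [2 K] from the block code times 2 from [sharpen]. *)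
Lemma level_op_near F F' x x' v e : 0 <= e ->
  (forall t j, (t <= reach (lN l) (lK l))%N -> (j <= reach (lN l) (lK l))%N -> forall v, (v < m')%N ->
     `|F (iter j T (iter t S x)) v - F' (iter j T (iter t S x')) v| <= e) ->
  `|level_op F x v - level_op F' x' v| <= 4 * (lK l)%:R * e.
Proof.
move=> e0 h; rewrite (_ : 4 * _ * e = 2 * (lK l)%:R * (2 * e)); last by ring.
apply: level_code_near => [a y|a y|t j tT jT|a t ap tT]; rewrite ?sharpen_itv//.
  by apply: sharpen_near => // v' v'm; exact: h.
by apply: sharpen_near => // v' v'm; exact: (h t 0%N).
Qed.

Variable (o : R).
Hypotheses (o4 : 4 * o <= 1)
  (osc_w : forall v x, (v < m')%N -> V' v x -> `|lw l x - lw l (c v)| <= o)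
  (osc_rho : forall a v x, (a < lp l)%N -> (v < m')%N -> V' v x -> `|lrho l a x - lrho l a (c v)| <= o).

Section soft_argument.
Variable (F : X -> nat -> R).
Hypothesis (sF : soft V' m' F).

Lemma continuous_sharpen f : continuous (sharpen m' c f F).
Proof.
apply: continuous_clamp; apply: continuous_affine; apply: continuous_bigmax => v.
by apply: continuous_Min; [exact: cst_continuous|exact: (soft_cont sF)].
Qed.

Lemma tightened_sharpen f : (forall x, 0 <= f x <= 1) ->
  (forall v x, (v < m')%N -> V' v x -> `|f x - f (c v)| <= o) -> tightened f (sharpen m' c f F).
Proof.
move=> f01 osc; split.
- by move=> x; exact: sharpen_itv.
- exact: continuous_sharpen.
- by move=> x; exact: (sharpen_gt0 o4 f01 (soft_supp sF) (soft_full sF) osc).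
- by move=> x; exact: (sharpen_eq1 o4 f01 (soft_supp sF) (soft_full sF) osc).
Qed.

Let tw : tightened (lw l) (sharpen m' c (lw l) F).
Proof. by apply: tightened_sharpen => //; exact: (lw_itv lvl). Qed.

Let tr a : (a < lp l)%N -> tightened (lrho l a) (sharpen m' c (lrho l a) F).
Proof. by move=> ap; apply: tightened_sharpen => [|v x]; [exact: (lrho_itv lvl a)|exact: osc_rho]. Qed.

Lemma level_op_soft : soft V m (level_op F).
Proof.
apply: level_code_soft => //; first by move=> a x; exact: sharpen_itv.
by move=> a; exact: continuous_sharpen.
Qed.

Lemma level_op_count : exists2 C : R, 0 <= C & forall eta, 0 < eta <= 1 ->
  exists n0 : nat, forall n, (n0 <= n)%N ->
  exists ws : seq (seq {ffun 'I_m -> 'I_(levels eta).+1}),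
   (size ws)%:R <= expR (n%:R * (D * ln eta^-1 + C)) /\
   forall y, word T (qcode m (level_op F) eta) n y \in ws.
Proof. by apply: level_code_count => // a x; exact: sharpen_itv. Qed.

Lemma level_op_base x v : `|level_op F x v - level_base x v| <= 4 * (lK l)%:R * o.
Proof.
rewrite (_ : 4 * _ * o = 2 * (lK l)%:R * (2 * o)); last by ring.
apply: level_code_near => [a y|a y|t j _ _|a t ap _]; rewrite ?sharpen_itv ?clamp_ge0 ?clamp_le1//.
  exact: (sharpen_approx (lw_itv lvl) (soft_supp sF) (soft_full sF) osc_w).
exact: (sharpen_approx (lrho_itv lvl a) (soft_supp sF) (soft_full sF) (fun v x => osc_rho ap)).
Qed.

End soft_argument.
End next_level.
End level_operator.

Section geometric_limit.
Context {R : realType} (u : nat -> R).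
Hypothesis hu : forall j, `|u j.+1 - u j| <= 2^-1 ^+ j.

Lemma geometric_limit : exists l, forall j, `|u j - l| <= 2 * 2^-1 ^+ j.
Proof.
pose a j := u j - 2 * 2^-1 ^+ j; pose b j := u j + 2 * 2^-1 ^+ j.
have e0 j : 0 <= 2^-1 ^+ j :> R by rewrite exprn_ge0.
have step j : a j <= a j.+1 /\ b j.+1 <= b j.
  have := hu j; rewrite ler_norml /a /b exprS; move: (2^-1 ^+ j) => z; lra.
have am i j : (i <= j)%N -> a i <= a j.
  by elim: j => [|j IH]; [rewrite leqn0 => /eqP ->|rewrite leq_eqVlt => /predU1P[->//|/IH h]; apply: (le_trans h); case: (step j)].
have bmono i j : (i <= j)%N -> b j <= b i.
  by elim: j => [|j IH]; [rewrite leqn0 => /eqP ->|rewrite leq_eqVlt => /predU1P[->//|/IH h]; apply: le_trans h; case: (step j)].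
have ab i j : a i <= b j.
  apply: (le_trans (am _ _ (leq_maxl i j))); apply: le_trans (bmono _ _ (leq_maxr i j)).
  by rewrite /a /b; have := e0 (maxn i j); lra.
have hs : has_sup (range a) by split; [exists (a 0%N), 0%N|exists (b 0%N) => _ [i _ <-]].
exists (sup (range a)) => j.
have h1 : a j <= sup (range a) by apply: (ub_le_sup hs.2); exists j.
have h2 : sup (range a) <= b j by apply: (ge_sup hs.1) => _ [i _ <-].
by rewrite ler_norml; move: h1 h2; rewrite /a /b; lra.
Qed.

End geometric_limit.

(** * The tower of codes *)

Section tower.
Context {R : realType} {X : ptopologicalType} (d : X -> X -> R) (T S : X -> X).
Hypotheses (cX : compact [set: X]) (cd : compatible_metric d) (cT : continuous T) (cS : continuous S).
Hypotheses (TK : cancel T S) (SK : cancel S T) (mk : marker_property T).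
Variable D : R.
Hypotheses (mD : (mdim R T <= D%:E)%E) (D0 : 0 <= D).

Lemma equicontinuous_family (p : nat) (f : nat -> X -> R) o : (forall a, continuous (f a)) -> 0 < o ->
  exists2 r, 0 < r & forall a x y, (a < p)%N -> d x y < r -> `|f a x - f a y| <= o.
Proof.
move=> cf o0; elim: p => [|p [r r0 hr]]; first by exists 1.
have [r' r'0 hr'] := cm_ucont cX cd (cf p) o0.
exists (Num.min r r'); first by rewrite lt_min r0.
move=> a x y; rewrite ltnS leq_eqVlt lt_min => /predU1P[->|ap] /andP[h1 h2]; last exact: hr.
by apply/ltW/hr'.
Qed.

Record stage := Stage { sm : nat; sV : nat -> set X; sc : nat -> X; sl : level R X; sE : R }.

Record stage_for (k : nat) (st : stage) : Prop := StageFor {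
  sV_mesh : forall v x y, sV st v x -> sV st v y -> d x y <= 2^-1 ^+ k;
  s_lvl : level_for T S (sV st) (sm st) (D + 2^-1 ^+ k) (sl st);
  sE1 : 1 <= sE st }.

(* [sE] bounds the product of the Lipschitz constants of the earlier levels, so the last but one condition makes
   a perturbation of this level negligible for all of them. *)
Definition stage_step (k : nat) (st st' : stage) : Prop := exists o : R,
  [/\ 0 <= o, 4 * o <= 1,
    (forall v x, (v < sm st')%N -> sV st' v x -> `|lw (sl st) x - lw (sl st) (sc st' v)| <= o) /\
    (forall a v x, (a < lp (sl st))%N -> (v < sm st')%N -> sV st' v x ->
       `|lrho (sl st) a x - lrho (sl st) a (sc st' v)| <= o),
    sE st * (4 * (lK (sl st))%:R * o) <= 2^-1 ^+ k &
    sE st' = sE st * (4 * (lK (sl st))%:R)].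

Lemma stage_exists k r E : 0 < r -> 1 <= E -> exists st,
  [/\ stage_for k st, sE st = E & forall v x, sV st v x -> d (sc st v) x < r].
Proof.
move=> r0 E1; pose r' := Num.min r (2^-1 ^+ k / 2).
have k0 : 0 < 2^-1 ^+ k :> R by rewrite exprn_gt0.
have r'0 : 0 < r' by rewrite lt_min r0 divr_gt0.
have [s hs] := cm_ball_cover cX cd (fun=> r'0).
pose c v := nth point s v; pose V v : set X := [set y | d (c v) y < r'].
have oV v : open (V v) by exact: cm_open_ball.
have cV x : exists2 v, (v < size s)%N & V v x.
  by have [y ys h] := hs x; exists (index y s); rewrite ?index_mem// /V /c /= nth_index.
have k2 : 0 < 2^-1 ^+ k / 2 :> R by rewrite divr_gt0.
have mD' : (mdim R T < (D + 2^-1 ^+ k / 2)%:E)%E by apply: (le_lt_trans mD); rewrite lte_fin ltrDl.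
have [l] := level_exists cX cd cT cS TK SK mk oV cV mD' (addr_ge0 D0 (ltW k2)) k2.
rewrite -addrA -splitr => hl.
exists (Stage (size s) V c l E); split => //=; last first.
  by move=> v x h; apply: lt_le_trans h _; rewrite ge_min lexx.
split => //= v x y hx hy; apply: (le_trans (cm_tri cd (c v) x y)); rewrite (cm_sym cd).
have : r' <= 2^-1 ^+ k / 2 by rewrite ge_min lexx orbT.
by move: hx hy; rewrite /V /=; lra.
Qed.

(** The next cover is taken so fine that the functions of this level oscillate on it by at most [o],
    small against the accumulated Lipschitz constants. *)
Lemma next_stage k st : stage_for k st -> exists st', stage_for k.+1 st' /\ stage_step k st st'.
Proof.
move=> hst; have lv := s_lvl hst; have E1 := sE1 hst.
have K1 : 1 <= (lK (sl st))%:R :> R by rewrite ler1n; exact: (lK0 lv).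
set q : R := 4 * (lK (sl st))%:R; have q1 : 1 <= q by rewrite /q; lra.
have k0 : 0 < 2^-1 ^+ k :> R by rewrite exprn_gt0.
have E0 : 0 < sE st by lra.
have q0 : 0 < q by lra.
pose o : R := Num.min 4^-1 (2^-1 ^+ k / (sE st * q)).
have o0 : 0 < o by rewrite lt_min invr_gt0 ltr0n divr_gt0// mulr_gt0.
have [r1 r10 h1] := cm_ucont cX cd (lw_cont lv) o0.
have [r2 r20 h2] := equicontinuous_family (lp (sl st)) (lrho_cont lv) o0.
have rr0 : 0 < Num.min r1 r2 by rewrite lt_min r10.
have Eq1 : 1 <= sE st * q by rewrite -[1]mulr1 ler_pM.
have [st' [hst' eE hr]] := stage_exists k.+1 rr0 Eq1.
exists st'; split => //; exists o; split => //.
- exact: ltW.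
- have : o <= 4^-1 by rewrite ge_min lexx.
  by rewrite -(ler_pM2l (_ : 0 < 4)) ?mulfV.
- split => [v x vm /hr|a v x ap vm /hr]; rewrite lt_min => /andP[d1 d2].
    by rewrite distrC; apply/ltW/h1.
  by rewrite distrC; apply: h2.
- have : o <= 2^-1 ^+ k / (sE st * q) by rewrite ge_min lexx orbT.
  rewrite (ler_pdivlMr _ _ (mulr_gt0 E0 q0)) => h; apply: le_trans h.
  by rewrite (_ : sE st * _ = o * (sE st * q))// /q; ring.
Qed.

Lemma tower_exists : exists st : nat -> stage, forall k, stage_for k (st k) /\ stage_step k (st k) (st k.+1).
Proof.
have [st0 [h0 _ _]] := stage_exists 0 (ltr01 : 0 < 1 :> R) (lexx 1).
have /choice[g hg] : forall ks : nat * stage, exists st', stage_for ks.1 ks.2 ->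
    stage_for ks.1.+1 st' /\ stage_step ks.1 ks.2 st'.
  move=> [k st] /=; have [h|h] := pselect (stage_for k st); last by exists st.
  by have [st' h'] := next_stage h; exists st'.
pose it := fix it n := if n is k.+1 then g (k, it k) else st0.
have hit k : stage_for k (it k) by elim: k => [//|k /(hg (k, it k))[]].
by exists it => k; split => //; case: (hg (k, it k) (hit k)).
Qed.

Section inverse_limit.
Variable st : nat -> stage.
Hypothesis hst : forall k, stage_for k (st k) /\ stage_step k (st k) (st k.+1).

Let lv k := s_lvl (hst k).1.

Definition tower_op k := level_op T S (sl (st k)) (sm (st k.+1)) (sc (st k.+1)).

(** Starts from the base code of level [k + j] and applies the operators down to level [k]. *)
Fixpoint tower_approx j k : X -> nat -> R :=
  if j is i.+1 then tower_op k (tower_approx i k.+1) else level_base T S (sl (st k)).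

Lemma tower_op_soft k F : soft (sV (st k.+1)) (sm (st k.+1)) F -> soft (sV (st k)) (sm (st k)) (tower_op k F).
Proof.
move=> sF; have [q [q0 q4 [hw hrho] _ _]] := (hst k).2.
exact: (level_op_soft cT cS SK (lv k) q4 hw hrho sF).
Qed.

Lemma tower_approx_soft j k : soft (sV (st k)) (sm (st k)) (tower_approx j k).
Proof.
elim: j k => [|j IH] k /=; last exact: tower_op_soft.
exact: (level_base_soft cT cS SK (lv k)).
Qed.

Lemma tower_op_near k F F' e : 0 <= e -> (forall x v, `|F x v - F' x v| <= e) ->
  forall x v, `|tower_op k F x v - tower_op k F' x v| <= 4 * (lK (sl (st k)))%:R * e.
Proof. by move=> e0 h x v; apply: (level_op_near (lv k)). Qed.

(** Starting one level deeper perturbs level [k + j] by the oscillation bound, and each operator on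
    the way to [k] multiplies the error by its Lipschitz constant, which [sE] compensates. *)
Lemma tower_approx_step j k x v :
  sE (st k) * `|tower_approx j.+1 k x v - tower_approx j k x v| <= 2^-1 ^+ (k + j).
Proof.
elim: j k x v => [|j IH] k x v.
  have [q [q0 q4 [hw hrho] hE _]] := (hst k).2; rewrite addn0; apply: le_trans hE.
  rewrite ler_pM2l; last by apply: lt_le_trans (sE1 (hst k).1).
  exact: (level_op_base (lv k) hw hrho (tower_approx_soft 0 k.+1)).
have [q [_ _ _ _ eE]] := (hst k).2.
have E0 : 0 < sE (st k) by apply: lt_le_trans (sE1 (hst k).1).
have E0' : 0 < sE (st k.+1) by apply: lt_le_trans (sE1 (hst k.+1).1).
rewrite addnS -addSn; set e := 2^-1 ^+ (k.+1 + j) / sE (st k.+1).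
have e0 : 0 <= e by rewrite divr_ge0 ?exprn_ge0// ltW.
have h : forall x v, `|tower_approx j.+1 k.+1 x v - tower_approx j k.+1 x v| <= e.
  by move=> x' v'; rewrite ler_pdivlMr// mulrC; exact: IH.
have := tower_op_near k e0 h x v; rewrite -(ler_pM2l E0) mulrA -eE => h'.
by apply: (le_trans h'); rewrite /e mulrC divfK ?gt_eqF.
Qed.

Lemma tower_limit : exists G : nat -> X -> nat -> R,
  forall j k x v, `|tower_approx j k x v - G k x v| <= 2 * 2^-1 ^+ j.
Proof.
have /choice[G hG] : forall kxv : nat * X * nat, exists l,
    forall j, `|tower_approx j kxv.1.1 kxv.1.2 kxv.2 - l| <= 2 * 2^-1 ^+ j.
  move=> [[k x] v] /=; apply: geometric_limit => j.
  apply: le_trans (le_trans (tower_approx_step j k x v) _); first by rewrite ler_peMl// (sE1 (hst k).1).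
  by rewrite exprD ler_piMl ?exprn_ge0// exprn_ile1// invf_le1// ler1n.
by exists (fun k x v => G (k, x, v)) => j k x v; exact: (hG (k, x, v)).
Qed.

Section limit_facts.
Variable G : nat -> X -> nat -> R.
Hypothesis hG : forall j k x v, `|tower_approx j k x v - G k x v| <= 2 * 2^-1 ^+ j.

Lemma small_power (e : R) : 0 < e -> exists j, 2 * 2^-1 ^+ j < e.
Proof.
move=> e0; have h : (fun j => 2^-1 ^+ j : R) @ \oo --> (0 : R).
  by apply: cvg_expr; rewrite ger0_norm// invf_lt1// ltr1n.
have e2 : 0 < e / 2 by rewrite divr_gt0.
have [j _ hj] := cvgr_lt _ h _ e2.
by exists j; have := hj j (leqnn j); rewrite /= ltr_pdivlMr// mulrC.
Qed.

Lemma limit_soft k : soft (sV (st k)) (sm (st k)) (G k).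
Proof.
have close e x v : 0 < e -> exists2 j, 2 * 2^-1 ^+ j < e & `|tower_approx j k x v - G k x v| < e.
  by move=> /small_power[j hj]; exists j => //; exact: le_lt_trans (hG j k x v) hj.
split.
- move=> x v; apply/andP; split; rewrite leNgt; apply/negP => h.
    have [j _] := close (- G k x v) x v ltac:(lra).
    have /andP[] := soft_itv (tower_approx_soft j k) x v; rewrite ltr_norml; lra.
  have [j _] := close (G k x v - 1) x v ltac:(lra).
  have /andP[] := soft_itv (tower_approx_soft j k) x v; rewrite ltr_norml; lra.
- move=> v; apply: (cm_cont cd) => x e e0.
  have e3 : 0 < e / 3 by rewrite divr_gt0.
  have [j hj] := small_power e3.
  have [r r0 hr] := cm_ucont cX cd (soft_cont (tower_approx_soft j k) (v := v)) e3.
  exists r => // y xy; have := hr x y xy.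
  have := hG j k x v; have := hG j k y v; move: hj; rewrite !ltr_norml !ler_norml.
  by move: (2 * _) (tower_approx _ _ _ _) (tower_approx _ _ _ _) => p a b; lra.
- move=> x v h; have [j _ hj] := close _ x v h; apply: (soft_supp (tower_approx_soft j k)).
  by move: hj; rewrite ltr_norml; lra.
- move=> x; apply: contrapT => H.
  have G1 v : G k x v <= 1.
    rewrite leNgt; apply/negP => h; have [j _] := close (G k x v - 1) x v ltac:(lra).
    have /andP[] := soft_itv (tower_approx_soft j k) x v; rewrite ltr_norml; lra.
  (* The index set is finite, so values all below 1 would stay away from 1, whereas the
     approximations attain 1. *)
  have : \big[Num.max/0]_(v < sm (st k)) G k x v < 1.
    apply: bigmax_lt => // v _; rewrite lt_neqAle G1 andbT; apply/eqP => e; apply: H.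
    by exists (nat_of_ord v).
  rewrite -subr_gt0 => /small_power[j hj].
  have [v vm hv] := soft_full (tower_approx_soft j k) x.
  have := le_bigmax 0 (fun v : 'I_(sm (st k)) => G k x v) (Ordinal vm).
  have := hG j k x v; rewrite hv /= ler_norml.
  by move: hj; move: (2 * _) (\big[_/_]_(_ < _) _) => p q; lra.
Qed.

(** Passage to the limit in the recursion of [tower_approx], by the Lipschitz bound on the
    operator. *)
Lemma limit_op k : G k = tower_op k (G k.+1).
Proof.
apply/funext => x; apply/funext => v; apply/eqP; rewrite -subr_eq0 -normr_eq0 eq_le normr_ge0 andbT leNgt.
apply/negP => h; set q : R := 4 * (lK (sl (st k)))%:R.
have q1 : 1 <= q.
  have : 1 <= (lK (sl (st k)))%:R :> R by rewrite ler1n; exact: (lK0 (lv k)).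
  by rewrite /q; lra.
have q0 : 0 < q + 1 by lra.
have [j hj] := small_power (divr_gt0 h q0).
have p0 : 0 <= 2 * 2^-1 ^+ j :> R by rewrite mulr_ge0// exprn_ge0.
have h1 := tower_op_near k p0 (hG j k.+1) x v.
have h2 := hG j.+1 k x v.
have h3 : 2 * 2^-1 ^+ j.+1 <= 2 * 2^-1 ^+ j :> R.
  by rewrite ler_pM2l// exprS ler_piMl ?exprn_ge0// invf_le1// ler1n.
move: hj; rewrite ltr_pdivlMr// => hj.
have := ler_distD (tower_approx j.+1 k x v) (G k x v) (tower_op k (G k.+1) x v).
rewrite (distrC (G k x v) (tower_approx _ _ _ _)) => h4.
have : 2 * 2^-1 ^+ j * (q + 1) = q * (2 * 2^-1 ^+ j) + 2 * 2^-1 ^+ j by ring.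
move: h1 h2 h3 h4 hj => /=; rewrite -/q.
lra.
Qed.

Lemma limit_count k : exists2 C : R, 0 <= C & forall eta, 0 < eta <= 1 ->
  exists n0 : nat, forall n, (n0 <= n)%N ->
  exists ws : seq (seq {ffun 'I_(sm (st k)) -> 'I_(levels eta).+1}),
   (size ws)%:R <= expR (n%:R * ((D + 2^-1 ^+ k) * ln eta^-1 + C)) /\
   forall y, word T (qcode (sm (st k)) (G k) eta) n y \in ws.
Proof.
have [q [q0 q4 [hw hrho] _ _]] := (hst k).2; rewrite limit_op.
exact: (level_op_count TK SK (lv k) q4 hw hrho (limit_soft k.+1)).
Qed.

End limit_facts.
End inverse_limit.

Lemma tower : exists (m : nat -> nat) (V : nat -> nat -> set X) (G : nat -> X -> nat -> R), forall k,
  [/\ soft (V k) (m k) (G k),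
    forall v x y, V k v x -> V k v y -> d x y <= 2^-1 ^+ k,
    (exists (L : R) (P : nat), 1 <= L /\ forall x y e, 0 <= e ->
       (forall t j, (t <= P)%N -> (j <= P)%N -> forall v, (v < m k.+1)%N ->
          `|G k.+1 (iter j T (iter t S x)) v - G k.+1 (iter j T (iter t S y)) v| <= e) ->
       forall v, `|G k x v - G k y v| <= L * e) &
    exists2 C : R, 0 <= C & forall eta, 0 < eta <= 1 ->
    exists n0 : nat, forall n, (n0 <= n)%N ->
    exists ws : seq (seq {ffun 'I_(m k) -> 'I_(levels eta).+1}),
      (size ws)%:R <= expR (n%:R * ((D + 2^-1 ^+ k) * ln eta^-1 + C)) /\
      forall y, word T (qcode (m k) (G k) eta) n y \in ws].
Proof.
have [st hst] := tower_exists; have [G hG] := tower_limit hst.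
exists (fun k => sm (st k)), (fun k => sV (st k)), G => k; split.
- exact: (limit_soft hst hG).
- exact: (sV_mesh (hst k).1).
- have lv := s_lvl (hst k).1.
  exists (4 * (lK (sl (st k)))%:R), (reach (lN (sl (st k))) (lK (sl (st k)))); split.
    have : 1 <= (lK (sl (st k)))%:R :> R by rewrite ler1n; exact: (lK0 lv).
    lra.
  by move=> x y e e0 h v; rewrite (limit_op hst hG); apply: (level_op_near lv).
- exact: (limit_count hst hG).
Qed.

End tower.

(** * A metric with few names *)

Lemma nth_word (X : Type) (T : X -> X) (A : eqType) (g : X -> A) a0 n y i : (i < n)%N ->
  nth a0 (word T g n y) i = g (iter i T y).
Proof. by move=> iN; rewrite (nth_map 0%N) ?size_iota// nth_iota. Qed.

Section measurable_codes.
Context {R : realType} {X : ptopologicalType}.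

Lemma mfin_ffun (dY : measure_display) (Y : measurableType dY) (I F : finType) (a : I -> Y -> F) :
  (forall i, mfin (a i)) -> mfin (fun x => [ffun i => a i x]).
Proof.
move=> ma w; rewrite (_ : _ @^-1` _ = \bigcap_(i in [set: I]) (a i @^-1` [set w i])).
  by apply: fin_bigcap_measurable => // i _; exact: ma.
apply/seteqP; split=> x /=; first by move=> <- i _ /=; rewrite ffunE.
by move=> h; apply/ffunP => i; rewrite ffunE; exact: h.
Qed.

Lemma mfin_quant (eta : R) (f : X -> R) q : 0 < eta -> continuous f ->
  mfin ((fun x => inord (quant eta (f x))) : borel X -> 'I_q.+1).
Proof.
move=> e0 cf.
have ml i : measurable ([set x | (quant eta (f x) <= i)%N] : set (borel X)).
  case: i => [|i].
    rewrite (_ : [set x | _] = f @^-1` [set t | t <= 0]).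
      by apply: borel_closed; apply: preimage_closed => //; exact: closed_le.
    by apply/seteqP; split => x /=; rewrite leqn0 quant_gt0.
  rewrite (_ : [set x | _] = f @^-1` [set t | t < i.+1%:R * eta]).
    by apply: borel_open; apply: open_comp => [x _|]; [exact: cf|exact: open_lt].
  apply/seteqP; split => x /=; rewrite /quant; case: (leP (f x) 0) => // f0.
  - by move=> _; apply: (le_lt_trans f0); rewrite mulr_gt0// ltr0n.
  - rewrite ltnS -ltr_pdivrMr// => h; apply: (lt_le_trans (truncnS_gt _)).
    by rewrite ler_nat ltnS.
  - rewrite -ltr_pdivrMr// => h; rewrite -(ltr_nat R); apply: le_lt_trans h.
    by rewrite truncn_le// divr_ge0// ltW.
have me i : measurable ([set x | quant eta (f x) = i] : set (borel X)).
  case: i => [|i].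
    rewrite (_ : [set x | _] = [set x | (quant eta (f x) <= 0)%N]); first exact: ml.
    by apply/seteqP; split => x /=; [move=> ->|rewrite leqn0 => /eqP].
  rewrite (_ : [set x | _] = [set x | (quant eta (f x) <= i.+1)%N] `\` [set x | (quant eta (f x) <= i)%N]).
    by apply: measurableD.
  apply/seteqP; split => x /=; first by move=> ->; split=> //; rewrite ltnn.
  by move=> [h1 /negP]; lia.
move=> c; rewrite (_ : _ @^-1` _ = \bigcup_(i in [set i | inord i = c]) [set x | quant eta (f x) = i]).
  by apply: bigcup_measurable => i _; exact: me.
by apply/seteqP; split => x /=; [move=> h; exists (quant eta (f x))|move=> [i hi ->]].
Qed.

End measurable_codes.

(** The single property from which every candidate entropy at slightly larger scales is bounded by
    [c]. *)
Definition few_names {R : realType} {X : ptopologicalType} (T : X -> X) (d : X -> X -> R) (eps c : R) : Prop :=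
  exists (k : nat) (kap : X -> 'I_k), [/\ mfin (kap : borel X -> 'I_k),
    forall x y, kap x = kap y -> d x y <= eps &
    exists n0 : nat, forall n, (n0 <= n)%N -> exists A : {set {ffun 'I_n -> 'I_k}},
      #|A|%:R <= expR (n%:R * c) /\ forall x, name T kap n x \in A].

Section tower_metric.
Context {R : realType} {X : ptopologicalType} (d0 : X -> X -> R) (T S : X -> X).
Hypotheses (cd0 : compatible_metric d0) (cT : continuous T) (cS : continuous S).
Hypotheses (TK : cancel T S) (SK : cancel S T).
Variables (D : R) (m : nat -> nat) (V : nat -> nat -> set X) (G : nat -> X -> nat -> R).
Hypotheses (D0 : 0 <= D)
  (sG : forall k, soft (V k) (m k) (G k))
  (meshV : forall k v x y, V k v x -> V k v y -> d0 x y <= 2^-1 ^+ k)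
  (lipG : forall k, exists (L : R) (P : nat), 1 <= L /\ forall x y e, 0 <= e ->
       (forall t j, (t <= P)%N -> (j <= P)%N -> forall v, (v < m k.+1)%N ->
          `|G k.+1 (iter j T (iter t S x)) v - G k.+1 (iter j T (iter t S y)) v| <= e) ->
       forall v, `|G k x v - G k y v| <= L * e)
  (countG : forall k, exists2 C : R, 0 <= C & forall eta, 0 < eta <= 1 ->
    exists n0 : nat, forall n, (n0 <= n)%N ->
    exists ws : seq (seq {ffun 'I_(m k) -> 'I_(levels eta).+1}),
      (size ws)%:R <= expR (n%:R * ((D + 2^-1 ^+ k) * ln eta^-1 + C)) /\
      forall y, word T (qcode (m k) (G k) eta) n y \in ws).

Lemma iter_window j' t' j t x :
  iter j' T (iter t' S (iter j T (iter t S x))) = iter (j' + j) T (iter (t' + t) S x).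
Proof.
rewrite (iterD j' j T) (iterD t' t S); congr (iter j' T _); move: (iter t S x) => {}x.
elim: t' => [//|t' IH] /=; rewrite IH; elim: j {IH} => [//|j IH] /=; first by rewrite TK -IH /= SK.
Qed.

(** [lipG] is iterated from level [K] downwards: constants multiply and windows add. *)
Lemma window_lip K : exists (L : R) (P : nat), 1 <= L /\ forall x y e, 0 <= e ->
   (forall t j, (t <= P)%N -> (j <= P)%N -> forall v, (v < m K)%N ->
      `|G K (iter j T (iter t S x)) v - G K (iter j T (iter t S y)) v| <= e) ->
   forall k v, (k <= K)%N -> (v < m k)%N -> `|G k x v - G k y v| <= L * e.
Proof.
elim: K => [|K [L [P [L1 IH]]]].
  exists 1, 0%N; split => // x y e e0 h k v; rewrite leqn0 => /eqP -> vm; rewrite mul1r.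
  exact: (h 0%N 0%N).
have [L' [P' [L1' hL']]] := lipG K.
exists (L * L'), (P + P')%N; split; first by rewrite -[1]mulr1 ler_pM.
move=> x y e e0 h k v; rewrite leq_eqVlt => /predU1P[->|kK] vm.
  apply: (le_trans (h 0%N 0%N isT isT v vm)); rewrite ler_peMl// -[1]mulr1 ler_pM//.
rewrite -mulrA; apply: IH => //; first by rewrite mulr_ge0//; lra.
move=> t j tP jP v' v'm; apply: hL' => // t' j' tP' jP' w wm.
by rewrite !iter_window; apply: h => //; lia.
Qed.

Definition layer k x y := \big[Num.max/0]_(v < m k) `|G k x v - G k y v|.

Lemma layer_itv k x y : 0 <= layer k x y <= 1.
Proof.
rewrite bigmax_ge0/=; apply: bigmax_le => // v _; rewrite ler_norml.
by have /andP[] := soft_itv (sG k) x v; have /andP[] := soft_itv (sG k) y v; lra.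
Qed.

Lemma layer_le k x y e : 0 <= e -> (forall v, (v < m k)%N -> `|G k x v - G k y v| <= e) -> layer k x y <= e.
Proof. by move=> e0 h; apply: bigmax_le => // v _; exact: h. Qed.

Lemma le_layer k x y v : (v < m k)%N -> `|G k x v - G k y v| <= layer k x y.
Proof. by move=> vm; exact: (le_bigmax _ (fun v : 'I_(m k) => `|G k x v - G k y v|) (Ordinal vm)). Qed.

Section weights.
Variable delta : nat -> R.
Hypotheses (dl0 : forall k, 0 < delta k) (dl1 : forall k, delta k <= 1)
  (dlS : forall j k, (j <= k)%N -> delta k <= delta j) (dlim : forall e, 0 < e -> exists k, delta k < e).

Definition tower_dist x y := sup (range (fun k => delta k * layer k x y)).

Lemma tower_dist_sup x y : has_sup (range (fun k => delta k * layer k x y)).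
Proof.
split; first by exists (delta 0%N * layer 0 x y), 0%N.
exists 1 => _ [k _ <-]; have /andP[h0 h1] := layer_itv k x y.
by rewrite -[leRHS]mulr1 ler_pM// ltW.
Qed.

Lemma tower_dist_le x y e : (forall k, delta k * layer k x y <= e) -> tower_dist x y <= e.
Proof. by move=> h; apply: (ge_sup (tower_dist_sup x y).1) => _ [k _ <-]. Qed.

Lemma le_tower_dist k x y : delta k * layer k x y <= tower_dist x y.
Proof. by apply: (ub_le_sup (tower_dist_sup x y).2); exists k. Qed.

(** Some index has value 1 at [x]; a distance below [delta k] leaves it positive at [y], so both
    points lie in one element of the fine cover. *)
Lemma tower_dist_small k x y : tower_dist x y < delta k -> d0 x y <= 2^-1 ^+ k.
Proof.
move=> h; have [v vm Gv] := soft_full (sG k) x.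
apply: (meshV (v := v)); apply: (soft_supp (sG k)); first by rewrite Gv.
have := le_lt_trans (le_tower_dist k x y) h; rewrite gtr_pMr// => hl.
by have := le_lt_trans (@le_layer k x y v vm) hl; rewrite Gv ltr_norml; lra.
Qed.

Lemma tower_dist_compatible : compact [set: X] -> compatible_metric tower_dist.
Proof.
move=> cX.
have dge0 x y : 0 <= tower_dist x y.
  by apply: le_trans (le_tower_dist 0 x y); rewrite mulr_ge0 ?bigmax_ge0// ltW.
have dxx x : tower_dist x x = 0.
  apply/le_anti; rewrite dge0 andbT; apply: tower_dist_le => k; rewrite pmulr_rle0//.
  by apply: layer_le => // v _; rewrite subrr normr0.
have pw (e : R) : 0 < e -> exists k, 2^-1 ^+ k < e.
  by move=> /small_power[k hk]; exists k; apply: le_lt_trans hk; rewrite ler_peMl ?exprn_ge0// ler1n.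
have dsym x y : tower_dist x y = tower_dist y x.
  rewrite /tower_dist; suff -> : (fun k => delta k * layer k x y) = (fun k => delta k * layer k y x) by [].
  apply/funext => k; congr (_ * _); rewrite /layer.
  by apply: eq_bigr => v _; rewrite distrC.
have dtri x y z : tower_dist x z <= tower_dist x y + tower_dist y z.
  apply: tower_dist_le => k; apply: le_trans (lerD (le_tower_dist k x y) (le_tower_dist k y z)).
  rewrite -mulrDr ler_pM2l//; apply: layer_le => [|v vm]; first by rewrite addr_ge0// bigmax_ge0.
  by apply: (le_trans (ler_distD (G k y v) _ _)); apply: lerD; exact: le_layer.
have ucont x e : 0 < e -> exists2 r, 0 < r & forall y, d0 x y < r -> tower_dist x y < e.
  move=> e0; have e2 : 0 < e / 2 by rewrite divr_gt0.
  have [K hK] := dlim e2.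
  have [r r0 hr] : exists2 r, 0 < r & forall y, d0 x y < r -> forall k v, (k < K)%N -> (v < m k)%N ->
      `|G k x v - G k y v| <= e / 2.
    elim: K {hK} => [|K [r r0 hr]]; first by exists 1.
    have [r' r'0 hr'] := equicontinuous_family cX cd0 (m K) (f := fun v x => G K x v) (soft_cont (sG K)) e2.
    exists (Num.min r r'); first by rewrite lt_min r0.
    move=> y; rewrite lt_min => /andP[h1 h2] k v; rewrite ltnS leq_eqVlt => /predU1P[->|kK] vm; last exact: hr.
    exact: hr'.
  exists r => // y xy; apply: (@le_lt_trans _ _ (e / 2)); last by rewrite ltr_pdivrMr// ltr_pMr// ltr1n.
  apply: tower_dist_le => k; have [Kk|kK] := leqP K k.
    apply: le_trans (ltW hK); apply: le_trans (dlS Kk).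
    by rewrite ler_piMr ?(ltW (dl0 k))//; case/andP: (layer_itv k x y).
  have h : layer k x y <= e / 2 by apply: layer_le => [|v vm]; [exact: ltW|exact: hr].
  by apply: le_trans h; rewrite ler_piMl ?bigmax_ge0.
split => //.
- move=> x y; split => [h|->//].
  apply: (cm_eq0 cd0); apply/eqP; rewrite eq_le (cm_ge0 cd0) andbT leNgt; apply/negP => d0xy.
  have [k hk] := pw _ d0xy.
  by have := @tower_dist_small k x y; rewrite h => /(_ (dl0 k)); rewrite leNgt hk.
- move=> x; apply/seteqP; split => [A /(cm_nbhsP cd0)[e e0 he]|A [e /= e0 he]].
    have [k hk] := pw _ e0; exists (delta k) => //= y h; apply: he.
    exact: le_lt_trans (tower_dist_small h) hk.
  apply/(cm_nbhsP cd0); have [r r0 hr] := ucont x e e0.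
  by exists r => // y xy; apply: he; exact: hr.
Qed.

(** The letter of [x] is a table of quantised values of [G K] on a window, which controls the layers
    up to [K]; later layers weigh at most [delta K.+1 <= eps]. A name of length [n] is read off a
    word of length [n + 2 P]. *)
Lemma tower_dist_names K L P C (eps : R) : 1 <= L -> 0 <= C ->
  (forall x y e, 0 <= e ->
   (forall t j, (t <= P)%N -> (j <= P)%N -> forall v, (v < m K)%N ->
      `|G K (iter j T (iter t S x)) v - G K (iter j T (iter t S y)) v| <= e) ->
   forall k v, (k <= K)%N -> (v < m k)%N -> `|G k x v - G k y v| <= L * e) ->
  (forall eta, 0 < eta <= 1 ->
    exists n0 : nat, forall n, (n0 <= n)%N ->
    exists ws : seq (seq {ffun 'I_(m K) -> 'I_(levels eta).+1}),
      (size ws)%:R <= expR (n%:R * ((D + 2^-1 ^+ K) * ln eta^-1 + C)) /\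
      forall y, word T (qcode (m K) (G K) eta) n y \in ws) ->
  0 < eps <= 1 -> delta K.+1 <= eps -> forall c,
  (D + 2^-1 ^+ K) * ln (L / eps) + C < c -> few_names T tower_dist eps c.
Proof.
move=> L1 C0 hL hC /andP[e0 e1] dle c hc.
have L0 : 0 < L by lra.
pose eta := eps / L; have eta0 : 0 < eta by rewrite divr_gt0.
have eta1 : 0 < eta <= 1 by rewrite eta0 ler_pdivrMr// mul1r (le_trans e1).
pose W := {ffun 'I_(m K) -> 'I_(levels eta).+1}.
pose g : X -> W := qcode (m K) (G K) eta.
pose Tab := {ffun 'I_P.+1 * 'I_P.+1 -> W}.
pose tab (x : X) : Tab := [ffun tj : 'I_P.+1 * 'I_P.+1 => g (iter tj.2 T (iter tj.1 S x))].
have tabE x tj : tab x tj = g (iter tj.2 T (iter tj.1 S x)) by rewrite ffunE.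
have gE z v (vm : (v < m K)%N) : val (g z (Ordinal vm)) = quant eta (G K z v).
  rewrite /g ffunE /= inordK// ltnS quant_levels//; case/andP: (soft_itv (sG K) z v) => //.
have near x y : tab x = tab y -> tower_dist x y <= eps.
  move=> hxy; apply: tower_dist_le => k; have [kK|Kk] := leqP k K; last first.
    apply: le_trans dle; apply: le_trans (dlS Kk).
    by rewrite ler_piMr ?(ltW (dl0 k))//; case/andP: (layer_itv k x y).
  apply: (@le_trans _ _ (layer k x y)); first by rewrite ler_piMl ?bigmax_ge0.
  apply: layer_le => [|v vm]; first exact: ltW.
  rewrite (_ : eps = L * eta); last by rewrite /eta mulrC divfK ?gt_eqF.
  apply: hL => //; first exact: ltW.
  move=> t j tP0 jP0 v' v'm; have tP : (t < P.+1)%N by []. have jP : (j < P.+1)%N by [].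
  have := congr1 (fun f : Tab => val (f (Ordinal tP, Ordinal jP) (Ordinal v'm))) hxy.
  rewrite !tabE !gE; apply: quant_near => //.
    by case/andP: (soft_itv (sG K) (iter j T (iter t S x)) v').
  by case/andP: (soft_itv (sG K) (iter j T (iter t S y)) v').
exists #|{: Tab}|, (fun x => enum_rank (tab x)); split.
- apply: (mfin_comp enum_rank (a := tab : borel X -> Tab)); apply: mfin_ffun => -[t j] /=.
  apply: mfin_ffun => v; apply: mfin_quant => //.
  exact: (@continuous_orbit R X T S cT cS (fun x => G K x v) j t (@soft_cont _ _ _ _ _ (sG K) v)).
- by move=> x y /enum_rank_inj; exact: near.
have [n0 hn0] := hC eta eta1.
set rate := (D + _) * ln eta^-1 + C in hn0.
have rE : rate < c by rewrite /rate /eta invf_div.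
(* From this length on, the [2 P] extra letters are absorbed by the gap [c - rate]. *)
pose n1 := (Num.truncn ((2 * P)%:R * rate / (c - rate))).+1.
exists (maxn n0 n1) => n; rewrite geq_max => /andP[nn0 nn1].
have [ws [szw hws]] := hn0 (n + 2 * P)%N (leq_trans nn0 (leq_addr _ _)).
pose w0 : W := [ffun=> ord0].
pose dec (w : seq W) : {ffun 'I_n -> 'I_#|{: Tab}|} :=
  [ffun i : 'I_n => enum_rank [ffun tj : 'I_P.+1 * 'I_P.+1 => nth w0 w (i + tj.2 + (P - tj.1))]].
exists [set z | z \in [seq dec w | w <- ws]]%SET; split.
  apply: (@le_trans _ _ (size ws)%:R).
    by rewrite ler_nat cardsE -(size_map dec); exact: card_size.
  apply: (le_trans szw); rewrite ler_expR natrD mulrDl -lerBrDl -mulrBr.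
  have h1 : (2 * P)%:R * rate / (c - rate) <= n%:R.
    by apply/ltW/(lt_le_trans (truncnS_gt _)); rewrite ler_nat.
  by rewrite -ler_pdivrMr// subr_gt0.
move=> x; rewrite finset.inE; apply/mapP; exists (word T g (n + 2 * P) (iter P S x)) => //.
apply/ffunP => i; rewrite !ffunE; congr enum_rank; apply/ffunP => -[t j]; rewrite !ffunE /=.
have tP := ltn_ord t; have jP := ltn_ord j; have iN := ltn_ord i.
have idx : (i + j + (P - t) < n + 2 * P)%N.
  apply: (@leq_ltn_trans (i + P + P)); first by rewrite leq_add ?leq_subr// leq_add2l.
  by rewrite mul2n -addnn -addnA ltn_add2r.
rewrite nth_word//.
congr (g _); rewrite  -[RHS](iter_window _ 0) /=.
have -> : iter (P - t) T (iter P S x) = iter t S x.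
  by rewrite (iterTS_le SK) ?leq_subr// subKn.
have := iter_window j t i 0 x; rewrite /= addn0 => ->.
by rewrite addnC.
Qed.

End weights.

(** At scale [eps] the code used is the one with [delta K.+1 <= eps < delta K], and the weights
    decrease so fast that its constant [E K] is then at most [ln (1/eps) / (K + 1)]. *)
Lemma tower_metric : compact [set: X] -> exists d, compatible_metric d /\
  forall theta, 0 < theta -> exists2 eps0, 0 < eps0 <= 1 & forall eps, 0 < eps < eps0 ->
    few_names T d eps ((D + theta) * ln eps^-1).
Proof.
move=> cX.
have /choice[LP hLP] : forall K, exists LP : R * nat, 1 <= LP.1 /\ forall x y e, 0 <= e ->
   (forall t j, (t <= LP.2)%N -> (j <= LP.2)%N -> forall v, (v < m K)%N ->
      `|G K (iter j T (iter t S x)) v - G K (iter j T (iter t S y)) v| <= e) ->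
   forall k v, (k <= K)%N -> (v < m k)%N -> `|G k x v - G k y v| <= LP.1 * e.
  by move=> K; have [L [P h]] := window_lip K; exists (L, P).
have /choice[C hC] : forall K, exists C : R, 0 <= C /\ forall eta, 0 < eta <= 1 ->
    exists n0 : nat, forall n, (n0 <= n)%N ->
    exists ws : seq (seq {ffun 'I_(m K) -> 'I_(levels eta).+1}),
      (size ws)%:R <= expR (n%:R * ((D + 2^-1 ^+ K) * ln eta^-1 + C)) /\
      forall y, word T (qcode (m K) (G K) eta) n y \in ws.
  by move=> K; have [C C0 h] := countG K; exists C.
pose E K := C K + (D + 2^-1 ^+ K) * ln (LP K).1.
have p0 K : 0 <= 2^-1 ^+ K :> R by rewrite exprn_ge0.
have E0 K : 0 <= E K.
  rewrite addr_ge0 ?(hC K).1// mulr_ge0 ?addr_ge0//; apply: ln_ge0; exact: (hLP K).1.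
pose s K := \sum_(j < K.+1) j.+1%:R * (E j + 1).
have s0 K : 0 <= s K by apply: sumr_ge0 => j _; rewrite mulr_ge0// addr_ge0.
have sS K : s K.+1 = s K + K.+2%:R * (E K.+1 + 1) by rewrite /s big_ord_recr.
have smono j k : (j <= k)%N -> s j <= s k.
  elim: k => [|k IH]; first by rewrite leqn0 => /eqP ->.
  rewrite leq_eqVlt => /predU1P[->//|/IH h]; apply: (le_trans h).
  by rewrite sS lerDl mulr_ge0// addr_ge0.
have sE K : K.+1%:R * (E K + 1) <= s K.
  by case: K => [|K]; [rewrite /s big_ord1|rewrite sS lerDr].
pose delta K := expR (- s K).
have dl0 k : 0 < delta k by exact: expR_gt0.
have dl1 k : delta k <= 1 by rewrite -expR0 ler_expR oppr_le0.
have dlS j k : (j <= k)%N -> delta k <= delta j by move=> /smono h; rewrite ler_expR lerN2.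
have dlim e : 0 < e -> exists k, delta k < e.
  move=> e1; exists (Num.truncn (ln e^-1)).
  rewrite -[ltRHS](@lnK R) ?posrE// ltr_expR ltrNl -lnV ?posrE//; apply: lt_le_trans (truncnS_gt _) _.
  by apply: le_trans (sE _); rewrite ler_peMr// lerDr.
exists (tower_dist delta); split; first exact: tower_dist_compatible.
move=> theta th0; pose K0 := Num.truncn (3 / theta).
(* Below [delta K0] the level [K] is at least [K0], whence [3 / (K + 1) <= theta]. *)
exists (delta K0) => [|eps /andP[e0 eK0]]; first by rewrite dl0 dl1.
have ex : exists K, delta K <= eps by have [K /ltW h] := dlim eps e0; exists K.
case: (ex_minnP ex) => -[|K] hK Kmin.
  by move: (lt_le_trans eK0 (le_trans (dlS 0%N K0 isT) hK)); rewrite ltxx.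
have eK : eps < delta K by rewrite ltNge; apply/negP => /Kmin; rewrite ltnn.
have K0K : (K0 <= K)%N.
  rewrite leqNgt; apply/negP => h; have := lt_le_trans eK0 (le_trans (dlS _ _ h) hK); by rewrite ltxx.
have e1 : 0 < eps <= 1 by rewrite e0 (le_trans (ltW eK)).
apply: (tower_dist_names dl0 dl1 dlS (hLP K).1 (hC K).1 (hLP K).2 (hC K).2 e1 hK).
set l := ln eps^-1.
have lK : K.+1%:R * (E K + 1) < l.
  by apply: (le_lt_trans (sE K)); rewrite /l lnV ?posrE// ltrNr -[ltRHS]expRK ltr_ln ?posrE// expR_gt0.
have l0 : 0 < l by apply: le_lt_trans lK; rewrite mulr_ge0// addr_ge0.
have L0 : 0 < (LP K).1 by apply: lt_le_trans (hLP K).1.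
rewrite lnM ?posrE ?invr_gt0// -/l.
have -> : (D + 2^-1 ^+ K) * (ln (LP K).1 + l) + C K = D * l + (2^-1 ^+ K * l + E K) by rewrite /E; ring.
rewrite mulrDl ltrD2l.
have KR : 0 < K.+1%:R :> R by [].
have k1 : 2^-1 ^+ K <= K.+1%:R^-1 :> R.
  rewrite exprVn lef_pV2 ?posrE ?exprn_gt0//.
  by rewrite -natrX ler_nat ltn_expl.
have k2 : E K < l / K.+1%:R by rewrite ltr_pdivlMr// mulrC (le_lt_trans _ lK)// ler_pM2l// lerDl.
have k3 : 3 / K.+1%:R <= theta.
  rewrite ler_pdivrMr// mulrC -ler_pdivrMr//.
  by apply: (le_trans (ltW (truncnS_gt _))); rewrite ler_nat ltnS.
have k4 : 2^-1 ^+ K * l <= l / K.+1%:R by rewrite mulrC ler_pM2l.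
have k5 : 3 / K.+1%:R * l <= theta * l by rewrite ler_pM2r.
have k6 : 0 < l / K.+1%:R by rewrite divr_gt0.
rewrite (_ : 3 / K.+1%:R * l = 3 * (l / K.+1%:R)) in k5; last by ring.
apply: (lt_le_trans (ler_ltD k4 k2)); apply: le_trans k5.
rewrite (_ : 3 = 1 + 1 + 1 :> R) ?mulrDl ?mul1r; last by ring.
by rewrite lerDl ltW.
Qed.

End tower_metric.

(** * Entropies bounded by the number of names *)

Lemma pr_marginal {R : realType} {dY : measure_display} {Y : measurableType dY} (mu : probability Y R)
  (F G : finType) (a : Y -> F) (b : Y -> G) j : mfin a -> mfin b ->
  \sum_i pr mu (fun x => (a x, b x)) (i, j) = pr mu b j.
Proof.
move=> ma mb; have mp := mfin_pair ma mb.
have h1 := Ex_code mu (fun z : F * G => (z.2 == j)%:R) mp.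
have h2 := Ex_code mu (fun z : G => (z == j)%:R) mb.
have : Ex mu (fun x => (b x == j)%:R) = \sum_(i : F) pr mu (fun x => (a x, b x)) (i, j).
  transitivity (\sum_i \sum_z pr mu (fun x => (a x, b x)) (i, z) * (z == j)%:R).
    by rewrite pair_bigA; apply: etrans h1 _; apply: eq_bigr => -[].
  apply: eq_bigr => i _; rewrite (bigD1 j)//= eqxx mulr1 big1 ?addr0// => z /negbTE ->.
  by rewrite mulr0.
move=> <-; rewrite h2 (bigD1 j)//= eqxx mulr1 big1 ?addr0// => z /negbTE ->.
by rewrite mulr0.
Qed.

Lemma partition_map (dY dE : measure_display) (Y : measurableType dY) (E : measurableType dE) (f : Y -> E)
  (P : {fset set E}) : (forall B, measurable B -> measurable (f @^-1` B)) -> finite_partition P ->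
  exists a : Y -> P, mfin a /\ forall B : P, a @^-1` [set B] = f @^-1` (val B).
Proof.
move=> mf [mP tP /is_coverP cP].
have /choice[a ha] : forall y, exists B : P, val B (f y).
  by move=> y; have [B BP h] := cP (f y); exists (FSetSub BP).
have aE B : a @^-1` [set B] = f @^-1` (val B).
  apply/seteqP; split => y /=; first by move=> <-; exact: ha.
  by move=> h; apply/val_inj; apply: (tP _ _ (valP (a y)) (valP B)); exists (f y).
by exists a; split => // B; rewrite aE; apply: mf; apply: mP; exact: valP.
Qed.

Section few_names_bounds.
Context {R : realType} {X : ptopologicalType} (d : X -> X -> R) (T : X -> X).
Hypotheses (cd : compatible_metric d) (cT : continuous T).
Variables (eps eps' c : R).
Hypotheses (e0 : 0 < eps) (ee' : eps < eps').
Variables (k : nat) (kap : X -> 'I_k).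
Hypotheses (mk : mfin (kap : borel X -> 'I_k)) (kd : forall x y, kap x = kap y -> d x y <= eps).
Variables (n0 : nat) (A : forall n, {set {ffun 'I_n -> 'I_k}}).
Hypotheses (cardA : forall n, (n0 <= n)%N -> #|A n|%:R <= expR (n%:R * c))
  (nameA : forall n x, (n0 <= n)%N -> name T kap n x \in A n).

Let e'0 : 0 < eps'. Proof. exact: lt_trans ee'. Qed.
Let mT : measurable_fun (setT : set (borel X)) (T : borel X -> borel X). Proof. exact: borel_map. Qed.

Lemma name_near n x y : name T kap n x = name T kap n y ->
  forall t, (t < n)%N -> d (iter t T x) (iter t T y) <= eps.
Proof.
move=> h t tn; apply: kd.
by have := congr1 (fun f : {ffun 'I_n -> 'I_k} => f (Ordinal tn)) h; rewrite !ffunE.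
Qed.

Lemma name_bowen n x y : name T kap n x = name T kap n y -> bowen_metric d T n x y < eps'.
Proof. by move=> h; apply/(bowen_lt _ _ _ _ _ e'0) => t tn; apply: le_lt_trans ee'; exact: name_near h t tn. Qed.

(** Points with the same name stay within [eps < eps'] of each other, so separated points have
    distinct names. *)
Lemma sep_number_names (Z : set X) n : (n0 <= n)%N -> (sep_number d T Z n eps' <= (expR (n%:R * c))%:E)%E.
Proof.
move=> nn; apply: ub_ereal_sup => _ [F [_ sF] <-]; rewrite lee_fin; apply: le_trans (cardA nn).
rewrite ler_nat cardE -(size_map (name T kap n)); apply: uniq_leq_size.
  rewrite map_inj_in_uniq ?fset_uniq// => x y xF yF h; apply/eqP; apply: contraT => xy.
  by have := le_lt_trans (sF x y xF yF xy) (name_bowen h); rewrite ltxx.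
by move=> _ /mapP[x _ ->]; rewrite mem_enum; exact: nameA.
Qed.

Lemma sep_rate_names (Z : nat -> set X) :
  (log_rate_sup (fun n => sep_number d T (Z n) n eps') <= c%:E)%E.
Proof.
apply: (@limn_esup_leP _ _ _ (maxn n0 1)) => n; rewrite geq_max => /andP[nn n1].
by apply: le_rate_exp => //; exact: sep_number_names.
Qed.

Lemma pfister_sullivan_names mu : (pfister_sullivan T d mu eps' <= c%:E)%E.
Proof.
apply: le_trans (sep_rate_names (empirical_in T setT)).
by apply: ereal_inf_lbound; exists setT => //; exact: filterT.
Qed.

(* An arbitrary point for names that are not realised. *)
Definition rep n (w : {ffun 'I_n -> 'I_k}) : X := xget point [set y | name T kap n y = w].

Lemma name_rep n x : name T kap n (rep (name T kap n x)) = name T kap n x.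
Proof. exact: (@xgetPex _ point [set y | name T kap n y = name T kap n x] (ex_intro _ x erefl)). Qed.

Section measures.
Variable mu : probability (borel X) R.

Lemma katok_number_names delta n : 0 < delta -> (n0 <= n)%N ->
  (katok_number T delta d mu n eps' <= (expR (n%:R * c))%:E)%E.
Proof.
move=> dl0 nn; pose E : {fset X} := seq_fset tt [seq rep w | w <- enum (A n)].
apply: (@le_trans _ _ (#|` E|%:R)%:E); last first.
  rewrite lee_fin; apply: le_trans (cardA nn); rewrite ler_nat size_seq_fset cardE -(size_map (@rep n)).
  exact: size_undup.
apply: ereal_inf_lbound; exists E => //=.
rewrite (_ : \bigcup_(x in _) _ = setT); first by rewrite (mu_setT mu) lte_fin ltrBlDr ltrDl.
apply/seteqP; split => // x _; exists (rep (name T kap n x)).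
  by rewrite /= seq_fsetE; apply: map_f; rewrite mem_enum; exact: nameA.
by rewrite /bowen_ball /=; apply: name_bowen; exact: name_rep.
Qed.

Lemma katok_sup_at_names delta : 0 < delta -> (katok_sup_at T delta d mu eps' <= c%:E)%E.
Proof.
move=> dl0; apply: (@limn_esup_leP _ _ _ (maxn n0 1)) => n; rewrite geq_max => /andP[nn n1].
by apply: le_rate_exp => //; exact: katok_number_names.
Qed.

Lemma katok_inf_at_names delta : 0 < delta -> (katok_inf_at T delta d mu eps' <= c%:E)%E.
Proof. by move=> dl0; apply: le_trans (katok_sup_at_names dl0); exact: log_rate_inf_le_sup. Qed.

Lemma katok_sup_names : (katok_sup T d mu eps' <= c%:E)%E.
Proof.
apply: lim_at_right_le => [x y _ xy _|x /andP[x0 _]]; first exact: katok_sup_mono.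
exact: katok_sup_at_names.
Qed.

Lemma katok_inf_names : (katok_inf T d mu eps' <= c%:E)%E.
Proof.
apply: lim_at_right_le => [x y _ xy _|x /andP[x0 _]]; first exact: katok_inf_mono.
exact: katok_inf_at_names.
Qed.

Lemma ent_names (F : finType) (b : X -> F) n : (n0 <= n)%N -> mfin (b : borel X -> F) ->
  (forall x y, name T kap n x = name T kap n y -> b x = b y) -> ent mu (b : borel X -> F) <= n%:R * c.
Proof.
move=> nn mb hb; have SA : (0 < #|A n|)%N by apply/card_gt0P; exists (name T kap n point); exact: nameA.
apply: (@le_trans _ _ (ln #|[set b (rep w) | w in A n]%SET|%:R)).
  apply: ent_le_card => // x; apply/finset.imsetP; exists (name T kap n x); first exact: nameA.
  by apply: hb; rewrite name_rep.
rewrite -[leRHS](@expRK R) ler_ln ?posrE ?expR_gt0//.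
  by apply: le_trans (cardA nn); rewrite ler_nat leq_imset_card.
rewrite ltr0n; apply/card_gt0P; exists (b (rep (name T kap n point))); apply/finset.imsetP.
by exists (name T kap n point) => //; exact: nameA.
Qed.

Section invariant.
Hypothesis inu : invariant_measure T mu.

Lemma entropy_of_fibers_names : (entropy_of_partition T mu (fibers (kap : borel X -> 'I_k)) <= c%:E)%E.
Proof.
have pa := fibers_partition mk.
have [l [-> cl]] := entropy_of_partition_cvg mT inu pa.
have [k' [kap' [mk' hk' hent]]] := partition_code T mu pa.
have kk x y : kap x = kap y -> kap' x = kap' y.
  move=> e; have [B /imfsetP[i _ ->] hB] := hk' x.
  have xi : kap x = i by have : (kap' @^-1` [set kap' x]) x by []; rewrite -hB.
  have hy : (kap @^-1` [set i]) y by rewrite /= -e.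
  by rewrite hB in hy; rewrite hy.
rewrite lee_fin -(cvg_lim _ cl)//; apply: limr_le; first exact: cvgP cl.
exists (maxn n0 1) => // n /=; rewrite geq_max => /andP[nn n1].
rewrite hent mulrC ler_pdivrMr ?ltr0n// mulrC; apply: ent_names => //; first exact: mfin_name.
move=> x y h; apply/ffunP => t; rewrite !ffunE; apply: kk.
by have := congr1 (fun f : {ffun 'I_n -> 'I_k} => f t) h; rewrite !ffunE.
Qed.

Lemma fibers_diam B x y : B \in fibers (kap : borel X -> 'I_k) -> B x -> B y -> d x y <= eps.
Proof. by move=> /imfsetP[i _ ->] /= hx hy; apply: kd; rewrite hx hy. Qed.

Lemma mesh_leP (alpha : {fset set X}) (r : R) : (forall B x y, B \in alpha -> B x -> B y -> d x y <= r) ->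
  (mesh d alpha <= r%:E)%E.
Proof.
move=> h; apply: ub_ereal_sup => _ [B Ba <-]; apply: ub_ereal_sup => _ [[x y] [Bx By] <-].
by rewrite lee_fin; exact: h Ba Bx By.
Qed.

Lemma inf_partition_entropy_names : (inf_partition_entropy T d mu eps' <= c%:E)%E.
Proof.
apply: le_trans entropy_of_fibers_names; apply: ereal_inf_lbound.
exists (fibers (kap : borel X -> 'I_k)) => //; split; first exact: fibers_partition.
by apply: mesh_leP => B x y Ba Bx By; apply: le_trans (ltW ee'); exact: fibers_diam Ba Bx By.
Qed.

Lemma inf_cover_entropy_names : (inf_cover_entropy T d mu eps' <= c%:E)%E.
Proof.
(* Thickening a cell by [s] raises its diameter by at most [2 s = eps' - eps]. *)
pose s := (eps' - eps) / 2; have s0 : 0 < s by rewrite divr_gt0// subr_gt0.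
pose th (B : set X) : set X := [set x | exists2 y, B y & d y x < s].
pose U : {fset set X} := [fset th B | B in fibers (kap : borel X -> 'I_k)]%fset.
have Bth B : B `<=` th B by move=> x Bx; exists x => //; rewrite (cm_xx cd).
have pa := fibers_partition mk.
apply: le_trans entropy_of_fibers_names; apply: (@le_trans _ _ (entropy_of_cover T mu U)).
  apply: ereal_inf_lbound; exists U => //; split; first split.
  - move=> _ /imfsetP[B _ ->]; apply/(cm_openP cd) => x [y By yx].
    exists (s - d y x); first by rewrite subr_gt0.
    by move=> z; rewrite ltrBrDl => h; exists y => //; apply: le_lt_trans h; exact: cm_tri.
  - case: pa => _ _ /is_coverP cov; apply/is_coverP => x; have [B Ba Bx] := cov x.
    by exists (th B); [apply/imfsetP; exists B|exact: Bth].
  - apply: mesh_leP => _ x y /imfsetP[B Ba ->] [x' Bx' h1] [y' By' h2].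
    have h3 := fibers_diam Ba Bx' By'.
    have := cm_tri cd x' x y; have := cm_tri cd y' x' y; rewrite (cm_sym cd x x').
    by move: h1 h2; rewrite /s; lra.
apply: ereal_inf_lbound; exists (fibers (kap : borel X -> 'I_k)) => //; split => //.
by move=> B Ba; exists (th B) => //; apply/imfsetP; exists B.
Qed.

End invariant.

(** A union bound over at most [exp (n c)] names. *)
Lemma rare_names n theta : (n0 <= n)%N -> (0 < n)%N -> 0 < theta ->
  (mu [set x | (pr mu (name T kap n) (name T kap n x) < expR (- (n%:R * (c + theta))))%R]
    <= (expR (- (n%:R * theta)))%:E)%E /\
  measurable ([set x | pr mu (name T kap n) (name T kap n x) < expR (- (n%:R * (c + theta)))] : set (borel X)).
Proof.
move=> nn n1 th0; set t := expR (- (n%:R * (c + theta))).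
have mn : mfin (name T kap n : borel X -> _) by exact: mfin_name.
pose g w := pr mu (name T kap n) w < t.
have mg : mfin (g \o (name T kap n : borel X -> _)) by exact: mfin_comp.
have eS : [set x | pr mu (name T kap n) (name T kap n x) < t] = (g \o name T kap n) @^-1` [set true] by [].
rewrite eS; split; last exact: mg.
have p1 : fine (mu ((g \o name T kap n) @^-1` [set true])) = \sum_w pr mu (name T kap n) w * (g w)%:R.
  have <- := Ex_code mu (fun w => (g w)%:R) mn.
  rewrite (_ : (fun x => _) = (fun x => (fun b : bool => b%:R) ((g \o (name T kap n : borel X -> _)) x))); last by [].
  by rewrite (Ex_code mu (fun b : bool => b%:R) mg) big_bool /= mulr1 mulr0 addr0.
rewrite (mu_fin mu (mg true)) lee_fin p1.
apply: (@le_trans _ _ (\sum_(w in A n) t)).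
  rewrite [leRHS]big_mkcond /=; apply: ler_sum => w _.
  case: (boolP (w \in A n)) => wA.
    rewrite /g; case: ltP => h; first by rewrite mulr1 ltW.
    by rewrite mulr0 expR_ge0.
  rewrite (_ : pr mu _ w = 0) ?mul0r// /pr (_ : _ @^-1` _ = set0) ?measure0//.
  by apply/seteqP; split => // x /= h; move: wA; rewrite -h nameA.
rewrite big_const iter_addr_0 -[_ *+ _]mulr_natl.
apply: (le_trans (ler_wpM2r (expR_ge0 _) (cardA nn))).
by rewrite -expRD ler_expR; lra.
Qed.

Lemma geometric_sum_le (z : R) N : 0 <= z < 1 -> \sum_(i < N) z ^+ i <= (1 - z)^-1.
Proof.
move=> /andP[z0 z1]; have z10 : 0 < 1 - z by rewrite subr_gt0.
rewrite -(ler_pM2l z10) mulfV ?gt_eqF//.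
have -> : (1 - z) * \sum_(i < N) z ^+ i = 1 - z ^+ N.
  by rewrite -[1 in RHS](expr1n R N) subrXX; congr (_ * _); apply: eq_bigr => i _; rewrite expr1n mul1r.
by rewrite lerBlDr lerDl exprn_ge0.
Qed.

(** The masses of rare names are summable, so by Borel-Cantelli almost every point eventually has a
    name of mass at least [exp (- n (c + theta))], and its Bowen ball contains the cell of that
    name. *)
Lemma brin_katok_names : (brin_katok_sup T d mu eps' <= c%:E)%E.
Proof.
apply/lee_addgt0Pr => theta th0.
pose n1 := (maxn n0 1).
have nn j : (n0 <= n1 + j)%N by apply: (leq_trans (leq_maxl n0 1)); exact: leq_addr.
have np j : (0 < n1 + j)%N by apply: (leq_trans (leq_maxr n0 1)); exact: leq_addr.
pose bad j : set (borel X) := [set x | pr mu (name T kap (n1 + j)) (name T kap (n1 + j) x) < expR (- ((n1 + j)%:R * (c + theta)))].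
have mbad j : measurable (bad j) by exact: (rare_names (nn j) (np j) th0).2.
pose z := expR (- theta); have z01 : 0 <= z < 1 by rewrite expR_ge0 -expR0 ltr_expR oppr_lt0.
have mub j : (mu (bad j) <= (z ^+ j)%:E)%E.
  apply: (le_trans (rare_names (nn j) (np j) th0).1); rewrite lee_fin /z -expRM_natl ler_expR mulrN lerN2.
  by rewrite ler_wpM2r ?ler_nat ?leq_addl// ltW.
pose Z := lim_sup_set bad.
have Z0 : mu Z = 0%E.
  apply: lim_sup_set_cvg0 => //.
  apply: (@le_lt_trans _ _ ((1 - z)^-1)%:E); last exact: ltry.
  apply: lime_le; first by apply: is_cvg_nneseries => n _ _; exact: measure_ge0.
  apply: nearW => N; apply: (@le_trans _ _ (\sum_(i < N) z ^+ i)%:E); last by rewrite lee_fin geometric_sum_le.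
  by rewrite big_mkord -sumEFin; apply: lee_sum => i _; exact: mub.
have mZ : measurable Z by apply: bigcapT_measurable => n; apply: bigcup_measurable => j _; exact: mbad.
pose f x := limn_esup (fun n => (n%:R^-1)%:E * - lne (mu (bowen_ball d T n x eps')))%E.
have mB n x : measurable (bowen_ball d T n x eps' : set (borel X)).
  by apply: borel_open; exact: bowen_ball_open.
have f0 x : (0 <= f x)%E.
  apply: limn_esup_geP => m; exists m => //; apply: mule_ge0; first by rewrite lee_fin invr_ge0.
  by rewrite oppe_ge0 lne_le0; exact: probability_le1.
have fc x : ~ Z x -> (f x <= (c + theta)%:E)%E.
  move=> nZ; have [N hN] : exists N, forall j, (N <= j)%N -> ~ bad j x.
    apply: contrapT => H; apply: nZ => N _; apply: contrapT => H'; apply: H; exists N => j Nj bj.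
    by apply: H'; exists j.
  apply: (@limn_esup_leP _ _ _ (n1 + N)) => n hn.
  have nE : n = (n1 + (n - n1))%N by rewrite subnKC//; apply: leq_trans hn; exact: leq_addr.
  have /hN/negP : (N <= n - n1)%N by rewrite leq_subRL//; apply: leq_trans hn; exact: leq_addr.
  rewrite -leNgt -nE => hp.
  have n0' : 0 < n%:R :> R by rewrite ltr0n nE.
  have mfi := mfin_name mT mk (n := n) (name T kap n x).
  have hle : ((expR (- (n%:R * (c + theta))))%:E <= mu (bowen_ball d T n x eps'))%E.
    apply: (@le_trans _ _ (mu (name T kap n @^-1` [set name T kap n x]))).
      by rewrite (mu_fin mu mfi) lee_fin.
    apply: le_measure; [exact: mem_set mfi|exact: mem_set (mB n x)|].
    by move=> y /= h; apply: name_bowen.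
  apply: (@le_trans _ _ ((n%:R^-1)%:E * (n%:R * (c + theta))%:E)%E); last first.
    by rewrite -EFinM mulrA mulVf ?gt_eqF// mul1r.
  rewrite lee_pmul2l ?lte_fin ?invr_gt0// leeNl -EFinN.
  by apply: le_trans (lne_mono hle); rewrite lne_EFin ?expR_gt0// expRK.
have mcZ : measurable (~` Z) by exact: measurableC.
have ct0 : (0 <= (c + theta)%:E)%E.
  have [x nZ] : exists x, ~ Z x.
    apply: contrapT => H; have : mu setT = 0%E.
      by rewrite -Z0; congr (mu _); apply/seteqP; split => // x _; apply: contrapT => h; apply: H; exists x.
    by rewrite probability_setT => /eqP; rewrite onee_eq0.
  exact: le_trans (fc x nZ).
rewrite -EFinD.
(* A measurable majorant of the local entropy: infinite on the null set [Z] and constant off it. *)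
apply: (@le_trans _ _ (\int[mu]_x (if x \in Z then +oo else (c + theta)%:E))%E).
  apply: ge0_le_integralT => // x; case: (boolP (x \in Z)) => [_|/negP xZ]; first exact: leey.
  by apply: fc => xZ'; apply: xZ; rewrite inE.
have -> : (\int[mu]_x (if x \in Z then +oo else (c + theta)%:E) = \int[mu]_x (cst (c + theta)%:E x))%E.
  apply: ae_eq_integral => //.
  + apply: measurable_fun_if => //=; apply: (@measurable_fun_bool _ _ _ _ true).
  by rewrite setTI (_ : _ @^-1` _ = Z)//; apply/seteqP; split => x /=; [exact: set_mem|exact: mem_set].
  + exists Z; split => // x /= h; apply: contrapT => nZ; apply: h => _.
    by case: (boolP (x \in Z)) => // /set_mem.
by rewrite integral_cst//= (mu_setT mu) mule1.
Qed.

Section rates.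
Variables (n : nat) (nn : (n0 <= n)%N) (n1 : (0 < n)%N).

Lemma measurable_of_names (dE : measure_display) (E : measurableType dE) (f : X -> E) :
  (forall x y, name T kap n x = name T kap n y -> f x = f y) ->
  measurable_fun (setT : set (borel X)) (f : borel X -> E).
Proof.
move=> hf _ B mB; rewrite setTI.
rewrite (_ : f @^-1` B = \bigcup_(w in [set w | B (f (rep w))]) (name T kap n @^-1` [set w])).
  by apply: fin_bigcup_measurable => // w _; exact: mfin_name.
apply/seteqP; split=> x /=.
  by move=> Bx; exists (name T kap n x) => //=; rewrite (hf _ x)// name_rep.
by move=> [w Bw /= e]; rewrite (hf x (rep w))// -e name_rep.
Qed.

(** Mutual information is at most the entropy of the cells of [eta], because a joint mass never
    exceeds the marginal of [xi]; these cells depend only on the name. *)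
Lemma mutual_information_names (d1 d2 : measure_display) (E1 : measurableType d1) (E2 : measurableType d2)
  (xi : {RV mu >-> E1}) (eta : {RV mu >-> E2}) :
  (forall x y, name T kap n x = name T kap n y -> eta x = eta y) ->
  (mutual_information xi eta <= (n%:R * c)%:E)%E.
Proof.
move=> he; apply: ub_ereal_sup => _ [[a b] [/= pa pb] <-]; rewrite lee_fin.
have [al [mal hal]] := @partition_map _ _ (borel X) E1 xi a (measurable_funPTI xi) pa.
have [be [mbe hbe]] := @partition_map _ _ (borel X) E2 eta b (measurable_funPTI eta) pb.
have hb x y : name T kap n x = name T kap n y -> be x = be y.
  move=> /he e; have : (be @^-1` [set be x]) x by []; rewrite hbe /= e => h.
  by have : (eta @^-1` (val (be x))) y by []; rewrite -hbe => /= ->.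
apply: le_trans (ent_names nn mbe hb).
rewrite exchange_big /= big_seq_fsetE /= /ent -sumrN; apply: ler_sum => B _.
rewrite big_seq_fsetE /= -mulrN.
rewrite -(pr_marginal mu B mal mbe) mulr_suml; apply: ler_sum => A' _.
rewrite (pr_marginal mu B mal mbe) -(hal A') -(hbe B).
have -> : (al @^-1` [set A'] `&` be @^-1` [set B]) = (fun x => (al x, be x)) @^-1` [set (A', B)].
  by apply/seteqP; split => x /=; [move=> [-> ->]|move=> [-> ->]].
have mp := mfin_pair mal mbe.
have h1 : pr mu (fun x => (al x, be x)) (A', B) <= pr mu al A' := pr_le_comp mu fst (A', B) mp.
have h2 : pr mu (fun x => (al x, be x)) (A', B) <= pr mu be B := pr_le_comp mu snd (A', B) mp.
move: (pr_ge0 mu (fun x => (al x, be x)) (A', B)) h1 h2; rewrite -!/(pr _ _ _).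
move: (pr _ _ (A', B)) (pr _ al A') (pr _ be B) => u v w; rewrite le_eqVlt => /predU1P[<- _ _|u0 uv uw].
  by rewrite !mul0r.
have v0 := lt_le_trans u0 uv; have w0 := lt_le_trans u0 uw.
rewrite ler_pM2l// -lnV ?posrE// ler_ln ?posrE ?invr_gt0 ?divr_gt0 ?mulr_gt0//.
by rewrite invfM mulrA ler_piMl ?invr_ge0 ?(ltW w0)// ler_pdivrMr// mul1r.
Qed.

Definition rep_orbit (x : X) : n.-tuple X := [tuple iter t T (rep (name T kap n x)) | t < n].

(** The coupling lives on [X] itself: [xi] is the identity and [eta] the orbit of the representative
    of the name. *)
Lemma rate_distortion_names (cost : forall n, X -> n.-tuple X -> R) (t : nat -> R) (r : R) : 0 <= r ->
  (forall x, 0 <= cost n x (rep_orbit x) <= r) -> r < t n ->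
  (rate_distortion mu cost t <= c%:E)%E.
Proof.
move=> r0 hc rt.
have meta : measurable_fun (setT : set (borel X)) (rep_orbit : borel X -> n.-tuple (borel X)).
  by apply: measurable_of_names => x y h; rewrite /rep_orbit h.
pose eta : {RV mu >-> n.-tuple (borel X)} := mfun_Sub (mem_set meta).
pose xi : {RV mu >-> borel X} := mfun_Sub (mem_set (@measurable_id _ (borel X) setT)).
have hI : (mutual_information xi eta <= (n%:R * c)%:E)%E.
  by apply: mutual_information_names => x y h; rewrite /eta /= /rep_orbit h.
apply: (@le_trans _ _ ((n%:R^-1)%:E * mutual_information xi eta)%E).
  apply: ereal_inf_lbound; exists _, (borel X), mu, n, xi, eta; split => //.
  set f := fun w : borel X => _; have -> : ('E_mu[f] = \int[mu]_w (f w)%:E)%E by rewrite unlock.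
  apply: (@le_lt_trans _ _ (\int[mu]_w (cst r%:E w))%E).
    by apply: ge0_le_integralT => w; rewrite lee_fin; have /andP[] := hc w.
  by rewrite integral_cst//= (mu_setT mu) mule1 lte_fin.
apply: (le_trans (lee_wpmul2l _ hI)); first by rewrite lee_fin invr_ge0.
by rewrite -EFinM mulrA mulVf ?mul1r// pnatr_eq0 -lt0n.
Qed.

Lemma rep_orbit_near x (i : 'I_n) : d (iter i T x) (tnth (rep_orbit x) i) <= eps.
Proof. by rewrite tnth_mktuple; apply: name_near (ltn_ord i); rewrite name_rep. Qed.

End rates.

Lemma rate_Lp_names p : 1 <= p -> (rate_Lp T p d mu eps' <= c%:E)%E.
Proof.
move=> p1; have p0 : 0 < p by lra.
apply: (@rate_distortion_names (maxn n0 1) _ _ _ _ (eps `^ p)).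
- exact: leq_maxl.
- exact: leq_maxr.
- exact: powR_ge0.
- move=> x; have nR : 0 < (maxn n0 1)%:R :> R by rewrite ltr0n leq_maxr.
  rewrite mulr_ge0 ?invr_ge0 ?sumr_ge0//=; last by move=> i _; exact: powR_ge0.
  rewrite ler_pdivrMl// mulr_natl -[X in _ *+ X]card_ord -sumr_const; apply: ler_sum => i _.
  apply: ge0_ler_powR; rewrite ?nnegrE ?(ltW p0) ?(ltW e0) ?(cm_ge0 cd)//; exact: rep_orbit_near.
- by apply: gt0_ltr_powR; rewrite ?nnegrE ?(ltW e0) ?(ltW e'0).
Qed.

Lemma rate_Loo_at_names s : 0 < s -> (rate_Loo_at T d mu eps' s <= c%:E)%E.
Proof.
move=> s0; apply: (@rate_distortion_names (maxn n0 1) _ _ _ _ 0) => //.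
- exact: leq_maxl.
- exact: leq_maxr.
- move=> x; rewrite eq_card0 ?lexx// => i; rewrite inE; apply/negbTE; rewrite -ltNge.
  by apply: le_lt_trans ee'; exact: rep_orbit_near.
- by rewrite mulr_gt0// ltr0n leq_maxr.
Qed.

Lemma rate_Loo_names : (rate_Loo T d mu eps' <= c%:E)%E.
Proof.
apply: lim_at_right_le => [x y x0 xy _|x /andP[x0 _]]; last exact: rate_Loo_at_names.
apply: le_ereal_inf => r; case=> dO; case=> Om; case=> P; case=> n; case=> xi; case=> zt; case=> n1 law hE ->.
exists dO, Om, P, n, xi, zt; split=> //; apply: (lt_le_trans hE).
by rewrite lee_fin ler_wpM2r.
Qed.

End measures.
End few_names_bounds.

(** * The minimum *)

Section candidates.
Context {R : realType} {X : ptopologicalType} (d : X -> X -> R) (T : X -> X).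
Hypotheses (cX : compact [set: X]) (cd : compatible_metric d) (cT : continuous T).
Variables (p delta : R).
Hypotheses (p1 : 1 <= p) (dl : 0 < delta < 1).
Variable h : (X -> X -> R) -> probability (borel X) R -> R -> \bar R.
Hypothesis hh : (entropy_candidates T delta `|` [set rate_Lp T p]) h.

Lemma compressible_mono eps (nu : probability (borel X) R) a b : a <= b -> compressible T d eps nu a -> compressible T d eps nu b.
Proof.
move=> ab [n [Q [kap [n0 vQ kQ hE]]]]; exists n, Q, kap; split => //; apply: (lt_le_trans hE).
by rewrite ler_wpM2l.
Qed.

Lemma candidate_compressible nu eps c : ergodic_measure T nu -> 0 < eps -> (h d nu eps < c%:E)%E ->
  compressible T d eps nu (c + 10).
Proof.
move=> enu e0; have inu := enu.1; have d0 : 0 < delta by case/andP: dl.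
have m k : k <= 10 -> compressible T d eps nu (c + k) -> compressible T d eps nu (c + 10).
  by move=> k10; apply: compressible_mono; rewrite lerD2l.
have two : 2 <= 10 :> R by lra.
have six : 6 <= 10 :> R by lra.
case: hh => [|-> hc]; last by apply: (m 6) => //; exact: (rate_Lp_compressible cX cd cT p1 e0 hc).
case=> [[[[[[[[->|->]|->]|->]|->]|->]|->]|->]|->] hc.
- by apply: (m 6) => //; exact: (rate_Loo_compressible cX cd cT e0 hc).
- by apply: (m 2) => //; exact: (inf_partition_entropy_compressible cd cT inu e0 hc).
- by apply: (m 2) => //; exact: (inf_cover_entropy_compressible cd cT inu e0 hc).
- exact: (katok_inf_at_compressible cX cd cT enu e0 dl hc).
- exact: (katok_sup_at_compressible cX cd cT enu e0 dl hc).
- exact: (katok_inf_compressible cX cd cT enu e0 hc).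
- exact: (katok_sup_compressible cX cd cT enu e0 hc).
- exact: (brin_katok_compressible cX cd cT enu e0 hc).
- exact: (pfister_sullivan_compressible cX cd cT enu e0 hc).
Qed.

Section names.
Variables (eps eps' c : R).
Hypotheses (e0 : 0 < eps) (ee' : eps < eps') (fn : few_names T d eps c).

Lemma realised_names : exists (k : nat) (kap : X -> 'I_k) (n0 : nat) (A : forall n, {set {ffun 'I_n -> 'I_k}}),
  [/\ mfin (kap : borel X -> 'I_k), forall x y, kap x = kap y -> d x y <= eps,
    forall n, (n0 <= n)%N -> #|A n|%:R <= expR (n%:R * c) &
    forall n x, (n0 <= n)%N -> name T kap n x \in A n].
Proof.
case: fn => k [kap [mk kd [n0 hn]]].
exists k, kap, n0, (fun n => [set w | `[< exists x, name T kap n x = w >]]%SET); split => // n.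
  move=> /hn[A [cA nA]]; apply: le_trans cA; rewrite ler_nat; apply: subset_leq_card.
  by apply/fintype.subsetP => w; rewrite finset.inE => /asboolP[x <-].
by move=> x _; rewrite finset.inE; apply/asboolP; exists x.
Qed.

Lemma candidate_few_names mu : invariant_measure T mu -> (h d mu eps' <= c%:E)%E.
Proof.
move=> imu; have d0 : 0 < delta by case/andP: dl.
have [k [kap [n0 [A [mk kd cA nA]]]]] := realised_names.
case: hh => [|->]; last exact: (rate_Lp_names cd cT e0 ee' mk kd cA nA mu p1).
case=> [[[[[[[[->|->]|->]|->]|->]|->]|->]|->]|->].
- exact: (rate_Loo_names cT ee' mk kd cA nA).
- exact: (inf_partition_entropy_names cT ee' mk kd cA nA imu).
- exact: (inf_cover_entropy_names cd cT ee' mk kd cA nA imu).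
- exact: (katok_inf_at_names e0 ee' kd cA nA mu d0).
- exact: (katok_sup_at_names e0 ee' kd cA nA mu d0).
- exact: (katok_inf_names e0 ee' kd cA nA).
- exact: (katok_sup_names e0 ee' kd cA nA).
- exact: (brin_katok_names cd cT e0 ee' mk kd cA nA).
- exact: (pfister_sullivan_names e0 ee' kd cA nA).
Qed.

Lemma sep_rate_few_names : (log_rate_sup (fun n => sep_number d T setT n eps') <= c%:E)%E.
Proof.
have [k [kap [n0 [A [mk kd cA nA]]]]] := realised_names.
exact: (sep_rate_names e0 ee' kd cA nA (fun=> setT)).
Qed.

End names.
End candidates.

(** * Upper scaling in [ln (1/eps)] *)

Section scaling.
Context {R : realType}.
Local Open Scope ereal_scope.

Lemma upper_log_scaling_le (h : R -> \bar R) (M : \bar R) (e0 : R) : (0 < e0)%R ->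
  (forall e : R, (0 < e < e0)%R -> ((ln e^-1)^-1)%:E * h e <= M) -> upper_log_scaling h <= M.
Proof.
move=> e00 H; rewrite /upper_log_scaling limf_esupE.
apply: (@le_trans _ _ (ereal_sup ((fun e : R => ((ln e^-1)^-1)%:E * h e) @` [set e : R | 0 < e < e0]%R))).
  apply: ereal_inf_lbound; exists [set e : R | 0 < e < e0]%R => //.
  near=> e; apply/andP; split; near: e; [exact: nbhs_right_gt|exact: nbhs_right_lt].
by apply: ub_ereal_sup => _ [e he <-]; exact: H.
Unshelve. all: by end_near. Qed.

Lemma upper_log_scaling_lt (h : R -> \bar R) (M : \bar R) : upper_log_scaling h < M ->
  exists2 e0 : R, (0 < e0)%R & forall e : R, (0 < e < e0)%R -> ((ln e^-1)^-1)%:E * h e < M.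
Proof.
rewrite /upper_log_scaling limf_esupE => /ereal_inf_lt[_ [A hA <-] hM].
have [e0 /= e00 he0] := hA; exists e0 => // e /andP[e1 e2].
apply: le_lt_trans hM; apply: ereal_sup_ubound; exists e => //; apply: he0 => //=.
by rewrite sub0r normrN gtr0_norm.
Qed.

(** Passing from [eps] to [2 eps] shifts [ln (1/eps)] by [ln 2], which half of [theta] absorbs at
    small scales. *)
Lemma upper_log_scaling_rate (h : R -> \bar R) (D : R) :
  (forall theta : R, (0 < theta)%R -> exists2 eps0 : R, (0 < eps0 <= 1)%R & forall eps : R, (0 < eps < eps0)%R ->
     h (2 * eps)%R <= ((D + theta) * ln eps^-1)%:E) -> (0 <= D)%R -> upper_log_scaling h <= D%:E.
Proof.
move=> H D0; apply/lee_addgt0Pr => theta th0.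
have t2 : (0 < theta / 2)%R by rewrite divr_gt0.
have [eps0 /andP[e00 e01] he] := H _ t2.
set q := ((D + theta / 2) * ln 2 / (theta / 2))%R.
have q0 : (0 <= q)%R by rewrite divr_ge0 ?mulr_ge0 ?addr_ge0 ?ln_ge0 ?ler1n// ltW.
apply: (@upper_log_scaling_le h _ (Num.min eps0 (Num.min 2^-1 (expR (- q))))%R).
  by rewrite !lt_min e00 invr_gt0 ltr0n expR_gt0.
move=> e /andP[e0]; rewrite !lt_min => /and3P[h1 h2 h3].
set l := ln e^-1; have ql : (q < l)%R.
  by rewrite /l lnV ?posrE// ltrNr -[ltRHS]expRK ltr_ln ?posrE ?expR_gt0.
have l0 : (0 < l)%R by exact: le_lt_trans ql.
have he2 : (0 < e / 2 < eps0)%R.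
  by rewrite divr_gt0//=; apply: lt_trans h1; rewrite ltr_pdivrMr// ltr_pMr// ltr1n.
have := he _ he2; rewrite mulrC divfK// invf_div lnM ?posrE ?invr_gt0// -/l => hle.
rewrite lee_pdivrMl//; apply: (le_trans hle); rewrite -EFinD -EFinM lee_fin.
move: ql; rewrite /q ltr_pdivrMr// => /ltW ql.
by rewrite mulrDr; lra.
Qed.

End scaling.

Theorem theorem3 (R : realType) (X : ptopologicalType) (T : X -> X) :
  compact [set: X] -> metrizable R X -> homeomorphism T ->
  marker_property T ->
  (mdim R T < +oo)%E ->
  forall (p delta : R), 1 <= p -> 0 < delta < 1 ->
  forall h : (X -> X -> R) -> probability (borel X) R -> R -> \bar R,
  (entropy_candidates T delta `|` [set rate_Lp T p]) h ->
  is_minimum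
    [set sup_log_scaling (ergodic_measure T) h d | d in finite_mdimM_metrics T]
    (mdim R T) /\
  is_minimum
    [set sup_log_scaling (invariant_measure T) h d | d in finite_mdimM_metrics T]
    (mdim R T).
Proof.
move=> cX [d0 cd0] [S [cT cS TK SK]] mk mfin0 p delta p1 dl h hh.
have fT : finite_open_cover ([fset setT]%fset : {fset set X}).
  split; first by move=> A; rewrite inE => /eqP ->; exact: openT.
  by apply/is_coverP => x; exists setT; rewrite ?inE.
have m0 : (0 <= mdim R T)%E.
  have [l [cl _ ll]] := mdim_limit cX cd0 cT fT; apply: le_trans ll; rewrite lee_fin -(cvg_lim _ cl)//.
  apply: limr_ge; first exact: cvgP cl.
  by apply: nearW => n; rewrite mulr_ge0// fine_ge0// cover_dim_ge0.
have [D mD] : exists D : R, mdim R T = D%:E.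
  by exists (fine (mdim R T)); rewrite fineK// ge0_fin_numE.
rewrite !mD in m0 mfin0 *; rewrite lee_fin in m0.
have lower d : compatible_metric d -> (D%:E <= sup_log_scaling (ergodic_measure T) h d)%E.
  move=> cd; rewrite leNgt; apply/negP => hlt.
  have [s hs sD] : exists2 s : R, (sup_log_scaling (ergodic_measure T) h d < s%:E)%E & s < D.
    move: hlt; case: (sup_log_scaling _ _ _) => [r| |].
    - by rewrite lte_fin => rD; exists ((r + D) / 2); rewrite ?lte_fin; lra.
    - by [].
    - by move=> _; exists (D - 1); [exact: ltNyr|lra].
  (* The gap between [s] and [s'] absorbs the additive 10: [s e + 10 <= s' e] once
     [e >= 10 / (s' - s)]. *)
  pose s' := (s + D) / 2; have ss' : s < s' by rewrite /s'; lra.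
  have s'D : s' < D by rewrite /s'; lra.
  have G nu : ergodic_measure T nu -> exists e0 : nat, forall e, (e0 <= e)%N -> compressible T d (expR (- e%:R)) nu (s' * e%:R).
    move=> enu; have : (upper_log_scaling (h d nu) < s%:E)%E.
      by apply: le_lt_trans hs; apply: ereal_sup_ubound; exists nu.
    move=> /upper_log_scaling_lt[e0 e00 he0].
    exists (maxn (Num.truncn (- ln e0)).+1 (Num.truncn (10 / (s' - s))).+1) => e; rewrite geq_max => /andP[h1 h2].
    have e1 : - ln e0 < e%:R by apply: lt_le_trans (truncnS_gt _) _; rewrite ler_nat.
    have e2 : 10 / (s' - s) <= e%:R by apply/ltW; apply: lt_le_trans (truncnS_gt _) _; rewrite ler_nat.
    have e3 : 0 < e%:R :> R by rewrite ltr0n; exact: leq_trans h1.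
    have hx : 0 < expR (- e%:R : R) < e0.
      by rewrite expR_gt0 /= -[ltRHS](@lnK R) ?posrE// ltr_expR; lra.
    have := he0 _ hx; rewrite -expRN opprK expRK lte_pdivrMl// -EFinM => hlt'.
    apply: compressible_mono (candidate_compressible cX cd cT p1 dl hh enu (expR_gt0 _) hlt').
    by move: e2; rewrite ler_pdivrMr ?subr_gt0//; lra.
  (* Some ergodic measure exists, obtained from the empirical measures of an orbit, and its rate is
     nonnegative because [pot <= 1]. *)
  have s'0 : 0 <= s'.
    have [mu [imu _ _ _]] := weak_limit cX cd cT cS TK SK (fun=> point) (fun k => ltnSn k).
    have [|nu enu _] := ergodic_component cX cd cT cS TK SK (K := fun=> setT) (e0 := 0) imu (fun=> closedT) (ltr01 : 0 < 1 :> R).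
      by move=> e _; rewrite (mu_setT mu).
    have [e0 he0] := G nu enu; have [n [Q [kap [n0 vQ _ hE]]]] := he0 e0.+1 (leqnSn _).
    rewrite leNgt; apply/negP => s'0; move: hE; apply/negP; rewrite -leNgt.
    apply: (@le_trans _ _ 0); first by rewrite mulr_ge0_le0// mulr_le0_ge0// ltW.
    apply: Rintegral_ge0 => x _; rewrite oppr_ge0; apply: ln_le0; apply: pot_le1 vQ => *; [exact: (cm_ge0 cd)|exact: expR_gt0].
  have := mdim_le_of_compressible cX cd cT cS TK SK s'0 G.
  by rewrite mD lee_fin leNgt s'D.
have mD' : (mdim R T <= D%:E)%E by rewrite mD.
have [m [V [F hF]]] := tower cX cd0 cT cS TK SK mk mD' m0.
have [d [cd hd]] : exists d, compatible_metric d /\ forall theta, 0 < theta ->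
    exists2 eps0, 0 < eps0 <= 1 & forall eps, 0 < eps < eps0 -> few_names T d eps ((D + theta) * ln eps^-1).
  by apply: (tower_metric cd0 cT cS TK SK m0 (V := V) (m := m) (G := F)) => // k; have [] := hF k.
have fd : finite_mdimM_metrics T d.
  split => //; apply: le_lt_trans (ltry D); apply: upper_log_scaling_rate => // theta th0.
  have [eps0 e00 he] := hd theta th0; exists eps0 => // eps h1.
  have e0 : 0 < eps by case/andP: h1.
  have e2 : eps < 2 * eps by rewrite ltr_pMl// ltr1n.
  exact: (sep_rate_few_names e0 e2 (he _ h1)).
have upper : (sup_log_scaling (invariant_measure T) h d <= D%:E)%E.
  apply: ub_ereal_sup => _ [mu imu <-]; apply: upper_log_scaling_rate => // theta th0.
  have [eps0 e00 he] := hd theta th0; exists eps0 => // eps h1.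
  have e0 : 0 < eps by case/andP: h1.
  have e2 : eps < 2 * eps by rewrite ltr_pMl// ltr1n.
  exact: (candidate_few_names cd cT p1 dl hh e0 e2 (he _ h1) imu).
have sub d' : (sup_log_scaling (ergodic_measure T) h d' <= sup_log_scaling (invariant_measure T) h d')%E.
  by apply: le_ereal_sup => _ [mu [imu _] <-]; exists mu.
split; split.
- by exists d => //; apply/le_anti; rewrite lower// andbT; exact: le_trans (sub d) upper.
- by move=> _ [d' [cd' _] <-]; exact: lower.
- by exists d => //; apply/le_anti; rewrite upper /=; apply: le_trans (sub d); exact: lower.
- by move=> _ [d' [cd' _] <-]; apply: le_trans (sub d'); exact: lower.
Qed.
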